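(* Let $-1<\alpha<0$, $b\ge0$ and $1<p<\infty$ be such that $p\ge2(\alpha+2)$. Then $$\|\mathcal{H}_b\|_{A_\alpha^p\to A_\alpha^p}=B\Big(\frac{\alpha+2}{p},\,b+1-\frac{\alpha+2}{p}\Big).$$
   Context: $\mathbb{D}$ is the open unit disk in $\mathbb{C}$ and $dA$ is the normalized area measure on $\mathbb{D}$. For $0<p<\infty$ and $\alpha>-1$, the weighted Bergman space $A_\alpha^p$ is the space of analytic functions $f$ on $\mathbb{D}$ with $\|f\|_{A_\alpha^p}^p=(\alpha+1)\int_{\mathbb{D}}|f(z)|^p(1-|z|^2)^\alpha\,dA(z)<\infty$; $\|T\|_{A_\alpha^p\to A_\alpha^p}$ denotes the operator norm. For $b\ge0$ the generalized Hilbert operator $\mathcal{H}_b$ is defined on $f(z)=\sum_{k\ge0}a_kz^k$ by $$\mathcal{H}_b(f)(z)=\sum_{n=0}^\infty\Big(\sum_{k=0}^\infty\frac{\Gamma(n+b+1)\Gamma(n+k+1)}{\Gamma(n+1)\Gamma(n+k+b+2)}a_k\Big)z^n;$$ when $1<p<\infty$, $\alpha+2<p(b+1)$ and $f\in A_\alpha^p$, this is well defined and equals $\int_0^1\frac{f(t)(1-t)^b}{(1-tz)^{b+1}}\,dt$ for $z\in\mathbb{D}$. $B(s,t)=\int_0^1x^{s-1}(1-x)^{t-1}dx$ is the Beta function. *)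

(* Defs.v *)
From mathcomp Require Export all_boot all_order all_algebra.
From mathcomp Require Export all_classical all_reals all_analysis.
From mathcomp Require Export complex.

Set Implicit Arguments.
Unset Strict Implicit.
Unset Printing Implicit Defensive.

Import Order.TTheory GRing.Theory Num.Theory.
Export numFieldNormedType.Exports.

Local Open Scope classical_set_scope.
Local Open Scope ring_scope.
Local Open Scope complex_scope.

Section Hilbert_Bergman.
Variable R : realType.
(* R[i] carries the topology and the normed space structure over itself that
   come from its norm only under this alias, convertible to R[i]. *)
Local Notation C := R[i]^o.
Implicit Types (alpha b p s t K : R) (a : nat -> C) (f : C -> C).

(* Real-valued modulus: the norm `|z| of z : C takes its values in R[i]. *)
Definition modulus (z : C) : R := ComplexField.Normc.normc z.

Definition unit_disk : set C := [set z | modulus z < 1].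

Definition Gamma s : R :=
  \int[lebesgue_measure]_(x in `]0, +oo[) (x `^ (s - 1) * expR (- x)).

Definition Beta s t : R :=
  \int[lebesgue_measure]_(x in `]0, 1[) (x `^ (s - 1) * (1 - x) `^ (t - 1)).

(* Integral of a nonnegative function over the disk with respect to the area
   measure, normalized so that the disk has measure 1. *)
Definition disk_integral (h : C -> R) : \bar R :=
  ((pi^-1)%:E *
   \int[lebesgue_measure \x lebesgue_measure]_(w in
       [set w : R * R | unit_disk (w.1 +i* w.2)]) (h (w.1 +i* w.2))%:E)%E.

Definition bergman_norm alpha p f : \bar R :=
  (((alpha + 1)%:E *
    disk_integral (fun z => (modulus (f z) `^ p *
                             (1 - modulus z ^+ 2) `^ alpha)%R)) `^ p^-1)%E.

(* Differentiability over the complex field; only the restriction of f to the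
   disk matters, which is open. *)
Definition analytic_on_disk f : Prop :=
  forall z, unit_disk z -> derivable f z 1.

Definition bergman alpha p : set (C -> C) :=
  [set f | analytic_on_disk f /\ (bergman_norm alpha p f < +oo)%E].

Definition taylor_series a (z : C) : nat -> C :=
  series (fun k => a k * z ^+ k).

(* f(z) = sum_k a_k z^k on the disk.  By Taylor's theorem every analytic f has
   exactly one such coefficient sequence, so quantifying over pairs (f, a) is
   quantifying over all analytic f. *)
Definition taylor_expansion f a : Prop :=
  forall z, unit_disk z -> taylor_series a z n @[n --> \oo] --> f z.

Definition hilbert_weight b (n k : nat) : R :=
  (Gamma (n%:R + b + 1) * Gamma (n%:R + k%:R + 1)) /
  (Gamma (n%:R + 1) * Gamma (n%:R + k%:R + b + 2)).

Definition hilbert_partial_sums b a (n : nat) : nat -> C :=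
  series (fun k => (hilbert_weight b n k)%:C * a k).

Definition hilbert_coef b a (n : nat) : C :=
  limn (hilbert_partial_sums b a n).

(* H_b f, for f(z) = sum_k a_k z^k. *)
Definition hilbert_op b a (z : C) : C :=
  limn (taylor_series (hilbert_coef b a) z).

(* The limits above are those of convergent series. *)
Definition hilbert_well_defined b a : Prop :=
  (forall n, cvgn (hilbert_partial_sums b a n)) /\
  (forall z, unit_disk z -> cvgn (taylor_series (hilbert_coef b a) z)).

(* H_b is a well-defined map from the Bergman space to itself, and
   ||H_b f|| <= K ||f|| for every f. *)
Definition hilbert_bounded_by alpha b p K : Prop :=
  forall f a, bergman alpha p f -> taylor_expansion f a ->
    [/\ hilbert_well_defined b a,
        bergman alpha p (hilbert_op b a) &
        (bergman_norm alpha p (hilbert_op b a) <=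
         K%:E * bergman_norm alpha p f)%E].

(* +oo when H_b is not a bounded operator on the Bergman space. *)
Definition hilbert_opnorm alpha b p : \bar R :=
  ereal_inf [set K%:E | K in
    [set K | 0 <= K /\ hilbert_bounded_by alpha b p K]].

End Hilbert_Bergman.

(* Main.v *)
(* With [s = (alpha + 2) / p], [H_b f] is the integral over [0 < t < 1] of
   [(1 - t)^b T_t f], where [T_t f z = f (t / w) / w] and [w = 1 - (1 - t) z].
   The substitution [z = 1 - 1 / zeta] maps the disk onto [Re zeta > 1/2] and turns
   [T_t] into an affine change of variable [zeta -> 1 + kappa zeta] with
   [kappa = t / (1 - t)].  For a polynomial [f], the integrals of
   [|zeta|^(-q p) |f (1 - 1 / zeta)|^p], [q p = 2 (alpha + 2)], along vertical lines are
   nonincreasing functions of [Re zeta], because they are bounded and convex; here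
   [q <= 1] is used.  Hence [zeta -> 1 + kappa zeta] may be replaced by the dilation
   about [1/2] of ratio [kappa], which scales the weight exactly, and
   [||T_t|| <= t^(s - 1) (1 - t)^(- s)].  Integrating in [t] (Jensen's inequality for
   the density [t^(s - 1) (1 - t)^(b - s)]) gives the Beta value.  General [f] are
   reached through Fejer means, which are averages of rotations and so do not increase
   the norm.

   Conversely the functions [(1 - z)^(- c)], [c < s], are reproduced by [T_t] up to the
   factor [(1 - t)^(- c) w^(c - 1)], and as [c] tends to [s] their norms blow up and
   concentrate at [z = 1], where that factor is [(1 - t)^(- c) t^(c - 1)]. *)

(* Neither Cauchy's formula nor subharmonicity is used. Averaging a second-order expansion over [v],
   [- v], [i v], [- i v] cancels the linear and quadratic terms, and the cubic error left is
   harmless because midpoint convexity up to [o(r^2)] already gives monotonicity. Polynomials come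
   first because their expansions are uniform on the half-plane. The condition [q <= 1] enters
   twice: it bounds the binomial coefficients of [(1 + v)^(- q)], and it makes [1 - q] an admissible
   power for [kappa |zeta| <= |1 + kappa zeta|].

   For general [f] even the convergence of the defining series needs proof: it holds once the sum of
   [|a_k| / (k + 1)] is finite. As [p >= 2 (alpha + 2) > 2], this follows from an [L^2] estimate and
   Parseval, with [(1 - |z|^2)^alpha >= 1] since [alpha <= 0].

   Circle averages are replaced by finite averages over roots of unity, complex integrals by real
   parts of [u H_b f] with a free multiplier [u], and the substitution [zeta = 1 / (1 - z)] is
   carried out along lines through [z = 1], where it is a one-variable inversion. *)
From HB Require Import structures.
Require Import Defs.
From mathcomp Require Import measurable_realfun ring lra zify cyclic separable cyclotomic.
Set Implicit Arguments.
Unset Strict Implicit.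
Unset Printing Implicit Defensive.
Import Order.TTheory GRing.Theory Num.Theory.
Local Open Scope classical_set_scope.
Local Open Scope ring_scope.
Local Open Scope complex_scope.

(** * Modulus, real and imaginary parts, convergence in the complex plane *)

Section ComplexBasics.
Context {R : realType}.
Local Notation C := R[i]^o.
Implicit Types (z w : C) (x y : R).

Lemma eqW x y : x = y -> x <= y.
Proof. by move=> ->. Qed.

Lemma modM z w : modulus (z * w) = modulus z * modulus w.
Proof. exact: ComplexField.Normc.normcM. Qed.

Lemma modV z : modulus z^-1 = (modulus z)^-1.
Proof. exact: ComplexField.Normc.normcV. Qed.

Lemma mod0 : modulus (0 : C) = 0. Proof. exact: ComplexField.Normc.normc0. Qed.

Lemma mod1 : modulus (1 : C) = 1. Proof. exact: ComplexField.Normc.normc1. Qed.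

Lemma modD z w : modulus (z + w) <= modulus z + modulus w.
Proof. exact: (@le_normcD R). Qed.

Lemma modN z : modulus (- z) = modulus z. Proof. exact: (@normcN R). Qed.

Lemma modB z w : modulus (z - w) <= modulus z + modulus w.
Proof. by rewrite -(modN w) modD. Qed.

Lemma modBC z w : modulus (z - w) = modulus (w - z).
Proof. by rewrite -modN opprB. Qed.

Lemma mod_ge0 z : 0 <= modulus z.
Proof. by case: z => a b; exact: sqrtr_ge0. Qed.

Lemma mod_eq0 z : (modulus z == 0) = (z == 0).
Proof.
apply/eqP/eqP => [|->]; last exact: mod0.
exact: ComplexField.Normc.eq0_normc.
Qed.

Lemma mod_gt0 z : (0 < modulus z) = (z != 0).
Proof. by rewrite lt_neqAle mod_ge0 andbT eq_sym mod_eq0. Qed.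

Lemma modX z n : modulus (z ^+ n) = modulus z ^+ n.
Proof. by elim: n => [|n IH]; rewrite ?mod1// !exprS modM IH. Qed.

Lemma sqr_mod z : modulus z ^+ 2 = complex.Re z ^+ 2 + complex.Im z ^+ 2.
Proof. by case: z => a b /=; rewrite sqr_sqrtr// addr_ge0// sqr_ge0. Qed.

Lemma mod_real x : modulus (x%:C : C) = `|x|.
Proof. by rewrite /modulus /= expr0n addr0 sqrtr_sqr. Qed.

Lemma mod_nat n : modulus (n%:R : C) = n%:R.
Proof. by rewrite -(rmorph_nat (real_complex R)) mod_real ger0_norm. Qed.

Lemma normc_mod z : `|z| = (modulus z)%:C.
Proof. by rewrite normc_def; case: z. Qed.

Lemma Re_le_mod z : `|complex.Re z| <= modulus z.
Proof.
by rewrite -sqrtr_sqr; case: z => a b; rewrite ler_wsqrtr// lerDl sqr_ge0.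
Qed.

Lemma Im_le_mod z : `|complex.Im z| <= modulus z.
Proof.
by rewrite -sqrtr_sqr; case: z => a b; rewrite ler_wsqrtr// lerDr sqr_ge0.
Qed.

Lemma mod_le_ReIm z : modulus z <= `|complex.Re z| + `|complex.Im z|.
Proof.
rewrite -ler_sqr ?nnegrE ?mod_ge0 ?addr_ge0// sqr_mod sqrrD !real_normK ?num_real//.
by rewrite -addrA [_ *+ 2 + _]addrC addrA lerDl mulrn_wge0// mulr_ge0.
Qed.

Lemma ReCD z w : complex.Re (z + w) = complex.Re z + complex.Re w.
Proof. by case: z w => [a b] [c d]. Qed.

Lemma ImCD z w : complex.Im (z + w) = complex.Im z + complex.Im w.
Proof. by case: z w => [a b] [c d]. Qed.

Lemma ReCN z : complex.Re (- z) = - complex.Re z. Proof. by case: z. Qed.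

Lemma ImCN z : complex.Im (- z) = - complex.Im z. Proof. by case: z. Qed.

Lemma ReCM z w : complex.Re (z * w) =
  complex.Re z * complex.Re w - complex.Im z * complex.Im w.
Proof. by case: z w => [a b] [c d]. Qed.

Lemma ImCM z w : complex.Im (z * w) =
  complex.Re z * complex.Im w + complex.Im z * complex.Re w.
Proof. by case: z w => [a b] [c d]. Qed.

Lemma ReZ x z : complex.Re (x%:C * z) = x * complex.Re z.
Proof. by case: z => a b /=; rewrite mul0r subr0. Qed.

Lemma ImZ x z : complex.Im (x%:C * z) = x * complex.Im z.
Proof. by case: z => a b /=; rewrite mul0r addr0. Qed.

Lemma Re_sum (I : Type) (r : seq I) (P : pred I) (F : I -> C) :
  complex.Re (\sum_(i <- r | P i) F i) = \sum_(i <- r | P i) complex.Re (F i).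
Proof. exact: (big_morph _ ReCD). Qed.

Lemma Im_sum (I : Type) (r : seq I) (P : pred I) (F : I -> C) :
  complex.Im (\sum_(i <- r | P i) F i) = \sum_(i <- r | P i) complex.Im (F i).
Proof. exact: (big_morph _ ImCD). Qed.

Lemma mod_sum (I : Type) (r : seq I) (P : pred I) (F : I -> C) :
  modulus (\sum_(i <- r | P i) F i) <= \sum_(i <- r | P i) modulus (F i).
Proof.
elim/big_rec2: _ => [|i y z _ ih]; first by rewrite mod0.
by rewrite (le_trans (modD _ _))// lerD2l.
Qed.

Lemma complex_eqP z w :
  complex.Re z = complex.Re w -> complex.Im z = complex.Im w -> z = w.
Proof. by case: z w => [a b] [c d] /= -> ->. Qed.

Lemma Re_conjM z : complex.Re ((z^*)%C * z) = modulus z ^+ 2.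
Proof. by rewrite sqr_mod; case: z => a b /=; ring. Qed.

Lemma mod_conj z : modulus (z^*)%C = modulus z.
Proof. by case: z => a b; rewrite /modulus /= sqrrN. Qed.

Lemma cvgC_modP (T : Type) (F : set_system T) (FF : Filter F) (u : T -> C) (l : C) :
  u x @[x --> F] --> l <-> modulus (u x - l) @[x --> F] --> (0 : R).
Proof.
split=> [/cvgrPdist_lt H|/cvgrPdist_lt H]; apply/cvgrPdist_lt => e e0.
- have e0' : 0 < (e%:C : C) by rewrite ltcR.
  have := H _ e0'; apply: filterS => x /=.
  by rewrite normc_mod ltcR sub0r normrN ger0_norm ?mod_ge0// modBC.
(* In the order of the complex numbers a positive element is a positive real. *)
- have [e1 e2] : complex.Im e = 0 /\ 0 < complex.Re e.
    by move: e0; rewrite ltcE/= => /andP[/eqP-> ->].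
  have := H _ e2; apply: filterS => x /=.
  rewrite sub0r normrN ger0_norm ?mod_ge0// modBC normc_mod => h.
  by case: e e0 e1 e2 h => a b /= _ -> _ h; rewrite ltcR.
Qed.

Lemma cvgC_Re (T : Type) (F : set_system T) (FF : Filter F) (u : T -> C) (l : C) :
  u x @[x --> F] --> l -> complex.Re (u x) @[x --> F] --> complex.Re l.
Proof.
move=> /cvgC_modP/cvgrPdist_lt H; apply/cvgrPdist_lt => e e0.
have := H _ e0; apply: filterS => x; rewrite sub0r normrN ger0_norm ?mod_ge0//.
by apply: le_lt_trans; rewrite -ReCN -ReCD modBC Re_le_mod.
Qed.

Lemma cvgC_Im (T : Type) (F : set_system T) (FF : Filter F) (u : T -> C) (l : C) :
  u x @[x --> F] --> l -> complex.Im (u x) @[x --> F] --> complex.Im l.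
Proof.
move=> /cvgC_modP/cvgrPdist_lt H; apply/cvgrPdist_lt => e e0.
have := H _ e0; apply: filterS => x; rewrite sub0r normrN ger0_norm ?mod_ge0//.
by apply: le_lt_trans; rewrite -ImCN -ImCD modBC Im_le_mod.
Qed.

Lemma cvgC_ReIm (T : Type) (F : set_system T) (FF : Filter F) (u : T -> C) (a b : R) :
  complex.Re (u x) @[x --> F] --> a -> complex.Im (u x) @[x --> F] --> b ->
  u x @[x --> F] --> (a +i* b : C).
Proof.
move=> ha hb; apply/cvgC_modP.
have h : (`|complex.Re (u x) - a| + `|complex.Im (u x) - b|) @[x --> F] --> (0 : R).
  rewrite -[0]addr0; apply: cvgD.
    by rewrite -(@normr0 _ R) -(subrr a); apply: cvg_norm; apply: cvgB => //; exact: cvg_cst.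
  by rewrite -(@normr0 _ R) -(subrr b); apply: cvg_norm; apply: cvgB => //; exact: cvg_cst.
apply: (squeeze_cvgr _ (cvg_cst 0) h); near=> x.
rewrite mod_ge0 /=; apply: le_trans (mod_le_ReIm _) _.
by case: (u x) => c d.
Unshelve. all: by end_near. Qed.

Lemma cvgC_mod (T : Type) (F : set_system T) (FF : Filter F) (u : T -> C) (l : C) :
  u x @[x --> F] --> l -> modulus (u x) @[x --> F] --> modulus l.
Proof.
move=> /cvgC_modP/cvgrPdist_lt H; apply/cvgrPdist_lt => e e0.
have := H _ e0; apply: filterS => x; rewrite sub0r normrN ger0_norm ?mod_ge0//.
apply: le_lt_trans; rewrite ler_norml; apply/andP; split.
  by have := modD (u x - l) l; rewrite subrK; lra.
by rewrite modBC; have := modD (l - u x) (u x); rewrite subrK; lra.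
Qed.

Lemma cvgC_abs_series (u : C^nat) (v : R^nat) :
  (forall n, modulus (u n) <= v n) -> cvgn (series v) -> cvgn (series u).
Proof.
move=> uv cv.
have v0 n : 0 <= v n by apply: le_trans (uv n); exact: mod_ge0.
have aux (w : R^nat) : (forall n, `|w n| <= v n) -> cvgn (series w).
  move=> wv; apply: normed_cvg.
  by apply: (series_le_cvg _ v0 wv cv) => n; exact: normr_ge0.
have cr : cvgn (series (fun n => complex.Re (u n))).
  by apply: aux => n; apply: le_trans (Re_le_mod _) (uv n).
have ci : cvgn (series (fun n => complex.Im (u n))).
  by apply: aux => n; apply: le_trans (Im_le_mod _) (uv n).
apply/cvg_ex; exists (limn (series (fun n => complex.Re (u n))) +i*
  limn (series (fun n => complex.Im (u n)))).
apply: cvgC_ReIm.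
  under eq_fun do rewrite Re_sum; exact: cr.
under eq_fun do rewrite Im_sum; exact: ci.
Qed.

Lemma mod_series_tail (u : C^nat) (v : R^nat) N :
  (forall n, modulus (u n) <= v n) -> cvgn (series v) ->
  modulus (limn (series u) - series u N) <= limn (series v) - series v N.
Proof.
move=> uv cv; have cu := cvgC_abs_series uv cv.
have h : modulus (series u n - series u N) @[n --> \oo] -->
         modulus (limn (series u) - series u N).
  apply: cvgC_mod; apply: cvgB; [exact: cu|exact: cvg_cst].
have h2 : series v n - series v N @[n --> \oo] --> limn (series v) - series v N.
  by apply: cvgB => //; exact: cvg_cst.
apply: (ler_cvg_to h h2).
near=> n; have Nn : (N <= n)%N by near: n; exact: nbhs_infty_ge.
rewrite !sub_series Nn; apply: le_trans (mod_sum _ _ _) _.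
by apply: ler_sum => i _; exact: uv.
Unshelve. all: by end_near. Qed.

Lemma mod_series_le (u : C^nat) (v : R^nat) :
  (forall n, modulus (u n) <= v n) -> cvgn (series v) ->
  modulus (limn (series u)) <= limn (series v).
Proof.
move=> uv cv; have := mod_series_tail 0 uv cv.
by rewrite /series/= !big_geq// !subr0.
Qed.

End ComplexBasics.

(** * Negative binomial series and differentiability of power series *)

Section PowerSeries.
Context {R : realType}.
Local Notation C := R[i]^o.
Implicit Types (z w : C) (x y r : R).

(** Finite form of [(1 - v) (1 - v)^(- k - 2) = (1 - v)^(- k - 1)], by Pascal's rule. Keeping the
    remainder exact lets an induction on [k] yield both the bound for real [r] and the limit for
    complex [v]. *)
Lemma negbin_partial_sum (A : comPzRingType) (v : A) k N :
  (1 - v) * (\sum_(0 <= n < N) 'C(n + k.+1, k.+1)%:R * v ^+ n) =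
  \sum_(0 <= n < N) 'C(n + k, k)%:R * v ^+ n - 'C(N + k, k.+1)%:R * v ^+ N.
Proof.
elim: N => [|N IH]; first by rewrite !big_geq// add0n bin_small// mul0r mulr0 subr0.
rewrite !big_nat_recr//= mulrDr {}IH addnS addSn !binS !natrD exprS; ring.
Qed.

Lemma negbin_sum_le r k N : 0 <= r -> r < 1 ->
  \sum_(0 <= n < N) 'C(n + k, k)%:R * r ^+ n <= (1 - r)^-1 ^+ k.+1.
Proof.
move=> r0 r1; have r1' : 0 < 1 - r by rewrite subr_gt0.
elim: k N => [|k IH] N.
  under eq_bigr do rewrite bin0 mul1r.
  rewrite expr1 -[leLHS]mul1r -[X in X * _](mulVf (lt0r_neq0 r1')) -mulrA.
  apply: ler_piMr; first by rewrite invr_ge0 ltW.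
  rewrite big_mkord.
  have -> : (1 - r) * (\sum_(i < N) r ^+ i) = 1 - r ^+ N.
    by rewrite -[in RHS](expr1n R N) subrXX; congr (_ * _); apply: eq_bigr => i _; rewrite expr1n mul1r.
  by rewrite gerBl exprn_ge0.
have := negbin_partial_sum r k N.
move=> /(congr1 ( *%R (1 - r)^-1)); rewrite mulKf ?lt0r_neq0// => ->.
rewrite [leRHS]exprS ler_wpM2l ?invr_ge0 ?(ltW r1')//.
by rewrite lerBlDr (le_trans (IH N))// lerDl mulr_ge0// exprn_ge0.
Qed.

Lemma negbin_cvg r k : 0 <= r -> r < 1 ->
  cvgn (series (fun n => 'C(n + k, k)%:R * r ^+ n)).
Proof.
move=> r0 r1; apply: nondecreasing_is_cvgn.
  by apply/nondecreasing_seqP => n; rewrite seriesSr lerDl mulr_ge0// exprn_ge0.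
exists ((1 - r)^-1 ^+ k.+1) => _ [N _ <-]; exact: negbin_sum_le.
Qed.

Lemma cvgCD (u v : C^nat) (a b : C) : u n @[n --> \oo] --> a ->
  v n @[n --> \oo] --> b -> u n + v n @[n --> \oo] --> a + b.
Proof. exact: cvgD. Qed.

Lemma cvgCB (u v : C^nat) (a b : C) : u n @[n --> \oo] --> a ->
  v n @[n --> \oo] --> b -> u n - v n @[n --> \oo] --> a - b.
Proof. exact: cvgB. Qed.

Lemma cvgCM (u v : C^nat) (a b : C) : u n @[n --> \oo] --> a ->
  v n @[n --> \oo] --> b -> u n * v n @[n --> \oo] --> a * b.
Proof. exact: cvgM. Qed.

Lemma cvgC_unique (u : C^nat) (a b : C) : u n @[n --> \oo] --> a ->
  u n @[n --> \oo] --> b -> a = b.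
Proof.
by move=> ua ub; apply: (cvg_unique (@norm_hausdorff _ C)) ua ub.
Qed.

Lemma cvgC_lim (u : C^nat) (a : C) : u n @[n --> \oo] --> a -> limn u = a.
Proof. exact: (@cvg_lim _ (@norm_hausdorff _ C)). Qed.

Lemma mod_lt1_neq0 (v : C) : modulus v < 1 -> 1 - v != 0.
Proof.
move=> v1; apply: contraTneq v1 => /eqP.
by rewrite subr_eq0 => /eqP <-; rewrite mod1 ltxx.
Qed.

(** It will expand the powers of the kernel [1 / (1 - (1 - t) z)] in powers of [z]. *)
Lemma cvg_negbin_complex (v : C) k : modulus v < 1 ->
  \sum_(0 <= n < N) 'C(n + k, k)%:R * v ^+ n @[N --> \oo] -->
    ((1 - v)^-1 ^+ k.+1 : C).
Proof.
move=> v1; have v10 := mod_lt1_neq0 v1.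
have term j : ('C(N + j, j.+1)%:R * v ^+ N : C) @[N --> \oo] --> (0 : C).
  have term : ('C(N + j.+1, j.+1)%:R * (modulus v) ^+ N) @[N --> \oo] --> (0 : R).
    by apply: cvg_series_cvg_0; apply: negbin_cvg => //; exact: mod_ge0.
  apply/cvgC_modP; apply: (squeeze_cvgr _ (cvg_cst 0) term); near=> N.
  rewrite subr0 mod_ge0 modM modX mod_nat ler_wpM2r ?exprn_ge0 ?mod_ge0//.
  by rewrite ler_nat leq_bin2l// leq_add2l.
elim: k => [|k IH].
  have -> : (fun N => \sum_(0 <= n < N) 'C(n + 0, 0)%:R * v ^+ n) =
            (fun N => (1 - v)^-1 * (1 - 'C(N + 0, 1)%:R * 0 - v ^+ N)).
    apply/funext => N; apply: (mulfI v10); rewrite mulrA divff// mul1r mulr0 subr0.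
    rewrite -[in RHS](expr1n C N) subrXX big_mkord; congr (_ * _).
    by apply: eq_bigr => i _; rewrite bin0 expr1n !mul1r.
  have -> : (1 - v)^-1 ^+ 1 = (1 - v)^-1 * (1 - 0) by rewrite expr1 subr0 mulr1.
  apply: cvgCM; first exact: cvg_cst.
  apply: cvgCB; first by under eq_fun do rewrite mulr0 subr0; exact: cvg_cst.
  apply/cvgC_modP; under eq_fun do rewrite subr0 modX.
  by apply: cvg_expr; rewrite ger0_norm ?mod_ge0.
have -> : (fun N => \sum_(0 <= n < N) 'C(n + k.+1, k.+1)%:R * v ^+ n) =
  (fun N => (1 - v)^-1 * (\sum_(0 <= n < N) 'C(n + k, k)%:R * v ^+ n - 'C(N + k, k.+1)%:R * v ^+ N)).
  by apply/funext => N; rewrite -negbin_partial_sum mulKf.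
rewrite exprS; apply: cvgCM; first exact: cvg_cst.
rewrite -[X in _ --> X]subr0; apply: cvgCB; first exact: IH.
exact: term.
Unshelve. all: by end_near. Qed.

(** With [e_n] the error inside the modulus, [e_(n+1) = w e_n + n z^(n-1) (w - z)^2]. Multiplying
    the left side by [r^2], rather than writing [r^(n-2)] on the right, covers [n = 0] and
    [n = 1]. *)
Lemma taylor_diff_bound z w r n : 0 <= r -> modulus z <= r -> modulus w <= r ->
  modulus (w ^+ n - z ^+ n - n%:R * z ^+ n.-1 * (w - z)) * r ^+ 2 <=
  n%:R ^+ 2 * r ^+ n * modulus (w - z) ^+ 2.
Proof.
move=> r0 zr wr; elim: n => [|n IH].
  by rewrite !expr0 subrr mul0r mul0r subr0 mod0 mul0r mulr_ge0 ?exprn_ge0 ?mod_ge0// mulr_ge0// ?exprn_ge0.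
have -> : w ^+ n.+1 - z ^+ n.+1 - n.+1%:R * z ^+ n.+1.-1 * (w - z) =
   w * (w ^+ n - z ^+ n - n%:R * z ^+ n.-1 * (w - z)) + n%:R * z ^+ n.-1 * (w - z) ^+ 2.
  by case: n {IH} => [|n] /=; rewrite !exprS -?natr1; ring.
apply: (@le_trans _ _ (r * (n%:R ^+ 2 * r ^+ n * modulus (w - z) ^+ 2) +
   n%:R * r ^+ n.+1 * modulus (w - z) ^+ 2)).
  apply: le_trans (ler_wpM2r (exprn_ge0 _ r0) (modD _ _)) _.
  rewrite mulrDl lerD//.
    rewrite modM -[leLHS]mulrA; apply: le_trans (_ : r * _ <= _).
      by apply: (ler_wpM2r _ wr); rewrite mulr_ge0 ?exprn_ge0 ?mod_ge0.
    by rewrite ler_wpM2l.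
  rewrite !modM !modX mod_nat mulrAC; apply: ler_wpM2r; rewrite ?mulr_ge0 ?exprn_ge0 ?mod_ge0//.
  case: n {IH} => [|n] /=; first by rewrite !mul0r.
  rewrite -mulrA; apply: ler_wpM2l => //; rewrite -[X in r ^+ X]addn2 exprD.
  by apply: ler_wpM2r; rewrite ?exprn_ge0//; apply: lerXn2r; rewrite ?nnegrE ?mod_ge0.
rewrite mulrA [r * _]mulrCA -exprS -mulrDl; apply: ler_wpM2r; rewrite ?exprn_ge0 ?mod_ge0//.
rewrite -mulrDl; apply: ler_wpM2r; rewrite ?exprn_ge0//.
by rewrite -natr1; have : 0 <= n%:R :> R by []; nra.
Qed.

Lemma sqr_series_cvg r : 0 <= r -> r < 1 ->
  cvgn (series (fun n => n%:R ^+ 2 * r ^+ n)).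
Proof.
move=> r0 r1; have := is_cvg_seriesZ (k := 2 : R) (@negbin_cvg r 2 r0 r1).
apply: series_le_cvg => n; first by rewrite mulr_ge0 ?exprn_ge0.
  by rewrite mulr_ge0 // mulr_ge0// exprn_ge0.
rewrite [leRHS](_ : _ = 2 * ('C(n + 2, 2)%:R * r ^+ n))// mulrA.
apply: ler_wpM2r; rewrite ?exprn_ge0//.
rewrite -natrX -natrM ler_nat addn2 bin2 -pred_Sn mul2n.
have : (((n.+2 * n.+1)./2).*2 = n.+2 * n.+1)%N by rewrite even_halfK// oddM /= negbK; case: (odd n).
by nia.
Qed.

Lemma geometric_cvg r : 0 <= r -> r < 1 -> cvgn (series (fun n => r ^+ n)).
Proof.
move=> r0 r1; have := @negbin_cvg r 0 r0 r1.
by rewrite (_ : (fun n => _) = (fun n => r ^+ n))//; apply/funext => n; rewrite bin0 mul1r.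
Qed.

Section BoundedCoefficients.
Variables (h : C^nat) (A : R).
Hypothesis hA : forall n, modulus (h n) <= A.

Let A0 : 0 <= A. Proof. exact: le_trans (mod_ge0 _) (hA 0). Qed.

Lemma bounded_taylor_cvg z : modulus z < 1 -> cvgn (taylor_series h z).
Proof.
move=> z1; apply: (@cvgC_abs_series _ _ (fun n => A * modulus z ^+ n)).
  by move=> n; rewrite modM modX ler_wpM2r ?exprn_ge0 ?mod_ge0.
exact/is_cvg_seriesZ/geometric_cvg/z1/mod_ge0.
Qed.

Let dh n (z : C) := h n * (n%:R * z ^+ n.-1).

(** Bounded coefficients cover both uses: the Taylor coefficients of [H_b f], bounded by the sum of
    [|a_k| / (k + 1)], and those of the test functions, bounded by 1. Summing [taylor_diff_bound]
    gives a remainder quadratic in [w - z]. *)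
Lemma bounded_taylor_derivable z : modulus z < 1 ->
  derivable (fun z => limn (taylor_series h z) : C) z 1.
Proof.
move=> z1; pose r : R := (1 + modulus z) / 2.
have z0 := mod_ge0 z.
have [r0 r1 zr] : [/\ 0 < r, r < 1 & modulus z <= r] by split; rewrite /r; lra.
have cS := sqr_series_cvg (ltW r0) r1.
pose S := limn (series (fun n => n%:R ^+ 2 * r ^+ n)).
have cD : cvgn (series (dh ^~ z)).
  apply: (@cvgC_abs_series _ _ (fun n => A / r * (n%:R ^+ 2 * r ^+ n))); last first.
    exact: is_cvg_seriesZ.
  move=> n; rewrite !modM modX mod_nat -mulrA; apply: ler_pM => //; rewrite ?mod_ge0//.
    by rewrite mulr_ge0// exprn_ge0 ?mod_ge0.
  case: n => [|n] /=; first by rewrite !mul0r ?mulr0 expr0n /= mul0r mulr0.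
  rewrite mulrCA (exprS r) (mulKf (lt0r_neq0 r0)); apply: ler_pM; rewrite ?exprn_ge0 ?mod_ge0//.
    by rewrite -natrX ler_nat expnS leq_pmulr.
  by apply: lerXn2r; rewrite ?nnegrE ?mod_ge0// ltW.
pose D := limn (series (dh ^~ z)).
have key (w : C) : modulus w <= r ->
    modulus (limn (taylor_series h w) - limn (taylor_series h z) - D * (w - z)) <=
    A * S / r ^+ 2 * modulus (w - z) ^+ 2.
  move=> wr.
  have w1 : modulus w < 1 by apply: le_lt_trans r1.
  pose e n := h n * (w ^+ n - z ^+ n - n%:R * z ^+ n.-1 * (w - z)).
  have ce : series e n @[n --> \oo] -->
    limn (taylor_series h w) - limn (taylor_series h z) - D * (w - z).
    have -> : series e = (fun n => taylor_series h w n - taylor_series h z n - series (dh ^~ z) n * (w - z)).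
      apply/funext => n; rewrite /taylor_series /series /= mulr_suml -!sumrB.
      by apply: eq_bigr => i _; rewrite /e /dh; ring.
    apply: cvgCB; last by apply: cvgCM; [exact: cD|exact: cvg_cst].
    by apply: cvgCB; exact: bounded_taylor_cvg.
  rewrite -(cvgC_lim ce).
  have cv : cvgn (series (fun n => A / r ^+ 2 * modulus (w - z) ^+ 2 * (n%:R ^+ 2 * r ^+ n))).
    exact: is_cvg_seriesZ.
  apply: le_trans (mod_series_le _ cv) _.
    move=> n; have tb := taylor_diff_bound n (ltW r0) zr wr.
    rewrite -ler_pdivlMr ?exprn_gt0// in tb.
    rewrite modM; apply: le_trans (ler_pM (mod_ge0 _) (mod_ge0 _) (hA n) tb) _.
    by apply/eqW; ring.
  by rewrite lim_seriesZ// -/S; apply/eqW; rewrite -[LHS]/(_ * S); ring.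
apply/cvg_ex; exists D; apply/cvgC_modP => /=.
have : (A * S / r ^+ 2 * modulus (k : C)) @[k --> (0 : C)^'] --> (0 : R).
  rewrite -(mulr0 (A * S / r ^+ 2)); apply: cvgM; first exact: cvg_cst.
  rewrite -mod0; apply: cvgC_mod; exact: cvg_within.
apply: squeeze_cvgr (cvg_cst 0); near=> k.
rewrite mod_ge0 /=.
have k0 : k != 0 by near: k; exact: nbhs_dnbhs_neq.
have kr : modulus k <= r - modulus z.
  near: k.
  have : modulus (k : C) @[k --> (0 : C)^'] --> modulus (0 : C).
    by apply: cvgC_mod; exact: cvg_within.
  rewrite mod0 => /cvgrPdist_lt /(_ (r - modulus z)) H.
  have : 0 < r - modulus z by rewrite /r; lra.
  move=> /H; apply: filterS => k; rewrite sub0r normrN ger0_norm ?mod_ge0//; exact: ltW.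
have wr : modulus (k + z) <= r by apply: le_trans (modD _ _) _; lra.
have := key _ wr; rewrite addrK => K.
have -> : k^-1 *: (limn (taylor_series h (k *: 1 + z)) - limn (taylor_series h z)) - D =
   k^-1 * (limn (taylor_series h (k + z)) - limn (taylor_series h z) - D * k).
  have -> : k%:A = k :> C by exact: mulr1.
  rewrite -[_ *: _]/(k^-1 * _) [RHS]mulrBr; congr (_ - _).
  by rewrite mulrCA mulVf// mulr1.
rewrite modM modV ler_pdivrMl ?mod_gt0//; apply: le_trans K _.
by rewrite expr2 mulrA mulrC.
Unshelve. all: by end_near. Qed.

End BoundedCoefficients.
End PowerSeries.

(** * Real powers of complex numbers on the right half-plane *)

Section ComplexPower.
Context {R : realType}.
Local Notation C := R[i]^o.
Implicit Types (z w : C) (x y r c d : R).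

(** The principal argument, but only on the right half-plane, where the bases of [cpow] lie. *)
Definition carg (z : C) : R := atan (complex.Im z / complex.Re z).

Definition cpow c (z : C) : C :=
  (modulus z `^ c * cos (c * carg z)) +i* (modulus z `^ c * sin (c * carg z)).

Lemma mod_polar r x : 0 <= r -> modulus (((r * cos x) +i* (r * sin x)) : C) = r.
Proof.
move=> r0; rewrite -[RHS](ger0_norm r0) -sqrtr_sqr /modulus /=; congr Num.sqrt.
by rewrite !exprMn -mulrDr cos2Dsin2 mulr1.
Qed.

Lemma mod_cpow c z : modulus (cpow c z) = modulus z `^ c.
Proof. by rewrite mod_polar// powR_ge0. Qed.

Lemma Re_gt0_mod z : 0 < complex.Re z -> 0 < modulus z.
Proof. by move=> z0; apply: lt_le_trans z0 (le_trans (ler_norm _) (Re_le_mod z)). Qed.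

Lemma carg_bounds z : - (pi / 2) < carg z < pi / 2.
Proof. by rewrite atan_gtNpi2 atan_ltpi2. Qed.

Lemma cos_carg z : 0 < complex.Re z -> modulus z * cos (carg z) = complex.Re z.
Proof.
move=> z0; rewrite /carg cos_atan.
have -> : 1 + (complex.Im z / complex.Re z) ^+ 2 = (modulus z / complex.Re z) ^+ 2.
  rewrite !expr_div_n sqr_mod mulrDl divff//.
  by rewrite expf_neq0// lt0r_neq0.
rewrite sqrtr_sqr ger0_norm ?divr_ge0 ?mod_ge0// 1?ltW// invf_div mulrC divfK//.
by rewrite lt0r_neq0// Re_gt0_mod.
Qed.

Lemma sin_carg z : 0 < complex.Re z -> modulus z * sin (carg z) = complex.Im z.
Proof.
move=> z0; have c0 : cos (carg z) != 0.
  by rewrite lt0r_neq0// cos_gt0_pihalf// carg_bounds.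
have := atanK (complex.Im z / complex.Re z); rewrite -/(carg z) /tan => h.
have -> : sin (carg z) = (complex.Im z / complex.Re z) * cos (carg z).
  by rewrite -h divfK.
by rewrite mulrCA cos_carg// divfK// lt0r_neq0.
Qed.

Lemma carg_unique z x : 0 < complex.Re z -> - (pi / 2) < x < pi / 2 ->
  modulus z * cos x = complex.Re z -> modulus z * sin x = complex.Im z -> carg z = x.
Proof.
move=> z0 xpi hc hs; have m0 := lt0r_neq0 (Re_gt0_mod z0).
by rewrite /carg -hc -hs -mulf_div divff// mul1r -/(tan x) tanK.
Qed.

Lemma cpowD c d z : 0 < complex.Re z -> cpow (c + d) z = cpow c z * cpow d z.
Proof.
move=> z0; have m0 := lt0r_neq0 (Re_gt0_mod z0).
apply: complex_eqP => /=; rewrite mulrDl powRD ?m0 ?implybT//.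
  by rewrite cosD; ring.
by rewrite sinD; ring.
Qed.

Lemma cpow0 z : cpow 0 z = 1.
Proof. by apply: complex_eqP; rewrite /= powRr0 mul0r ?cos0 ?sin0 ?mulr1 ?mulr0. Qed.

Lemma cpow1 z : 0 < complex.Re z -> cpow 1 z = z.
Proof.
move=> z0; apply: complex_eqP; rewrite /= powRr1 ?mod_ge0// mul1r.
  exact: cos_carg.
exact: sin_carg.
Qed.

Lemma cpowN1 z : 0 < complex.Re z -> cpow (-1) z = z^-1.
Proof.
move=> z0; have z1 : z != 0 by rewrite -mod_gt0 Re_gt0_mod.
apply: (mulfI z1); rewrite divff// -{1}(cpow1 z0) -cpowD// subrr; exact: cpow0.
Qed.

Lemma cpow_real c x : 0 < x -> cpow c x%:C = (x `^ c)%:C.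
Proof.
move=> x0; have cx : carg (x%:C : C) = 0 by rewrite /carg /= mul0r atan0.
have mx : modulus (x%:C : C) = x by rewrite mod_real ger0_norm// ltW.
by rewrite /cpow cx mx !mulr0 cos0 sin0 mulr0 mulr1.
Qed.

(** The sum of the two arguments lies in []- pi, pi[] and its cosine has the sign of [Re (z w) > 0],
    which leaves only []- pi / 2, pi / 2[]. *)
Lemma cargM z w : 0 < complex.Re z -> 0 < complex.Re w ->
  0 < complex.Re (z * w) -> carg (z * w) = carg z + carg w.
Proof.
move=> z0 w0 zw0.
have hc : modulus (z * w) * cos (carg z + carg w) = complex.Re (z * w).
  by rewrite modM cosD ReCM -(cos_carg z0) -(cos_carg w0) -(sin_carg z0) -(sin_carg w0); ring.
have hs : modulus (z * w) * sin (carg z + carg w) = complex.Im (z * w).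
  by rewrite modM sinD ImCM -(cos_carg z0) -(cos_carg w0) -(sin_carg z0) -(sin_carg w0); ring.
have cpos : 0 < cos (carg z + carg w) by have := zw0; rewrite -hc pmulr_rgt0 ?Re_gt0_mod.
have /andP[z1 z2] := carg_bounds z; have /andP[w1 w2] := carg_bounds w.
apply: carg_unique => //; apply/andP; split; rewrite ltNge; apply/negP => h.
  have : cos (carg z + carg w) <= 0.
    rewrite -cosN -[- _](subrK (pi / 2)) cosDpihalf oppr_le0 sin_ge0_pi//; lra.
  by rewrite leNgt cpos.
have : cos (carg z + carg w) <= 0.
  rewrite -[carg z + _](subrK (pi / 2)) cosDpihalf oppr_le0 sin_ge0_pi//; lra.
by rewrite leNgt cpos.
Qed.

Lemma cpowM c z w : 0 < complex.Re z -> 0 < complex.Re w ->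
  0 < complex.Re (z * w) -> cpow c (z * w) = cpow c z * cpow c w.
Proof.
move=> z0 w0 zw0; apply: complex_eqP; rewrite /= cargM// modM powRM ?mod_ge0// mulrDr.
  by rewrite cosD; ring.
by rewrite sinD; ring.
Qed.

(* Since [|c * carg z| <= |carg z| < pi / 2], the cosine only increases. *)
Lemma Re_cpow_ge c z : -1 <= c -> c <= 0 -> 0 < complex.Re z ->
  modulus z `^ (c - 1) * complex.Re z <= complex.Re (cpow c z).
Proof.
move=> c1 c0 z0; rewrite -(cos_carg z0) mulrA /=.
have m0 := Re_gt0_mod z0.
have -> : modulus z `^ (c - 1) * modulus z = modulus z `^ c.
  by rewrite -{2}(powRr1 (ltW m0)) -powRD ?lt0r_neq0 ?implybT// subrK.
apply: ler_wpM2l; first exact: powR_ge0.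
have /andP[h1 h2] := carg_bounds z.
have -> : cos (carg z) = cos `|carg z| by case: (ger0P (carg z)); rewrite ?cosN.
have -> : cos (c * carg z) = cos `|c * carg z| by case: (ger0P (c * _)); rewrite ?cosN.
have pi0 : 0 < pi :> R := pi_gt0 R.
have a1 : `|carg z| < pi / 2 by rewrite ltr_norml h1 h2.
have a2 : `|c * carg z| <= `|carg z|.
  by rewrite normrM ler_piMl// ler0_norm; lra.
move: a2; rewrite le_eqVlt => /orP[/eqP -> //|a2].
by apply: ltW; rewrite ltr_cos ?in_itv /= ?normr_ge0//=; lra.
Qed.

(** The rising factorial of [c] over [k!], that is, the Taylor coefficient of [(1 - z)^(- c)]. *)
Definition binc c k : R := \prod_(i < k) ((c + i%:R) / i.+1%:R).

Lemma bincS c k : k.+1%:R * binc c k.+1 = (c + k%:R) * binc c k.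
Proof. by rewrite /binc big_ord_recr /= -/(binc c k) mulrCA mulrC [k.+1%:R * _]mulrC divfK// pnatr_eq0. Qed.

Lemma binc0 c : binc c 0 = 1. Proof. by rewrite /binc big_ord0. Qed.

Lemma binc_ge0 c k : 0 <= c -> 0 <= binc c k.
Proof. by move=> c0; apply: prodr_ge0 => i _; rewrite divr_ge0// addr_ge0. Qed.

Lemma binc_le1 c k : 0 <= c -> c <= 1 -> binc c k <= 1.
Proof.
move=> c0 c1; apply: prodr_ile1 => i _; rewrite divr_ge0 ?addr_ge0//=.
by rewrite ler_pdivrMr// mul1r -natr1 addrC lerD2l.
Qed.

Lemma mod_binc_le1 c k : 0 <= c -> c <= 1 -> modulus ((binc c k)%:C : C) <= 1.
Proof. by move=> c0 c1; rewrite mod_real ger0_norm ?binc_ge0 ?binc_le1. Qed.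

(** * The binomial series, by a differential equation along the radius of [z] *)

Section BinomialSeries.
Variables (c : R) (z : C).
Hypotheses (c0 : 0 <= c) (c1 : c <= 1) (z1 : modulus z < 1).

Let a n := binc c n * complex.Re (z ^+ n).
Let b n := binc c n * complex.Im (z ^+ n).

(** The series in the real variable [x] along the radius converge at some [K > 1], so that [x = 1]
    is an interior point. Two formal derivatives are controlled because termwise differentiation
    asks for them. *)
Let le_pow K (f : R^nat) : 1 < K -> K * modulus z < 1 ->
  (forall n, `|f n| <= modulus z ^+ n) ->
  [/\ cvgn (pseries f K), cvgn (pseries (pseries_diffs f) K) &
     cvgn (pseries (pseries_diffs (pseries_diffs f)) K)].
Proof.
move=> K1 Kz hf; have K0 : 0 < K by lra.
pose r := K * modulus z; have r0 : 0 <= r by rewrite mulr_ge0 ?mod_ge0 ?ltW.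
have fK n : `|f n * K ^+ n| <= r ^+ n.
  rewrite normrM [`|K ^+ n|]ger0_norm ?exprn_ge0 ?(ltW K0)// exprMn mulrC.
  by apply: ler_wpM2l; rewrite ?exprn_ge0 ?(ltW K0)//; exact: hf.
have fK1 n j : `|f (n + j)%N * K ^+ n| <= r ^+ n.
  apply: (@le_trans _ _ (modulus z ^+ (n + j) * K ^+ n)).
    rewrite normrM [`|K ^+ n|]ger0_norm ?exprn_ge0 ?(ltW K0)//.
    by apply: ler_wpM2r; rewrite ?exprn_ge0 ?(ltW K0)//; exact: hf.
  rewrite exprD /r exprMn mulrAC [leRHS]mulrC ler_piMr ?mulr_ge0 ?exprn_ge0 ?mod_ge0 ?(ltW K0)//.
  by rewrite exprn_ile1 ?mod_ge0// ltW.
have dom (g : R^nat) : (forall n, `|g n| <= 2 * ('C(n + 2, 2)%:R * r ^+ n)) -> cvgn (series g).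
  move=> hg; apply: normed_cvg.
  have := is_cvg_seriesZ (k := 2 : R) (@negbin_cvg _ r 2 r0 Kz).
  apply: series_le_cvg => n /=; [exact: normr_ge0| |exact: hg].
  by apply: mulr_ge0 => //; rewrite mulr_ge0 ?exprn_ge0.
have bin2n n : (2 * 'C(n + 2, 2) = (n.+1 * n.+2))%N.
  rewrite addn2 bin2 -pred_Sn mul2n even_halfK 1?mulnC//.
  by rewrite oddM /=; case: (odd n).
have mono (m : nat) n x : (m <= n.+1 * n.+2)%N -> `|x| <= r ^+ n ->
    `|m%:R * x| <= 2 * ('C(n + 2, 2)%:R * r ^+ n).
  move=> mn hx; rewrite mulrA -natrM bin2n normrM [`|m%:R|]ger0_norm//.
  by apply: ler_pM => //; rewrite ler_nat.
split; apply: dom => n.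
- by have := mono 1%N n _ _ (fK n); rewrite mul1r; apply; nia.
- rewrite /= /pseries_diffs -mulrA; apply: mono; first by nia.
  by have := fK1 n 1%N; rewrite addn1.
- rewrite /= /pseries_diffs [_.+1%:R * (_ * _)]mulrA -natrM -mulrA; apply: mono; first by nia.
  by have := fK1 n 2%N; rewrite addn2.
Qed.

Let ha n : `|a n| <= modulus z ^+ n.
Proof.
rewrite /a normrM ger0_norm ?binc_ge0// -modX -[leRHS]mul1r.
by apply: ler_pM; rewrite ?binc_ge0 ?binc_le1 ?Re_le_mod.
Qed.

Let hb n : `|b n| <= modulus z ^+ n.
Proof.
rewrite /b normrM ger0_norm ?binc_ge0// -modX -[leRHS]mul1r.
by apply: ler_pM; rewrite ?binc_ge0 ?binc_le1 ?Im_le_mod.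
Qed.

Let K : R := 2 / (1 + modulus z).

Let mz0 : 0 <= modulus z. Proof. exact: mod_ge0. Qed.

Let K1 : 1 < K. Proof. by rewrite /K ltr_pdivlMr; have := mz0; have := z1; lra. Qed.

Let Kz : K * modulus z < 1. Proof. by rewrite /K mulrAC ltr_pdivrMr; have := mz0; have := z1; lra. Qed.

Let xK x : 0 <= x -> x <= 1 -> `|x| < `|K|.
Proof. by move=> x0 x1; rewrite !ger0_norm//; have := K1; lra. Qed.

Let pA := le_pow K1 Kz ha.
Let pB := le_pow K1 Kz hb.

Let F x : C := limn (pseries a x) +i* limn (pseries b x).
Let dF x : C := limn (pseries (pseries_diffs a) x) +i* limn (pseries (pseries_diffs b) x).

Let rpow x n : (x%:C : C) ^+ n = (x ^+ n)%:C.
Proof. by rewrite -rmorphXn. Qed.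

Let FE x : 0 <= x -> x <= 1 ->
  taylor_series (fun k => (binc c k)%:C) (x%:C * z) n @[n --> \oo] --> F x.
Proof.
move=> x0 x1; have xk := xK x0 x1.
have [cA _ _] := pA; have [cB _ _] := pB.
apply: cvgC_ReIm.
  have -> : (fun n => complex.Re (taylor_series (fun k => (binc c k)%:C) (x%:C * z) n)) = pseries a x.
    apply/funext => n; rewrite Re_sum; apply: eq_bigr => i _.
    by rewrite exprMn rpow ReZ ReZ /= /a; ring.
  exact: is_cvg_pseries_inside cA xk.
have -> : (fun n => complex.Im (taylor_series (fun k => (binc c k)%:C) (x%:C * z) n)) = pseries b x.
  apply/funext => n; rewrite Im_sum; apply: eq_bigr => i _.
  by rewrite exprMn rpow ImZ ImZ /= /b; ring.
exact: is_cvg_pseries_inside cB xk.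
Qed.

Let P x N : C := \sum_(0 <= k < N) k.+1%:R * ((binc c k.+1)%:C * z ^+ k.+1) * x%:C ^+ k.

Let PE x : 0 <= x -> x <= 1 -> P x N @[N --> \oo] --> dF x.
Proof.
move=> x0 x1; have xk := xK x0 x1.
have [_ cA _] := pA; have [_ cB _] := pB.
apply: cvgC_ReIm.
  have -> : (fun n => complex.Re (P x n)) = pseries (pseries_diffs a) x.
    apply/funext => n; rewrite Re_sum; apply: eq_bigr => i _.
    rewrite -(rmorph_nat (real_complex R)) rpow -mulrA [_ * (x ^+ i)%:C]mulrC.
    by rewrite !ReZ /= /pseries_diffs /a; ring.
  exact: is_cvg_pseries_inside cA xk.
have -> : (fun n => complex.Im (P x n)) = pseries (pseries_diffs b) x.
  apply/funext => n; rewrite Im_sum; apply: eq_bigr => i _.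
  rewrite -(rmorph_nat (real_complex R)) rpow -mulrA [_ * (x ^+ i)%:C]mulrC.
  by rewrite !ImZ /= /pseries_diffs /b; ring.
exact: is_cvg_pseries_inside cB xk.
Qed.

Let bincSC k : k.+1%:R * (binc c k.+1)%:C = (c%:C + k%:R) * (binc c k)%:C :> C.
Proof.
by rewrite -!(rmorph_nat (real_complex R)) -rmorphM -rmorphD -rmorphM bincS.
Qed.

(** The recurrence [bincS] summed over [k]; in the limit it reads [(1 - x z) F' = c z F]. *)
Let PS x N : P x N.+1 = z * (c%:C * taylor_series (fun k => (binc c k)%:C) (x%:C * z) N.+1
   + x%:C * P x N).
Proof.
elim: N => [|N IH].
  rewrite /P /taylor_series /series /= !big_nat1 big_geq// mulr0 addr0 !expr0 !mulr1 expr1.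
  by rewrite mulrA bincSC addr0; ring.
have rec M : P x M.+1 = P x M + M.+1%:R * ((binc c M.+1)%:C * z ^+ M.+1) * x%:C ^+ M.
  by rewrite /P big_nat_recr.
rewrite rec {1}IH rec /taylor_series [in RHS]seriesSr.
rewrite [_.+2%:R * _]mulrA bincSC exprMn !exprS; ring.
Qed.

Let dFE x : 0 <= x -> x <= 1 -> (1 - x%:C * z) * dF x = c%:C * z * F x.
Proof.
move=> x0 x1.
have h1 : P x N.+1 @[N --> \oo] --> dF x by rewrite (cvg_shiftS (P x)); exact: PE.
have h2 : P x N.+1 @[N --> \oo] --> z * (c%:C * F x + x%:C * dF x).
  under eq_fun do rewrite PS.
  apply: cvgCM; first exact: cvg_cst.
  apply: cvgCD; apply: cvgCM; try exact: cvg_cst.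
    have := FE x0 x1; rewrite -(cvg_shiftS (taylor_series _ _)); exact.
  exact: PE.
have := cvgC_unique h1 h2 => e.
by rewrite mulrBl mul1r {1}e; ring.
Qed.

(** Polar form of [1 - x z]: [D] is its squared modulus, [lam] the logarithm of its modulus and [th]
    its argument, so that [pu + i pv] is [(1 - x z)^c] in a form that can be differentiated in
    [x]. *)
Let za := complex.Re z.
Let zb := complex.Im z.
Let U x := 1 - x * za.
Let V x := - (x * zb).
Let D x := U x ^+ 2 + V x ^+ 2.
Let lam x := 2^-1 * ln (D x).
Let th x := atan (V x / U x).
Let pu x := expR (c * lam x) * cos (c * th x).
Let pv x := expR (c * lam x) * sin (c * th x).

Let ReE x : complex.Re (1 - x%:C * z) = U x.
Proof. by rewrite ReCD ReCN ReZ. Qed.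

Let ImE x : complex.Im (1 - x%:C * z) = V x.
Proof. by rewrite ImCD ImCN ImZ sub0r. Qed.

Let U0 x : 0 <= x -> x <= 1 -> 0 < U x.
Proof.
move=> x0 x1; rewrite /U subr_gt0; have := Re_le_mod z; rewrite ler_norml => /andP[_ h].
by have := z1; have := mz0; rewrite /za; nra.
Qed.

Let D0 x : 0 <= x -> x <= 1 -> 0 < D x.
Proof. by move=> x0 xl1; rewrite /D ltr_wpDr ?sqr_ge0// exprn_gt0// U0. Qed.

Let cpowE x : 0 <= x -> x <= 1 -> cpow c (1 - x%:C * z) = pu x +i* pv x.
Proof.
move=> x0 x1; rewrite /cpow /carg ReE ImE -/(th x).
have -> : modulus (1 - x%:C * z) `^ c = expR (c * lam x); last by [].
have m0 : 0 < modulus (1 - x%:C * z) by apply: Re_gt0_mod; rewrite ReE U0.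
rewrite /powR gt_eqF//; congr (expR (_ * _)).
have e : D x = modulus (1 - x%:C * z) ^+ 2 by rewrite sqr_mod ReE ImE.
have -> : lam x = 2^-1 * ln (D x) by [].
by rewrite e lnXn// -[ln _ *+ 2]mulr_natl mulKf.
Qed.

Let dM (f g : R -> R) x df dg : is_derive x (1 : R) f df -> is_derive x (1 : R) g dg ->
  is_derive x (1 : R) (fun y => f y * g y) (f x * dg + g x * df).
Proof. exact: is_deriveM. Qed.

Let dD (f g : R -> R) x df dg : is_derive x (1 : R) f df -> is_derive x (1 : R) g dg ->
  is_derive x (1 : R) (fun y => f y + g y) (df + dg).
Proof. exact: is_deriveD. Qed.

Let dZ (k : R) (f : R -> R) x df : is_derive x (1 : R) f df ->
  is_derive x (1 : R) (fun y => k * f y) (k * df).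
Proof.
move=> h; apply: is_derive_eq (dM (is_derive_cst k x 1) h) _.
by rewrite mulr0 addr0.
Qed.

Let dcomp (f g : R -> R) x (df dg : R) : is_derive (g x) (1 : R) f df ->
  is_derive x (1 : R) g dg -> is_derive x (1 : R) (fun y => f (g y)) (df * dg).
Proof. exact: is_derive1_comp. Qed.

Let dlin (k m : R) x : is_derive x (1 : R) (fun y => k + y * m) m.
Proof.
apply: is_derive_eq (dD (is_derive_cst k x 1) (dM (is_derive_id x 1) (is_derive_cst m x 1))) _.
by rewrite mulr0 !add0r mulr1.
Qed.

Let dU x : is_derive x (1 : R) U (- za).
Proof.
have -> : U = (fun y => 1 + y * - za) by apply/funext => y; rewrite /U mulrN.
exact: dlin.
Qed.

Let dV x : is_derive x (1 : R) V (- zb).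
Proof.
have -> : V = (fun y => 0 + y * - zb) by apply/funext => y; rewrite /V add0r mulrN.
exact: dlin.
Qed.

Let dlam x : 0 <= x -> x <= 1 ->
  is_derive x (1 : R) lam ((- za * U x - zb * V x) / D x).
Proof.
move=> x0 x1; have d0 := D0 x0 x1.
have hD : is_derive x (1 : R) D (2 * (- za * U x - zb * V x)).
  by apply: is_derive_eq (dD (dM (dU x) (dU x)) (dM (dV x) (dV x))) _; ring.
apply: is_derive_eq (dZ 2^-1 (dcomp (is_derive1_ln d0) hD)) _.
by field; rewrite lt0r_neq0.
Qed.

Let dth x : 0 <= x -> x <= 1 ->
  is_derive x (1 : R) th ((- zb * U x + za * V x) / D x).
Proof.
move=> x0 x1; have u0 := lt0r_neq0 (U0 x0 x1); have d0 := lt0r_neq0 (D0 x0 x1).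
have hV : is_derive x (1 : R) (fun y => (U y)^-1) (za / U x ^+ 2).
  have h := is_deriveV u0 (dU x).
  by apply: is_derive_eq h _; rewrite /GRing.scale /= mulrNN mulrC.
apply: is_derive_eq (dcomp (is_derive1_atan _) (dM (dV x) hV)) _.
have e : 1 + (V x / U x) ^+ 2 = D x / U x ^+ 2.
  by rewrite /D expr_div_n mulrDl divff// expf_neq0.
rewrite e invf_div; field.
by rewrite u0 d0.
Qed.

Let dpu x : 0 <= x -> x <= 1 -> is_derive x (1 : R) pu
  (c * ((- za * U x - zb * V x) / D x * pu x - (- zb * U x + za * V x) / D x * pv x)).
Proof.
move=> x0 x1; have hl := dZ c (dlam x0 x1); have ht := dZ c (dth x0 x1).
apply: is_derive_eq (dM (dcomp (is_derive_expR _) hl) (dcomp (is_derive_cos _) ht)) _.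
by rewrite /pu /pv; ring.
Qed.

Let dpv x : 0 <= x -> x <= 1 -> is_derive x (1 : R) pv
  (c * ((- za * U x - zb * V x) / D x * pv x + (- zb * U x + za * V x) / D x * pu x)).
Proof.
move=> x0 x1; have hl := dZ c (dlam x0 x1); have ht := dZ c (dth x0 x1).
apply: is_derive_eq (dM (dcomp (is_derive_expR _) hl) (dcomp (is_derive_sin _) ht)) _.
by rewrite /pu /pv; ring.
Qed.

Let A x := limn (pseries a x).
Let B x := limn (pseries b x).
Let A' x := limn (pseries (pseries_diffs a) x).
Let B' x := limn (pseries (pseries_diffs b) x).

Let dA x : 0 <= x -> x <= 1 -> is_derive x (1 : R) A (A' x).
Proof.
by move=> x0 x1; have [? ? ?] := pA; apply: (@pseries_snd_diffs _ _ K) => //; exact: xK.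
Qed.

Let dB x : 0 <= x -> x <= 1 -> is_derive x (1 : R) B (B' x).
Proof.
by move=> x0 x1; have [? ? ?] := pB; apply: (@pseries_snd_diffs _ _ K) => //; exact: xK.
Qed.

Let ode x : 0 <= x -> x <= 1 ->
  U x * A' x - V x * B' x = c * (za * A x - zb * B x) /\
  U x * B' x + V x * A' x = c * (za * B x + zb * A x).
Proof.
move=> x0 x1; have e := dFE x0 x1; split.
  have /= := congr1 (@complex.Re R) e; rewrite -mulrA ReZ !ReCM ReE ImE /=.
  by move=> ->.
have /= := congr1 (@complex.Im R) e; rewrite -mulrA ImZ !ImCM ReE ImE /=.
by move=> ->.
Qed.

Let cst_on (f : R -> R) : (forall x, 0 <= x -> x <= 1 -> is_derive x (1 : R) f 0) ->
  f 1 = f 0.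
Proof.
move=> df.
have [x||y _] := @MVT_segment R f (cst 0) 0 1 ler01.
- by rewrite in_itv /= => /andP[/ltW x0 /ltW x1]; exact: df.
- apply: derivable_within_continuous => x; rewrite in_itv /= => /andP[x0 x1].
  by have [] := df x x0 x1.
- by rewrite mul0r => /eqP; rewrite subr_eq0 => /eqP.
Qed.

Let A0 : A 0 = 1.
Proof.
apply: (@cvg_lim _ (@Rhausdorff R)); apply: cvg_near_cst; near=> n.
have n0 : (0 < n)%N by near: n; exact: nbhs_infty_gt.
rewrite -(prednK n0) /pseries /series /= big_nat_recl//= big1 ?addr0.
  by rewrite /a binc0 !mul1r.
by move=> i _; rewrite expr0n mulr0.
Unshelve. all: by end_near. Qed.

Let B0 : B 0 = 0.
Proof.
apply: (@cvg_lim _ (@Rhausdorff R)); apply: cvg_near_cst; near=> n.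
rewrite /pseries /series /= big1// => -[|i] _; last by rewrite expr0n mulr0.
by rewrite /b mulr0 mul0r.
Unshelve. all: by end_near. Qed.

(** The series and [(1 - x z)^c] solve opposite linear equations, so their product is constant on
    [[0, 1]]. Its real and imaginary parts are treated separately, and at [x = 0] it equals 1. *)
Let prod1 : F 1 * cpow c (1 - z) = 1.
Proof.
have solve x : 0 <= x -> x <= 1 ->
    A' x = c * ((za * U x + zb * V x) * A x + (za * V x - zb * U x) * B x) / D x /\
    B' x = c * ((zb * U x - za * V x) * A x + (za * U x + zb * V x) * B x) / D x.
  move=> x0 x1; have [h1 h2] := ode x0 x1; have d0 := lt0r_neq0 (D0 x0 x1).
  split; apply: (canRL (mulfK d0)).
    transitivity (U x * (U x * A' x - V x * B' x) + V x * (U x * B' x + V x * A' x)).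
      by rewrite /D; ring.
    by rewrite h1 h2; ring.
  transitivity (U x * (U x * B' x + V x * A' x) - V x * (U x * A' x - V x * B' x)).
    by rewrite /D; ring.
  by rewrite h1 h2; ring.
have e1 : A 1 * pu 1 + - 1 * (B 1 * pv 1) = A 0 * pu 0 + - 1 * (B 0 * pv 0).
  apply: (@cst_on (fun x => A x * pu x + - 1 * (B x * pv x))) => x x0 x1.
  have [hA hB] := solve x x0 x1; have d0 := lt0r_neq0 (D0 x0 x1).
  apply: is_derive_eq (dD (dM (dA x0 x1) (dpu x0 x1)) (dZ (- 1) (dM (dB x0 x1) (dpv x0 x1)))) _.
  by rewrite hA hB; field.
have e2 : A 1 * pv 1 + B 1 * pu 1 = A 0 * pv 0 + B 0 * pu 0.
  apply: (@cst_on (fun x => A x * pv x + B x * pu x)) => x x0 x1.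
  have [hA hB] := solve x x0 x1; have d0 := lt0r_neq0 (D0 x0 x1).
  apply: is_derive_eq (dD (dM (dA x0 x1) (dpv x0 x1)) (dM (dB x0 x1) (dpu x0 x1))) _.
  by rewrite hA hB; field.
have c0' : cpow c (1 - 0%:C * z) = 1.
  by rewrite mul0r subr0 (cpow_real c ltr01) powR1.
move: c0'; rewrite cpowE// => /eqP; rewrite eq_complex /= => /andP[/eqP p0 /eqP q0].
have := @cpowE 1 ler01 (lexx _); rewrite mul1r => ->.
apply: complex_eqP; rewrite /= -/(A 1) -/(B 1); move: e1 e2; rewrite A0 B0 p0 q0.
  by move=> + _; rewrite mulN1r => ->; ring.
by move=> _ ->; ring.
Qed.

Lemma cvg_binomial_series :
  taylor_series (fun k => (binc c k)%:C) z n @[n --> \oo] --> cpow (- c) (1 - z).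
Proof.
have := FE ler01 (lexx 1); rewrite mul1r.
have Re0 : 0 < complex.Re (1 - z) by have := ReE 1; rewrite mul1r => ->; exact: U0.
have -> // : F 1 = cpow (- c) (1 - z).
have cN : cpow (- c) (1 - z) * cpow c (1 - z) = 1 by rewrite -cpowD// addNr cpow0.
have c0' : cpow c (1 - z) != 0.
  by apply/eqP => e; move: cN; rewrite e mulr0 => /eqP; rewrite eq_sym oner_eq0.
by apply: (mulIf c0'); rewrite cN prod1.
Qed.

End BinomialSeries.
End ComplexPower.

(** * Change of variable on the line and improper integrals *)

Section Substitution.
Context {R : realType}.
Local Open Scope ereal_scope.
Local Notation mu := (@lebesgue_measure R).
Import HBNNSimple.

Section OneVariable.
Local Notation T := (measurableTypeR R).
Variables (psi : T -> T) (w : T -> R).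
Hypotheses (mpsi : measurable_fun [set: T] psi) (mw : measurable_fun [set: T] w).
Hypothesis w0 : forall x, (0 <= w x)%R.
Hypothesis psi_itv : forall a b : R, (a < b)%R ->
  \int[mu]_(x in psi @^-1` `]a, b]) (w x)%:E = (b - a)%:E.

(** Image under [psi] of the measure with density [w]. Agreement with Lebesgue measure on half-open
    intervals makes the two equal, so neither an inverse nor a derivative of [psi] is involved. *)
Definition subst_measure (A : set (measurableTypeR R)) : \bar R :=
  \int[mu]_(x in psi @^-1` A) (w x)%:E.

Let subst_measure0 : subst_measure set0 = 0.
Proof. by rewrite /subst_measure preimage_set0 integral_set0. Qed.

Let subst_measure_ge0 A : 0 <= subst_measure A.
Proof. by apply: integral_ge0 => x _; rewrite lee_fin. Qed.

Let mpre (A : set T) : measurable A -> measurable (psi @^-1` A).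
Proof. by move=> mA; rewrite -[X in measurable X]setTI; exact: mpsi. Qed.

Let subst_measure_sigma_additive : semi_sigma_additive subst_measure.
Proof.
move=> /= F mF tF mUF; rewrite /subst_measure; apply: cvg_toP.
  apply: ereal_nondecreasing_is_cvgn => m n mn.
  apply: lee_sum_nneg_natr => // k _ _; apply: integral_ge0 => /= x _.
  by rewrite lee_fin.
rewrite preimage_bigcup ge0_integral_bigcup//=.
- by move=> k; exact: mpre.
- exact/measurable_funTS/measurableT_comp.
- by move=> x _; rewrite lee_fin.
- move=> i j _ _ [x [/= Fi Fj]]; apply: tF => //; by exists (psi x).
Qed.

HB.instance Definition _ := isMeasure.Build _ _ _ subst_measure
  subst_measure0 subst_measure_ge0 subst_measure_sigma_additive.

Lemma subst_measureE (A : set T) : measurable A -> mu A = subst_measure A.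
Proof.
move=> mA; apply: (@lebesgue_measure_unique R subst_measure) => // X /ocitvP[->|].
  by rewrite !measure0.
move=> [[a b]] /= ab ->; rewrite lebesgue_measure_itv /= lte_fin ab.
by rewrite /subst_measure psi_itv// EFinB.
Qed.

Lemma ge0_integral_subst (g : T -> \bar R) : measurable_fun [set: T] g ->
  (forall x, 0 <= g x) -> \int[mu]_x g x = \int[mu]_x (g (psi x) * (w x)%:E).
Proof.
move=> mg g0; pose g_ := nnsfun_approx measurableT mg.
have cvg_ x : EFin \o g_^~ x @ \oo --> g x by exact: cvg_nnsfun_approx.
have nd x : {homo (fun n => (g_ n x)%:E) : m n / (m <= n)%N >-> m <= n}.
  by move=> m n mn; rewrite lee_fin; exact/lefP/nd_nnsfun_approx.
transitivity (limn (fun n => \int[mu]_x (g_ n x)%:E)).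
  rewrite -monotone_convergence//.
  - by apply: eq_integral => x _; apply/esym/cvg_lim => //; exact: cvg_.
  - by move=> n; exact/measurable_EFinP/measurable_funTS.
  - by move=> n x _; rewrite lee_fin.
transitivity (limn (fun n => \int[mu]_x ((g_ n (psi x))%:E * (w x)%:E))); last first.
  rewrite -monotone_convergence//.
  - apply: eq_integral => x _; apply/cvg_lim => //.
    by apply: cvgeZr => //; exact: cvg_.
  - move=> n; apply: emeasurable_funM; last exact/measurable_EFinP.
    by apply/measurable_EFinP; apply: measurableT_comp.
  - by move=> n x _; rewrite mule_ge0// lee_fin.
  - by move=> x _ m n mn; rewrite lee_wpmul2r ?lee_fin//; exact: nd.
congr (limn _); apply/funext => n; rewrite integralT_nnsfun sintegralE.
transitivity (\int[mu]_x (\sum_(r \in range (g_ n))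
    (r * \1_(g_ n @^-1` [set r]) (psi x) * w x)%:E)); last first.
  apply: eq_integral => x _; rewrite [in RHS]fimfunE -EFinM mulr_fsuml//.
  by rewrite fsumEFin.
rewrite ge0_integral_fsum//; last 2 first.
- move=> r; apply/measurable_EFinP; apply: measurable_funM => //.
  by apply: measurable_funM => //; apply: measurableT_comp.
- by move=> r x _; rewrite lee_fin mulr_ge0//; exact: nnfun_muleindic_ge0.
apply: eq_fsbigr => r /set_mem[x _ <-].
rewrite [X in _ * X](subst_measureE _)// /subst_measure [X in _ * X]integral_mkcond.
rewrite -ge0_integralZl_EFin//=; last 2 first.
- by move=> y _; apply: erestrict_ge0 => z _; rewrite lee_fin.
- apply/(measurable_restrictT _ _).1; first exact: mpre.
  exact/measurable_funTS/measurable_EFinP.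
apply: eq_integral => y _; rewrite patchE indicE.
case: ifPn => h.
  by rewrite (_ : _ \in _ = true) ?mulr1// inE; move: h; rewrite inE.
rewrite (_ : (_ \in _) = false) ?mulr0 ?mul0r ?mule0//.
by apply/negbTE; move: h; rewrite !notin_setE.
Qed.

End OneVariable.

Lemma ge0_integral_affine (c d : R) (g : R -> \bar R) : (c != 0)%R ->
  measurable_fun [set: R] g -> (forall x, 0 <= g x) ->
  \int[mu]_x g x = `|c|%:E * \int[mu]_x g (c * x + d)%R.
Proof.
move=> c0 mg g0.
have mpsi : measurable_fun [set: R] (fun x : R => c * x + d)%R.
  by apply: measurable_funD => //; exact: measurable_funM.
rewrite (@ge0_integral_subst (fun x => c * x + d)%R (cst `|c|%R) mpsi)//.
  under eq_integral do rewrite muleC.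
  rewrite ge0_integralZl_EFin//.
  exact: measurableT_comp.
move=> a b ab; rewrite (@integral_cst _ _ _ mu _ _ `|c|%:E) ?[X in measurable X](_ : _ = (fun x : R => c * x + d)%R @^-1` `]a, b])//; last first.
  by rewrite -[X in measurable X]setTI; exact: mpsi.
have [cp|cn|/eqP] := ltrgtP c 0%R; last by rewrite (negbTE c0).
- rewrite (_ : _ @^-1` _ = `[((b - d) / c)%R, ((a - d) / c)%R[%classic); last first.
    apply/seteqP; split => x /=; rewrite !in_itv /= => /andP[h1 h2].
      by rewrite ler_ndivrMr// ltr_ndivlMr//; apply/andP; split; nra.
    by move: h1 h2; rewrite ler_ndivrMr// ltr_ndivlMr// => h1 h2; apply/andP; split; nra.
  have e : mu `[((b - d) / c)%R, ((a - d) / c)%R[ = ((a - d) / c - (b - d) / c)%:E.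
    by rewrite lebesgue_measure_itv /= lte_fin ltr_nM2r ?invr_lt0// ltrD2r ab EFinB.
  rewrite [X in _ * X]e -EFinM ltr0_norm//; congr EFin; field.
  exact: c0.
- rewrite (_ : _ @^-1` _ = `]((a - d) / c)%R, ((b - d) / c)%R]%classic); last first.
    apply/seteqP; split => x /=; rewrite !in_itv /= => /andP[h1 h2].
      by rewrite ler_pdivlMr// ltr_pdivrMr//; apply/andP; split; nra.
    by move: h1 h2; rewrite ler_pdivlMr// ltr_pdivrMr// => h1 h2; apply/andP; split; nra.
  have e : mu `]((a - d) / c)%R, ((b - d) / c)%R] = ((b - d) / c - (a - d) / c)%:E.
    by rewrite lebesgue_measure_itv /= lte_fin ltr_pM2r ?invr_gt0// ltrD2r ab EFinB.
  rewrite [X in _ * X]e -EFinM gtr0_norm//; congr EFin; field.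
  exact: c0.
Qed.

Lemma cvg_integral_itv (D : set R) (x y : R^nat) (f : R -> \bar R) :
  measurable D -> measurable_fun D f -> (forall t, D t -> 0 <= f t) ->
  (forall n, `[x n, y n] `<=` D) -> {homo x : m n / (m <= n)%N >-> (n <= m)%R} ->
  {homo y : m n / (m <= n)%N >-> (m <= n)%R} ->
  (forall t, D t -> exists n, (x n <= t <= y n)%R) ->
  \int[mu]_(t in `[x n, y n]) f t @[n --> \oo] --> \int[mu]_(t in D) f t.
Proof.
move=> mD mf f0 xyD hx hy Dxy.
have -> : D = \bigcup_n `[x n, y n]%classic.
  apply/seteqP; split => [t /Dxy[n tn]|t [n _ tn]]; last exact: xyD tn.
  by exists n => //=; rewrite in_itv.
apply: ge0_nondecreasing_set_cvg_integral.
- move=> m n mn; apply/subsetPset => t /=; rewrite !in_itv /= => /andP[h1 h2].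
  by rewrite (le_trans _ h1) ?hx//= (le_trans h2)// hy.
- by move=> i; exact: measurable_itv.
- by move=> i; apply: measurable_funS mf => //; exact: xyD.
- by move=> i t ti; apply: f0; exact: xyD ti.
Qed.

(** The fundamental theorem of calculus on growing compact intervals. It admits integrands that blow
    up at an end of [D] as well as unbounded [D]: only the limit of the increments of [F] is
    required. *)
Lemma ge0_FTC_exhaust (D : set R) (x y : R^nat) (f F : R -> R) (l : R) :
  measurable D -> measurable_fun D f ->
  (forall t, D t -> 0 <= f t)%R ->
  (forall t, D t -> {for t, continuous f}) ->
  (forall t, D t -> is_derive t 1%R F (f t)) ->
  (forall n, x n < y n)%R ->
  (forall n, `[x n, y n] `<=` D) -> {homo x : m n / (m <= n)%N >-> (n <= m)%R} ->
  {homo y : m n / (m <= n)%N >-> (m <= n)%R} ->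
  (forall t, D t -> exists n, (x n <= t <= y n)%R) ->
  (F (y n) - F (x n))%R @[n --> \oo] --> l ->
  \int[mu]_(t in D) (f t)%:E = l%:E.
Proof.
move=> mD mf f0 cf dF xy xyD hx hy Dxy Fl.
have h : \int[mu]_(t in `[x n, y n]) (f t)%:E @[n --> \oo] --> \int[mu]_(t in D) (f t)%:E.
  by apply: cvg_integral_itv => //; exact/measurable_EFinP.
have e n : \int[mu]_(t in `[x n, y n]) (f t)%:E = (F (y n) - F (x n))%:E.
  have inD t : t \in `[x n, y n] -> D t by move=> tn; exact: xyD tn.
  have cF t : t \in `[x n, y n] -> {for t, continuous F}.
    move=> /inD/dF[dFt _]; exact/differentiable_continuous/derivable1_diffP.
  rewrite (@continuous_FTC2 _ f F)// ?EFinB//.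
  - apply: continuous_in_subspaceT => t; rewrite inE /= => tn; exact: cf (inD _ tn).
  - split.
    + move=> t tn; have /dF[] : D t by apply: inD; exact: subset_itv_oo_cc.
      by [].
    + by apply: cvg_at_right_filter; apply: cF; rewrite in_itv /= lexx ltW.
    + by apply: cvg_at_left_filter; apply: cF; rewrite in_itv /= lexx ltW.
  - move=> t tn; have /dF[? ?] : D t by apply: inD; exact: subset_itv_oo_cc.
    by rewrite derive1E.
move: h; under eq_fun do rewrite e.
have h2 : (F (y n) - F (x n))%:E @[n --> \oo] --> l%:E by apply: cvg_EFin => //; exact: nearW.
by move=> h; apply: (cvg_unique _ h h2).
Qed.

End Substitution.

(** * The substitution [x -> 1 / x] on the positive half-line *)

Section Inversion.
Context {R : realType}.
Local Notation mu := (@lebesgue_measure R).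
Implicit Types (f F : R -> R) (p q : R).

Lemma cvg_harmonic_shift (c : R) k : c / (n + k)%:R @[n --> \oo] --> (0 : R).
Proof.
rewrite -(mulr0 c); apply: cvgM; first exact: cvg_cst.
apply/cvgrPdist_lt => e e0; near=> n; rewrite sub0r normrN ger0_norm ?invr_ge0//.
have n0 : (0 < n)%N by near: n; exact: nbhs_infty_gt.
rewrite invf_plt ?posrE ?ltr0n ?addn_gt0 ?n0//.
apply: (@lt_le_trans _ _ n%:R); last by rewrite ler_nat leq_addr.
by near: n; exact: nbhs_infty_gtr.
Unshelve. all: by end_near. Qed.

Lemma ge0_FTC_oo p q f F lp lq : p < q -> measurable_fun `]p, q[ f ->
  (forall t, p < t < q -> 0 <= f t) ->
  (forall t, p < t < q -> {for t, continuous f}) ->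
  (forall t, p < t < q -> is_derive t (1 : R) F (f t)) ->
  F t @[t --> p^'+] --> lp -> F t @[t --> q^'-] --> lq ->
  (\int[mu]_(t in `]p, q[) (f t)%:E = (lq - lp)%:E)%E.
Proof.
move=> pq mf f0 cf dF Fp Fq; have qp : 0 < q - p by rewrite subr_gt0.
(* With 3 in the denominator, [x n < y n] holds from [n = 0] on. *)
pose x n := p + (q - p) / (n + 3)%:R; pose y n := q - (q - p) / (n + 3)%:R.
have small n : 0 < (q - p) / (n + 3)%:R <= (q - p) / 3.
  rewrite divr_gt0 ?ltr0n ?addn_gt0 ?orbT//= ler_pM2l// lef_pV2 ?posrE ?ltr0n ?addn_gt0 ?orbT//.
  by rewrite ler_nat leq_addl.
have dec m n : (m <= n)%N -> (q - p) / (n + 3)%:R <= (q - p) / (m + 3)%:R.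
  move=> mn; rewrite ler_pM2l// lef_pV2 ?posrE ?ltr0n ?addn_gt0 ?orbT//.
  by rewrite ler_nat leq_add2r.
have cx : x n @[n --> \oo] --> p.
  by rewrite -[X in _ --> X]addr0; apply: cvgD; [exact: cvg_cst|exact: cvg_harmonic_shift].
have cy : y n @[n --> \oo] --> q.
  by rewrite -[X in _ --> X]subr0; apply: cvgB; [exact: cvg_cst|exact: cvg_harmonic_shift].
apply: (@ge0_FTC_exhaust _ _ x y _ F) => //.
- by move=> n; have /andP[] := small n; rewrite /x /y; lra.
- move=> n t /=; rewrite !in_itv /= => /andP[h1 h2]; have /andP[] := small n.
  by move: h1 h2; rewrite /x /y; lra.
- by move=> m n mn; have := dec _ _ mn; rewrite /x; lra.
- by move=> m n mn; have := dec _ _ mn; rewrite /y; lra.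
- move=> t; rewrite /= in_itv /= => /andP[pt tq].
  have := cvg_harmonic_shift (q - p) 3 => /cvgrPdist_lt /(_ (Num.min (t - p) (q - t))).
  rewrite lt_min !subr_gt0 pt tq /= => /(_ isT)[n _ /(_ n (leqnn n))] /=.
  have /andP[sm _] := small n.
  rewrite sub0r normrN gtr0_norm// lt_min => /andP[h1 h2].
  by exists n; rewrite /x /y; lra.
- apply: cvgB.
    move/cvg_at_leftP : Fq; apply; split => // n.
    by have /andP[? _] := small n; rewrite /y; lra.
  move/cvg_at_rightP : Fp; apply; split => // n.
  by have /andP[? _] := small n; rewrite /x; lra.
Qed.

Lemma ge0_FTC_oy p f F lp lq : measurable_fun `]p, +oo[ f ->
  (forall t, p < t -> 0 <= f t) ->
  (forall t, p < t -> {for t, continuous f}) ->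
  (forall t, p < t -> is_derive t (1 : R) F (f t)) ->
  F t @[t --> p^'+] --> lp -> F t @[t --> +oo] --> lq ->
  (\int[mu]_(t in `]p, +oo[) (f t)%:E = (lq - lp)%:E)%E.
Proof.
move=> mf f0 cf dF Fp Fq.
pose x n := p + 1 / (n + 1)%:R; pose y n := p + (n + 2)%:R.
have small n : 0 < (1 : R) / (n + 1)%:R <= 1.
  by rewrite divr_gt0 ?ltr0n ?addn1//= ler_pdivrMr ?ltr0n// mul1r ler1n.
have dec m n : (m <= n)%N -> 1 / (n + 1)%:R <= 1 / (m + 1)%:R :> R.
  move=> mn; rewrite ler_pM2l// lef_pV2 ?posrE ?ltr0n ?addn1//.
  by rewrite ler_nat.
have cx : x n @[n --> \oo] --> p.
  by rewrite -[X in _ --> X]addr0; apply: cvgD; [exact: cvg_cst|exact: cvg_harmonic_shift].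
have yn n : (n%:R : R) + 2 = (n + 2)%:R by rewrite natrD.
apply: (@ge0_FTC_exhaust _ _ x y _ F) => //.
- by move=> t; rewrite /= in_itv /= andbT; exact: f0.
- by move=> t; rewrite /= in_itv /= andbT; exact: cf.
- by move=> t; rewrite /= in_itv /= andbT; exact: dF.
- move=> n; have /andP[] := small n; rewrite /x /y -yn.
  by have : 0 <= n%:R :> R by []; lra.
- move=> n t /=; rewrite !in_itv /= andbT => /andP[h1 h2]; have /andP[] := small n.
  by move: h1 h2; rewrite /x /y; lra.
- by move=> m n mn; have := dec _ _ mn; rewrite /x; lra.
- by move=> m n mn; rewrite /y lerD2l ler_nat leq_add2r.
- move=> t; rewrite /= in_itv /= andbT => pt.
  have := cvg_harmonic_shift 1 1 => /cvgrPdist_lt /(_ (t - p)).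
  rewrite subr_gt0 pt /= => /(_ isT)[n _ hn].
  pose m := maxn n (Num.truncn (t - p)).
  exists m; have := hn m (leq_maxl _ _) => /=.
  have /andP[sm _] := small m.
  rewrite sub0r normrN gtr0_norm// => h1.
  have h2 : t - p <= (m + 2)%:R.
    apply: ltW; apply: (lt_le_trans (truncnS_gt _)); rewrite ler_nat addn2 ltnS.
    by rewrite (leq_trans (leq_maxr n _)).
  by rewrite /x /y; lra.
- apply: cvgB.
    apply: (cvg_comp _ _ _ Fq); apply/cvgryPge => M; near=> n.
    have : M - p <= n%:R by near: n; exact: nbhs_infty_ger.
    by rewrite /y -yn; lra.
  move/cvg_at_rightP : Fp; apply; split => // n.
  by have /andP[? _] := small n; rewrite /x; lra.
Unshelve. all: by end_near. Qed.

Lemma measurable_inv : measurable_fun [set: R] (fun x : R => x^-1).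
Proof.
have -> : (fun x : R => x^-1) = (fun x => if x < 0 then - ((- x) `^ (-1)) else x `^ (-1)).
  apply/funext => x; case: ltP => x0; last by rewrite powR_inv1.
  by rewrite powR_inv1 ?oppr_ge0 1?ltW// invrN opprK.
apply: measurable_fun_if => //; first exact: measurable_fun_ltr.
  apply: measurable_funTS; apply: measurable_funN.
  exact: (measurableT_comp (measurable_powR _)).
by apply: measurable_funTS; exact: measurable_powR.
Qed.

(** Inversion on the positive half-line, completed by the identity so that every interval of the
    whole line has a preimage of the right mass. *)
Let psi (x : R) : R := if x <= 0 then x else x^-1.
Let w (x : R) : R := if x <= 0 then 1 else x ^- 2.

Let mpsi : measurable_fun [set: measurableTypeR R] (psi : _ -> measurableTypeR R).
Proof.
apply: measurable_fun_if => //; first exact: measurable_fun_ler.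
by apply: measurable_funTS; exact: measurable_inv.
Qed.

Let mw : measurable_fun [set: measurableTypeR R] w.
Proof.
apply: measurable_fun_if => //; first exact: measurable_fun_ler.
apply: measurable_funTS.
rewrite [X in measurable_fun _ X](_ : _ = (fun x : R => (x^-1) ^+ 2)); last first.
  by apply/funext => x; rewrite exprVn.
apply: measurable_funX; exact: measurable_inv.
Qed.

Let w0 x : 0 <= w x.
Proof. by rewrite /w; case: ifP => // _; rewrite invr_ge0 sqr_ge0. Qed.

Let inv_is_derive (t : R) : 0 < t -> is_derive t (1 : R) (fun u : R => - u^-1) (t ^- 2).
Proof.
move=> t0; have h := is_deriveV (lt0r_neq0 t0) (is_derive_id t (1 : R)).
apply: is_derive_eq (is_deriveN h) _.
by rewrite /GRing.scale /= mulr1 opprK.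
Qed.

Let inv_cont (t : R) : 0 < t -> {for t, continuous (fun u : R => u^-1)}.
Proof. by move=> t0; apply: inv_continuous; rewrite lt0r_neq0. Qed.

Let sqr_cont (t : R) : 0 < t -> {for t, continuous (fun u : R => u ^- 2)}.
Proof.
move=> t0; have -> : (fun u : R => u ^- 2) = (fun u => u^-1 * u^-1).
  by apply/funext => u; rewrite -exprVn expr2.
by apply: cvgM; exact: inv_cont.
Qed.

Let m2 (i : interval R) : measurable_fun [set` i] (fun u : R => u ^- 2).
Proof.
apply: measurable_funTS.
rewrite [X in measurable_fun _ X](_ : _ = (fun x : R => (x^-1) ^+ 2)); last first.
  by apply/funext => x; rewrite exprVn.
apply: measurable_funX; exact: measurable_inv.
Qed.

Let int_y p : 0 < p -> (\int[mu]_(x in `[p, +oo[) (x ^- 2)%:E = p^-1%:E)%E.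
Proof.
move=> p0; rewrite -integral_itv_obnd_cbnd; last by apply/measurable_EFinP; exact: m2.
have -> : p^-1 = 0 - - p^-1 by rewrite sub0r opprK.
apply: (@ge0_FTC_oy p _ (fun u => - u^-1) (- p^-1) 0).
- exact: m2.
- by move=> t _; rewrite invr_ge0 sqr_ge0.
- by move=> t pt; apply: sqr_cont; exact: lt_trans pt.
- by move=> t pt; apply: inv_is_derive; exact: lt_trans pt.
- by apply: cvgN; apply: cvg_at_right_filter; exact: inv_cont.
- rewrite -oppr0; apply: cvgN; apply/cvgrPdist_lt => e e0; near=> t.
  have t0 : 0 < t by near: t; exact: nbhs_pinfty_gt.
  rewrite sub0r normrN gtr0_norm ?invr_gt0// invf_plt ?posrE//.
  by near: t; apply: nbhs_pinfty_gt; rewrite num_real.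
Unshelve. all: by end_near. Qed.

Let int_oo p q : 0 < p -> p < q -> (\int[mu]_(x in `[p, q[) (x ^- 2)%:E = (p^-1 - q^-1)%:E)%E.
Proof.
move=> p0 pq; rewrite integral_itv_bndoo; last by apply/measurable_EFinP; exact: m2.
have -> : p^-1 - q^-1 = - q^-1 - - p^-1 by rewrite opprK addrC.
apply: (@ge0_FTC_oo p q _ (fun u => - u^-1) (- p^-1) (- q^-1)).
- exact: pq.
- exact: m2.
- by move=> t _; rewrite invr_ge0 sqr_ge0.
- by move=> t /andP[pt _]; apply: sqr_cont; exact: lt_trans pt.
- by move=> t /andP[pt _]; apply: inv_is_derive; exact: lt_trans pt.
- by apply: cvgN; apply: cvg_at_right_filter; exact: inv_cont.
- by apply: cvgN; apply: cvg_at_left_filter; apply: inv_cont; exact: lt_trans pq.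
Qed.

Let psi_itv (a b : R) : a < b ->
  (\int[mu]_(x in psi @^-1` `]a, b]) (w x)%:E = (b - a)%:E)%E.
Proof.
move=> ab; pose P := psi @^-1` `]a, b] `&` [set x | x <= 0].
pose N := psi @^-1` `]a, b] `&` [set x | 0 < x].
have mpre : measurable (psi @^-1` `]a, b]).
  by rewrite -[X in measurable X]setTI; exact: mpsi.
have mP : measurable P.
  by apply: measurableI => //; rewrite (_ : [set _ | _] = `]-oo, 0]%classic).
have mN : measurable N.
  apply: measurableI => //; rewrite (_ : [set _ | _] = `]0, +oo[%classic)//.
  by apply/seteqP; split => x /=; rewrite in_itv /= andbT.
have -> : psi @^-1` `]a, b] = P `|` N.
  rewrite /P /N -setIUr [X in _ `&` X](_ : _ = setT) ?setIT//.
  by apply/seteqP; split => x //= _; case: (ltP 0 x); [right|left].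
rewrite ge0_integral_setU//; last 3 first.
- by apply: measurable_funTS; apply/measurable_EFinP; exact: mw.
- by move=> x _; rewrite lee_fin.
- by apply/disj_setPLR => x [_ /= x0] [_ /=]; rewrite ltNge x0.
have eP : (\int[mu]_(x in P) (w x)%:E = mu P)%E.
  rewrite -[RHS]mul1e -(@integral_cst _ _ _ mu _ mP 1%E).
  by apply: eq_integral => x /set_mem[_ /= x0]; rewrite /w x0.
have eN : (\int[mu]_(x in N) (w x)%:E = \int[mu]_(x in N) (x ^- 2)%:E)%E.
  by apply: eq_integral => x /set_mem[_ /= x0]; rewrite /w leNgt x0.
rewrite [X in (X + _)%E]eP [X in (_ + X)%E]eN {eP eN}.
have PE : P = `]a, b] `&` `]-oo, 0].
  apply/seteqP; split => x; rewrite /P /psi /= !in_itv /= => -[h1 h2]; split => //.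
    by move: h1; rewrite h2.
  by rewrite h2.
have NE : N = [set x | 0 < x /\ a < x^-1 <= b].
  apply/seteqP; split => x; rewrite /N /psi /= in_itv /= => -[h1 h2]; split => //.
    by move: h1; rewrite leNgt h2.
  by rewrite leNgt h1.
(* The positive part of the preimage is empty for [b <= 0], the half-line from [1 / b] for
   [a <= 0 < b], and [[1 / b, 1 / a[] for [0 < a]. *)
have [b0|b0] := leP b 0.
  have -> : N = set0.
    apply/seteqP; split => // x; rewrite NE /= => -[x0 /andP[_]].
    by rewrite leNgt (le_lt_trans b0)// invr_gt0.
  have -> : P = `]a, b]%classic.
    rewrite PE; apply/seteqP; split => x /=; rewrite !in_itv /=; first by case.
    by move=> /andP[h1 h2]; rewrite h1 h2 (le_trans h2 b0).
  by rewrite integral_set0 adde0 lebesgue_measure_itv /= lte_fin ab EFinB.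
have [a0|a0] := ltP a 0.
  have -> : N = `[b^-1, +oo[%classic.
    apply/seteqP; split => x; rewrite NE /= in_itv /= andbT.
      by move=> [x0 /andP[_ h]]; rewrite invf_ple ?posrE.
    move=> h; have x0 : 0 < x by apply: lt_le_trans h; rewrite invr_gt0.
    split => //; rewrite (lt_trans a0) ?invr_gt0//=.
    by rewrite invf_ple ?posrE.
  have -> : P = `]a, 0]%classic.
    rewrite PE; apply/seteqP; split => x /=; rewrite !in_itv /=.
      by case=> /andP[-> _] ->.
    by move=> /andP[h1 h2]; rewrite h1 h2 (le_trans h2 (ltW b0)).
  rewrite int_y ?invr_gt0// lebesgue_measure_itv /= lte_fin a0 invrK.
  by rewrite -EFinB -EFinD sub0r addrC.
have -> : P = set0.
  rewrite PE; apply/seteqP; split => x //=; rewrite !in_itv /= => -[/andP[h1 _] h2].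
  by have := le_lt_trans a0 (lt_le_trans h1 h2); rewrite ltxx.
rewrite measure0 add0e.
move: a0; rewrite le_eqVlt => /predU1P[a0|a0].
  have -> : N = `[b^-1, +oo[%classic.
    apply/seteqP; split => x; rewrite NE /= in_itv /= andbT.
      by move=> [x0 /andP[_ h]]; rewrite invf_ple ?posrE.
    move=> h; have x0 : 0 < x by apply: lt_le_trans h; rewrite invr_gt0.
    by split => //; rewrite -a0 invr_gt0 x0 /= invf_ple ?posrE.
  by rewrite int_y ?invr_gt0// invrK -a0 subr0.
have -> : N = `[b^-1, a^-1[%classic.
  apply/seteqP; split => x; rewrite NE /= in_itv /=.
    by move=> [x0 /andP[h1 h]]; rewrite invf_ple ?posrE// h /= invf_pgt ?posrE.
  move=> /andP[h h1]; have x0 : 0 < x by apply: lt_le_trans h; rewrite invr_gt0.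
  by split => //; rewrite invf_ple ?posrE// h andbT -[a]invrK ltf_pV2 ?posrE ?invr_gt0.
by rewrite int_oo ?invr_gt0 ?ltf_pV2 ?posrE// !invrK.
Qed.

Lemma ge0_integral_inv (g : R -> \bar R) : measurable_fun [set: R] g ->
  (forall x, 0 <= g x)%E ->
  (\int[mu]_(x in `]0%R, +oo[) g x = \int[mu]_(x in `]0%R, +oo[) (g (x^-1)%R * (x ^- 2)%:E))%E.
Proof.
move=> mg g0; rewrite [LHS]integral_mkcond [RHS]integral_mkcond.
rewrite (ge0_integral_subst mpsi mw w0 psi_itv).
- apply: eq_integral => x _; rewrite !patchE /psi /w.
  have [x0|x0] := leP x 0.
    by rewrite !memNset ?mul0e//= in_itv /= andbT ltNge x0.
  by rewrite !mem_set//= in_itv /= andbT// invr_gt0.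
- by apply/(measurable_restrictT _ _).1 => //; exact: measurable_funTS.
- by move=> x; apply: erestrict_ge0.
Qed.

End Inversion.

(** * Measurability of complex-valued functions, componentwise *)

Section ComplexMeasurable.
Context {R : realType} d {T : measurableType d}.
Local Notation C := R[i]^o.
Implicit Types (E : set T) (f g : T -> C).

Definition cmeasurable E f :=
  measurable_fun E (fun t => complex.Re (f t)) /\
  measurable_fun E (fun t => complex.Im (f t)).

Lemma cmeasurable_cst E (c : C) : cmeasurable E (fun=> c).
Proof. by split; exact: measurable_cst. Qed.

Lemma cmeasurable_real E (f : T -> R) : measurable_fun E f ->
  cmeasurable E (fun t => (f t)%:C).
Proof. by move=> mf; split => //=; exact: measurable_cst. Qed.

Lemma cmeasurableD E f g : cmeasurable E f -> cmeasurable E g ->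
  cmeasurable E (fun t => f t + g t).
Proof.
move=> [f1 f2] [g1 g2]; split.
  by under eq_fun do rewrite ReCD; exact: measurable_funD.
by under eq_fun do rewrite ImCD; exact: measurable_funD.
Qed.

Lemma cmeasurableN E f : cmeasurable E f -> cmeasurable E (fun t => - f t).
Proof.
move=> [f1 f2]; split.
  by under eq_fun do rewrite ReCN; exact: measurable_funN.
by under eq_fun do rewrite ImCN; exact: measurable_funN.
Qed.

Lemma cmeasurableM E f g : cmeasurable E f -> cmeasurable E g ->
  cmeasurable E (fun t => f t * g t).
Proof.
move=> [f1 f2] [g1 g2]; split.
  under eq_fun do rewrite ReCM.
  by apply: measurable_funB; exact: measurable_funM.
under eq_fun do rewrite ImCM.
by apply: measurable_funD; exact: measurable_funM.
Qed.

Lemma cmeasurableX E f n : cmeasurable E f -> cmeasurable E (fun t => f t ^+ n).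
Proof.
move=> mf; elim: n => [|n IH].
  by under eq_fun do rewrite expr0; exact: cmeasurable_cst.
by under eq_fun do rewrite exprS; exact: cmeasurableM.
Qed.

Lemma measurable_funV E (f : T -> R) : measurable_fun E f ->
  measurable_fun E (fun t => (f t)^-1).
Proof. by move=> mf; exact: (measurableT_comp measurable_inv mf). Qed.

Lemma cmeasurableV E f : cmeasurable E f -> cmeasurable E (fun t => (f t)^-1).
Proof.
move=> [f1 f2].
have mn : measurable_fun E (fun t => (complex.Re (f t) ^+ 2 + complex.Im (f t) ^+ 2)^-1).
  apply: measurable_funV; apply: measurable_funD; exact: measurable_funX.
split.
  rewrite [X in measurable_fun _ X](_ : _ = (fun t => complex.Re (f t) *
    (complex.Re (f t) ^+ 2 + complex.Im (f t) ^+ 2)^-1)); first exact: measurable_funM.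
  by apply/funext => t; case: (f t).
rewrite [X in measurable_fun _ X](_ : _ = (fun t => - (complex.Im (f t) *
  (complex.Re (f t) ^+ 2 + complex.Im (f t) ^+ 2)^-1))).
  by apply: measurable_funN; exact: measurable_funM.
by apply/funext => t; case: (f t) => a b.
Qed.

Lemma cmeasurable_sum E I (r : seq I) (f : I -> T -> C) :
  (forall i, cmeasurable E (f i)) -> cmeasurable E (fun t => \sum_(i <- r) f i t).
Proof.
move=> mf; elim: r => [|i r IH].
  by under eq_fun do rewrite big_nil; exact: cmeasurable_cst.
by under eq_fun do rewrite big_cons; exact: cmeasurableD.
Qed.

Lemma measurable_modulus E f : cmeasurable E f ->
  measurable_fun E (fun t => modulus (f t)).
Proof.
move=> [f1 f2].
rewrite [X in measurable_fun _ X](_ : _ = (fun t =>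
  (complex.Re (f t) ^+ 2 + complex.Im (f t) ^+ 2) `^ 2^-1)).
  apply: (measurableT_comp (measurable_powR _)).
  by apply: measurable_funD; exact: measurable_funX.
apply/funext => t; rewrite powR12_sqrt ?addr_ge0 ?sqr_ge0//.
by rewrite -sqr_mod sqrtr_sqr ger0_norm// mod_ge0.
Qed.

Lemma measurable_powR_comp E (f : T -> R) p : measurable_fun E f ->
  measurable_fun E (fun t => f t `^ p).
Proof. by move=> mf; exact: (measurableT_comp (measurable_powR _) mf). Qed.

Lemma cmeasurable_cvg E (u : nat -> T -> C) f : measurable E ->
  (forall n, cmeasurable E (u n)) ->
  (forall t, E t -> u n t @[n --> \oo] --> f t) -> cmeasurable E f.
Proof.
move=> mE mu uf; split.
  apply: (@measurable_fun_cvg _ _ _ E (fun n t => complex.Re (u n t))).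
    by move=> n; case: (mu n).
  by move=> t Et; apply: cvgC_Re; exact: uf.
apply: (@measurable_fun_cvg _ _ _ E (fun n t => complex.Im (u n t))).
  by move=> n; case: (mu n).
by move=> t Et; apply: cvgC_Im; exact: uf.
Qed.

End ComplexMeasurable.

Lemma measurable_patch (R : realType) d (T : measurableType d) (D : set T) (f : T -> \bar R) :
  measurable D -> measurable_fun [set: T] f -> measurable_fun [set: T] (f \_ D).
Proof.
by move=> mD mf; apply: (measurable_restrictT f mD).1; exact: measurable_funTS.
Qed.

(** * Tonelli's theorem and rotation invariance in the plane *)

Section Plane.
Context {R : realType}.
Local Notation C := R[i]^o.
Local Notation mu := (@lebesgue_measure R).
Implicit Types (f h : R * R -> \bar R).
Local Open Scope ereal_scope.

Lemma tonelli f : measurable_fun [set: R * R] f -> (forall z, 0 <= f z) ->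
  \int[mu \x mu]_z f z = \int[mu]_x \int[mu]_y f (x, y).
Proof. by move=> mf f0; rewrite fubini_tonelli1. Qed.

Lemma tonelli_swap f : measurable_fun [set: R * R] f -> (forall z, 0 <= f z) ->
  \int[mu]_x \int[mu]_y f (x, y) = \int[mu]_y \int[mu]_x f (x, y).
Proof. by move=> mf f0; exact: fubini_tonelli. Qed.

Lemma measurable_section1 f x : measurable_fun [set: R * R] f ->
  measurable_fun [set: R] (fun y => f (x, y)).
Proof. by move=> mf; apply: (measurableT_comp mf); exact: pair1_measurable. Qed.

Lemma measurable_section2 f y : measurable_fun [set: R * R] f ->
  measurable_fun [set: R] (fun x => f (x, y)).
Proof. by move=> mf; apply: (measurableT_comp mf); exact: pair2_measurable. Qed.

Lemma measurable_plane_comp f (u v : R * R -> R) : measurable_fun [set: R * R] f ->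
  measurable_fun [set: R * R] u -> measurable_fun [set: R * R] v ->
  measurable_fun [set: R * R] (fun z => f (u z, v z)).
Proof.
move=> mf mu' mv; apply: (measurableT_comp mf).
by apply/measurable_fun_pairP; split.
Qed.

Lemma integral_shear1 f (c : R) : measurable_fun [set: R * R] f -> (forall z, 0 <= f z) ->
  \int[mu \x mu]_z f (z.1 + c * z.2, z.2)%R = \int[mu \x mu]_z f z.
Proof.
move=> mf f0.
have mg : measurable_fun [set: R * R] (fun z : R * R => f (z.1 + c * z.2, z.2)%R).
  apply: measurable_plane_comp => //; apply: measurable_funD => //.
  exact: measurable_funM.
rewrite (tonelli mf f0) (tonelli mg (fun z => f0 _)).
rewrite (tonelli_swap mf f0) (tonelli_swap mg (fun z => f0 _)).
apply: eq_integral => y _ /=.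
rewrite [RHS](@ge0_integral_affine _ 1%R (c * y)%R) ?oner_neq0//; last exact: measurable_section2.
by rewrite normr1 mul1e; apply: eq_integral => x _; rewrite mul1r.
Qed.

Lemma integral_shear2 f (c : R) : measurable_fun [set: R * R] f -> (forall z, 0 <= f z) ->
  \int[mu \x mu]_z f (z.1, z.2 + c * z.1)%R = \int[mu \x mu]_z f z.
Proof.
move=> mf f0.
have mg : measurable_fun [set: R * R] (fun z : R * R => f (z.1, z.2 + c * z.1)%R).
  apply: measurable_plane_comp => //; apply: measurable_funD => //.
  exact: measurable_funM.
rewrite (tonelli mf f0) (tonelli mg (fun z => f0 _)); apply: eq_integral => x _ /=.
rewrite [RHS](@ge0_integral_affine _ 1%R (c * x)%R) ?oner_neq0//; last exact: measurable_section1.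
by rewrite normr1 mul1e; apply: eq_integral => y _; rewrite mul1r.
Qed.

(** The half-turn is the one rotation, besides the identity, that the three-shear formula misses. *)
Lemma integral_oppr f : measurable_fun [set: R * R] f -> (forall z, 0 <= f z) ->
  \int[mu \x mu]_z f (- z.1, - z.2)%R = \int[mu \x mu]_z f z.
Proof.
move=> mf f0.
have mg : measurable_fun [set: R * R] (fun z : R * R => f (- z.1, - z.2)%R).
  by apply: measurable_plane_comp => //; exact: measurable_funN.
rewrite (tonelli mf f0) (tonelli mg (fun z => f0 _)).
rewrite [RHS](@ge0_integral_affine _ (-1)%R 0%R) ?oppr_eq0 ?oner_neq0//; last 2 first.
- exact: measurable_fun_fubini_tonelli_F.
- by move=> x; exact: integral_ge0.
rewrite normrN1 mul1e; apply: eq_integral => x _ /=.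
rewrite mulN1r addr0.
rewrite [RHS](@ge0_integral_affine _ (-1)%R 0%R) ?oppr_eq0 ?oner_neq0//; last first.
  exact: measurable_section1.
by rewrite normrN1 mul1e; apply: eq_integral => y _; rewrite mulN1r addr0.
Qed.

(* For [b != 0] a rotation is a product of three shears. *)
Lemma integral_rotation f (a b : R) : (a ^+ 2 + b ^+ 2 = 1)%R ->
  measurable_fun [set: R * R] f -> (forall z, 0 <= f z) ->
  \int[mu \x mu]_z f (a * z.1 - b * z.2, b * z.1 + a * z.2)%R = \int[mu \x mu]_z f z.
Proof.
move=> ab mf f0; have [b0|b0] := eqVneq b 0%R.
  move: ab; rewrite b0 expr0n addr0 => /eqP; rewrite sqrf_eq1 => /orP[]/eqP->.
    by apply: eq_integral => -[x y] _ /=; rewrite !mul0r !mul1r subr0 add0r.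
  rewrite -[RHS]integral_oppr//.
  by apply: eq_integral => -[x y] _ /=; rewrite !mul0r !mulN1r subr0 add0r.
(* With [a = cos x] and [b = sin x] this is [- tan (x / 2)]. *)
pose p := ((a - 1) / b)%R.
have m1 : measurable_fun [set: R * R] (fun z : R * R => f (z.1 + p * z.2, z.2)%R).
  apply: measurable_plane_comp => //; apply: measurable_funD => //.
  exact: measurable_funM.
have m2 : measurable_fun [set: R * R] (fun z : R * R => f (z.1 + p * (z.2 + b * z.1), z.2 + b * z.1)%R).
  apply: (@measurable_plane_comp (fun z => f (z.1 + p * z.2, z.2)%R) fst (fun z => z.2 + b * z.1)%R) => //.
  by apply: measurable_funD => //; exact: measurable_funM.
rewrite -[RHS](integral_shear1 p)//.
rewrite -[RHS](@integral_shear2 (fun z => f (z.1 + p * z.2, z.2)%R) b)//.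
rewrite -[RHS](@integral_shear1 (fun z => f (z.1 + p * (z.2 + b * z.1), z.2 + b * z.1)%R) p)//.
apply: eq_integral => -[x y] _ /=; congr (f (_, _)).
  have -> : a = (1 + p * b)%R by rewrite /p divfK// addrC subrK.
  have pb : (p * b = a - 1)%R by rewrite /p divfK.
  have e2 : (b * (p + p * (p * b) + p + b) = 0)%R.
    have -> : (b * (p + p * (p * b) + p + b) = p * b * (2 + p * b) + b ^+ 2)%R by ring.
    rewrite pb; transitivity (a ^+ 2 + b ^+ 2 - 1)%R; first by ring.
    by rewrite ab subrr.
  move/eqP : e2; rewrite mulf_eq0 (negbTE b0)/= => /eqP e2.
  have -> : (x + p * y + p * (y + b * (x + p * y)) =
    (1 + p * b) * x - b * y + y * (p + p * (p * b) + p + b))%R by ring.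
  by rewrite e2 mulr0 addr0.
by rewrite /p; field.
Qed.

End Plane.

(** * From the disk to the half-plane [Re zeta > 1 / 2] *)

Section HalfPlane.
Context {R : realType}.
Local Notation C := R[i]^o.
Local Notation mu := (@lebesgue_measure R).
Implicit Types (h : R * R -> \bar R).
Local Open Scope ereal_scope.

Definition disk2 : set (R * R) := [set w : R * R | unit_disk (w.1 +i* w.2)].

Lemma disk2E w : disk2 w <-> (w.1 ^+ 2 + w.2 ^+ 2 < 1)%R.
Proof.
rewrite /disk2 /unit_disk /= -[X in (_ < X)%R]sqrtr1 ltr_sqrt//.
Qed.

Lemma measurable_disk2 : measurable disk2.
Proof.
have -> : disk2 = (fun w : R * R => w.1 ^+ 2 + w.2 ^+ 2)%R @^-1` `]-oo, 1%R[.
  by apply/seteqP; split => w /=; rewrite in_itv /=; apply disk2E.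
rewrite -[X in measurable X]setTI.
have m : measurable_fun [set: R * R] (fun w : R * R => w.1 ^+ 2 + w.2 ^+ 2)%R.
  by apply: measurable_funD; exact: measurable_funX.
by apply: m => //; exact: measurable_itv.
Qed.

(** The point is [1 - 1 / zeta] for [zeta = x (1 + i v)]. *)
Lemma slope_in_disk (v x : R) : (0 < x)%R ->
  disk2 (1 - ((1 + v ^+ 2) * x)^-1, v / ((1 + v ^+ 2) * x))%R <-> (2^-1 < x)%R.
Proof.
move=> x0; rewrite disk2E /=.
have k0 : (0 < 1 + v ^+ 2)%R by rewrite ltr_pwDl// sqr_ge0.
have -> : ((1 - ((1 + v ^+ 2) * x)^-1) ^+ 2 + (v / ((1 + v ^+ 2) * x)) ^+ 2 =
   1 + (x^-1 - 2) / ((1 + v ^+ 2) * x))%R.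
  by field; rewrite !lt0r_neq0.
rewrite gtrDl pmulr_llt0 ?invr_gt0 ?mulr_gt0// subr_lt0 invf_plt ?posrE//.
Qed.

Let mule_rearrange (A : \bar R) (k c d : R) :
  k%:E * (c%:E * A * d%:E) = A * (k * c * d)%:E.
Proof. by rewrite (muleC c%:E) -muleA (muleCA _ A) !EFinM !muleA. Qed.

(** The lines through 1 are preserved: with [X = 1 - Re z] and [Im z = X v] the area element is
    [X dX dv], and for fixed [v] the relation [X = 1 / ((1 + v^2) x)] is a one-variable
    inversion. *)
Lemma integral_disk_slope h : measurable_fun [set: R * R] h -> (forall z, 0 <= h z) ->
  \int[mu \x mu]_(w in disk2) h w =
  \int[mu]_v \int[mu]_(x in `]2^-1%R, +oo[)
    (h (1 - ((1 + v ^+ 2) * x)^-1, v / ((1 + v ^+ 2) * x))%R *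
     ((1 + v ^+ 2) ^+ 2 * x ^+ 3)^-1%:E).
Proof.
move=> mh h0; pose H := h \_ disk2.
have mH : measurable_fun [set: R * R] H.
  exact: measurable_patch measurable_disk2 mh.
have H0 z : 0 <= H z by apply: erestrict_ge0.
rewrite integral_mkcond (tonelli mH H0).
rewrite (@ge0_integral_affine _ (-1)%R 1%R) ?oppr_eq0 ?oner_neq0//; last 2 first.
- exact: measurable_fun_fubini_tonelli_F.
- by move=> x; exact: integral_ge0.
rewrite normrN1 mul1e.
(* The disk lies in [0 < X]; the factor [z.1] is the Jacobian of [y = X v]. *)
pose G (z : R * R) : \bar R := if (0 < z.1)%R then z.1%:E * H (1 - z.1, z.1 * z.2)%R else 0.
have mG : measurable_fun [set: R * R] G.
  apply: measurable_fun_if => //; first exact: measurable_fun_ltr.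
  apply: measurable_funTS; apply: emeasurable_funM; first exact/measurable_EFinP.
  by apply: measurable_plane_comp => //; [exact: measurable_funB|exact: measurable_funM].
have G0 z : 0 <= G z by rewrite /G; case: ifP => // /ltW z0; rewrite mule_ge0.
transitivity (\int[mu]_X \int[mu]_v G (X, v)).
  apply: eq_integral => X _; rewrite mulN1r addrC.
  have [X0|X0] := ltP 0%R X.
    rewrite (@ge0_integral_affine _ X 0%R) ?lt0r_neq0//; last exact: measurable_section1.
    rewrite gtr0_norm// -ge0_integralZl_EFin//; last 2 first.
    - by apply: (measurableT_comp (measurable_section1 _ mH)); exact: measurable_funD.
    - exact: ltW.
    by apply: eq_integral => v _; rewrite /G /= X0 addr0.
  rewrite !integral0_eq// => y _; rewrite /G /= ?ltNge ?X0//.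
  rewrite /H patchE memNset// disk2E /=; apply/negP; rewrite -leNgt.
  by have := sqr_ge0 y; nra.
rewrite (tonelli_swap mG G0); apply: eq_integral => v _.
set k := (1 + v ^+ 2)%R.
have k0 : (0 < k)%R by rewrite ltr_pwDl// sqr_ge0.
pose g (X : R) := X%:E * H (1 - X, X * v)%R.
transitivity (\int[mu]_X ((fun X => `|g X|) \_ `]0%R, +oo[) X).
  apply: eq_integral => X _; rewrite /G /= patchE.
  have [X0|X0] := ltP 0%R X.
    by rewrite mem_set/= ?in_itv/= ?X0// gee0_abs// mule_ge0// ltW.
  by rewrite memNset//= in_itv /= andbT; apply/negP; rewrite -leNgt.
have mg : measurable_fun [set: R] (fun X => `|g X|).
  apply: measurableT_comp => //; apply: emeasurable_funM; first exact/measurable_EFinP.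
  apply: (measurableT_comp mH); apply/measurable_fun_pairP; split.
    exact: measurable_funB.
  exact: measurable_funM.
rewrite -integral_mkcond ge0_integral_inv// integral_mkcond.
set q := (X in \int[mu]_x X x).
have mq : measurable_fun [set: R] q.
  apply: measurable_patch => //.
  apply: emeasurable_funM; first exact: (measurableT_comp mg measurable_inv).
  apply/measurable_EFinP; under eq_fun do rewrite -exprVn.
  by apply: measurable_funX; exact: measurable_inv.
have q0 x : 0 <= q x.
  by apply: erestrict_ge0 => y _; rewrite mule_ge0// lee_fin invr_ge0 sqr_ge0.
rewrite (@ge0_integral_affine _ k 0%R _ (lt0r_neq0 k0) mq q0).
rewrite gtr0_norm// -ge0_integralZl_EFin//; last 2 first.
- by apply: (measurableT_comp mq); apply: measurable_funD => //; exact: measurable_funM.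
- exact: ltW.
rewrite [RHS]integral_mkcond; apply: eq_integral => x _; rewrite /q addr0 !patchE.
have [x0|x0] := ltP 0%R x; last first.
  rewrite memNset ?mule0 /=; last by rewrite in_itv /= andbT; apply/negP; rewrite -leNgt pmulr_rle0.
  rewrite memNset//= in_itv /= andbT; apply/negP; rewrite -leNgt (le_trans x0)//.
have kx0 : (0 < k * x)%R by rewrite mulr_gt0.
rewrite mem_set/= ?in_itv/= ?kx0// /g /H patchE.
have [xh|xh] := ltP 2^-1%R x.
  rewrite mem_set; last by rewrite [X in disk2 (_, X)]mulrC; apply slope_in_disk.
  rewrite mem_set/= ?in_itv/= ?xh//.
  rewrite gee0_abs ?mule_ge0 ?lee_fin ?invr_ge0 ?(ltW kx0)//.
  rewrite [X in h (_, X)]mulrC -/k.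
  rewrite mule_rearrange; congr (_ * _%:E); field.
  by rewrite !lt0r_neq0.
rewrite memNset; last first.
  rewrite [X in disk2 (_, X)]mulrC; move=> /(slope_in_disk v x0).1.
  by rewrite ltNge xh.
by rewrite mule0 abse0 mul0e mule0 memNset//= in_itv /= andbT; apply/negP; rewrite -leNgt.
Qed.

(** The slope is traded for the ordinate by [y = x v]. The density [|zeta|^(- 4)] is the Jacobian of
    [zeta -> 1 - 1 / zeta]. *)
Lemma integral_disk_halfplane h : measurable_fun [set: R * R] h -> (forall z, 0 <= h z) ->
  \int[mu \x mu]_(w in disk2) h w =
  \int[mu]_(x in `]2^-1%R, +oo[) \int[mu]_y
    (h (1 - x / (x ^+ 2 + y ^+ 2), y / (x ^+ 2 + y ^+ 2))%R *
     ((x ^+ 2 + y ^+ 2) ^- 2)%:E).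
Proof.
move=> mh h0; rewrite (integral_disk_slope mh h0).
pose G (z : R * R) : \bar R := if (2^-1 < z.1)%R then
   h (1 - ((1 + z.2 ^+ 2) * z.1)^-1, z.2 / ((1 + z.2 ^+ 2) * z.1))%R *
     ((1 + z.2 ^+ 2) ^+ 2 * z.1 ^+ 3)^-1%:E else 0.
have G0 z : 0 <= G z.
  rewrite /G; case: ifP => // z0; rewrite mule_ge0// lee_fin invr_ge0 mulr_ge0 ?sqr_ge0//.
  by rewrite exprn_ge0// (le_trans _ (ltW z0)).
have mk : measurable_fun [set: R * R] (fun z : R * R => (1 + z.2 ^+ 2) * z.1)%R.
  by apply: measurable_funM => //; apply: measurable_funD => //; exact: measurable_funX.
have mG : measurable_fun [set: R * R] G.
  apply: measurable_fun_if => //; first exact: measurable_fun_ltr.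
  apply: measurable_funTS; apply: emeasurable_funM.
    apply: measurable_plane_comp => //.
      by apply: measurable_funB => //; exact: measurable_funV.
    by apply: measurable_funM => //; exact: measurable_funV.
  apply/measurable_EFinP; apply: measurable_funV; apply: measurable_funM.
    by apply: measurable_funX; apply: measurable_funD => //; exact: measurable_funX.
  exact: measurable_funX.
transitivity (\int[mu]_v \int[mu]_x G (x, v)).
  apply: eq_integral => v _; rewrite integral_mkcond; apply: eq_integral => x _.
  rewrite patchE /G /=; case: ifPn => hx.
    by move: hx; rewrite inE /= in_itv /= andbT => ->.
  by move: hx; rewrite notin_setE /= in_itv /= andbT => /negP/negbTE ->.
rewrite -(tonelli_swap mG G0) [RHS]integral_mkcond; apply: eq_integral => x _.
rewrite patchE /G /=; case: ifPn => hx; last first.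
  move: hx; rewrite notin_setE /= in_itv /= andbT => /negP/negbTE ->.
  by rewrite integral0_eq.
move: hx; rewrite inE /= in_itv /= andbT => hx; rewrite hx.
have x0 : (0 < x)%R by apply: lt_trans hx; rewrite invr_gt0.
set q := (X in _ = \int[mu]_y X y).
have mq : measurable_fun [set: R] q.
  have mr : measurable_fun [set: R] (fun y : R => (x ^+ 2 + y ^+ 2)^-1)%R.
    by apply: measurable_funV; apply: measurable_funD => //; exact: measurable_funX.
  apply: emeasurable_funM.
    apply: (measurableT_comp mh); apply/measurable_fun_pairP; split.
      by apply: measurable_funB => //; exact: measurable_funM.
    exact: measurable_funM.
  apply/measurable_EFinP; under eq_fun do rewrite -exprVn; exact: measurable_funX.
have q0 y : 0 <= q y by rewrite mule_ge0// lee_fin invr_ge0 sqr_ge0.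
rewrite (@ge0_integral_affine _ x 0%R _ (lt0r_neq0 x0) mq q0).
rewrite gtr0_norm// -ge0_integralZl_EFin//; last 2 first.
- by apply: (measurableT_comp mq); apply: measurable_funD => //; exact: measurable_funM.
- exact: ltW.
apply: eq_integral => v _; rewrite /q addr0 muleCA -EFinM.
have k0 : (0 < 1 + v ^+ 2)%R by rewrite ltr_pwDl// sqr_ge0.
have e : (x ^+ 2 + (x * v) ^+ 2 = x ^+ 2 * (1 + v ^+ 2))%R by rewrite exprMn; ring.
congr (h (_, _) * _%:E); rewrite e; field; by rewrite !lt0r_neq0.
Qed.

End HalfPlane.

(** * Gamma and Beta integrals; the weights of the Hilbert operator *)

Section GammaBeta.
Context {R : realType}.
Local Notation mu := (@lebesgue_measure R).
Implicit Types (b c s t x : R).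

Lemma powR_cvg_gt0 c x : 0 < x -> t `^ c @[t --> x] --> x `^ c.
Proof.
move=> x0; have [h _] := is_derive1_powR c x0.
suff : {for x, continuous (fun t : R => t `^ c)} by [].
exact/differentiable_continuous/derivable1_diffP.
Qed.

Lemma integral_powR01 c : 0 < c ->
  (\int[mu]_(t in `]0%R, 1%R[) (t `^ (c - 1))%:E = c^-1%:E)%E.
Proof.
move=> c0; have -> : c^-1 = c^-1 - 0 by rewrite subr0.
apply: (@ge0_FTC_oo _ 0 1 _ (fun t => c^-1 * t `^ c)) => //.
- by apply: measurable_funTS; exact: measurable_powR.
- by move=> t _; exact: powR_ge0.
- by move=> t /andP[t0 _]; exact: powR_cvg_gt0.
- move=> t /andP[t0 _].
  have h := is_derive1_powR c t0.
  have := is_deriveM (is_derive_cst (c^-1) t (1 : R)) h.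
  by rewrite /GRing.scale /= mulr0 addr0 mulKf ?lt0r_neq0.
- by rewrite -[X in _ --> X](mulr0 c^-1); apply: cvgM; [exact: cvg_cst|exact: (powR_cvg0 c0)].
- rewrite -[X in _ --> X]mulr1; apply: cvgM; first exact: cvg_cst.
  rewrite -[X in _ --> X](_ : 1 `^ c = 1); last by rewrite powR1.
  by apply: cvg_at_left_filter; exact: powR_cvg_gt0.
Qed.

Lemma integral_onem (f : R -> \bar R) : measurable_fun [set: R] f ->
  (forall x, 0 <= f x)%E ->
  (\int[mu]_(t in `]0%R, 1%R[) f (1 - t)%R = \int[mu]_(t in `]0%R, 1%R[) f t)%E.
Proof.
move=> mf f0; rewrite [LHS]integral_mkcond [RHS]integral_mkcond.
rewrite [RHS](@ge0_integral_affine _ (-1) 1) ?oppr_eq0 ?oner_neq0//; last 2 first.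
- exact: measurable_patch.
- by move=> x; exact: erestrict_ge0.
rewrite normrN1 mul1e; apply: eq_integral => x _; rewrite !patchE mulN1r [- x + 1]addrC.
rewrite (_ : (1 - x \in `]0%R, 1%R[%classic) = (x \in `]0%R, 1%R[%classic))//.
by rewrite !mem_setE !in_itv /=; apply/andP/andP => -[? ?]; split; lra.
Qed.

(** The product form of the Beta value at [(k + 1, b + 1)]. *)
Definition beta_nat (k : nat) b : R := k`!%:R / \prod_(i < k.+1) (b + 1 + i%:R).

Lemma measurable_beta_integrand (k : nat) b :
  measurable_fun [set: R] (fun t => t ^+ k * (1 - t) `^ b).
Proof.
apply: measurable_funM; first exact: measurable_funX.
by apply: measurable_powR_comp; exact: measurable_funB.
Qed.

(** Splitting [1 = t + (1 - t)] gives the value at [(k + 1, b)] from those at [(k, b)] and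
    [(k, b + 1)]; hence the induction on [k] for all [b] at once. *)
Lemma integral_beta_nat (k : nat) b : 0 <= b ->
  (\int[mu]_(t in `]0%R, 1%R[) (t ^+ k * (1 - t) `^ b)%:E = (beta_nat k b)%:E)%E.
Proof.
elim: k b => [|k IH] b b0.
  under eq_integral do rewrite expr0 mul1r.
  rewrite (@integral_onem (fun t => (t `^ b)%:E)); last 2 first.
  - by apply/measurable_EFinP; exact: measurable_powR.
  - by move=> x; rewrite lee_fin powR_ge0.
  have -> : b = (b + 1) - 1 by rewrite addrK.
  rewrite integral_powR01 ?ltr_pwDr// /beta_nat fact0 big_ord1 addr0 div1r.
  by rewrite addrK.
have b1 : 0 <= b + 1 by rewrite addr_ge0.
have e : (\int[mu]_(t in `]0%R, 1%R[) (t ^+ k * (1 - t) `^ b)%:E =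
  \int[mu]_(t in `]0%R, 1%R[) (t ^+ k.+1 * (1 - t) `^ b)%:E +
  \int[mu]_(t in `]0%R, 1%R[) (t ^+ k * (1 - t) `^ (b + 1))%:E)%E.
  rewrite -ge0_integralD//; last 4 first.
  - by move=> t; rewrite /= in_itv /= => /andP[/ltW t0 _]; rewrite lee_fin mulr_ge0 ?powR_ge0// exprn_ge0.
  - by apply: measurable_funTS; apply/measurable_EFinP; exact: measurable_beta_integrand.
  - by move=> t; rewrite /= in_itv /= => /andP[/ltW t0 _]; rewrite lee_fin mulr_ge0 ?powR_ge0// exprn_ge0.
  - by apply: measurable_funTS; apply/measurable_EFinP; exact: measurable_beta_integrand.
  apply: eq_integral => t; rewrite inE /= in_itv /= => /andP[t0 t1].
  rewrite -EFinD; congr EFin.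
  rewrite powRD; last by apply/implyP => _; rewrite subr_eq0 eq_sym lt_eqF.
  by rewrite powRr1 ?subr_ge0 ?ltW// exprS; ring.
move: e; rewrite !IH//.
have p0 (d : R) m : 0 <= d -> \prod_(i < m) (d + 1 + i%:R) != 0.
  move=> d0; rewrite lt0r_neq0//; apply: prodr_gt0 => i _.
  by rewrite ltr_wpDr// ltr_wpDl.
(* The equation writes a finite value as the unknown integral plus a finite one, so the unknown is a
   real [r]. *)
case: (\int[mu]_(t in _) _)%E => //= r; rewrite -EFinD => -[] er; congr EFin.
have -> : r = beta_nat k b - beta_nat k (b + 1) by rewrite er addrK.
rewrite /beta_nat (big_ord_recl k.+1) [in X in _ - X]big_ord_recr /=.
rewrite [in X in X - _]big_ord_recl /= addr0 [in RHS]big_ord_recr /=.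
have e (m : nat) : \prod_(i < m) (b + 1 + (bump 0 i)%:R) = \prod_(i < m) (b + 1 + 1 + i%:R).
  by apply: eq_bigr => i _; rewrite /bump /= add1n -natr1; ring.
rewrite !e factS natrM.
have h1 := p0 _ k b1.
set P := \prod_(i < k) _ in h1 *.
have h2 : b + 1 != 0 by rewrite lt0r_neq0// ltr_wpDl.
have h3 : b + 1 + 1 + k%:R != 0 by rewrite lt0r_neq0// ltr_wpDr// ltr_wpDl.
rewrite (_ : (bump 0 k)%:R = k%:R + 1); last by rewrite /bump /= add1n natr1.
have k0 : 0 <= k%:R :> R by [].
by field; rewrite h1 /=; repeat (apply/andP; split => //); apply: lt0r_neq0; lra.
Qed.

Lemma measurable_gamma_integrand s : measurable_fun [set: R] (fun x => x `^ (s - 1) * expR (- x)).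
Proof.
apply: measurable_funM; first exact: measurable_powR.
exact: (measurableT_comp (@measurable_expR R)).
Qed.

(** The Gamma integral with values in the extended reals: the recurrence holds for it before
    finiteness is known, and finiteness then comes from the factorials. *)
Definition egamma s : \bar R := (\int[mu]_(x in `]0%R, +oo[) (x `^ (s - 1) * expR (- x))%:E)%E.

Lemma egamma_ge0 s : (0 <= egamma s)%E.
Proof. by apply: integral_ge0 => x _; rewrite lee_fin mulr_ge0 ?powR_ge0 ?expR_ge0. Qed.

Let int_exp u : (\int[mu]_(x in `]u, +oo[) (expR (- x))%:E = (expR (- u))%:E)%E.
Proof.
have -> : expR (- u) = 0 - - expR (- u) by rewrite sub0r opprK.
have cN (x : R) : {for x, continuous (fun x : R => expR (- x))}.
  apply: continuous_comp; [exact: opp_continuous|exact: continuous_expR].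
apply: (@ge0_FTC_oy _ u _ (fun x => - expR (- x)) (- expR (- u)) 0).
- by apply: measurable_funTS; exact: (measurableT_comp (@measurable_expR R)).
- by move=> t _; exact: expR_ge0.
- by move=> t _; exact: cN.
- move=> t _; have := is_deriveN (is_derive1_comp (is_derive_expR (- t)) (is_deriveNid t (1 : R))).
  by rewrite mulrN1 opprK.
- by apply: cvgN; apply: cvg_at_right_filter; exact: cN.
- by rewrite -oppr0; apply: cvgN; exact: cvgr_expR.
Qed.

Let int_pow s x : 0 < s -> 0 < x ->
  (\int[mu]_(u in `]0%R, x[) (s * u `^ (s - 1))%:E = (x `^ s)%:E)%E.
Proof.
move=> s0 x0; have -> : x `^ s = x `^ s - 0 by rewrite subr0.
apply: (@ge0_FTC_oo _ 0 x _ (fun t => t `^ s)) => //.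
- by apply: measurable_funTS; apply: measurable_funM => //; exact: measurable_powR.
- by move=> t _; rewrite mulr_ge0 ?powR_ge0// ltW.
- by move=> t /andP[t0 _]; apply: cvgM; [exact: cvg_cst|exact: powR_cvg_gt0].
- by move=> t /andP[t0 _]; exact: is_derive1_powR.
- exact: (powR_cvg0 s0).
- by apply: cvg_at_left_filter; exact: powR_cvg_gt0.
Qed.

(* Writing [x `^ s] as the integral of its derivative over [0 < u < x]. *)
Lemma egammaS s : 0 < s -> (egamma (s + 1) = s%:E * egamma s)%E.
Proof.
move=> s0.
pose f (z : R * R) : \bar R := if (0 < z.2) && (z.2 < z.1) then
  (s * z.2 `^ (s - 1) * expR (- z.1))%:E else 0%E.
have f0 z : (0 <= f z)%E.
  by rewrite /f; case: ifP => // _; rewrite lee_fin !mulr_ge0 ?powR_ge0 ?expR_ge0 ?(ltW s0).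
have mf : measurable_fun [set: R * R] f.
  apply: measurable_fun_if => //.
    by apply: measurable_and; exact: measurable_fun_ltr.
  apply: measurable_funTS; apply/measurable_EFinP; apply: measurable_funM.
    by apply: measurable_funM => //; exact: measurable_powR_comp.
  by apply: (measurableT_comp (@measurable_expR R)); exact: measurable_funN.
transitivity (\int[mu]_x \int[mu]_u f (x, u))%E.
  rewrite /egamma integral_mkcond; apply: eq_integral => x _; rewrite patchE.
  case: ifPn => [|]; rewrite ?notin_setE ?inE /= in_itv /= andbT => x0.
    rewrite addrK EFinM muleC -(int_pow s0 x0) -ge0_integralZl_EFin ?expR_ge0//; last 2 first.
    - by move=> u _; rewrite lee_fin mulr_ge0 ?powR_ge0// ltW.
    - by apply: measurable_funTS; apply/measurable_EFinP; apply: measurable_funM => //; exact: measurable_powR.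
    rewrite integral_mkcond; apply: eq_integral => u _; rewrite /f patchE /=.
    rewrite mem_setE in_itv /=; case: ifP => // _.
    by rewrite -EFinM mulrC.
  rewrite integral0_eq// => u _; rewrite /f /=.
  by case: ifP => // /andP[u0 ux]; case: x0; exact: lt_trans u0 ux.
rewrite (tonelli_swap mf f0) /egamma -ge0_integralZl_EFin ?(ltW s0)//; last 2 first.
- by move=> u _; rewrite lee_fin mulr_ge0 ?powR_ge0 ?expR_ge0.
- by apply: measurable_funTS; apply/measurable_EFinP; exact: measurable_gamma_integrand.
rewrite [RHS]integral_mkcond; apply: eq_integral => u _; rewrite patchE.
case: ifPn => [|]; rewrite ?notin_setE ?inE /= in_itv /= andbT => u0; last first.
  rewrite integral0_eq// => x _; rewrite /f /=.
  by case: ifP => // /andP[]; move: u0 => /negP/negbTE ->.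
rewrite -EFinM mulrA EFinM -(int_exp u) -ge0_integralZl_EFin ?mulr_ge0 ?powR_ge0 ?(ltW s0)//; last first.
  by apply: measurable_funTS; apply/measurable_EFinP; exact: (measurableT_comp (@measurable_expR R)).
rewrite [RHS]integral_mkcond; apply: eq_integral => x _; rewrite patchE /f /= u0 /=.
by rewrite mem_setE in_itv /= andbT; case: ifP => // _; rewrite -EFinM.
Qed.

Lemma egamma1 : egamma 1 = 1%E.
Proof.
rewrite /egamma; under eq_integral do rewrite subrr powRr0 mul1r.
by rewrite int_exp oppr0 expR0.
Qed.

Lemma egamma_nat n : egamma (n%:R + 1) = (n`!%:R)%:E.
Proof.
elim: n => [|n IH]; first by rewrite add0r egamma1 fact0.
have -> : n.+1%:R + 1 = (n%:R + 1) + 1 :> R by rewrite -natr1.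
by rewrite egammaS ?ltr_wpDl// IH factS natrM -natr1.
Qed.

(** For an integer [n > s] one has [x^(s - 1) <= 1 + x^n], and the integrals of the two terms are
    factorials. *)
Lemma egamma_fin s : 1 <= s -> egamma s \is a fin_num.
Proof.
move=> s1; rewrite ge0_fin_numE ?egamma_ge0//.
pose n := (Num.truncn s).+1.
apply: (@le_lt_trans _ _ (egamma 1 + egamma (n%:R + 1))%E); last first.
  by rewrite egamma1 egamma_nat -EFinD ltry.
rewrite /egamma -ge0_integralD//; last 4 first.
- by move=> x _; rewrite lee_fin mulr_ge0 ?powR_ge0 ?expR_ge0.
- by apply: measurable_funTS; apply/measurable_EFinP; exact: measurable_gamma_integrand.
- by move=> x _; rewrite lee_fin mulr_ge0 ?powR_ge0 ?expR_ge0.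
- by apply: measurable_funTS; apply/measurable_EFinP; exact: measurable_gamma_integrand.
apply: ge0_le_integral => //.
- by move=> x _; rewrite lee_fin mulr_ge0 ?powR_ge0 ?expR_ge0.
- by apply: measurable_funTS; apply/measurable_EFinP; exact: measurable_gamma_integrand.
- by apply: emeasurable_funD; apply: measurable_funTS; apply/measurable_EFinP; exact: measurable_gamma_integrand.
move=> x; rewrite /= in_itv /= andbT => x0; rewrite -EFinD lee_fin -mulrDl.
rewrite ler_wpM2r ?expR_ge0// subrr powRr0 addrK.
have [x1|x1] := leP x 1.
  apply: (@le_trans _ _ 1); last by rewrite lerDl powR_ge0.
  rewrite -[leRHS](powRr0 x); apply: ger_powR; first by rewrite x0.
  by rewrite subr_ge0.
apply: (@le_trans _ _ (x `^ n%:R)); last by rewrite lerDr.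
apply: ler_powR; first exact: ltW.
have : s < n%:R by exact: truncnS_gt.
lra.
Qed.

Lemma egamma_gt0 s : 0 < s -> (0 < egamma s)%E.
Proof.
move=> s0.
have h : (\int[mu]_(x in `]0%R, 1%R[) (expR (- 1) * x `^ (s - 1))%:E <= egamma s)%E.
  apply: (@le_trans _ _ (\int[mu]_(x in `]0%R, 1%R[) (x `^ (s - 1) * expR (- x))%:E)%E).
    apply: ge0_le_integral => //.
    - by move=> x _; rewrite lee_fin mulr_ge0 ?powR_ge0 ?expR_ge0.
    - by apply: measurable_funTS; apply/measurable_EFinP; apply: measurable_funM => //; exact: measurable_powR.
    - by apply: measurable_funTS; apply/measurable_EFinP; exact: measurable_gamma_integrand.
    move=> x; rewrite /= in_itv /= => /andP[x0 x1].
    by rewrite lee_fin mulrC ler_wpM2l ?powR_ge0// ler_expR lerN2 ltW.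
  apply: ge0_subset_integral => //.
  - by apply: measurable_funTS; apply/measurable_EFinP; exact: measurable_gamma_integrand.
  - by move=> x _; rewrite lee_fin mulr_ge0 ?powR_ge0 ?expR_ge0.
  - by move=> x; rewrite /= !in_itv /= andbT => /andP[].
apply: lt_le_trans h; under eq_integral do rewrite EFinM.
rewrite ge0_integralZl_EFin ?expR_ge0//; last 2 first.
- by move=> x _; rewrite lee_fin powR_ge0.
- by apply: measurable_funTS; apply/measurable_EFinP; exact: measurable_powR.
by rewrite integral_powR01// -EFinM lte_fin mulr_gt0 ?expR_gt0 ?invr_gt0.
Qed.

Lemma GammaE s : 1 <= s -> (Gamma s)%:E = egamma s.
Proof. by move=> s1; rewrite /Gamma /Rintegral fineK// egamma_fin. Qed.

Lemma Gamma_gt0 s : 1 <= s -> 0 < Gamma s.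
Proof. by move=> s1; rewrite -lte_fin GammaE// egamma_gt0// (lt_le_trans ltr01). Qed.

Lemma GammaS s : 1 <= s -> Gamma (s + 1) = s * Gamma s.
Proof.
move=> s1; apply: EFin_inj; rewrite EFinM !GammaE ?egammaS//.
  by rewrite (lt_le_trans ltr01).
by rewrite (le_trans s1)// lerDl.
Qed.

Lemma Gamma_nat n : Gamma (n%:R + 1 : R) = n`!%:R.
Proof. by apply: EFin_inj; rewrite GammaE ?egamma_nat// lerDr. Qed.

Lemma Gamma_prod s k : 1 <= s -> Gamma (s + k%:R) = \prod_(i < k) (s + i%:R) * Gamma s.
Proof.
move=> s1; elim: k => [|k IH]; first by rewrite addr0 big_ord0 mul1r.
have s2 : 1 <= s + k%:R by rewrite (le_trans s1)// lerDl.
have -> : s + k.+1%:R = s + k%:R + 1 by rewrite -natr1 addrA.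
by rewrite (GammaS s2) IH big_ord_recr /= mulrCA mulrA.
Qed.

(** [Gamma (n + b + 1)] cancels against the product formula for [Gamma (n + b + 1 + (k + 1))],
    leaving the Beta value at [(k + 1, n + b + 1)]. *)
Lemma hilbert_weightE b n k : 0 <= b ->
  hilbert_weight b n k = 'C(n + k, k)%:R * beta_nat k (n%:R + b).
Proof.
move=> b0; rewrite /hilbert_weight /beta_nat -natrD Gamma_nat Gamma_nat.
have s1 : 1 <= n%:R + b + 1 by rewrite lerDr addr_ge0.
have -> : (n + k)%:R + b + 2 = n%:R + b + 1 + k.+1%:R :> R by rewrite natrD; rewrite -natr1; ring.
rewrite Gamma_prod//.
have G0 := lt0r_neq0 (Gamma_gt0 s1).
have P0 : \prod_(i < k.+1) (n%:R + b + 1 + i%:R) != 0.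
  rewrite lt0r_neq0//; apply: prodr_gt0 => i _.
  by rewrite (lt_le_trans ltr01)// (le_trans s1)// lerDl.
have n0 : n`!%:R != 0 :> R by rewrite pnatr_eq0 -lt0n fact_gt0.
have -> : (n + k)`!%:R = 'C(n + k, k)%:R * k`!%:R * n`!%:R :> R.
  by rewrite -!natrM -(bin_fact (leq_addl n k)) addnK mulnA.
by field; rewrite n0 P0 G0.
Qed.

(** Without [(1 - t)^b], the integrand is the coefficient of [z^n] in
    [t^k (1 - (1 - t) z)^(- k - 1)], the image of [z^k] under [T_t]. *)
Lemma integral_hilbert_weight b n k : 0 <= b ->
  (\int[mu]_(t in `]0%R, 1%R[) ('C(n + k, k)%:R * t ^+ k * (1 - t) ^+ n * (1 - t) `^ b)%:E =
   (hilbert_weight b n k)%:E)%E.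
Proof.
move=> b0; rewrite hilbert_weightE// EFinM -integral_beta_nat ?addr_ge0//.
rewrite -ge0_integralZl_EFin//; last 2 first.
- by move=> t; rewrite /= in_itv /= => /andP[/ltW t0 _]; rewrite lee_fin mulr_ge0 ?powR_ge0// exprn_ge0.
- by apply: measurable_funTS; apply/measurable_EFinP; exact: measurable_beta_integrand.
apply: eq_integral => t; rewrite inE /= in_itv /= => /andP[t0 t1].
rewrite -EFinM; congr EFin; rewrite powRD; last first.
  by apply/implyP => _; rewrite subr_eq0 eq_sym lt_eqF.
by rewrite powR_mulrn ?subr_ge0 ?ltW// -!mulrA.
Qed.

Lemma hilbert_weight_ge0 b n k : 0 <= b -> 0 <= hilbert_weight b n k.
Proof.
move=> b0; rewrite hilbert_weightE// mulr_ge0// divr_ge0//; apply: prodr_ge0 => i _.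
by rewrite !addr_ge0.
Qed.

(** The weight decreases in [b], and for [b = 0] it is [1 / (n + k + 1)]. *)
Lemma hilbert_weight_le b n k : 0 <= b -> hilbert_weight b n k <= (k.+1%:R)^-1.
Proof.
move=> b0.
have P0 (d : R) : 0 <= d -> 0 < \prod_(i < k.+1) (d + 1 + i%:R).
  by move=> d0; apply: prodr_gt0 => i _; rewrite ltr_wpDr// ltr_wpDl.
apply: (@le_trans _ _ (hilbert_weight (0 : R) n k)).
  rewrite !hilbert_weightE// ler_wpM2l// ler_wpM2l//.
  rewrite lef_pV2 ?posrE ?P0 ?addr_ge0//.
  by apply: ler_prod => i _; rewrite !addr_ge0//= !lerD2r addr0 lerDl.
have -> : hilbert_weight (0 : R) n k = ((n + k).+1%:R)^-1.
  rewrite hilbert_weightE// addr0 /beta_nat.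
  have -> : \prod_(i < k.+1) (n%:R + 1 + i%:R) = (n + k).+1`!%:R / n`!%:R :> R.
    elim: k {P0} => [|k IH].
      by rewrite big_ord1 addr0 addn0 factS natrM -natr1 mulfK// pnatr_eq0 -lt0n fact_gt0.
    rewrite big_ord_recr /= IH addnS [in RHS]factS natrM -2!natr1 natrD -natr1.
    by ring.
  rewrite factS natrM -(bin_fact (leq_addl n k)) addnK !natrM.
  have n0 m : m`!%:R != 0 :> R by rewrite pnatr_eq0 -lt0n fact_gt0.
  have m0 : (n + k).+1%:R != 0 :> R by rewrite pnatr_eq0.
  have c0 : 'C(n + k, k)%:R != 0 :> R by rewrite pnatr_eq0 -lt0n bin_gt0 leq_addl.
  move: (n0 n) (n0 k) m0 c0.
  move: (n`!%:R : R) (k`!%:R : R) ((n + k).+1%:R : R) ('C(n + k, k)%:R : R) => x y z w.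
  by move=> x0 y0 z0 w0; field; rewrite x0 y0 z0 w0.
by rewrite lef_pV2 ?posrE// ler_nat ltnS leq_addl.
Qed.

End GammaBeta.

(** * Termwise integration of a dominated series *)

Section SeriesIntegral.
Context d (T : measurableType d) {R : realType} (mu : {measure set T -> \bar R}).
Variables (D : set T) (g : nat -> T -> R) (G : T -> R) (c M : R^nat).
Hypotheses (mD : measurable D) (mg : forall n, measurable_fun D (g n)).
Hypothesis gM : forall n, (\int[mu]_(t in D) `|g n t|%:E <= (M n)%:E)%E.
Hypothesis cM : cvgn (series M).
Hypothesis gG : forall t, D t -> series (g ^~ t) n @[n --> \oo] --> G t.
Hypothesis gc : forall n, (\int[mu]_(t in D) (g n t)%:E = (c n)%:E)%E.

Let h t : \bar R := (\sum_(n <oo) `|g n t|%:E)%E.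

Let h_ge N t : (`|series (g ^~ t) N|%:E <= h t)%E.
Proof.
apply: (@le_trans _ _ (\sum_(0 <= n < N) `|g n t|%:E)%E).
  by rewrite sumEFin lee_fin; exact: ler_norm_sum.
by apply: nneseries_lim_ge => // n _; rewrite lee_fin.
Qed.

Let mabs n : measurable_fun D (fun t => `|g n t|%:E).
Proof. by apply/measurable_EFinP; exact: measurableT_comp. Qed.

Let int_h : (\int[mu]_(t in D) h t <= (limn (series M))%:E)%E.
Proof.
rewrite /h integral_nneseries//.
rewrite -EFin_lim//.
rewrite (_ : EFin \o _ = (fun n => \sum_(0 <= k < n) (M k)%:E)%E).
  by apply: lee_nneseries => [n _ _|n _]; [exact: integral_ge0|exact: gM].
by apply/funext => n /=; rewrite sumEFin.
Qed.

Let mh : measurable_fun D h.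
Proof. by apply: ge0_emeasurable_sum => // n t _ _; rewrite lee_fin. Qed.

Let mG : measurable_fun D G.
Proof.
apply: (@measurable_fun_cvg _ _ _ D (fun n t => series (g ^~ t) n)) => //.
by move=> n; exact: measurable_sum.
Qed.

Let dom : [/\ mu.-integrable D (EFin \o G),
  (\int[mu]_(x in D) `|(series (g ^~ x) n)%:E - (G x)%:E|)%E @[n --> \oo] --> 0%E &
  (\int[mu]_(t in D) (series (g ^~ t) n)%:E)%E @[n --> \oo] --> (\int[mu]_(t in D) (G t)%:E)%E].
Proof.
apply: (@dominated_convergence _ _ _ mu D mD (fun n t => (series (g ^~ t) n)%:E) _ h).
- by move=> n; apply/measurable_EFinP; exact: measurable_sum.
- exact/measurable_EFinP.
- by apply: aeW => t Dt; apply: cvg_EFin; [exact: nearW|exact: gG].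
- apply/integrableP; split => //; apply: le_lt_trans (ltry (limn (series M))).
  apply: le_trans int_h; by under eq_integral => t _ do rewrite gee0_abs ?nneseries_ge0//.
- by apply: aeW => t n Dt; exact: h_ge.
Qed.

Lemma series_integrable : mu.-integrable D (EFin \o G).
Proof. by have [] := dom. Qed.

Lemma cvg_series_integral :
  series c n @[n --> \oo] --> fine (\int[mu]_(t in D) (G t)%:E)%E.
Proof.
have [iG _ H] := dom.
have gi n : mu.-integrable D (EFin \o g n).
  apply/integrableP; split; first exact/measurable_EFinP.
  exact: le_lt_trans (gM n) (ltry _).
suff : (series c n)%:E @[n --> \oo] --> (fine (\int[mu]_(t in D) (G t)%:E))%:E.
  exact: fine_cvg.
rewrite fineK ?integrable_fin_num//.
apply: cvg_trans H; apply: near_eq_cvg; apply: nearW => N /=.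
under eq_integral do rewrite -sumEFin.
rewrite integral_sum//.
by rewrite /series/= -sumEFin; apply: eq_bigr => n _; rewrite gc.
Qed.

Lemma abs_series_integral_le : (\int[mu]_(t in D) `|G t|%:E <= (limn (series M))%:E)%E.
Proof.
apply: le_trans int_h; apply: ge0_le_integral => //.
  by apply/measurable_EFinP; exact: measurableT_comp.
move=> t Dt.
have h2 : `|series (g ^~ t) n|%:E @[n --> \oo] --> `|G t|%:E.
  by apply: cvg_EFin; [exact: nearW|apply: cvg_norm; exact: gG].
apply: (cvge_to_le h2); apply: nearW => n; exact: h_ge.
Qed.

End SeriesIntegral.

(** * Dominated convergence for series *)

Section Tannery.
Context {R : realType}.
Local Notation C := R[i]^o.

Lemma tannery (x : nat -> nat -> C) (y : nat -> C) (M : R^nat) :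
  (forall N k, modulus (x N k) <= M k) -> cvgn (series M) ->
  (forall k, x N k @[N --> \oo] --> y k) ->
  limn (series (x N)) @[N --> \oo] --> limn (series y).
Proof.
move=> xM cM xy.
have yM k : modulus (y k) <= M k.
  have h : modulus (x N k) @[N --> \oo] --> modulus (y k) by apply: cvgC_mod; exact: xy.
  apply: (cvgr_to_le h); by apply: nearW => N; exact: xM.
apply/cvgC_modP; apply/cvgrPdist_lt => e e0.
have e4 : 0 < e / 4 by rewrite divr_gt0.
have [K _ HK] : \forall k \near \oo, `|limn (series M) - series M k| < e / 4.
  by move/cvgrPdist_lt : cM; exact.
have {}HK : limn (series M) - series M K < e / 4.
  by apply: le_lt_trans (HK K _) => //=; exact: ler_norm.
have c : modulus (series (x N) K - series y K) @[N --> \oo] --> (0 : R).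
  apply/cvgC_modP; elim: (K) => [|k IH].
    by rewrite /series/= big_geq//; under eq_fun do rewrite big_geq//; exact: cvg_cst.
  rewrite seriesSr; under eq_fun do rewrite seriesSr.
  by apply: cvgCD; [exact: IH|exact: xy].
move/cvgrPdist_lt : c => /(_ _ e4) c; near=> N.
rewrite sub0r normrN ger0_norm ?mod_ge0//.
have h1 := mod_series_tail K (xM N) cM.
have h2 := mod_series_tail K yM cM.
have h3 : modulus (series (x N) K - series y K) < e / 4.
  have : `|0 - modulus (series (x N) K - series y K)| < e / 4 by near: N.
  by rewrite sub0r normrN ger0_norm ?mod_ge0.
have -> : limn (series (x N)) - limn (series y) =
  (limn (series (x N)) - series (x N) K) + (series (x N) K - series y K) -
  (limn (series y) - series y K) by ring.
apply: le_lt_trans (modB _ _) _; have h4 := modD (limn (series (x N)) - series (x N) K) (series (x N) K - series y K).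
lra.
Unshelve. all: by end_near. Qed.

End Tannery.

(** * The integral formula for the Hilbert operator *)

Section HilbertFormula.
Context {R : realType}.
Local Notation C := R[i]^o.
Local Notation mu := (@lebesgue_measure R).
Variables (b : R) (b0 : 0 <= b).
Implicit Types (a : nat -> C) (z u : C).

(** Since the weights are at most [1 / (k + 1)] for every [n], this makes all coefficients of
    [H_b f] converge absolutely with a common bound. *)
Definition hsummable a := cvgn (series (fun k => modulus (a k) / k.+1%:R)).

Lemma weighted_coef_le a n k :
  modulus ((hilbert_weight b n k)%:C * a k) <= modulus (a k) / k.+1%:R.
Proof.
rewrite modM mod_real ger0_norm ?hilbert_weight_ge0// mulrC ler_wpM2l ?mod_ge0//.
exact: hilbert_weight_le.
Qed.

Lemma hilbert_coef_le a n : hsummable a ->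
  modulus (hilbert_coef b a n) <= limn (series (fun k => modulus (a k) / k.+1%:R)).
Proof. by move=> sa; apply: mod_series_le => // k; exact: weighted_coef_le. Qed.

Lemma hsummable_well_defined a : hsummable a -> hilbert_well_defined b a.
Proof.
move=> sa; split=> [n|z z1]; first by apply: cvgC_abs_series sa => k; exact: weighted_coef_le.
by apply: bounded_taylor_cvg z1 => n; exact: hilbert_coef_le.
Qed.

Lemma hilbert_op_analytic a : hsummable a -> analytic_on_disk (hilbert_op b a).
Proof.
by move=> sa z z1; apply: bounded_taylor_derivable z1 => n; exact: hilbert_coef_le.
Qed.

Lemma hilbert_op_cvg (x : nat -> nat -> C) a z :
  (forall N k, modulus (x N k) <= modulus (a k)) ->
  (forall k, x N k @[N --> \oo] --> a k) -> hsummable a -> modulus z < 1 ->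
  hilbert_op b (x N) z @[N --> \oo] --> hilbert_op b a z.
Proof.
move=> xa xc sa z1.
have sx N k n : modulus ((hilbert_weight b n k)%:C * x N k) <= modulus (a k) / k.+1%:R.
  apply: le_trans (weighted_coef_le _ _ _) _.
  by rewrite ler_wpM2r.
apply: (tannery (M := fun n => limn (series (fun k => modulus (a k) / k.+1%:R)) * modulus z ^+ n)).
- move=> N n; rewrite modM modX ler_wpM2r ?exprn_ge0 ?mod_ge0//.
  by apply: mod_series_le => // k.
- exact/is_cvg_seriesZ/geometric_cvg/z1/mod_ge0.
- move=> n; apply: cvgCM; last exact: cvg_cst.
  apply: (tannery (M := fun k => modulus (a k) / k.+1%:R)); [by move=> N k|exact: sa|].
  by move=> k; apply: cvgCM; [exact: cvg_cst|exact: xc].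
Qed.

Definition trunc a (K k : nat) : C := if (k < K)%N then a k else 0.

Lemma hilbert_coef_trunc a K n :
  hilbert_coef b (trunc a K) n = \sum_(0 <= k < K) (hilbert_weight b n k)%:C * a k.
Proof.
apply: cvgC_lim.
apply: cvg_near_cst; near=> N.
have KN : (K <= N)%N by near: N; exact: nbhs_infty_ge.
rewrite /hilbert_partial_sums /series /= (big_cat_nat (leq0n K) KN)/= [X in _ + X]big1_seq ?addr0.
  by rewrite big_nat [RHS]big_nat; apply: eq_bigr => k /andP[_ kK]; rewrite /trunc kK.
move=> k; rewrite mem_index_iota => /andP[_ /andP[Kk _]].
by rewrite /trunc ltnNge Kk/= mulr0.
Unshelve. all: by end_near. Qed.

Definition kern (t : R) z : C := (1 - (1 - t)%:C * z)^-1.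

Lemma mod_onem_mul (t : R) z : 0 < t -> t < 1 -> modulus z < 1 -> modulus ((1 - t)%:C * z) < 1.
Proof.
move=> t0 t1 z1; rewrite modM mod_real ger0_norm ?subr_ge0 ?(ltW t1)//.
by have := mod_ge0 z; nra.
Qed.

Section Term.
Variables (A z : C) (k : nat).
Hypothesis z1 : modulus z < 1.

(** The case of one monomial [A z^k]: [G] is its integrand and [g n] the [n]-th term of [G] in
    powers of [z]. Real parts keep the integrals real-valued. *)
Let wt n (t : R) := 'C(n + k, k)%:R * t ^+ k * (1 - t) ^+ n * (1 - t) `^ b.
Let g n (t : R) : R := complex.Re (A * z ^+ n) * wt n t.
Let G (t : R) : R := (1 - t) `^ b * complex.Re (A * (t%:C ^+ k * kern t z ^+ k.+1)).
Let M n : R := modulus A / k.+1%:R * modulus z ^+ n.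
Let c n : R := complex.Re (A * z ^+ n) * hilbert_weight b n k.

Let mwt n : measurable_fun [set: R] (wt n).
Proof.
apply: measurable_funM; last by apply: measurable_powR_comp; exact: measurable_funB.
apply: measurable_funM; last by apply: measurable_funX; exact: measurable_funB.
by apply: measurable_funM => //; exact: measurable_funX.
Qed.

Let mg n : measurable_fun `](0 : R), (1 : R)[ (g n).
Proof. by apply: measurable_funTS; apply: measurable_funM => //; exact: mwt. Qed.

Let wt0 n t : `]0%R, 1%R[%classic t -> 0 <= wt n t.
Proof.
rewrite /= in_itv /= => /andP[t0 t1].
by rewrite /wt !mulr_ge0 ?powR_ge0// exprn_ge0 ?subr_ge0 ?(ltW t0) ?(ltW t1).
Qed.

Let int_wt n : (\int[mu]_(t in `]0%R, 1%R[) (wt n t)%:E = (hilbert_weight b n k)%:E)%E.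
Proof. exact: integral_hilbert_weight. Qed.

Let gM n : (\int[mu]_(t in `]0%R, 1%R[) `|g n t|%:E <= (M n)%:E)%E.
Proof.
have -> : (\int[mu]_(t in `]0%R, 1%R[) `|g n t|%:E =
   `|complex.Re (A * z ^+ n)|%:E * \int[mu]_(t in `]0%R, 1%R[) (wt n t)%:E)%E.
  rewrite -ge0_integralZl_EFin//; last 2 first.
  - by move=> t /wt0; rewrite lee_fin.
  - by apply: measurable_funTS; apply/measurable_EFinP; exact: mwt.
  apply: eq_integral => t; rewrite inE => /wt0 w0.
  by rewrite -EFinM /g normrM [X in _ * X]ger0_norm.
rewrite int_wt -EFinM lee_fin /M mulrAC ler_pM ?normr_ge0 ?hilbert_weight_ge0 ?hilbert_weight_le//.
by apply: le_trans (Re_le_mod _) _; rewrite modM modX.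
Qed.

Let cM : series M n @[n --> \oo] --> modulus A / ((1 - modulus z) * k.+1%:R).
Proof.
have := @cvg_geometric_series R (modulus A / k.+1%:R) (modulus z).
rewrite ger0_norm ?mod_ge0// => /(_ z1).
by rewrite -mulrA -invfM [k.+1%:R * _]mulrC.
Qed.

Let gG (t : R) : `]0%R, 1%R[%classic t -> series (g ^~ t) n @[n --> \oo] --> G t.
Proof.
rewrite /= in_itv /= => /andP[t0 t1].
have h := @cvg_negbin_complex _ _ k (mod_onem_mul t0 t1 z1).
have {}h : ((1 - t) `^ b)%:C * (A * (t%:C ^+ k * \sum_(0 <= n < N) 'C(n + k, k)%:R * ((1 - t)%:C * z) ^+ n))
    @[N --> \oo] --> (((1 - t) `^ b)%:C * (A * (t%:C ^+ k * kern t z ^+ k.+1)) : C).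
  by do 3!(apply: cvgCM; first exact: cvg_cst); exact: h.
have := cvgC_Re (@filter_filter _ _ eventually_filter) h; rewrite ReZ.
apply: cvg_trans; apply: near_eq_cvg; apply: nearW => N /=.
rewrite !mulr_sumr Re_sum /series /=; apply: eq_bigr => n _.
rewrite ReZ /g /wt.
have -> : A * (t%:C ^+ k * ('C(n + k, k)%:R * ((1 - t)%:C * z) ^+ n)) =
  ('C(n + k, k)%:R * t ^+ k * (1 - t) ^+ n)%:C * (A * z ^+ n).
  rewrite exprMn !rmorphM /= !rmorphXn /= rmorph_nat; ring.
by rewrite ReZ; ring.
Qed.

Let gc n : (\int[mu]_(t in `]0%R, 1%R[) (g n t)%:E = (c n)%:E)%E.
Proof.
rewrite /c EFinM -int_wt -integralZl//.
apply/integrableP; split; first by apply: measurable_funTS; apply/measurable_EFinP; exact: mwt.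
rewrite (_ : (\int[mu]_(x in _) _ = (hilbert_weight b n k)%:E)%E) ?ltry//.
by rewrite -int_wt; apply: eq_integral => t; rewrite inE => /wt0 w0; rewrite gee0_abs ?lee_fin.
Qed.

Let cvM : cvgn (series M). Proof. by apply/cvg_ex; eexists; exact: cM. Qed.

Lemma hilbert_term_integrable : mu.-integrable `]0%R, 1%R[ (EFin \o G).
Proof. by apply: (@series_integrable _ _ _ mu _ g G M) => //; exact: gG. Qed.

Lemma cvg_hilbert_term : series c n @[n --> \oo] --> fine (\int[mu]_(t in `]0%R, 1%R[) (G t)%:E)%E.
Proof. by apply: (@cvg_series_integral _ _ _ mu _ g G c M) => //; exact: gG. Qed.

(** The factor [1 / (k + 1)] survives, so these bounds can be summed over the monomials under
    [hsummable]. *)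
Lemma hilbert_term_abs_le :
  (\int[mu]_(t in `]0%R, 1%R[) `|G t|%:E <= (modulus A / ((1 - modulus z) * k.+1%:R))%:E)%E.
Proof.
apply: le_trans (@abs_series_integral_le _ _ _ mu _ g G M _ mg gM cvM gG) _ => //.
by rewrite lee_fin (cvg_lim _ cM).
Qed.

End Term.

Section Formula.
Variables (a : nat -> C) (z u : C) (T : R -> C).
Hypotheses (sa : hsummable a) (z1 : modulus z < 1).
Hypothesis aT : forall t, 0 < t < 1 -> taylor_series a (t%:C * kern t z) n @[n --> \oo] --> T t.

(** The multiplier [u] makes up for taking real parts: a unit [u] recovers a modulus, and the
    conjugate of the value of [f] at [z] produces a lower bound. *)
Let A k := u * a k.
Let g k (t : R) : R := (1 - t) `^ b * complex.Re (A k * (t%:C ^+ k * kern t z ^+ k.+1)).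
Let G (t : R) : R := (1 - t) `^ b * complex.Re (u * (kern t z * T t)).
Let M k : R := modulus (A k) / ((1 - modulus z) * k.+1%:R).
Let c k : R := fine (\int[mu]_(t in `]0%R, 1%R[) (g k t)%:E)%E.

Let ig k : mu.-integrable `]0%R, 1%R[ (EFin \o g k).
Proof. exact: hilbert_term_integrable. Qed.

Let mg k : measurable_fun `](0 : R), (1 : R)[ (g k).
Proof. by have /integrableP[/measurable_EFinP] := ig k. Qed.

Let gc k : (\int[mu]_(t in `]0%R, 1%R[) (g k t)%:E = (c k)%:E)%E.
Proof. by rewrite /c fineK//; exact: (integrable_fin_num _ (ig k)). Qed.

Let gM k : (\int[mu]_(t in `]0%R, 1%R[) `|g k t|%:E <= (M k)%:E)%E.
Proof. exact: hilbert_term_abs_le. Qed.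

Let cM : cvgn (series M).
Proof.
have := is_cvg_seriesZ (k := modulus u / (1 - modulus z)) sa.
rewrite (_ : _ *: _ = M)//; apply/funext => k.
by rewrite scalrfctE /M /A modM invfM /GRing.scale /=; ring.
Qed.

Let gG (t : R) : `]0%R, 1%R[%classic t -> series (g ^~ t) n @[n --> \oo] --> G t.
Proof.
rewrite /= in_itv /= => /aT h.
have {}h : ((1 - t) `^ b)%:C * (u * (kern t z * taylor_series a (t%:C * kern t z) N))
    @[N --> \oo] --> (((1 - t) `^ b)%:C * (u * (kern t z * T t)) : C).
  by do 3!(apply: cvgCM; first exact: cvg_cst); exact: h.
have := cvgC_Re (@filter_filter _ _ eventually_filter) h; rewrite ReZ.
apply: cvg_trans; apply: near_eq_cvg; apply: nearW => N /=.
rewrite /taylor_series /series /= !mulr_sumr Re_sum; apply: eq_bigr => k _.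
rewrite ReZ /g /A; congr (_ * complex.Re _).
by rewrite exprMn exprS; ring.
Qed.

Let sum_c K : series c K = complex.Re (u * hilbert_op b (trunc a K) z).
Proof.
have st : hsummable (trunc a K).
  apply: (series_le_cvg _ _ _ sa) => k; rewrite ?divr_ge0 ?mod_ge0//.
  by rewrite ler_wpM2r// /trunc; case: ifP => // _; rewrite mod0 mod_ge0.
have [_ cH] := hsummable_well_defined st.
have h1 : complex.Re (u * taylor_series (hilbert_coef b (trunc a K)) z N) @[N --> \oo] -->
    complex.Re (u * hilbert_op b (trunc a K) z).
  by apply: cvgC_Re; apply: cvgCM; [exact: cvg_cst|exact: cH].
apply: (cvg_unique (@norm_hausdorff _ R) _ h1).
have h2 : \sum_(0 <= k < K) series (fun n => complex.Re (A k * z ^+ n) * hilbert_weight b n k) N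
   @[N --> \oo] --> \sum_(0 <= k < K) c k.
  apply: cvg_big; first exact: add_continuous.
  by move=> k _; exact: cvg_hilbert_term.
apply: cvg_trans h2; apply: near_eq_cvg; apply: nearW => N /=.
rewrite /taylor_series /series /= mulr_sumr Re_sum exchange_big /=; apply: eq_bigr => n _.
rewrite hilbert_coef_trunc mulr_suml mulr_sumr Re_sum; apply: eq_bigr => k _.
by rewrite /A mulrC -ReZ; congr complex.Re; ring.
Qed.

Lemma hilbert_op_integrable : mu.-integrable `]0%R, 1%R[ (EFin \o G).
Proof. by apply: (@series_integrable _ _ _ mu _ g G M) => //; exact: gG. Qed.

(** Both sides are limits over truncations of [a]: the integral by domination in [t], the operator
    by Tannery's theorem in the coefficients. *)
Lemma hilbert_op_integral :
  ((complex.Re (u * hilbert_op b a z))%:E = \int[mu]_(t in `]0%R, 1%R[) (G t)%:E)%E.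
Proof.
have h1 : series c n @[n --> \oo] --> fine (\int[mu]_(t in `]0%R, 1%R[) (G t)%:E)%E.
  by apply: (@cvg_series_integral _ _ _ mu _ g G c M) => //; exact: gG.
have h2 : complex.Re (u * hilbert_op b (trunc a N) z) @[N --> \oo] -->
    complex.Re (u * hilbert_op b a z).
  apply: cvgC_Re; apply: cvgCM; first exact: cvg_cst.
  apply: hilbert_op_cvg => // [N k|k].
    by rewrite /trunc; case: ifP => // _; rewrite mod0 mod_ge0.
  apply: cvg_near_cst; near=> N; rewrite /trunc.
  by have -> : (k < N)%N by near: N; exact: nbhs_infty_gt.
have e : complex.Re (u * hilbert_op b a z) = fine (\int[mu]_(t in `]0%R, 1%R[) (G t)%:E).
  apply: (cvg_unique (@norm_hausdorff _ R) h2); apply: cvg_trans h1.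
  by apply: near_eq_cvg; apply: nearW => N; rewrite sum_c.
by rewrite e fineK// integrable_fin_num//; exact: hilbert_op_integrable.
Unshelve. all: by end_near. Qed.

End Formula.
End HilbertFormula.

(** * Uniform second-order expansions and a four-point mean inequality *)

Section Jets.
Context {R : realType}.
Local Notation C := R[i]^o.
Implicit Types (F G : C -> C -> C) (v z : C) (K : R).

(* Second-order expansions in [v], uniform for [z] in the half-plane. *)
Definition jet2 F := exists2 K : R, 0 <= K & forall z, 2^-1 < complex.Re z ->
  exists A B D : C, [/\ modulus A <= K, modulus B <= K, modulus D <= K &
    forall v, modulus v <= 2^-1 ->
      modulus (F z v - (A + B * v + D * v ^+ 2)) <= K * modulus v ^+ 3].

Lemma jet2_cst (c : C) : jet2 (fun _ _ => c).
Proof.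
exists (modulus c) => [|z _]; first exact: mod_ge0.
exists c, 0, 0; rewrite mod0 mod_ge0; split => // v _.
by rewrite !mul0r !addr0 subrr mod0 mulr_ge0 ?exprn_ge0 ?mod_ge0.
Qed.

Lemma jet2D F G : jet2 F -> jet2 G -> jet2 (fun z v => F z v + G z v).
Proof.
move=> [K K0 hF] [L L0 hG]; exists (K + L) => [|z z0]; first exact: addr_ge0.
have [A [B [D [hA hB hD hv]]]] := hF z z0.
have [A' [B' [D' [hA' hB' hD' hv']]]] := hG z z0.
exists (A + A'), (B + B'), (D + D'); split; try exact: le_trans (modD _ _) (lerD _ _).
move=> v v1; have -> : F z v + G z v - (A + A' + (B + B') * v + (D + D') * v ^+ 2) =
  (F z v - (A + B * v + D * v ^+ 2)) + (G z v - (A' + B' * v + D' * v ^+ 2)) by ring.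
by apply: le_trans (modD _ _) _; rewrite mulrDl lerD ?hv ?hv'.
Qed.

Lemma mod_jet_le (A B D v : C) K : modulus A <= K -> modulus B <= K -> modulus D <= K ->
  modulus v <= 2^-1 -> modulus (A + B * v + D * v ^+ 2) <= 3 * K.
Proof.
move=> hA hB hD hv.
have v0 := mod_ge0 v; have K0 : 0 <= K := le_trans (mod_ge0 _) hA.
have h1 : modulus (B * v) <= K by rewrite modM; have := mod_ge0 B; nra.
have h2 : modulus (D * v ^+ 2) <= K.
  rewrite modM modX; have := mod_ge0 D => D0.
  have : modulus v ^+ 2 <= 1 by rewrite expr_le1//; lra.
  by have := exprn_ge0 2 v0; nra.
have h3 := modD (A + B * v) (D * v ^+ 2); have h4 := modD A (B * v); lra.
Qed.

Lemma jet2M F G : jet2 F -> jet2 G -> jet2 (fun z v => F z v * G z v).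
Proof.
(* 10 = 4 + 3 + 3, from the three groups into which the error is split below. *)
move=> [K K0 hF] [L L0 hG]; exists (10 * (K * L)) => [|z z0]; first by rewrite !mulr_ge0.
have [A [B [D [hA hB hD hv]]]] := hF z z0.
have [A' [B' [D' [hA' hB' hD' hv']]]] := hG z z0.
have KL : 0 <= K * L by rewrite mulr_ge0.
have pr (x y : C) : modulus x <= K -> modulus y <= L -> modulus (x * y) <= K * L.
  by move=> hx hy; rewrite modM ler_pM ?mod_ge0.
exists (A * A'), (A * B' + B * A'), (A * D' + B * B' + D * A'); split.
- by apply: le_trans (pr _ _ hA hA') _; lra.
- by apply: le_trans (modD _ _) _; have := pr _ _ hA hB'; have := pr _ _ hB hA'; lra.
- apply: le_trans (modD _ _) _; have := modD (A * D') (B * B').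
  by have := pr _ _ hA hD'; have := pr _ _ hB hB'; have := pr _ _ hD hA'; lra.
move=> v v1.
set P := A + B * v + D * v ^+ 2 in hv *; set Q := A' + B' * v + D' * v ^+ 2 in hv' *.
have -> : F z v * G z v - (A * A' + (A * B' + B * A') * v + (A * D' + B * B' + D * A') * v ^+ 2) =
  (F z v - P) * G z v + P * (G z v - Q) + v ^+ 3 * (B * D' + D * B' + D * D' * v).
  by rewrite /P /Q; ring.
have v0 := mod_ge0 v; have v30 : 0 <= modulus v ^+ 3 by rewrite exprn_ge0.
have v31 : modulus v ^+ 3 <= 1 by rewrite expr_le1//; lra.
have mP : modulus P <= 3 * K := mod_jet_le hA hB hD v1.
have mQ : modulus Q <= 3 * L := mod_jet_le hA' hB' hD' v1.
have mG : modulus (G z v) <= 4 * L.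
  have := modD Q (G z v - Q); rewrite [Q + _]addrC subrK.
  by have := hv' v v1; nra.
have h1 : modulus ((F z v - P) * G z v) <= 4 * (K * L) * modulus v ^+ 3.
  rewrite modM (le_trans (ler_pM (mod_ge0 _) (mod_ge0 _) (hv v v1) mG))//.
  by rewrite le_eqVlt; apply/orP; left; apply/eqP; ring.
have h2 : modulus (P * (G z v - Q)) <= 3 * (K * L) * modulus v ^+ 3.
  rewrite modM (le_trans (ler_pM (mod_ge0 _) (mod_ge0 _) mP (hv' v v1)))//.
  by rewrite le_eqVlt; apply/orP; left; apply/eqP; ring.
have h3 : modulus (v ^+ 3 * (B * D' + D * B' + D * D' * v)) <= 3 * (K * L) * modulus v ^+ 3.
  rewrite modM modX [leRHS]mulrC ler_wpM2l//.
  apply: le_trans (modD _ _) _; have := modD (B * D') (D * B').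
  have := pr _ _ hB hD'; have := pr _ _ hD hB'; have := pr _ _ hD hD'.
  have : modulus (D * D' * v) <= modulus (D * D') by rewrite [leLHS]modM; have := mod_ge0 (D * D'); nra.
  lra.
apply: le_trans (modD _ _) _; have := modD ((F z v - P) * G z v) (P * (G z v - Q)).
have -> : 10 * (K * L) * modulus v ^+ 3 = 4 * (K * L) * modulus v ^+ 3 + 3 * (K * L) * modulus v ^+ 3 + 3 * (K * L) * modulus v ^+ 3 by ring.
lra.
Qed.

Lemma jet2X F n : jet2 F -> jet2 (fun z v => F z v ^+ n).
Proof.
move=> hF; elim: n => [|n IH].
  by under eq_fun do under eq_fun do rewrite expr0; exact: jet2_cst.
by under eq_fun do under eq_fun do rewrite exprS; exact: jet2M.
Qed.

Lemma jet2_taylor F (a : nat -> C) n : jet2 F -> jet2 (fun z v => taylor_series a (F z v) n).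
Proof.
move=> hF; rewrite /taylor_series /series /=; elim: n => [|n IH].
  by under eq_fun do under eq_fun do rewrite big_geq//; exact: jet2_cst.
under eq_fun do under eq_fun do rewrite big_nat_recr//=.
by apply: jet2D => //; apply: jet2M; [exact: jet2_cst|exact: jet2X].
Qed.

Lemma onem_neq0 v : modulus v <= 2^-1 -> 1 + v != 0.
Proof.
move=> v1; rewrite -[v]opprK; apply: mod_lt1_neq0; rewrite modN.
by apply: le_lt_trans v1 _; lra.
Qed.

(** Perturbing [z] by the factor [1 + v], not by addition, makes the expansion uniform: only
    [1 / |z| <= 2] and [1 / |1 + v| <= 2] enter. *)
Lemma jet2_inv : jet2 (fun z v => (z * (1 + v))^-1).
Proof.
exists 4 => // z z0.
have mz : 2^-1 < modulus z.
  by apply: lt_le_trans z0 _; apply: le_trans (ler_norm _) (Re_le_mod _).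
have zi : modulus z^-1 <= 2.
  have m0 : 0 < modulus z by apply: lt_trans mz; rewrite invr_gt0.
  by rewrite modV -[leRHS]invrK lef_pV2 ?posrE ?invr_gt0//; exact: ltW.
have z1 : z != 0 by rewrite -mod_gt0 (lt_trans _ mz).
exists z^-1, (- z^-1), z^-1; rewrite modN; split; try by apply: le_trans zi _; lra.
move=> v v1; have v2 := onem_neq0 v1.
have -> : (z * (1 + v))^-1 - (z^-1 + - z^-1 * v + z^-1 * v ^+ 2) = - (z^-1 * (1 + v)^-1 * v ^+ 3).
  by field; rewrite z1 v2.
rewrite modN modM modX modM ler_wpM2r ?exprn_ge0 ?mod_ge0//.
have h : modulus (1 + v)^-1 <= 2.
  rewrite modV -[leRHS]invrK lef_pV2 ?posrE ?invr_gt0// ?mod_gt0//.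
  by have := modB (1 + v) v; rewrite addrK mod1; lra.
by rewrite (le_trans (ler_pM (mod_ge0 _) (mod_ge0 _) zi h))//; lra.
Qed.

(** For [0 <= q <= 1] the binomial coefficients are at most 1 in modulus, so the remainder is
    bounded by that of a geometric series. *)
Lemma jet2_cpow (q : R) : 0 <= q -> q <= 1 -> jet2 (fun _ v => cpow (- q) (1 + v)).
Proof.
move=> q0 q1; exists 2 => // z _.
have b1 k : modulus ((binc q k)%:C : C) <= 1 by exact: mod_binc_le1.
exists (binc q 0)%:C, (- (binc q 1)%:C), (binc q 2)%:C; rewrite modN.
split; try by apply: le_trans (b1 _) _; lra.
move=> v v1; have mv : modulus (- v) < 1 by rewrite modN; lra.
have h := cvg_binomial_series q0 q1 mv; rewrite opprK in h.
have mvn : `|modulus v| < 1 by rewrite ger0_norm ?mod_ge0//; move: mv; rewrite modN.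
have cg := @cvg_geometric_series R 1 _ mvn.
have tl := @mod_series_tail _ (fun k => (binc q k)%:C * (- v) ^+ k) (geometric 1 (modulus v)) 3.
move: tl; rewrite (cvgC_lim h) (cvg_lim _ cg)// => tl.
have {}tl : modulus (cpow (- q) (1 + v) -
    ((binc q 0)%:C + - (binc q 1)%:C * v + (binc q 2)%:C * v ^+ 2)) <=
    1 / (1 - modulus v) - (1 + modulus v + modulus v ^+ 2).
  have h3 : series (geometric 1 (modulus v)) 3 = 1 + modulus v + modulus v ^+ 2.
    by rewrite /series /= !big_nat_recr//= big_geq// /geometric /= add0r !mul1r expr0 expr1.
  rewrite -h3; apply: le_trans (tl _ cg).
    rewrite le_eqVlt; apply/orP; left; apply/eqP; congr (modulus (_ - _)).
    by rewrite /series /= !big_nat_recr//= big_geq// add0r expr0 expr1 sqrrN; ring.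
  move=> k; rewrite /geometric /= modM modX modN mul1r -[leRHS]mul1r.
  by rewrite ler_wpM2r ?exprn_ge0 ?mod_ge0.
apply: le_trans tl _.
have v0 := mod_ge0 v; have v1' : 0 < 1 - modulus v by lra.
have -> : 1 / (1 - modulus v) - (1 + modulus v + modulus v ^+ 2) = (1 - modulus v)^-1 * modulus v ^+ 3.
  by field; rewrite lt0r_neq0.
rewrite ler_wpM2r ?exprn_ge0// -[leRHS]invrK lef_pV2 ?posrE ?invr_gt0//.
by lra.
Qed.

(** A discrete substitute for the subharmonicity of the modulus: the numbers [v], [- v], [i v],
    [- i v] sum to 0 and so do their squares, hence the mean of [F] differs from [F z 0] by
    third-order terms only. *)
Lemma jet2_mean F : jet2 F -> exists2 K : R, 0 <= K &
  (forall z v, 2^-1 < complex.Re z -> modulus v <= 2^-1 -> modulus (F z v) <= K) /\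
  forall z v, 2^-1 < complex.Re z -> modulus v <= 2^-1 ->
  modulus (F z 0) <= (modulus (F z v) + modulus (F z (- v)) +
    modulus (F z ('i * v)) + modulus (F z (- ('i * v)))) / 4 + K * modulus v ^+ 3.
Proof.
move=> [K K0 hF]; exists (4 * K); first by rewrite mulr_ge0.
split=> z v z0 v1; have [A [B [D [hA hB hD hv]]]] := hF z z0;
  have v0 := mod_ge0 v; have v30 : 0 <= modulus v ^+ 3 by rewrite exprn_ge0.
  have := modD (A + B * v + D * v ^+ 2) (F z v - (A + B * v + D * v ^+ 2)).
  rewrite [_ + (_ - _)]addrC subrK.
  have := mod_jet_le hA hB hD v1; have := hv v v1.
  have : modulus v ^+ 3 <= 1 by rewrite expr_le1//; lra.
  by nra.
have mi : modulus ('i * v) = modulus v.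
  by rewrite modM; case: (v) => x y; rewrite /modulus /= expr0n expr1n add0r sqrtr1 mul1r.
have FA : F z 0 = A.
  have := hv 0; rewrite mod0 invr_ge0 ler0n => /(_ isT).
  rewrite !expr0n/= !mulr0 !addr0; have := mod_ge0 (F z 0 - A) => h1 h2.
  by apply/eqP; rewrite -subr_eq0 -mod_eq0 eq_le h1 andbT.
have e : A = (F z v + F z (- v) + F z ('i * v) + F z (- ('i * v))) / 4 -
  ((F z v - (A + B * v + D * v ^+ 2)) +
   (F z (- v) - (A + B * (- v) + D * (- v) ^+ 2)) +
   (F z ('i * v) - (A + B * ('i * v) + D * ('i * v) ^+ 2)) +
   (F z (- ('i * v)) - (A + B * (- ('i * v)) + D * (- ('i * v)) ^+ 2))) / 4.
  have i2 : ('i : C) ^+ 2 = -1 by exact: sqr_i.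
  by rewrite !sqrrN !exprMn i2; field.
have h1 := hv v v1.
have h2 := hv (- v); rewrite modN in h2; have {}h2 := h2 v1.
have h3 := hv ('i * v); rewrite mi in h3; have {}h3 := h3 v1.
have h4 := hv (- ('i * v)); rewrite modN mi in h4; have {}h4 := h4 v1.
have m4 (x : C) : modulus (x / 4) = modulus x / 4 by rewrite modM modV (mod_nat 4).
rewrite FA [in leLHS]e; apply: le_trans (modB _ _) _; rewrite !m4.
set r1 := F z v - _ in h1 *; set r2 := F z (- v) - _ in h2 *.
set r3 := F z ('i * v) - _ in h3 *; set r4 := F z (- ('i * v)) - _ in h4 *.
have := modD (r1 + r2 + r3) r4; have := modD (r1 + r2) r3; have := modD r1 r2.
have := modD (F z v + F z (- v) + F z ('i * v)) (F z (- ('i * v))).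
have := modD (F z v + F z (- v)) (F z ('i * v)); have := modD (F z v) (F z (- v)).
have := mulr_ge0 K0 v30; lra.
Qed.

End Jets.

(** * Almost convex functions on a half-line; convexity of powers *)

Section Convexity.
Context {R : realType}.
Implicit Types (x y t p r K B : R).

(** The mean increment from 0 is at most the next increment ([hd]), so it is nondecreasing in the
    endpoint. *)
Lemma convex_seq_le (E : R^nat) m N : (forall j, 2 * E j.+1 <= E j + E j.+2) ->
  (m <= N)%N -> N%:R * (E m - E 0%N) <= m%:R * (E N - E 0%N).
Proof.
move=> cE; have hd k : E k - E 0%N <= k%:R * (E k.+1 - E k).
  elim: k => [|k IH]; first by rewrite subrr mul0r.
  have k0 : 0 <= k.+1%:R :> R by [].
  have := ler_wpM2l k0 (cE k); rewrite -natr1 in k0 *; nra.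
elim: N => [|N IH]; first by rewrite leqn0 => /eqP ->.
rewrite leq_eqVlt => /predU1P[<-//|]; rewrite ltnS => mN.
case: N => [|N] in IH mN *; first by move: mN; rewrite leqn0 => /eqP ->; rewrite subrr mulr0 mul0r.
have {}IH := IH mN; have h := hd N.+1.
have N0 : 0 < N.+1%:R :> R by [].
have m0 : 0 <= m%:R :> R by [].
rewrite -(ler_pM2l N0) -[N.+2%:R]natr1.
move: (N.+1%:R : R) (m%:R : R) (E m) (E N.+2) (E N.+1) (E 0%N) N0 m0 IH h => n k Em E2 E1 E0 n0 k0 IH h.
have := ler_wpM2l k0 h; have n1 : 0 <= n + 1 by rewrite addr_ge0// ltW.
by have := ler_wpM2l n1 IH; lra.
Qed.

(* A bounded function on a half-line that is midpoint convex up to [o(r^2)] is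
   nonincreasing: a strict increase would propagate with linear growth. *)
Lemma almost_convex_nonincreasing (M : R -> R) x y K B : x < y -> 0 <= K ->
  (forall z r, 0 < r -> r <= 4^-1 -> x <= z - r -> 2 * M z <= M (z + r) + M (z - r) + K * r ^+ 3) ->
  (forall z, x <= z -> `|M z| <= B) -> M y <= M x.
Proof.
move=> xy K0 cM bM; rewrite leNgt; apply/negP => D0.
pose L := y - x; pose D := M y - M x.
have L0 : 0 < L by rewrite subr_gt0.
have {}D0 : 0 < D by rewrite subr_gt0.
(* An increase by [D] over a length [L], repeated [T] times, exceeds the largest possible
   oscillation [2 B] by more than 1. *)
pose T := (Num.truncn ((2 * B + 1) / D)).+1.
have hT : 2 * B + 1 < T%:R * D by rewrite -ltr_pdivrMr//; exact: truncnS_gt.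
(* Enough subdivisions of [L] for [r <= 1 / 4] and for the correction in [E], accumulated over [T]
   lengths, to stay below 1. *)
pose X := K / 2 * L ^+ 3 * T%:R ^+ 2 + 4 * L.
pose m := (Num.truncn X).+1.
have hm : X < m%:R by exact: truncnS_gt.
have X1 : 0 <= K / 2 * L ^+ 3 * T%:R ^+ 2 by rewrite !mulr_ge0 ?exprn_ge0// ltW.
have m0 : 0 < m%:R :> R by [].
pose r := L / m%:R.
have r0 : 0 < r by rewrite divr_gt0.
have r4 : r <= 4^-1 by rewrite /r ler_pdivrMr//; move: hm; rewrite /X; lra.
(* The second difference of the added quadratic is [K r^3], which restores exact convexity. *)
pose E j := M (x + j%:R * r) + K / 2 * r ^+ 3 * j%:R ^+ 2.
have cE j : 2 * E j.+1 <= E j + E j.+2.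
  rewrite /E; have := cM (x + j.+1%:R * r) r r0 r4.
  have -> : x + j.+1%:R * r + r = x + j.+2%:R * r by rewrite -!natr1; ring.
  have -> : x + j.+1%:R * r - r = x + j%:R * r by rewrite -!natr1; ring.
  have j0 : 0 <= j%:R * r by rewrite mulr_ge0// ltW.
  rewrite lerDl => /(_ j0).
  move: (M _) (M _) (M _) => m1 m2 m3.
  have -> : j.+2%:R = j%:R + 2 :> R by rewrite -!natr1; ring.
  have -> : j.+1%:R = j%:R + 1 :> R by rewrite natr1.
  move: (j%:R : R) => J h.
  have -> : K / 2 * r ^+ 3 * (J + 1) ^+ 2 =
    (K / 2 * r ^+ 3 * J ^+ 2 + K / 2 * r ^+ 3 * (J + 2) ^+ 2) / 2 - K * r ^+ 3 / 2 by field.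
  lra.
have /(convex_seq_le cE) : (m <= m * T)%N by rewrite leq_pmulr.
have mr : m%:R * r = L by rewrite /r mulrC divfK// gt_eqF.
rewrite /E !mul0r addr0 expr0n/= mulr0 addr0 natrM mr.
have -> : x + L = y by rewrite /L addrC subrK.
have b1 := bM x (lexx x).
have b2 : `|M (x + m%:R * T%:R * r)| <= B.
  by apply: bM; rewrite lerDl !mulr_ge0// ltW.
rewrite -mulrA ler_pM2l// => h.
have e1 : K / 2 * r ^+ 3 * m%:R ^+ 2 * m%:R = K / 2 * L ^+ 3.
  by rewrite -mr; ring.
have e2 : K / 2 * r ^+ 3 * (m%:R * T%:R) ^+ 2 = K / 2 * r ^+ 3 * m%:R ^+ 2 * T%:R ^+ 2 by ring.
rewrite e2 in h.
have W0 : 0 <= K / 2 * r ^+ 3 * m%:R ^+ 2 by rewrite !mulr_ge0 ?exprn_ge0// ltW.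
move: W0 e1 h; set W := K / 2 * r ^+ 3 * m%:R ^+ 2 => W0 e1 h.
have T0 : 0 <= T%:R :> R by [].
have h1 : W * T%:R ^+ 2 < 1.
  rewrite -(ltr_pM2r m0) mul1r mulrAC e1; move: hm; rewrite /X; lra.
move: b1 b2; rewrite !ler_norml => /andP[b1 b1'] /andP[b2 b2'].
have TW := mulr_ge0 T0 W0.
move: hT; rewrite /D; lra.
Qed.

Lemma powR_convex p t x y : 1 <= p -> 0 <= t -> t <= 1 -> 0 <= x -> 0 <= y ->
  ((1 - t) * x + t * y) `^ p <= (1 - t) * x `^ p + t * y `^ p.
Proof.
move=> p1 t0 t1 x0 y0.
have u0 : 0 <= 1 - t by lra.
have u1 : 1 - t <= 1 by lra.
have := convex_powR p1 (Itv01 u0 u1); rewrite /prop_in2 => /(_ x y).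
rewrite !inE /= !in_itv /= !andbT => /(_ x0 y0).
by rewrite convRE [X in X `^ _ <= _ -> _]convRE /= /unstable.onem opprB addrCA subrr addr0.
Qed.

Lemma powR_mean4 p x1 x2 x3 x4 : 1 <= p -> 0 <= x1 -> 0 <= x2 -> 0 <= x3 -> 0 <= x4 ->
  ((x1 + x2 + x3 + x4) / 4) `^ p <= (x1 `^ p + x2 `^ p + x3 `^ p + x4 `^ p) / 4.
Proof.
move=> p1 h1 h2 h3 h4.
have c (x y : R) : 0 <= x -> 0 <= y -> ((x + y) / 2) `^ p <= (x `^ p + y `^ p) / 2.
  move=> x0 y0; have := @powR_convex p 2^-1 x y p1.
  have -> : (1 - 2^-1) * x + 2^-1 * y = (x + y) / 2 by field.
  have -> : (1 - 2^-1) * x `^ p + 2^-1 * y `^ p = (x `^ p + y `^ p) / 2 by field.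
  by apply => //; lra.
have -> : (x1 + x2 + x3 + x4) / 4 = ((x1 + x2) / 2 + (x3 + x4) / 2) / 2 by field.
have := c x1 x2 h1 h2; have := c x3 x4 h3 h4.
have := c ((x1 + x2) / 2) ((x3 + x4) / 2); rewrite !divr_ge0 ?addr_ge0// => /(_ isT isT).
lra.
Qed.

End Convexity.

(** * Mean inequality for a polynomial carried to the half-plane *)

Section HalfPlaneMeans.
Context {R : realType}.
Local Notation C := R[i]^o.
Local Notation mu := (@lebesgue_measure R).
Variables (a : nat -> C) (n : nat) (q p : R).
Hypotheses (q0 : 0 <= q) (q1 : q <= 1) (p1 : 1 <= p) (qp : 2 <= q * p).
Implicit Types (z v : C) (x y r K : R).

(** The modulus of [f (1 - 1 / zeta) zeta^(- q)] for the polynomial [f] with the first [n]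
    coefficients of [a]. *)
Definition hp_fun z : R := modulus (taylor_series a (1 - z^-1) n) * modulus z `^ (- q).

Lemma hp_fun_ge0 z : 0 <= hp_fun z.
Proof. by rewrite mulr_ge0 ?mod_ge0 ?powR_ge0. Qed.

(** Writing [z + v = z (1 + v / z)] factors out [|z|^(- q)] and leaves a function whose expansion is
    uniform in [z]. The decay stays attached to the error, which has to be integrable along vertical
    lines after the power [p]. *)
Lemma hp_fun_mean : exists2 K : R, 0 < K &
  (forall z v, 2^-1 < complex.Re z -> modulus v <= 4^-1 -> hp_fun (z + v) <= K * modulus z `^ (- q)) /\
  forall z r, 2^-1 < complex.Re z -> 0 <= r -> r <= 4^-1 ->
  hp_fun z <= (hp_fun (z + r%:C) + hp_fun (z - r%:C) + hp_fun (z + 'i * r%:C) + hp_fun (z - 'i * r%:C)) / 4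
    + K * r ^+ 3 * modulus z `^ (- q).
Proof.
pose F (z v : C) : C := taylor_series a (1 - (z * (1 + v))^-1) n * cpow (- q) (1 + v).
have jF : jet2 F.
  apply: jet2M; last exact: jet2_cpow.
  apply: (@jet2_taylor _ (fun z v => 1 - (z * (1 + v))^-1)).
  apply: (@jet2D _ (fun _ _ => 1) (fun z v => - (z * (1 + v))^-1)); first exact: jet2_cst.
  under eq_fun do under eq_fun do rewrite -mulN1r.
  by apply: (@jet2M _ (fun _ _ => -1)); [exact: jet2_cst|exact: jet2_inv].
have [K K0 [bF mF]] := jet2_mean jF.
have zm z : 2^-1 < complex.Re z -> 2^-1 < modulus z.
  by move=> z0; apply: lt_le_trans z0 _; apply: le_trans (ler_norm _) (Re_le_mod _).
have hF z v : 2^-1 < complex.Re z -> hp_fun (z + v) = modulus (F z (v / z)) * modulus z `^ (- q).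
  move=> z0; have z1 : z != 0 by rewrite -mod_gt0 (lt_trans _ (zm z z0)).
  rewrite /F modM mod_cpow -mulrA -powRM ?mod_ge0// -modM /hp_fun.
  have e : z * (1 + v / z) = z + v by field.
  by rewrite e [(1 + v / z) * z]mulrC e.
have vz z v : 2^-1 < complex.Re z -> modulus v <= 4^-1 -> modulus (v / z) <= 2 * modulus v.
  move=> /zm z0 v4; have m0 : 0 < modulus z by apply: lt_trans z0.
  rewrite modM modV ler_pdivrMr//; have := mod_ge0 v; nra.
(* 8 = 2^3 comes from [|r / z| <= 2 r]; adding 1 makes the constant positive. *)
exists (8 * K + 1); first by rewrite ltr_wpDl// mulr_ge0.
split=> [z v z0 v4|z r z0 r0 r4].
  rewrite hF// ler_wpM2r ?powR_ge0//.
  by have := bF z (v / z) z0; have := vz z v z0 v4 => h /(_ _); lra.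
have mr : modulus (r%:C : C) = r by rewrite mod_real ger0_norm.
have hv := vz z r%:C z0; rewrite mr in hv; have {}hv := hv r4.
have := mF z (r%:C / z) z0; have hv2 : modulus (r%:C / z) <= 2^-1 by lra.
move=> /(_ hv2) h.
have e0 : hp_fun z = modulus (F z 0) * modulus z `^ (- q).
  by rewrite -[z in LHS]addr0 hF// mul0r.
have ei : 'i * r%:C / z = 'i * (r%:C / z) by rewrite mulrA.
rewrite e0 !hF// !mulNr ei.
have W0 := powR_ge0 (modulus z) (- q).
have m0 := mod_ge0 (r%:C / z).
have h3 : modulus (r%:C / z) ^+ 3 <= (2 * r) ^+ 3 by apply: lerXn2r; rewrite ?nnegrE ?mulr_ge0.
have r30 : 0 <= r ^+ 3 by rewrite exprn_ge0.
have h4 := ler_wpM2r W0 (ler_wpM2l K0 h3).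
have h5 := ler_wpM2r W0 h; have h6 := mulr_ge0 r30 W0; have h7 := mulr_ge0 K0 h6.
by rewrite exprMn in h4; lra.
Qed.

(** The error passes through the power by convexity: [m + r^3 X] is the combination
    [(1 - r^3) m + r^3 (m + X)], and [m <= X], so its power [p] exceeds [m^p] by at most
    [r^3 (2 X)^p]. *)
Lemma hp_funX_mean : exists2 K : R, 0 <= K &
  (forall z, 2^-1 < complex.Re z -> hp_fun z `^ p <= K * modulus z `^ (- (q * p))) /\
  forall z r, 2^-1 < complex.Re z -> 0 <= r -> r <= 4^-1 ->
  hp_fun z `^ p <= (hp_fun (z + r%:C) `^ p + hp_fun (z - r%:C) `^ p +
    hp_fun (z + 'i * r%:C) `^ p + hp_fun (z - 'i * r%:C) `^ p) / 4
    + K * r ^+ 3 * modulus z `^ (- (q * p)).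
Proof.
have [K K0 [bF mF]] := hp_fun_mean.
have p0 : 0 <= p by rewrite (le_trans ler01).
have Kp z : (K * modulus z `^ (- q)) `^ p = K `^ p * modulus z `^ (- (q * p)).
  by rewrite powRM ?powR_ge0 ?(ltW K0)// -powRrM mulNr.
have two : 1 <= 2 `^ p :> R by rewrite -[leLHS](powRr0 2) ler_powR// ler1n.
exists (2 `^ p * K `^ p); first by rewrite mulr_ge0 ?powR_ge0.
split=> [z z0|z r z0 r0 r4].
  apply: (@le_trans _ _ ((K * modulus z `^ (- q)) `^ p)).
    rewrite ge0_ler_powR ?nnegrE ?hp_fun_ge0 ?mulr_ge0 ?powR_ge0 ?(ltW K0)//.
    by have := bF z 0 z0; rewrite addr0 mod0; apply; rewrite invr_ge0.
  rewrite Kp -mulrA ler_peMl// mulr_ge0 ?powR_ge0//.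
have mr : modulus (r%:C : C) <= 4^-1 by rewrite mod_real ger0_norm.
have mi : modulus ('i * r%:C : C) <= 4^-1.
  by rewrite modM mod_real ger0_norm// /modulus /= expr0n expr1n add0r sqrtr1 mul1r.
have nb v : modulus v <= 4^-1 -> hp_fun (z - v) <= K * modulus z `^ (- q).
  by move=> hv; apply: bF; rewrite ?modN.
have b1 := bF z r%:C z0 mr; have b2 := nb _ mr; have b3 := bF z ('i * r%:C) z0 mi; have b4 := nb _ mi.
have := mF z r z0 r0 r4.
have := powR_mean4 p1 (hp_fun_ge0 (z + r%:C)) (hp_fun_ge0 (z - r%:C)) (hp_fun_ge0 (z + 'i * r%:C)) (hp_fun_ge0 (z - 'i * r%:C)).
set m := (_ + _) / 4; set mp := (_ + _) / 4; rewrite -/m => hm h.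
apply: (@le_trans _ _ (m `^ p + r ^+ 3 * (2 `^ p * (K `^ p * modulus z `^ (- (q * p)))))); last first.
  by rewrite lerD// le_eqVlt; apply/orP; left; apply/eqP; ring.
rewrite -Kp -powRM ?mulr_ge0 ?powR_ge0 ?(ltW K0)//.
set X := K * modulus z `^ (- q) in h b1 b2 b3 b4 *.
have X0 : 0 <= X by rewrite mulr_ge0 ?powR_ge0 ?(ltW K0).
have m0 : 0 <= m by rewrite divr_ge0 ?addr_ge0 ?hp_fun_ge0.
have mX : m <= X by rewrite /m; lra.
have r30 : 0 <= r ^+ 3 by rewrite exprn_ge0.
have r31 : r ^+ 3 <= 1 by rewrite expr_le1//; lra.
have := powR_convex p1 r30 r31 m0 (addr_ge0 m0 X0) => hc.
apply: (@le_trans _ _ (((1 - r ^+ 3) * m + r ^+ 3 * (m + X)) `^ p)).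
  rewrite ge0_ler_powR ?nnegrE ?hp_fun_ge0//.
    by rewrite addr_ge0// mulr_ge0//; lra.
  by apply: le_trans h _; rewrite /X; lra.
apply: le_trans hc _; rewrite lerD//.
  by rewrite ler_piMl ?powR_ge0//; lra.
by apply: ler_wpM2l => //; apply: ge0_ler_powR; rewrite ?nnegrE //; lra.
Qed.

End HalfPlaneMeans.

(** [M x] occurs twice on the right because shifting a vertical line along itself does not change
    the integral; what remains is midpoint convexity in [x] up to a cubic error. *)
Lemma almost_convex_ereal_nonincreasing (R : realType) (M : R -> \bar R) (l B K : R) :
  0 <= K -> (forall x, 0 <= M x)%E -> (forall x, l < x -> (M x <= B%:E)%E) ->
  (forall x r, l < x - r -> 0 <= r -> r <= 4^-1 ->
   (M x <= 4^-1%:E * (M (x + r)%R + M (x - r)%R + M x + M x) + (K * r ^+ 3)%:E)%E) ->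
  forall x y, l < x -> x <= y -> (M y <= M x)%E.
Proof.
move=> K0 M0 bM mM x y x0.
have aux (u v w k : R) :
    (u%:E <= 4^-1%:E * (v%:E + w%:E + u%:E + u%:E) + k%:E)%E -> 2 * u <= v + w + 4 * k.
  by rewrite -!EFinD lee_fin; lra.
have fM (z : R) : l < z -> M z = (fine (M z))%:E.
  by move=> z0; rewrite fineK// ge0_fin_numE//; exact: le_lt_trans (bM z z0) (ltry _).
rewrite le_eqVlt => /predU1P[->//|xy].
have y0 := lt_trans x0 xy; rewrite (fM y y0) (fM x x0) lee_fin.
pose Mf (z : R) := fine (M z); suff : Mf y <= Mf x by [].
apply: (@almost_convex_nonincreasing _ Mf x y (4 * K) B xy); rewrite /Mf.
- by rewrite mulr_ge0.
- move=> z r r0 r4 xz.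
  have zr : l < z - r by apply: lt_le_trans x0 xz.
  have z0 : l < z by lra.
  have zr' : l < z + r by lra.
  have h := mM z r zr (ltW r0) r4; rewrite (fM z z0) (fM _ zr) (fM _ zr') in h.
  have := aux _ _ _ _ h; lra.
- move=> z xz; have z0 : l < z by apply: lt_le_trans x0 xz.
  have := bM z z0; rewrite (fM z z0) lee_fin ger0_norm//.
  by rewrite /= fine_ge0.
Qed.

Lemma integral_shift (R : realType) (d : R) (g : R -> \bar R) :
  measurable_fun [set: R] g -> (forall x, 0 <= g x)%E ->
  (\int[@lebesgue_measure R]_x g (x + d)%R = \int[@lebesgue_measure R]_x g x)%E.
Proof.
move=> mg g0; rewrite [RHS](@ge0_integral_affine _ 1 d) ?oner_neq0//.
by rewrite normr1 mul1e; apply: eq_integral => x _; rewrite mul1r.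
Qed.

Lemma integral_mean4 (R : realType) (V W : R -> R -> R) (J x r : R) :
  let I (x : R) : \bar R := (\int[@lebesgue_measure R]_y (V x y)%:E)%E in
  (forall x, measurable_fun [set: R] (fun y => (V x y)%:E)) -> (forall x y, 0 <= V x y) ->
  (forall x, measurable_fun [set: R] (fun y => (W x y)%:E)) -> (forall x y, 0 <= W x y) ->
  (\int[@lebesgue_measure R]_y (W x y)%:E <= J%:E)%E -> 0 <= r ->
  (forall y, V x y <= (V (x + r) y + V (x - r) y + V x (y + r) + V x (y - r)) / 4 + r ^+ 3 * W x y) ->
  (I x <= 4^-1%:E * (I (x + r)%R + I (x - r)%R + I x + I x) + (J * r ^+ 3)%:E)%E.
Proof.
move=> I mV V0 mW W0 WJ r0 h.
have sh d : (\int[@lebesgue_measure R]_y (V x (y + d))%:E = I x)%E.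
  apply: (@integral_shift _ d _ (mV x)) => y; by rewrite lee_fin.
have ms d : measurable_fun [set: R] (fun y : R => (V x (y + d))%:E).
  by apply: (measurableT_comp (mV x)); exact: measurable_funD.
have h' y : ((V x y)%:E <= 4^-1%:E * ((V (x + r) y)%:E + (V (x - r) y)%:E + (V x (y + r))%:E + (V x (y - r))%:E)
    + (r ^+ 3)%:E * (W x y)%:E)%E.
  by rewrite -!EFinD lee_fin mulrC; apply: h.
have pos (f : R -> R -> R) (y z : R) : (forall x y, 0 <= f x y) -> (0 <= (f y z)%:E)%E.
  by move=> f0; rewrite lee_fin.
pose S y := ((V (x + r) y)%:E + (V (x - r) y)%:E + (V x (y + r))%:E + (V x (y - r))%:E)%E.
have S0 y : (0 <= S y)%E by rewrite /S -!EFinD lee_fin !addr_ge0.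
have mS : measurable_fun [set: R] S by do 3?apply: emeasurable_funD.
have mA : measurable_fun [set: R] (fun y => 4^-1%:E * S y)%E by exact: measurable_funeM.
have mB : measurable_fun [set: R] (fun y => (r ^+ 3)%:E * (W x y)%:E)%E by exact: measurable_funeM.
have r30 : 0 <= r ^+ 3 by rewrite exprn_ge0.
have q0 : 0 <= 4^-1 :> R by rewrite invr_ge0.
apply: (@le_trans _ _ (\int[@lebesgue_measure R]_y (4^-1%:E * S y + (r ^+ 3)%:E * (W x y)%:E))%E).
  apply: ge0_le_integral => //.
  - by move=> y _; rewrite lee_fin.
  - exact: mV.
  - exact: (emeasurable_funD mA mB).
have nn (g : R -> \bar R) : (forall y, 0 <= g y)%E -> forall y, [set: R] y -> (0 <= g y)%E by move=> g0 y _.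
have V0' x' y : (0 <= (V x' y)%:E)%E by rewrite lee_fin.
have W0' y : (0 <= (W x y)%:E)%E by rewrite lee_fin.
pose L := @lebesgue_measure R.
have A0 y : (0 <= 4^-1%:E * S y)%E by rewrite mule_ge0// lee_fin.
have B0 y : (0 <= (r ^+ 3)%:E * (W x y)%:E)%E by rewrite mule_ge0// lee_fin.
have e1 : (\int[L]_y (4^-1%:E * S y + (r ^+ 3)%:E * (W x y)%:E) =
    \int[L]_y (4^-1%:E * S y) + \int[L]_y ((r ^+ 3)%:E * (W x y)%:E))%E.
  by apply: ge0_integralD; [exact: measurableT|by move=> y _; exact: A0|exact: mA|by move=> y _; exact: B0|exact: mB].
have e2 : (\int[L]_y (4^-1%:E * S y) = 4^-1%:E * \int[L]_y S y)%E.
  by apply: ge0_integralZl_EFin; [exact: measurableT|by move=> y _; exact: S0|exact: mS|exact: q0].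
have e3 : (\int[L]_y ((r ^+ 3)%:E * (W x y)%:E) = (r ^+ 3)%:E * \int[L]_y (W x y)%:E)%E.
  by apply: ge0_integralZl_EFin; [exact: measurableT|by move=> y _; exact: W0'|exact: (mW x)|exact: r30].
rewrite e1 e2 e3; apply: leeD; last first.
  have -> : (J * r ^+ 3)%:E = ((r ^+ 3)%:E * J%:E)%E by rewrite mulrC.
  by apply: lee_wpmul2l; [rewrite lee_fin|exact: WJ].
apply: lee_wpmul2l; first by rewrite lee_fin.
have f2 y : (0 <= (V (x + r) y)%:E + (V (x - r) y)%:E)%E by rewrite -EFinD lee_fin addr_ge0.
have f3 y : (0 <= (V (x + r) y)%:E + (V (x - r) y)%:E + (V x (y + r))%:E)%E.
  by rewrite -!EFinD lee_fin !addr_ge0.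
have m2 : measurable_fun [set: R] (fun y => (V (x + r) y)%:E + (V (x - r) y)%:E)%E.
  exact: emeasurable_funD.
have m3 : measurable_fun [set: R] (fun y => (V (x + r) y)%:E + (V (x - r) y)%:E + (V x (y + r))%:E)%E.
  exact: emeasurable_funD.
have e4 : (\int[L]_y S y = \int[L]_y ((V (x + r) y)%:E + (V (x - r) y)%:E + (V x (y + r))%:E) +
    \int[L]_y (V x (y - r))%:E)%E.
  by apply: ge0_integralD; [exact: measurableT|by move=> y _; exact: f3|exact: m3|by move=> y _; exact: (fun y => V0' x (y - r))|exact: (ms (- r))].
have e5 : (\int[L]_y ((V (x + r) y)%:E + (V (x - r) y)%:E + (V x (y + r))%:E) =
    \int[L]_y ((V (x + r) y)%:E + (V (x - r) y)%:E) + \int[L]_y (V x (y + r))%:E)%E.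
  by apply: ge0_integralD; [exact: measurableT|by move=> y _; exact: f2|exact: m2|by move=> y _; exact: (fun y => V0' x (y + r))|exact: (ms r)].
have e6 : (\int[L]_y ((V (x + r) y)%:E + (V (x - r) y)%:E) = I (x + r)%R + I (x - r)%R)%E.
  by apply: ge0_integralD; [exact: measurableT|by move=> y _; exact: (V0' (x + r))|exact: (mV _)|by move=> y _; exact: (V0' (x - r))|exact: (mV _)].
by rewrite e4 e5 e6 (sh r) (sh (- r)).
Qed.

(** * Monotonicity of the integrals along vertical lines *)

Section HalfPlaneIntegrals.
Context {R : realType}.
Local Notation C := R[i]^o.
Local Notation mu := (@lebesgue_measure R).
Variables (a : nat -> C) (n : nat) (q p : R).
Hypotheses (q0 : 0 <= q) (q1 : q <= 1) (p1 : 1 <= p) (qp : 2 <= q * p).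
Implicit Types (z v : C) (x y r K : R).
Local Notation hp_fun := (hp_fun a n q).

Definition hp_int x : \bar R := (\int[mu]_y (hp_fun (x +i* y) `^ p)%:E)%E.

Lemma measurable_hp_funX :
  measurable_fun [set: R * R] (fun w : R * R => hp_fun (w.1 +i* w.2) `^ p).
Proof.
apply: measurable_powR_comp.
have mz : cmeasurable [set: R * R] (fun w : R * R => w.1 +i* w.2).
  by split; [exact: measurable_fst|exact: measurable_snd].
apply: measurable_funM; last by apply: measurable_powR_comp; exact: measurable_modulus.
apply: measurable_modulus; apply: cmeasurable_sum => k.
apply: cmeasurableM; first exact: cmeasurable_cst.
apply: cmeasurableX; apply: cmeasurableD; first exact: cmeasurable_cst.
by apply: cmeasurableN; exact: cmeasurableV.
Qed.

Lemma measurable_hp_section x : measurable_fun [set: R] (fun y => (hp_fun (x +i* y) `^ p)%:E).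
Proof.
apply: (@measurable_section1 _ (fun w : R * R => (hp_fun (w.1 +i* w.2) `^ p)%:E)).
by apply/measurable_EFinP; exact: measurable_hp_funX.
Qed.

(** Since [2 |z| > 1] the exponent [q p >= 2] may be replaced by 2, and [4 |z|^2 >= 1 + y^2] gives a
    majorant integrable in [y]. *)
Lemma powR_mod_le z : 2^-1 < complex.Re z ->
  modulus z `^ (- (q * p)) <= 2 `^ (q * p) * (oneDsqr (complex.Im z))^-1.
Proof.
move=> z0; have mz : 2^-1 < modulus z.
  by apply: lt_le_trans z0 _; apply: le_trans (ler_norm _) (Re_le_mod _).
have m0 : 0 < modulus z by apply: lt_trans mz; rewrite invr_gt0.
have -> : modulus z `^ (- (q * p)) = 2 `^ (q * p) * (2 * modulus z) `^ (- (q * p)).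
  rewrite powRM ?mod_ge0// mulrA -powRD; last by apply/implyP => _.
  by rewrite subrr powRr0 mul1r.
rewrite ler_wpM2l ?powR_ge0//.
apply: (@le_trans _ _ ((2 * modulus z) `^ (- 2%:R))).
  by apply: ler_powR; [lra|rewrite lerN2].
rewrite powRN powR_mulrn ?mulr_ge0 ?mod_ge0// lef_pV2 ?posrE ?exprn_gt0 ?mulr_gt0//.
rewrite exprMn sqr_mod /oneDsqr; have := sqr_ge0 (complex.Im z); nra.
Qed.

(** The integral of [1 / (1 + y^2)] bounds both the values and the cubic error, uniformly in [x]. *)
Lemma hp_int_bounded : exists2 B : R, 0 <= B &
  (forall x, 2^-1 < x -> (hp_int x <= B%:E)%E) /\
  exists2 K, 0 <= K & forall x r, 2^-1 < x - r -> 0 <= r -> r <= 4^-1 ->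
   (hp_int x <= 4^-1%:E * (hp_int (x + r) + hp_int (x - r) + hp_int x + hp_int x) + (K * r ^+ 3)%:E)%E.
Proof.
have [K K0 [bF mF]] := hp_funX_mean a n q0 q1 p1.
have Jfin : (\int[mu]_y ((oneDsqr y)^-1)%:E < +oo)%E.
  rewrite ge0_symfun_integralT.
  - by rewrite (_ : [set x | 0 <= x] = `[0%R, +oo[%classic) ?integral0y_oneDsqr ?ltry//; apply/seteqP; split => x /=; rewrite in_itv /= andbT.
  - by move=> x; rewrite invr_ge0 (le_trans ler01).
  - exact: continuous_oneDsqrV.
  - by move=> x /=; rewrite /oneDsqr sqrrN.
have J0 : (0 <= \int[mu]_y ((oneDsqr y)^-1)%:E)%E.
  by apply: integral_ge0 => y _; rewrite lee_fin invr_ge0 (le_trans ler01).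
pose J := fine (\int[mu]_y ((oneDsqr y)^-1)%:E)%E.
have JE : (\int[mu]_y ((oneDsqr y)^-1)%:E = J%:E)%E by rewrite fineK// ge0_fin_numE.
have {}J0 : 0 <= J by rewrite -lee_fin -JE.
have mJ : measurable_fun [set: R] (fun y : R => ((oneDsqr y)^-1)%:E).
  apply/measurable_EFinP; apply: continuous_measurable_fun; exact: continuous_oneDsqrV.
pose W x := (\int[mu]_y (modulus (x +i* y) `^ (- (q * p)))%:E)%E.
have mW x : measurable_fun [set: R] (fun y : R => (modulus (x +i* y) `^ (- (q * p)))%:E).
  apply/measurable_EFinP; apply: measurable_powR_comp; apply: measurable_modulus.
  by split; [exact: measurable_cst|exact: measurable_id].
have WJ x : 2^-1 < x -> (W x <= (2 `^ (q * p) * J)%:E)%E.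
  move=> x0; rewrite EFinM -JE -ge0_integralZl_EFin ?powR_ge0//.
  apply: ge0_le_integral => //.
  - by move=> y _; rewrite lee_fin powR_ge0.
  - exact: mW.
  - by apply: emeasurable_funM => //; exact: measurable_cst.
  - move=> y _; rewrite -EFinM lee_fin; exact: (@powR_mod_le (x +i* y)).
have K1 : 0 <= 2 `^ (q * p) * J by rewrite mulr_ge0 ?powR_ge0.
exists (K * (2 `^ (q * p) * J)); first by rewrite mulr_ge0.
split.
  move=> x x0; apply: (@le_trans _ _ (K%:E * W x)%E); last first.
    by rewrite EFinM lee_wpmul2l ?lee_fin ?WJ.
  rewrite -ge0_integralZl_EFin//; last exact: mW.
  apply: ge0_le_integral => //.
  - by move=> y _; rewrite lee_fin powR_ge0.
  - exact: measurable_hp_section.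
  - by apply: emeasurable_funM; [exact: measurable_cst|exact: mW].
  - by move=> y _; rewrite -EFinM lee_fin; exact: (bF (x +i* y)).
  by move=> y _; rewrite lee_fin powR_ge0.
exists (K * (2 `^ (q * p) * J)); first by rewrite mulr_ge0.
move=> x r xr r0 r4; have x0 : 2^-1 < x by lra.
apply: (@integral_mean4 _ (fun x y => hp_fun (x +i* y) `^ p) (fun x y => K * modulus (x +i* y) `^ (- (q * p)))).
- exact: measurable_hp_section.
- by move=> x' y; rewrite powR_ge0.
- move=> x'; apply/measurable_EFinP; apply: measurable_funM => //.
  by have /measurable_EFinP := mW x'.
- by move=> x' y; rewrite mulr_ge0 ?powR_ge0.
- under eq_integral do rewrite EFinM.
  rewrite ge0_integralZl_EFin//; first by rewrite EFinM lee_wpmul2l ?lee_fin// WJ.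
  by move=> y _; rewrite lee_fin powR_ge0.
  exact: mW.
- exact: r0.
- move=> y; have := mF (x +i* y) r x0 r0 r4.
  have e1 : x +i* y + r%:C = (x + r) +i* y by apply: complex_eqP => /=; rewrite ?addr0.
  have e2 : x +i* y - r%:C = (x - r) +i* y by apply: complex_eqP => /=; rewrite ?subr0.
  have e3 : x +i* y + 'i * r%:C = x +i* (y + r) by apply: complex_eqP => /=; ring.
  have e4 : x +i* y - 'i * r%:C = x +i* (y - r) by apply: complex_eqP => /=; ring.
  rewrite e1 e2 e3 e4 => h; apply: le_trans h _; rewrite lerD2l.
  by rewrite le_eqVlt; apply/orP; left; apply/eqP; ring.
Qed.

Lemma hp_int_nonincreasing x y : 2^-1 < x -> x <= y -> (hp_int y <= hp_int x)%E.
Proof.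
have [B _ [bM [K K0 mM]]] := hp_int_bounded.
apply: (almost_convex_ereal_nonincreasing K0 _ bM mM) => z.
by apply: integral_ge0 => t _; rewrite lee_fin powR_ge0.
Qed.

End HalfPlaneIntegrals.

Arguments modulus : simpl never.

Lemma measurable_affine (R : realType) (k d : R) : measurable_fun [set: R] (fun x => k * x + d).
Proof.
apply: measurable_funD; last exact: measurable_cst.
by apply: measurable_funM; [exact: measurable_cst|exact: measurable_id].
Qed.

(** * Weighted area integrals and the norm bound for [T_t] *)

Section WeightedArea.
Context {R : realType}.
Local Notation C := R[i]^o.
Local Notation mu := (@lebesgue_measure R).
Implicit Types (alpha p q t x y : R) (g : C -> R) (z : C).

Lemma ge0_integralZT (k : R) (g : R -> \bar R) : 0 <= k -> measurable_fun [set: R] g ->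
  (forall x, 0 <= g x)%E -> (\int[mu]_x (k%:E * g x) = k%:E * \int[mu]_x g x)%E.
Proof.
by move=> k0 mg g0; apply: ge0_integralZl_EFin; [exact: measurableT|by move=> x _; exact: g0|exact: mg|exact: k0].
Qed.

Lemma ge0_integral_scale_le (k D : R) (F V : R -> R) : 0 < k -> 0 <= D ->
  measurable_fun [set: R] F -> measurable_fun [set: R] V ->
  (forall y, 0 <= F y) -> (forall y, 0 <= V y) ->
  (forall y, F y <= D * V (k * y)) ->
  (\int[mu]_y (F y)%:E <= (D * k^-1)%:E * \int[mu]_y (V y)%:E)%E.
Proof.
move=> k0 D0 mF mV F0 V0 FV.
have mV' : measurable_fun [set: R] (EFin \o V) by exact/measurable_EFinP.
rewrite (@ge0_integral_affine _ k 0 (EFin \o V) (lt0r_neq0 k0) mV'); last first.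
  by move=> y; rewrite lee_fin.
rewrite ger0_norm ?(ltW k0)// muleA -EFinM mulfVK ?gt_eqF//.
have mV2 : measurable_fun [set: R] (fun y => (V (k * y + 0))%:E).
  by apply: (measurableT_comp mV'); exact: measurable_affine.
rewrite -(ge0_integralZT D0 mV2); last by move=> y; rewrite lee_fin.
apply: ge0_le_integral; [exact: measurableT|by move=> y _; rewrite lee_fin|exact/measurable_EFinP|exact: measurable_funeM|].
by move=> y _; rewrite -EFinM lee_fin addr0.
Qed.

(** The [p]-th power of the Bergman norm up to the factor [(alpha + 1) / pi], as a functional of the
    modulus. *)
Definition wint alpha p g : \bar R :=
  (\int[mu \x mu]_(w in @disk2 R) (g (w.1 +i* w.2) `^ p *
     (1 - modulus (w.1 +i* w.2) ^+ 2) `^ alpha)%:E)%E.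

Lemma complex_eta z : complex.Re z +i* complex.Im z = z.
Proof. by case: z. Qed.

Lemma cmeasurable_plane : cmeasurable [set: R * R] (fun w : R * R => w.1 +i* w.2).
Proof. by split; [exact: measurable_fst|exact: measurable_snd]. Qed.

Lemma measurable_cplane_comp d (T : measurableType d) g (u : T -> C) :
  measurable_fun [set: R * R] (fun w => g (w.1 +i* w.2)) -> cmeasurable [set: T] u ->
  measurable_fun [set: T] (fun s => g (u s)).
Proof.
move=> mg [u1 u2].
have -> : (fun s => g (u s)) = (fun w : R * R => g (w.1 +i* w.2)) \o
    (fun s => (complex.Re (u s), complex.Im (u s))).
  by apply/funext => s /=; rewrite complex_eta.
apply: (measurableT_comp mg).
by apply: measurable_fun_pair; [exact: u1|exact: u2].
Qed.

Lemma measurable_wint_integrand alpha p g :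
  measurable_fun [set: R * R] (fun w => g (w.1 +i* w.2)) ->
  measurable_fun [set: R * R] (fun w : R * R => (g (w.1 +i* w.2) `^ p *
     (1 - modulus (w.1 +i* w.2) ^+ 2) `^ alpha)%:E).
Proof.
move=> mg; apply/measurable_EFinP; apply: measurable_funM.
  exact: measurable_powR_comp.
apply: measurable_powR_comp; apply: measurable_funB => //; apply: measurable_funX.
by apply: measurable_modulus; exact: cmeasurable_plane.
Qed.

Lemma sqr_mod_onemV x y : x ^+ 2 + y ^+ 2 != 0 ->
  1 - modulus (1 - (x +i* y)^-1 : C) ^+ 2 = (2 * x - 1) / (x ^+ 2 + y ^+ 2).
Proof. by move=> xy; rewrite sqr_mod /=; field. Qed.

Lemma measurable_halfplane_slices p q g :
  measurable_fun [set: R * R] (fun w => g (w.1 +i* w.2)) ->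
  measurable_fun [set: R]
   (fun x => \int[mu]_y ((g (1 - (x +i* y)^-1) * modulus (x +i* y) `^ (- q)) `^ p)%:E)%E.
Proof.
move=> mg.
apply: (@measurable_fun_fubini_tonelli_F _ _ _ _ _ mu (fun w : R * R =>
  ((g (1 - (w.1 +i* w.2)^-1) * modulus (w.1 +i* w.2) `^ (- q)) `^ p)%:E)).
- apply/measurable_EFinP; apply: measurable_powR_comp; apply: measurable_funM.
    apply: (measurable_cplane_comp mg); apply: cmeasurableD; first exact: cmeasurable_cst.
    by apply: cmeasurableN; apply: cmeasurableV; exact: cmeasurable_plane.
  by apply: measurable_powR_comp; apply: measurable_modulus; exact: cmeasurable_plane.
- by move=> w; rewrite lee_fin powR_ge0.
Qed.

(** [1 - |z|^2 = (2 x - 1) / |zeta|^2] and the Jacobian is [|zeta|^(- 4)]; the powers of [|zeta|]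
    add up to [- 2 alpha - 4 = - q p]. *)
Lemma wint_halfplane alpha p q g : q * p = 2 * (alpha + 2) -> (forall z, 0 <= g z) ->
  measurable_fun [set: R * R] (fun w => g (w.1 +i* w.2)) ->
  (wint alpha p g = \int[mu]_(x in `]2^-1%R, +oo[) (((2 * x - 1) `^ alpha)%:E *
    \int[mu]_y ((g (1 - (x +i* y)^-1) * modulus (x +i* y) `^ (- q)) `^ p)%:E))%E.
Proof.
move=> qp g0 mg; rewrite /wint integral_disk_halfplane; last 2 first.
- exact: measurable_wint_integrand.
- by move=> w; rewrite lee_fin mulr_ge0 ?powR_ge0.
apply: eq_integral => x; rewrite inE /= in_itv /= andbT => x0.
have x1 : 0 < x by apply: lt_trans x0; rewrite invr_gt0.
have cx : cmeasurable [set: R] (fun y => x +i* y).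
  by split; [exact: measurable_cst|exact: measurable_id].
have mi : measurable_fun [set: R]
    (fun y => ((g (1 - (x +i* y)^-1) * modulus (x +i* y) `^ (- q)) `^ p)%:E).
  apply/measurable_EFinP; apply: measurable_powR_comp; apply: measurable_funM.
    apply: (measurable_cplane_comp mg); apply: cmeasurableD; first exact: cmeasurable_cst.
    by apply: cmeasurableN; exact: cmeasurableV.
  by apply: measurable_powR_comp; exact: measurable_modulus.
rewrite -ge0_integralZT ?powR_ge0//; last by move=> y; rewrite lee_fin powR_ge0.
apply: eq_integral => y _; rewrite -!EFinM; congr EFin.
have r0 : 0 < x ^+ 2 + y ^+ 2 by have := sqr_ge0 y; have := exprn_gt0 2 x1; lra.
have -> : (1 - x / (x ^+ 2 + y ^+ 2)) +i* (y / (x ^+ 2 + y ^+ 2)) = 1 - (x +i* y)^-1.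
  by apply: complex_eqP => /=; field; rewrite lt0r_neq0.
rewrite (sqr_mod_onemV (lt0r_neq0 r0)).
have mz : modulus (x +i* y) ^+ 2 = x ^+ 2 + y ^+ 2 by rewrite sqr_mod.
have m0 : 0 < modulus (x +i* y).
  by rewrite lt0r mod_ge0 andbT -sqrf_eq0 mz lt0r_neq0.
rewrite -mz powRM ?invr_ge0 ?sqr_ge0//; last by lra.
rewrite powRM ?powR_ge0// -powRrM mulNr qp.
have -> : (modulus (x +i* y) ^+ 2)^-1 `^ alpha = modulus (x +i* y) `^ (- (2 * alpha)).
  by rewrite -powR_mulrn ?mod_ge0// -powRN -powRrM mulNr.
have -> : (modulus (x +i* y) ^+ 2) ^- 2 = modulus (x +i* y) `^ (- 4%:R).
  by rewrite -exprM powRN powR_mulrn ?mod_ge0.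
have -> : - (2 * (alpha + 2)) = - (2 * alpha) + - 4%:R by ring.
rewrite powRD; last by apply/implyP => _; rewrite gt_eqF.
ring.
Qed.

Variables (alpha p : R).
Hypotheses (al : -1 < alpha) (p1 : 1 <= p) (pal : 2 * (alpha + 2) <= p).
Variables (a : nat -> C) (n : nat).
Let q := 2 * (alpha + 2) / p.

Let p0 : 0 < p. Proof. exact: lt_le_trans p1. Qed.
Let qp : q * p = 2 * (alpha + 2). Proof. by rewrite divfK// gt_eqF. Qed.
Let q0 : 0 <= q. Proof. by rewrite divr_ge0 ?(ltW p0)//; move: al; lra. Qed.
Let q1 : q <= 1. Proof. by rewrite ler_pdivrMr// mul1r. Qed.

Lemma measurable_taylor : cmeasurable [set: R * R] (fun w : R * R => taylor_series a (w.1 +i* w.2) n).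
Proof.
apply: cmeasurable_sum => k; apply: cmeasurableM; first exact: cmeasurable_cst.
by apply: cmeasurableX; exact: cmeasurable_plane.
Qed.

Lemma wint_taylor : (wint alpha p (fun z => modulus (taylor_series a z n)) =
  \int[mu]_(x in `]2^-1%R, +oo[) (((2 * x - 1) `^ alpha)%:E * hp_int a n q p x))%E.
Proof.
rewrite (wint_halfplane qp)//; first by move=> z; exact: mod_ge0.
by apply: measurable_modulus; exact: measurable_taylor.
Qed.

Section Slice.
Variable (t : R).
Hypothesis t01 : 0 < t < 1.
Let kappa := t / (1 - t).

Let k0 : 0 < kappa. Proof. by case/andP: t01 => h1 h2; rewrite divr_gt0// subr_gt0. Qed.

(** At [1 - 1 / zeta] the kernel equals [zeta / ((1 - t) (1 + kappa zeta))], and [t] times it is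
    [1 - 1 / (1 + kappa zeta)]. The bound is then [kappa |zeta| <= |1 + kappa zeta|] raised to the
    power [1 - q >= 0]. *)
Lemma slice_le z : 2^-1 < complex.Re z ->
  modulus (kern t (1 - z^-1) * taylor_series a (t%:C * kern t (1 - z^-1)) n) * modulus z `^ (- q) <=
  (1 - t)^-1 * kappa `^ (q - 1) * hp_fun a n q (1 + kappa%:C * z).
Proof.
case/andP: t01 => t0 t1 z0.
have x0 : 0 < complex.Re z by apply: lt_trans z0; rewrite invr_gt0.
have m0 := Re_gt0_mod x0.
have z1 : z != 0 by rewrite -mod_gt0.
have Re1 : 0 < complex.Re (1 + kappa%:C * z).
  by rewrite ReCD ReZ /= ltr_wpDl// mulr_gt0.
have M0 := Re_gt0_mod Re1.
have Z0 : 1 + kappa%:C * z != 0 by rewrite -mod_gt0.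
have t1' : (1 - t)%:C != 0 :> C by rewrite -mod_gt0 mod_real normr_gt0 subr_eq0 eq_sym lt_eqF.
have kE : (1 - t)%:C * kappa%:C = t%:C :> C.
  by rewrite -rmorphM /= /kappa mulrC divfK// subr_eq0 eq_sym lt_eqF.
have t1C : (1 - t)%:C = 1 - t%:C :> C by rewrite rmorphB.
have eK : kern t (1 - z^-1) = z / ((1 - t)%:C * (1 + kappa%:C * z)).
  rewrite /kern -[RHS]invrK invf_div; congr (_^-1).
  by rewrite [in RHS]mulrDr mulr1 [in RHS]mulrA kE t1C; field.
have eP : t%:C * kern t (1 - z^-1) = 1 - (1 + kappa%:C * z)^-1.
  rewrite eK -kE; move: t1' Z0; move: ((1 - t)%:C : C) (kappa%:C : C) => A B A0 B0.
  by field; rewrite A0 B0.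
rewrite eP modM /hp_fun eK.
set F := modulus (taylor_series _ _ _); have F0 : 0 <= F := mod_ge0 _.
have mt : modulus ((1 - t)%:C : C) = 1 - t by rewrite mod_real ger0_norm// subr_ge0 ltW.
rewrite modM modV modM mt.
set M := modulus (1 + _) in M0 *; set m := modulus z in m0 *.
have mM : kappa * m <= M.
  have := Re_conjM (1 : C) => _.
  rewrite -(@ler_pXn2r _ 2) ?nnegrE ?(ltW M0)//; last by rewrite mulr_ge0 ?(ltW m0)// ltW.
  rewrite exprMn !sqr_mod !ReCD !ImCD ReZ ImZ /=.
  have := mulr_gt0 k0 x0; nra.
have e1 : m * m `^ (- q) = m `^ (1 - q).
  by rewrite -{1}(powRr1 (ltW m0)) -powRD//; apply/implyP => _; rewrite gt_eqF.
have e2 : M `^ (- q) = M^-1 * M `^ (1 - q).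
  rewrite -powR_inv1 ?(ltW M0)// -powRD; last by apply/implyP => _; rewrite gt_eqF.
  by congr powR; ring.
have e3 : m `^ (1 - q) <= kappa `^ (q - 1) * M `^ (1 - q).
  have -> : m = kappa^-1 * (kappa * m) by rewrite mulKf// gt_eqF.
  rewrite powRM ?invr_ge0 ?(ltW k0)//; last by rewrite mulr_ge0 ?(ltW m0)// ltW.
  rewrite -powR_inv1 ?(ltW k0)// -powRrM mulN1r opprB ler_wpM2l ?powR_ge0//.
  by apply: ge0_ler_powR mM; rewrite ?nnegrE ?subr_ge0 ?(ltW M0)// mulr_ge0 ?(ltW m0)// ltW.
have -> : m / ((1 - t) * M) * F * m `^ (- q) = F * ((1 - t)^-1 * M^-1 * m `^ (1 - q)).
  by rewrite -e1 invfM; ring.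
have -> : (1 - t)^-1 * kappa `^ (q - 1) * (F * M `^ (- q)) =
   F * ((1 - t)^-1 * M^-1 * (kappa `^ (q - 1) * M `^ (1 - q))).
  by rewrite e2; ring.
rewrite ler_wpM2l// ler_wpM2l// mulr_ge0 ?invr_ge0 ?subr_ge0 ?(ltW t1) ?(ltW M0)//.
Qed.

Lemma measurable_kern_taylor : measurable_fun [set: R * R]
  (fun w => modulus (kern t (w.1 +i* w.2) * taylor_series a (t%:C * kern t (w.1 +i* w.2)) n)).
Proof.
have mk : cmeasurable [set: R * R] (fun w => kern t (w.1 +i* w.2)).
  apply: cmeasurableV; apply: cmeasurableD; first exact: cmeasurable_cst.
  apply: cmeasurableN; apply: cmeasurableM; first exact: cmeasurable_cst.
  exact: cmeasurable_plane.
apply: measurable_modulus; apply: cmeasurableM => //.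
apply: cmeasurable_sum => k; apply: cmeasurableM; first exact: cmeasurable_cst.
by apply: cmeasurableX; apply: cmeasurableM => //; exact: cmeasurable_cst.
Qed.

Lemma measurable_hp_int : measurable_fun [set: R] (hp_int a n q p).
Proof.
apply: (@measurable_fun_fubini_tonelli_F _ _ _ _ _ mu (fun w : R * R => (hp_fun a n q (w.1 +i* w.2) `^ p)%:E)).
- by apply/measurable_EFinP; exact: measurable_hp_funX.
- by move=> w; rewrite lee_fin powR_ge0.
Qed.

Lemma integral_slice_inner x : 2^-1 < x ->
  (\int[mu]_y ((modulus (kern t (1 - (x +i* y)^-1) * taylor_series a (t%:C * kern t (1 - (x +i* y)^-1)) n)
     * modulus (x +i* y) `^ (- q)) `^ p)%:E <=
   (((1 - t)^-1 * kappa `^ (q - 1)) `^ p * kappa^-1)%:E * hp_int a n q p (kappa * x + (1 - kappa) / 2)%R)%E.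
Proof.
case/andP: t01 => t0 t1 x0.
set D := (1 - t)^-1 * kappa `^ (q - 1).
have D0 : 0 <= D by rewrite mulr_ge0 ?powR_ge0 ?invr_ge0 ?subr_ge0 ?(ltW t1).
have kx : 2^-1 < kappa * x + (1 - kappa) / 2 by have := k0; nra.
have le1 : kappa * x + (1 - kappa) / 2 <= 1 + kappa * x by have := k0; lra.
apply: (@le_trans _ _ ((D `^ p * kappa^-1)%:E * hp_int a n q p (1 + kappa * x)%R)%E); last first.
  apply: lee_wpmul2l; first by rewrite lee_fin mulr_ge0 ?powR_ge0 ?invr_ge0 ?(ltW k0).
  have qp2 : 2 <= q * p by rewrite qp; have := al; lra.
  by apply: hp_int_nonincreasing.
have cx : cmeasurable [set: R] (fun y => x +i* y).
  by split; [exact: measurable_cst|exact: measurable_id].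
apply: (@ge0_integral_scale_le kappa (D `^ p) _ (fun y => hp_fun a n q ((1 + kappa * x) +i* y) `^ p) k0).
- exact: powR_ge0.
- apply: measurable_powR_comp; apply: measurable_funM; last first.
    by apply: measurable_powR_comp; exact: measurable_modulus.
  apply: (measurable_cplane_comp (g := fun z => modulus (kern t z * taylor_series a (t%:C * kern t z) n)) measurable_kern_taylor).
  by apply: cmeasurableD; [exact: cmeasurable_cst|apply: cmeasurableN; exact: cmeasurableV].
- by have /measurable_EFinP := @measurable_hp_section _ a n q p (1 + kappa * x).
- by move=> y; exact: powR_ge0.
- by move=> y; exact: powR_ge0.
move=> y; have := @slice_le (x +i* y) x0; rewrite -/D.
have -> : 1 + kappa%:C * (x +i* y) = (1 + kappa * x) +i* (kappa * y).
  by apply: complex_eqP => /=; ring.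
move=> h; rewrite -powRM ?hp_fun_ge0//.
apply: ge0_ler_powR h; first exact: ltW.
  by rewrite nnegrE mulr_ge0 ?mod_ge0 ?powR_ge0.
by rewrite nnegrE mulr_ge0// hp_fun_ge0.
Qed.

(** Powers of [kappa]: [(q - 1) p] from the pointwise bound, [- 1] from each of the substitutions in
    [y] and in [x], and [- alpha] from the weight. They add up to [alpha + 2 - p], and the pointwise
    bound also contributes [(1 - t)^(- p)]. *)
Lemma wint_slice_le :
  (wint alpha p (fun z => modulus (kern t z * taylor_series a (t%:C * kern t z) n)%R) <=
   (t `^ (alpha + 2 - p) * (1 - t) `^ (- (alpha + 2)))%:E *
   wint alpha p (fun z => modulus (taylor_series a z n)%R))%E.
Proof.
case/andP: (t01) => t0 t1; have k1 := k0.
pose d := (1 - kappa) / 2.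
pose G x := if 2^-1 < x then (((2 * x - 1) `^ alpha)%:E * hp_int a n q p x)%E else 0%E.
have M0 x : (0 <= hp_int a n q p x)%E by apply: integral_ge0 => y _; rewrite lee_fin powR_ge0.
have G0 x : (0 <= G x)%E by rewrite /G; case: ifP => // _; rewrite mule_ge0// lee_fin powR_ge0.
have mG : measurable_fun [set: R] G.
  apply: measurable_fun_if => //; first exact: measurable_fun_ltr.
  apply: measurable_funTS; apply: emeasurable_funM; last exact: measurable_hp_int.
  by apply/measurable_EFinP; apply: measurable_powR_comp; exact: measurable_affine.
have wE : (wint alpha p (fun z => modulus (taylor_series a z n)%R) = \int[mu]_x G x)%E.
  rewrite wint_taylor integral_mkcond; apply: eq_integral => x _.
  by rewrite patchE mem_setE in_itv /= andbT.
pose Dp := ((1 - t)^-1 * kappa `^ (q - 1)) `^ p * kappa^-1.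
have Dp0 : 0 <= Dp by rewrite mulr_ge0 ?powR_ge0 ?invr_ge0 ?(ltW k1).
rewrite (wint_halfplane qp); last 2 first.
- by move=> z; exact: mod_ge0.
- exact: measurable_kern_taylor.
have eG := @ge0_integral_affine _ kappa d _ (lt0r_neq0 k1) mG G0.
have mGd : measurable_fun [set: R] (fun x => G (kappa * x + d)).
  by apply: (measurableT_comp mG); exact: measurable_affine.
have c0 : 0 <= Dp * kappa `^ (- alpha) by rewrite mulr_ge0 ?powR_ge0.
apply: (@le_trans _ _ (\int[mu]_x ((Dp * kappa `^ (- alpha))%:E * G (kappa * x + d)%R))%E); last first.
  have nk : `|kappa| = kappa by rewrite ger0_norm// ltW.
  have eZ := ge0_integralZT c0 mGd (fun x => G0 _).
  rewrite nk in eG.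
  rewrite wE eG eZ.
  suff -> : Dp * kappa `^ (- alpha) = t `^ (alpha + 2 - p) * (1 - t) `^ (- (alpha + 2)) * kappa.
    by rewrite EFinM -muleA.
  have A0 : 0 < 1 - t by rewrite subr_gt0.
  have -> : Dp * kappa `^ (- alpha) = (1 - t) `^ (- p) * kappa `^ (alpha + 2 - p) * kappa.
    rewrite /Dp powRM ?powR_ge0 ?invr_ge0 ?(ltW A0)// -powRrM -powR_inv1 ?(ltW A0)// -powRrM mulN1r.
    rewrite -[kappa^-1]powR_inv1 ?(ltW k1)// -[X in _ = _ * X]powRr1 ?(ltW k1)// -!mulrA; congr (_ * _).
    rewrite -!powRD; try by apply/implyP => _; rewrite gt_eqF.
    by congr powR; rewrite mulrBl qp; ring.
  congr (_ * _); rewrite /kappa powRM ?invr_ge0 ?(ltW A0) ?(ltW t0)//.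
  rewrite -[(1 - t)^-1]powR_inv1 ?(ltW A0)// -powRrM mulN1r mulrCA -powRD; last by apply/implyP => _; rewrite gt_eqF.
  by congr (_ * powR _ _); ring.
rewrite integral_mkcond; apply: ge0_le_integral; first exact: measurableT.
- move=> x _; apply: erestrict_ge0 => y _; rewrite mule_ge0 ?lee_fin ?powR_ge0//.
  by apply: integral_ge0 => z _; rewrite lee_fin powR_ge0.
- apply: measurable_patch => //; apply: emeasurable_funM.
    by apply/measurable_EFinP; apply: measurable_powR_comp; exact: measurable_affine.
  exact: (@measurable_halfplane_slices p q (fun z =>
    modulus (kern t z * taylor_series a (t%:C * kern t z) n)) measurable_kern_taylor).
- exact: measurable_funeM.
move=> x _; rewrite patchE mem_setE in_itv /= andbT.
case: ifPn => x0; last by rewrite mule_ge0// lee_fin.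
have kx : 2^-1 < kappa * x + d by rewrite /d; nra.
rewrite /G kx.
apply: (@le_trans _ _ (((2 * x - 1) `^ alpha)%:E * (Dp%:E * hp_int a n q p (kappa * x + d)%R))%E).
  apply: lee_wpmul2l; first by rewrite lee_fin powR_ge0.
  exact: integral_slice_inner.
rewrite muleA [leRHS]muleA -!EFinM; apply: lee_wpmul2r => //; rewrite lee_fin.
have -> : 2 * (kappa * x + d) - 1 = kappa * (2 * x - 1) by rewrite /d; field.
rewrite powRM ?(ltW k1)//; last by lra.
rewrite le_eqVlt; apply/orP; left; apply/eqP.
have : kappa `^ (- alpha) * kappa `^ alpha = 1.
  rewrite -powRD; last by apply/implyP => _; rewrite gt_eqF.
  by rewrite addNr powRr0.
move: (kappa `^ alpha) (kappa `^ (- alpha)) => u v uv.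
have -> : Dp * v * (u * (2 * x - 1) `^ alpha) = Dp * (v * u) * (2 * x - 1) `^ alpha by ring.
by rewrite uv; ring.
Qed.

End Slice.
End WeightedArea.

(** * Tonelli's theorem for the plane and a parameter *)

Section Fubini3.
Context {R : realType}.
Local Notation mu := (@lebesgue_measure R).
Variable F : (R * R) * R -> \bar R.
Hypotheses (mF : measurable_fun [set: (R * R) * R] F) (F0 : forall z, (0 <= F z)%E).

Lemma measurable_inner_integral :
  measurable_fun [set: R * R] (fun w => \int[mu]_t F (w, t))%E.
Proof. by apply: (@measurable_fun_fubini_tonelli_F _ _ _ _ _ mu F). Qed.

Let inner_swap (x : R) : (\int[mu]_y \int[mu]_t F ((x, y), t) = \int[mu]_t \int[mu]_y F ((x, y), t))%E.
Proof.
apply: (@tonelli_swap _ (fun z : R * R => F ((x, z.1), z.2))) => //.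
apply: (measurableT_comp mF); apply: measurable_fun_pair; last exact: measurable_snd.
by apply: measurable_fun_pair; [exact: measurable_cst|exact: measurable_fst].
Qed.

Let outer_swap : (\int[mu]_x \int[mu]_t \int[mu]_y F ((x, y), t) = \int[mu]_t \int[mu]_x \int[mu]_y F ((x, y), t))%E.
Proof.
apply: (@tonelli_swap _ (fun z : R * R => \int[mu]_y F ((z.1, y), z.2))%E) => [|z]; last exact: integral_ge0.
apply: (@measurable_fun_fubini_tonelli_F _ _ _ _ _ mu (fun v : (R * R) * R => F ((v.1.1, v.2), v.1.2))) => //.
have m1 : measurable_fun [set: (R * R) * R] (fun v => v.1.1).
  by apply: (measurableT_comp (@measurable_fst _ _ R R)); exact: measurable_fst.
have m2 : measurable_fun [set: (R * R) * R] (fun v => v.1.2).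
  by apply: (measurableT_comp (@measurable_snd _ _ R R)); exact: measurable_fst.
apply: (measurableT_comp mF); apply: measurable_fun_pair; last exact: m2.
by apply: measurable_fun_pair; [exact: m1|exact: measurable_snd].
Qed.

Lemma fubini3 : (\int[mu \x mu]_w \int[mu]_t F (w, t) = \int[mu]_t \int[mu \x mu]_w F (w, t))%E.
Proof.
rewrite tonelli; [|exact: measurable_inner_integral|by move=> w; exact: integral_ge0].
transitivity (\int[mu]_x \int[mu]_t \int[mu]_y F ((x, y), t))%E.
  by apply: eq_integral => x _; exact: inner_swap.
rewrite outer_swap; apply: eq_integral => t _; apply/esym.
have mt : measurable_fun [set: R * R] (fun w => F (w, t)).
  by apply: (measurableT_comp mF); apply: measurable_fun_pair; [exact: measurable_id|exact: measurable_cst].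
exact: (tonelli mt (fun w => F0 _)).
Qed.

End Fubini3.

(** * The Beta density and Jensen's inequality for it *)

Section HilbertPolynomial.
Context {R : realType}.
Local Notation C := R[i]^o.
Local Notation mu := (@lebesgue_measure R).
Implicit Types (x y t : R) (z u : C).
Variables (alpha p b : R).
Hypotheses (al : -1 < alpha) (p1 : 1 < p) (pal : 2 * (alpha + 2) <= p) (b0 : 0 <= b).
Local Notation s := ((alpha + 2) / p).
Local Notation I01 := `](0 : R), (1 : R)[%classic.

Let p0 : 0 < p. Proof. exact: lt_trans p1. Qed.
Let sp : s * p = alpha + 2. Proof. by rewrite divfK// gt_eqF. Qed.
Let s0 : 0 < s. Proof. by rewrite divr_gt0//; move: al; lra. Qed.
Let s2 : s <= 2^-1. Proof. by rewrite ler_pdivrMr//; move: pal; lra. Qed.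

Definition kweight t : R := t `^ (s - 1) * (1 - t) `^ (b - s).

Lemma kweight_ge0 t : 0 <= kweight t. Proof. by rewrite mulr_ge0 ?powR_ge0. Qed.

Lemma measurable_kweight : measurable_fun [set: R] kweight.
Proof.
apply: measurable_funM; apply: measurable_powR_comp => //.
exact: measurable_funB.
Qed.

(** [(1 - t)^b] is at most 1. On each half of the interval the factor that is singular at the far
    end is at most 2, because [- s] and [s - 1] lie in [[- 1, 0]]. *)
Lemma kweight_le t : 0 < t < 1 -> kweight t <= 2 * (t `^ (s - 1) + (1 - t) `^ (1 - s - 1)).
Proof.
move=> /andP[t0 t1]; have t1' : 0 < 1 - t by rewrite subr_gt0.
have h1 : (1 - t) `^ (b - s) <= (1 - t) `^ (- s).
  rewrite powRD; last by apply/implyP => _; rewrite gt_eqF.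
  rewrite ler_piMl ?powR_ge0// -[leRHS](powRr0 (1 - t)); apply: ger_powR b0.
  by rewrite t1' /=; lra.
have e : 1 - s - 1 = - s by ring.
have pw2 (x r : R) : 2^-1 <= x -> -1 <= r -> r <= 0 -> x `^ r <= 2.
  move=> x2 r1 r0; have x0 : 0 < x by apply: lt_le_trans x2; rewrite invr_gt0.
  have -> : r = - (- r) by rewrite opprK.
  rewrite powRN -[leRHS]invrK lef_pV2 ?posrE ?invr_gt0 ?powR_gt0//.
  apply: (@le_trans _ _ (2^-1 `^ (- r))); last by apply: ge0_ler_powR; rewrite ?nnegrE ?invr_ge0//; lra.
  rewrite -[leLHS](@powRr1 _ 2^-1) ?invr_ge0//; apply: ger_powR; last by lra.
  by apply/andP; split; lra.
rewrite e /kweight; have P1 := powR_ge0 t (s - 1); have P2 := powR_ge0 (1 - t) (- s).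
have [t2|t2] := leP t 2^-1.
  have := pw2 (1 - t) (- s); have := s0; have := s2 => h3 h4.
  have t3 : 2^-1 <= 1 - t by lra.
  move=> /(_ t3) h; have {}h : (1 - t) `^ (- s) <= 2 by apply: h; lra.
  nra.
have := pw2 t (s - 1) (ltW t2); have := s0; have := s2 => h3 h4 h.
have {}h : t `^ (s - 1) <= 2 by apply: h; lra.
nra.
Qed.

Lemma integral_kweight_lt_pinfty : (\int[mu]_(t in I01) (kweight t)%:E < +oo)%E.
Proof.
have i1 : (\int[mu]_(t in I01) (t `^ (s - 1))%:E = (s^-1)%:E)%E by exact: integral_powR01.
have i2 : (\int[mu]_(t in I01) ((1 - t) `^ (1 - s - 1))%:E = ((1 - s)^-1)%:E)%E.
  rewrite (@integral_onem _ (fun t => (t `^ (1 - s - 1))%:E)).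
  - by apply: integral_powR01; have := s2; lra.
  - by apply/measurable_EFinP; exact: measurable_powR.
  - by move=> x; rewrite lee_fin powR_ge0.
have m1 : measurable_fun I01 (fun t : R => (t `^ (s - 1))%:E).
  by apply: measurable_funTS; apply/measurable_EFinP; exact: measurable_powR.
have m2 : measurable_fun I01 (fun t : R => ((1 - t) `^ (1 - s - 1))%:E).
  apply: measurable_funTS; apply/measurable_EFinP; apply: measurable_powR_comp.
  exact: measurable_funB.
apply: (@le_lt_trans _ _ (\int[mu]_(t in I01) (2%:E * ((t `^ (s - 1))%:E + ((1 - t) `^ (1 - s - 1))%:E)))%E).
  apply: ge0_le_integral; first exact: measurable_itv.
  - by move=> t _; rewrite lee_fin kweight_ge0.
  - by apply: measurable_funTS; apply/measurable_EFinP; exact: measurable_kweight.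
  - by apply: measurable_funeM; exact: emeasurable_funD.
  - by move=> t; rewrite /= in_itv /= => t01; rewrite -EFinD -EFinM lee_fin kweight_le.
rewrite ge0_integralZl_EFin//; last first.
- exact: emeasurable_funD.
- by move=> t _; rewrite -EFinD lee_fin addr_ge0 ?powR_ge0.
rewrite ge0_integralD//; last 2 first.
- by move=> t _; rewrite lee_fin powR_ge0.
- by move=> t _; rewrite lee_fin powR_ge0.
by rewrite [X in (_ * (X + _))%E]i1 [X in (_ * (_ + X))%E]i2 -EFinD -EFinM ltry.
Qed.

Definition hbeta : R := Beta s (b + 1 - s).

Lemma integral_kweight : (\int[mu]_(t in I01) (kweight t)%:E = hbeta%:E)%E.
Proof.
rewrite /hbeta /Beta /Rintegral fineK.
  by apply: eq_integral => t _; rewrite /kweight; congr (_ * powR _ _)%:E; ring.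
rewrite ge0_fin_numE; last by apply: integral_ge0 => t _; rewrite lee_fin mulr_ge0 ?powR_ge0.
apply: le_lt_trans integral_kweight_lt_pinfty.
rewrite le_eqVlt; apply/orP; left; apply/eqP.
by apply: eq_integral => t _; rewrite /kweight; congr (_ * powR _ _)%:E; ring.
Qed.

Lemma hbeta_gt0 : 0 < hbeta.
Proof.
rewrite -lte_fin -integral_kweight; apply: (@lt_le_trans _ _ (\int[mu]_(t in I01) ((1 - t) `^ (b + 1 - 1))%:E)%E).
  rewrite (@integral_onem _ (fun t => (t `^ (b + 1 - 1))%:E)).
  - by rewrite integral_powR01 ?lte_fin ?invr_gt0; move: b0; lra.
  - by apply/measurable_EFinP; exact: measurable_powR.
  - by move=> x; rewrite lee_fin powR_ge0.
apply: ge0_le_integral; first exact: measurable_itv.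
- by move=> t _; rewrite lee_fin powR_ge0.
- apply: measurable_funTS; apply/measurable_EFinP; apply: measurable_powR_comp.
  exact: measurable_funB.
- by apply: measurable_funTS; apply/measurable_EFinP; exact: measurable_kweight.
move=> t; rewrite /= in_itv /= => /andP[t0 t1]; have t1' : 0 < 1 - t by rewrite subr_gt0.
rewrite lee_fin /kweight addrK.
have h1 : 1 <= t `^ (s - 1).
  rewrite -[leLHS](powRr0 t); apply: ger_powR; first by rewrite t0 ltW.
  by have := s2; lra.
have h2 : (1 - t) `^ b <= (1 - t) `^ (b - s).
  by apply: ger_powR; [rewrite t1' /=|have := s0]; lra.
by have := powR_ge0 (1 - t) b; nra.
Qed.

(** Young's inequality, with equality at [x = c]: the graph of [x^p / p] lies above its tangent
    there. *)
Lemma young_tangent (x c : R) : 0 <= x -> 0 <= c ->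
  x * c `^ (p - 1) <= x `^ p / p + c `^ p * (1 - p^-1).
Proof.
move=> x0 c0; have pm : 0 < p - 1 by rewrite subr_gt0.
have := @conjugate_powR _ x (c `^ (p - 1)) p (p / (p - 1)) x0 (powR_ge0 _ _) p0 (divr_gt0 p0 pm).
have -> : p^-1 + (p / (p - 1))^-1 = 1 by field; rewrite !gt_eqF.
move=> /(_ erefl); rewrite -powRrM.
have -> : (p - 1) * (p / (p - 1)) = p by field; rewrite gt_eqF.
have -> : (p / (p - 1))^-1 = 1 - p^-1 by field; rewrite !gt_eqF.
by [].
Qed.

(* Jensen's inequality for the probability density [kweight / hbeta], through the
   tangent line at [h / hbeta]. *)
Lemma jensen_kweight (h : R) (X : R -> R) : 0 <= h -> measurable_fun [set: R] X ->
  (forall t, 0 <= X t) ->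
  (h%:E <= \int[mu]_(t in I01) (kweight t * X t)%:E)%E ->
  ((h `^ p)%:E <= (hbeta `^ (p - 1))%:E * \int[mu]_(t in I01) (kweight t * X t `^ p)%:E)%E.
Proof.
move=> h0 mX X0 hX; have B0 := hbeta_gt0.
have J0 : (0 <= \int[mu]_(t in I01) (kweight t * X t `^ p)%:E)%E.
  by apply: integral_ge0 => t _; rewrite lee_fin mulr_ge0 ?kweight_ge0 ?powR_ge0.
have [->|hn0] := eqVneq h 0.
  by rewrite powR0 ?gt_eqF// mule_ge0// lee_fin powR_ge0.
have hp : 0 < h by rewrite lt0r hn0.
pose c := h / hbeta; have c0 : 0 < c by rewrite divr_gt0.
have mk : measurable_fun I01 kweight by apply: measurable_funTS; exact: measurable_kweight.
have mX1 : measurable_fun I01 X by exact: measurable_funTS.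
have mXp : measurable_fun I01 (fun t => kweight t * X t `^ p).
  by apply: measurable_funM => //; exact: measurable_powR_comp.
have pi1 : 0 <= 1 - p^-1 by rewrite subr_ge0 invf_le1// ltW.
have step : ((h * c `^ (p - 1))%:E <=
    p^-1%:E * \int[mu]_(t in I01) (kweight t * X t `^ p)%:E + (c `^ p * (1 - p^-1) * hbeta)%:E)%E.
  rewrite mulrC EFinM; apply: (@le_trans _ _ ((c `^ (p - 1))%:E * \int[mu]_(t in I01) (kweight t * X t)%:E)%E).
    by apply: lee_wpmul2l => //; rewrite lee_fin powR_ge0.
  rewrite -ge0_integralZl_EFin ?powR_ge0//; last 2 first.
  - by move=> t _; rewrite lee_fin mulr_ge0 ?kweight_ge0.
  - by apply/measurable_EFinP; exact: measurable_funM.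
  apply: (@le_trans _ _ (\int[mu]_(t in I01) ((p^-1)%:E * (kweight t * X t `^ p)%:E +
     (c `^ p * (1 - p^-1))%:E * (kweight t)%:E))%E).
    apply: ge0_le_integral; first exact: measurable_itv.
    - by move=> t _; rewrite mule_ge0// lee_fin ?powR_ge0// mulr_ge0 ?kweight_ge0.
    - by apply: measurable_funeM; apply/measurable_EFinP; exact: measurable_funM.
    - by apply: emeasurable_funD; apply: measurable_funeM; exact/measurable_EFinP.
    - move=> t _; rewrite -!EFinM -EFinD lee_fin.
      have := ler_wpM2l (kweight_ge0 t) (young_tangent (X0 t) (ltW c0)); lra.
  rewrite ge0_integralD//; last 4 first.
  - by move=> t _; rewrite mule_ge0// lee_fin ?invr_ge0 ?(ltW p0)// mulr_ge0 ?kweight_ge0 ?powR_ge0.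
  - by apply: measurable_funeM; exact/measurable_EFinP.
  - by move=> t _; rewrite mule_ge0// lee_fin ?kweight_ge0// mulr_ge0 ?powR_ge0.
  - by apply: measurable_funeM; exact/measurable_EFinP.
  rewrite ge0_integralZl_EFin ?invr_ge0 ?(ltW p0)//; last 2 first.
  - by move=> t _; rewrite lee_fin mulr_ge0 ?kweight_ge0 ?powR_ge0.
  - exact/measurable_EFinP.
  rewrite ge0_integralZl_EFin ?mulr_ge0 ?powR_ge0//; last 2 first.
  - by move=> t _; rewrite lee_fin kweight_ge0.
  - exact/measurable_EFinP.
  by rewrite integral_kweight -EFinM.
move: J0 step; case: (\int[mu]_(t in I01) (kweight t * X t `^ p)%:E)%E => [J| |] //; last first.
  by move=> _ _; rewrite gt0_muley ?leey// lte_fin powR_gt0.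
rewrite lee_fin => J0; rewrite -!EFinM -EFinD !lee_fin.
have cB : c * hbeta = h by rewrite /c divfK// gt_eqF.
have cp : c * c `^ (p - 1) = c `^ p.
  rewrite -{1}(powRr1 (ltW c0)) -powRD; last by apply/implyP => _; rewrite gt_eqF.
  by congr powR; ring.
have hpE : h `^ p = c `^ p * hbeta `^ (p - 1) * hbeta.
  rewrite -cB powRM ?(ltW c0) ?(ltW B0)// -mulrA; congr (_ * _).
  rewrite -[X in _ = _ * X](powRr1 (ltW B0)) -powRD; last by apply/implyP => _; rewrite gt_eqF.
  by congr powR; ring.
have -> : h * c `^ (p - 1) = c `^ p * hbeta by rewrite -cB -cp; ring.
move=> st; have {}st : c `^ p * hbeta <= J.
  have st' : p^-1 * (c `^ p * hbeta) <= p^-1 * J by lra.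
  by rewrite ler_pM2l ?invr_gt0 in st'.
rewrite hpE mulrAC mulrC ler_wpM2l ?powR_ge0//.
Qed.

End HilbertPolynomial.

Lemma measurable_outer_integral (R : realType) (F : (R * R) * R -> \bar R) :
  measurable_fun [set: (R * R) * R] F -> (forall z, (0 <= F z)%E) ->
  measurable_fun [set: R] (fun t => \int[@lebesgue_measure R \x @lebesgue_measure R]_w F (w, t))%E.
Proof.
move=> mF F0.
have mt (t : R) : measurable_fun [set: R * R] (fun w => F (w, t)).
  by apply: (measurableT_comp mF); apply: measurable_fun_pair; [exact: measurable_id|exact: measurable_cst].
have -> : (fun t => \int[@lebesgue_measure R \x @lebesgue_measure R]_w F (w, t))%E =
    (fun t => \int[@lebesgue_measure R]_x \int[@lebesgue_measure R]_y F ((x, y), t))%E.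
  by apply/funext => t; exact: (tonelli (mt t) (fun w => F0 _)).
apply: (@measurable_fun_fubini_tonelli_F _ _ _ _ _ (@lebesgue_measure R) (fun z : R * R => \int[@lebesgue_measure R]_y F ((z.2, y), z.1))%E).
  apply: (@measurable_fun_fubini_tonelli_F _ _ _ _ _ (@lebesgue_measure R) (fun v : (R * R) * R => F ((v.1.2, v.2), v.1.1))) => //.
  have m1 : measurable_fun [set: (R * R) * R] (fun v => v.1.1).
    by apply: (measurableT_comp (@measurable_fst _ _ R R)); exact: measurable_fst.
  have m2 : measurable_fun [set: (R * R) * R] (fun v => v.1.2).
    by apply: (measurableT_comp (@measurable_snd _ _ R R)); exact: measurable_fst.
  apply: (measurableT_comp mF); apply: measurable_fun_pair; last exact: m1.
  by apply: measurable_fun_pair; [exact: m2|exact: measurable_snd].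
by move=> z; exact: integral_ge0.
Qed.

(** * The upper bound for polynomials *)

Section UpperBoundPolynomial.
Context {R : realType}.
Local Notation C := R[i]^o.
Local Notation mu := (@lebesgue_measure R).
Implicit Types (x y t : R) (z u : C).
Variables (alpha p b : R).
Hypotheses (al : -1 < alpha) (p1 : 1 < p) (pal : 2 * (alpha + 2) <= p) (b0 : 0 <= b).
Local Notation s := ((alpha + 2) / p).
Local Notation I01 := `](0 : R), (1 : R)[%classic.
Local Notation kw := (kweight alpha p b).
Local Notation B := (hbeta alpha p b).

Let p0 : 0 < p. Proof. exact: lt_trans p1. Qed.
Let sp : s * p = alpha + 2. Proof. by rewrite divfK// gt_eqF. Qed.

Lemma hilbert_op_abs_le (a : nat -> C) z (T : R -> C) : hsummable a -> modulus z < 1 ->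
  (forall t, 0 < t < 1 -> taylor_series a (t%:C * kern t z) n @[n --> \oo] --> T t) ->
  measurable_fun I01 (fun t => modulus (kern t z * T t)) ->
  ((modulus (hilbert_op b a z))%:E <=
   \int[mu]_(t in I01) ((1 - t) `^ b * modulus (kern t z * T t))%:E)%E.
Proof.
move=> sa z1 aT mT; set h := hilbert_op b a z.
have [->|h0] := eqVneq h 0.
  by rewrite mod0; apply: integral_ge0 => t _; rewrite lee_fin mulr_ge0 ?powR_ge0 ?mod_ge0.
have m0 : 0 < modulus h by rewrite mod_gt0.
(* A unit that turns [h] into the positive number [modulus h], so that the formula for real parts
   computes the modulus. *)
pose u : C := (modulus h)^-1%:C * (h^*)%C.
have -> : modulus h = complex.Re (u * h).
  by rewrite /u -mulrA ReZ Re_conjM expr2 mulKf// gt_eqF.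
have mu1 : modulus u = 1.
  by rewrite modM mod_real mod_conj ger0_norm ?invr_ge0 ?(ltW m0)// mulVf// gt_eqF.
rewrite (hilbert_op_integral b0 u sa z1 aT).
have iG := hilbert_op_integrable b0 u sa z1 aT.
have mG : measurable_fun I01 (fun t => ((1 - t) `^ b * complex.Re (u * (kern t z * T t)))%:E).
  by have /integrableP[] := iG.
apply: (le_trans (lee_abs _)); apply: (le_trans (le_abse_integral mu _ mG)); first exact: measurable_itv.
apply: ge0_le_integral; first exact: measurable_itv.
- by [].
- exact: measurableT_comp.
- apply/measurable_EFinP; apply: measurable_funM => //; apply: measurable_powR_comp.
  exact: measurable_funB.
move=> t _; rewrite lee_fin normrM ger0_norm ?powR_ge0// ler_wpM2l ?powR_ge0//.
by apply: le_trans (Re_le_mod _) _; rewrite modM mu1 mul1r.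
Qed.

Lemma cmeasurableS d (T : measurableType d) (E : set T) (f : T -> C) :
  cmeasurable [set: T] f -> cmeasurable E f.
Proof. by move=> [f1 f2]; split; exact: measurable_funTS. Qed.

Lemma cmeasurable_hilbert_op (c : nat -> C) : hsummable c ->
  cmeasurable (@disk2 R) (fun w => hilbert_op b c (w.1 +i* w.2)).
Proof.
move=> sc; apply: (@cmeasurable_cvg _ _ _ _ (fun N w => taylor_series (hilbert_coef b c) (w.1 +i* w.2) N)).
- exact: measurable_disk2.
- by move=> N; apply: cmeasurableS; exact: measurable_taylor.
- by move=> w Dw; have [_] := hsummable_well_defined b0 sc; exact.
Qed.

Variables (a : nat -> C) (n : nat).

Lemma trunc_summable : hsummable (trunc a n).
Proof.
apply/cvg_ex; exists (\sum_(0 <= k < n) modulus (a k) / k.+1%:R).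
apply: cvg_near_cst; near=> N; have nN : (n <= N)%N by near: N; exact: nbhs_infty_ge.
rewrite /series /= (big_cat_nat (leq0n n) nN)/= [X in _ + X]big1_seq ?addr0.
  by rewrite big_nat [RHS]big_nat; apply: eq_bigr => k /andP[_ kn]; rewrite /trunc kn.
move=> k; rewrite mem_index_iota => /andP[_ /andP[nk _]].
by rewrite /trunc ltnNge nk/= mod0 mul0r.
Unshelve. all: by end_near. Qed.

Lemma taylor_trunc_cvg z : taylor_series (trunc a n) z N @[N --> \oo] --> (taylor_series a z n : C).
Proof.
apply: cvg_near_cst; near=> N; have nN : (n <= N)%N by near: N; exact: nbhs_infty_ge.
rewrite /taylor_series /series /= (big_cat_nat (leq0n n) nN)/= [X in _ + X]big1_seq ?addr0.
  by rewrite big_nat [RHS]big_nat; apply: eq_bigr => k /andP[_ kn]; rewrite /trunc kn.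
move=> k; rewrite mem_index_iota => /andP[_ /andP[nk _]].
by rewrite /trunc ltnNge nk/= mul0r.
Unshelve. all: by end_near. Qed.

Let Tt (t : R) z : R := modulus (kern t z * taylor_series a (t%:C * kern t z) n).

Lemma measurable_slices : measurable_fun [set: (R * R) * R] (fun v => Tt v.2 (v.1.1 +i* v.1.2)).
Proof.
have m1 : measurable_fun [set: (R * R) * R] (fun v => v.1.1).
  by apply: (measurableT_comp (@measurable_fst _ _ R R)); exact: measurable_fst.
have m2 : measurable_fun [set: (R * R) * R] (fun v => v.1.2).
  by apply: (measurableT_comp (@measurable_snd _ _ R R)); exact: measurable_fst.
have mz : cmeasurable [set: (R * R) * R] (fun v => v.1.1 +i* v.1.2) by split; [exact: m1|exact: m2].
have mk : cmeasurable [set: (R * R) * R] (fun v => kern v.2 (v.1.1 +i* v.1.2)).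
  apply: cmeasurableV; apply: cmeasurableD; first exact: cmeasurable_cst.
  apply: cmeasurableN; apply: cmeasurableM; last exact: mz.
  by apply: cmeasurable_real; apply: measurable_funB; [exact: measurable_cst|exact: measurable_snd].
apply: measurable_modulus; apply: cmeasurableM; first exact: mk.
apply: cmeasurable_sum => k; apply: cmeasurableM; first exact: cmeasurable_cst.
apply: cmeasurableX; apply: cmeasurableM; last exact: mk.
by apply: cmeasurable_real; exact: measurable_snd.
Qed.

Let mTt z : measurable_fun [set: R] (fun t => Tt t z).
Proof.
case: z => x y.
apply: (measurableT_comp measurable_slices (f := fun v => Tt v.2 (v.1.1 +i* v.1.2)) (g := fun t => ((x, y), t))).
by apply: measurable_fun_pair; [exact: measurable_cst|exact: measurable_id].
Qed.

(** [T_t f] divided by the bound [t^(s - 1) (1 - t)^(- s)] of its norm, so that [kw t] times [X] is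
    [(1 - t)^b] times the modulus of [T_t f]. *)
Let X t z := Tt t z * (t `^ (1 - s) * (1 - t) `^ s).

Let mX z : measurable_fun [set: R] (fun t => X t z).
Proof.
apply: measurable_funM; first exact: mTt.
by apply: measurable_funM; apply: measurable_powR_comp => //; exact: measurable_funB.
Qed.

Let X0 t z : 0 <= X t z.
Proof. by rewrite /X !mulr_ge0 ?powR_ge0 ?mod_ge0. Qed.

Lemma hilbert_poly_powR_le z : modulus z < 1 ->
  ((modulus (hilbert_op b (trunc a n) z) `^ p)%:E <=
   (B `^ (p - 1))%:E * \int[mu]_(t in I01) (kw t * X t z `^ p)%:E)%E.
Proof.
move=> z1; apply: (jensen_kweight al p1 pal b0 (mod_ge0 _) (mX z)) => [t|]; first exact: X0.
apply: le_trans (hilbert_op_abs_le (T := fun t => taylor_series a (t%:C * kern t z) n) trunc_summable z1 _ _) _.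
- by move=> t _; exact: taylor_trunc_cvg.
- by apply: measurable_funTS; exact: mTt.
rewrite le_eqVlt; apply/orP; left; apply/eqP; apply: eq_integral => t.
rewrite inE /= in_itv /= => /andP[t0 t1]; have t1' : 0 < 1 - t by rewrite subr_gt0.
rewrite -/(Tt t z) /kweight /X; congr EFin.
have e1 : t `^ (s - 1) * t `^ (1 - s) = 1.
  rewrite -powRD; last by apply/implyP => _; rewrite gt_eqF.
  by rewrite (_ : s - 1 + (1 - s) = 0) ?powRr0//; ring.
have e2 : (1 - t) `^ (b - s) * (1 - t) `^ s = (1 - t) `^ b.
  rewrite -powRD; last by apply/implyP => _; rewrite gt_eqF.
  by rewrite subrK.
rewrite -e2; set P := (1 - t) `^ (b - s); set Q := (1 - t) `^ s; set M := Tt t z.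
have -> : t `^ (s - 1) * P * (M * (t `^ (1 - s) * Q)) = (t `^ (s - 1) * t `^ (1 - s)) * (P * Q * M) by ring.
by rewrite e1 mul1r.
Qed.

Let wt (w : R * R) : R := (1 - modulus (w.1 +i* w.2) ^+ 2) `^ alpha.

Let mwt : measurable_fun [set: R * R] wt.
Proof.
apply: measurable_powR_comp; apply: measurable_funB; first exact: measurable_cst.
by apply: measurable_funX; apply: measurable_modulus; exact: cmeasurable_plane.
Qed.

Let G (v : (R * R) * R) : R := kw v.2 * X v.2 (v.1.1 +i* v.1.2) `^ p * wt v.1.

Let G0 v : 0 <= G v.
Proof. by rewrite /G !mulr_ge0 ?powR_ge0. Qed.

(** Cut off to the disk and to [0 < t < 1], so that the integrals can be exchanged over the whole
    space. *)
Let F (v : (R * R) * R) : \bar R := if (v.2 \in I01) && (v.1 \in @disk2 R) then (G v)%:E else 0%E.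

Let F0 v : (0 <= F v)%E.
Proof. by rewrite /F; case: ifP => // _; rewrite lee_fin. Qed.

Let mG : measurable_fun [set: (R * R) * R] G.
Proof.
apply: measurable_funM; last by apply: (measurableT_comp mwt); exact: measurable_fst.
apply: measurable_funM.
  by apply: (measurableT_comp (measurable_kweight alpha p b)); exact: measurable_snd.
apply: measurable_powR_comp; apply: measurable_funM; first exact: measurable_slices.
apply: measurable_funM; apply: measurable_powR_comp; first exact: measurable_snd.
by apply: measurable_funB; [exact: measurable_cst|exact: measurable_snd].
Qed.

Let mF : measurable_fun [set: (R * R) * R] F.
Proof.
pose A := (snd @^-1` I01 `&` fst @^-1` @disk2 R : set ((R * R) * R)).
have mA : measurable A.
  apply: measurableI.
    rewrite -[X in measurable X]setTI; apply: (@measurable_snd _ _ (R * R)%type R) => //.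
  rewrite -[X in measurable X]setTI; apply: (@measurable_fst _ _ (R * R)%type R) => //.
  exact: measurable_disk2.
have -> : F = (EFin \o G) \_ A.
  apply/funext => v; rewrite patchE /F /A /=; congr (if _ then _ else _).
  apply/idP/idP; first by case/andP; rewrite !inE => h1 h2; split.
  by rewrite inE => -[h1 h2]; apply/andP; rewrite !inE.
by apply: measurable_patch => //; exact/measurable_EFinP.
Qed.

(** Jensen's inequality at each point contributes [B^(p - 1)]. After the exchange of integrals a
    slice contributes at most [kw t] times the integral of the polynomial, and integrating [kw]
    gives the last factor [B]. *)
Lemma wint_hilbert_poly_le :
  (wint alpha p (fun z => modulus (hilbert_op b (trunc a n) z)) <=
   (B `^ p)%:E * wint alpha p (fun z => modulus (taylor_series a z n)%R))%E.
Proof.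
set N := wint alpha p (fun z => modulus (taylor_series a z n)).
have B0 : 0 < B by exact: hbeta_gt0.
have N0 : (0 <= N)%E.
  by apply: integral_ge0 => w _; rewrite lee_fin mulr_ge0 ?powR_ge0.
have Bp0 : 0 <= B `^ (p - 1) by exact: powR_ge0.
have mI := measurable_inner_integral mF F0.
have mm : measurable_fun (@disk2 R) (fun w : R * R =>
    modulus (hilbert_op b (trunc a n) (w.1 +i* w.2)) `^ p * wt w).
  apply: measurable_funM; last exact: measurable_funTS.
  apply: measurable_powR_comp; apply: measurable_modulus.
  by apply: cmeasurable_hilbert_op; exact: trunc_summable.
apply: (@le_trans _ _ ((B `^ (p - 1))%:E * \int[mu \x mu]_w \int[mu]_t F (w, t))%E).
  apply: (@le_trans _ _ (\int[mu \x mu]_(w in @disk2 R) ((B `^ (p - 1))%:E * \int[mu]_t F (w, t)))%E).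
    apply: ge0_le_integral; first exact: measurable_disk2.
    - by move=> w _; rewrite lee_fin mulr_ge0 ?powR_ge0.
    - by apply/measurable_EFinP; exact: mm.
    - by apply: measurable_funeM; exact: measurable_funTS.
    move=> w Dw; rewrite EFinM.
    have -> : (\int[mu]_t F (w, t) = (wt w)%:E * \int[mu]_(t in I01) (kw t * X t (w.1 +i* w.2) `^ p)%:E)%E.
      rewrite -ge0_integralZl_EFin ?powR_ge0//; last 2 first.
      - by move=> t _; rewrite lee_fin mulr_ge0 ?kweight_ge0 ?powR_ge0.
      - apply: measurable_funTS; apply/measurable_EFinP; apply: measurable_funM.
          exact: measurable_kweight.
        by apply: measurable_powR_comp; exact: mX.
      rewrite [RHS]integral_mkcond; apply: eq_integral => t _; rewrite patchE /F /=.
      by rewrite (mem_set Dw) andbT; case: ifP => // _; rewrite -EFinM mulrC.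
    rewrite muleCA muleC; apply: lee_wpmul2l; first by rewrite lee_fin powR_ge0.
    exact: hilbert_poly_powR_le.
  rewrite ge0_integralZl_EFin//; last 3 first.
  - exact: measurable_disk2.
  - by move=> w _; exact: integral_ge0.
  - exact: measurable_funTS.
  apply: lee_wpmul2l => //; apply: ge0_subset_integral => //; first exact: measurable_disk2.
  by move=> w _; exact: integral_ge0.
rewrite (fubini3 mF F0).
have sl t : (\int[mu \x mu]_w F (w, t) <= if t \in I01 then (kw t)%:E * N else 0)%E.
  case: ifPn => t01; last first.
    by rewrite integral0_eq// => w _; rewrite /F /= (negbTE t01).
  have tt : 0 < t < 1 by move: t01; rewrite inE /= in_itv.
  case/andP: (tt) => t0 t1; have t1' : 0 < 1 - t by rewrite subr_gt0.
  pose c := kw t * (t `^ (1 - s) * (1 - t) `^ s) `^ p.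
  have c0 : 0 <= c by rewrite mulr_ge0 ?kweight_ge0 ?powR_ge0.
  have -> : (\int[mu \x mu]_w F (w, t) = c%:E * wint alpha p (Tt t))%E.
    rewrite /wint -ge0_integralZl_EFin//; last 3 first.
    - exact: measurable_disk2.
    - by move=> w _; rewrite lee_fin mulr_ge0 ?powR_ge0.
    - by apply: measurable_funTS; apply: measurable_wint_integrand; exact: measurable_kern_taylor.
    rewrite [RHS]integral_mkcond; apply: eq_integral => w _; rewrite patchE /F /= t01 /=.
    case: ifP => // _; rewrite -EFinM /G /c /X /=; congr EFin.
    by rewrite powRM ?mulr_ge0 ?powR_ge0 ?mod_ge0//; rewrite /wt; ring.
  have cE : c * (t `^ (alpha + 2 - p) * (1 - t) `^ (- (alpha + 2))) = kw t.
    rewrite /c powRM ?powR_ge0// -!powRrM sp mulrBl mul1r sp.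
    have h1 : t `^ (p - (alpha + 2)) * t `^ (alpha + 2 - p) = 1.
      rewrite -powRD; last by apply/implyP => _; rewrite gt_eqF.
      by rewrite (_ : p - (alpha + 2) + (alpha + 2 - p) = 0) ?powRr0//; ring.
    have h2 : (1 - t) `^ (alpha + 2) * (1 - t) `^ (- (alpha + 2)) = 1.
      rewrite -powRD; last by apply/implyP => _; rewrite gt_eqF.
      by rewrite subrr powRr0.
    move: h1 h2; set P1 := t `^ _; set P2 := t `^ _; set P3 := (1 - t) `^ _; set P4 := (1 - t) `^ _ => h1 h2.
    have -> : kw t * (P1 * P3) * (P2 * P4) = kw t * (P1 * P2) * (P3 * P4) by ring.
    by rewrite h1 h2 !mulr1.
  have -> : ((kw t)%:E * N = c%:E * ((t `^ (alpha + 2 - p) * (1 - t) `^ (- (alpha + 2)))%:E * N))%E.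
    by rewrite muleA -EFinM cE.
  apply: lee_wpmul2l; first by rewrite lee_fin.
  exact: (wint_slice_le al (ltW p1) pal a n tt).
apply: (@le_trans _ _ ((B `^ (p - 1))%:E * (B%:E * N))%E); last first.
  rewrite muleA -EFinM; apply: lee_wpmul2r => //; rewrite lee_fin -{2}(powRr1 (ltW B0)) -powRD.
    by rewrite subrK.
  by apply/implyP => _; rewrite gt_eqF.
apply: lee_wpmul2l; first by rewrite lee_fin powR_ge0.
rewrite -(integral_kweight al p1 pal b0) -ge0_integralZr//; last 2 first.
- by apply: measurable_funTS; apply/measurable_EFinP; exact: measurable_kweight.
- by move=> t _; rewrite lee_fin kweight_ge0.
rewrite [leRHS]integral_mkcond; apply: ge0_le_integral; first exact: measurableT.
- by move=> t _; exact: integral_ge0.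
- exact: (measurable_outer_integral mF F0).
- apply: measurable_patch => //; apply: emeasurable_funM; last exact: measurable_cst.
  by apply/measurable_EFinP; exact: measurable_kweight.
by move=> t _; rewrite patchE; exact: sl.
Qed.

End UpperBoundPolynomial.

Lemma fatou_le d (T : measurableType d) (R : realType) (mu : {measure set T -> \bar R})
    (D : set T) (f_ : nat -> T -> R) (f : T -> R) (c : \bar R) :
  measurable D -> (forall n, measurable_fun D (f_ n)) -> (forall n x, D x -> 0 <= f_ n x) ->
  (forall x, D x -> f_ n x @[n --> \oo] --> f x) ->
  (\forall n \near \oo, (\int[mu]_(x in D) (f_ n x)%:E <= c)%E) ->
  (\int[mu]_(x in D) (f x)%:E <= c)%E.
Proof.
move=> mD mf f0 fc hc.
have -> : (\int[mu]_(x in D) (f x)%:E = \int[mu]_(x in D) limn_einf (fun n => (f_ n x)%:E))%E.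
  apply: eq_integral => x; rewrite inE => Dx; apply/esym.
  have h : (f_ n x)%:E @[n --> \oo] --> (f x)%:E.
    by apply: cvg_EFin; [exact: nearW|exact: fc].
  by rewrite is_cvg_limn_einfE; [exact/cvg_lim|apply/cvg_ex; exists (f x)%:E].
apply: (@le_trans _ _ (limn_einf (fun n => \int[mu]_(x in D) (f_ n x)%:E))%E).
  by apply: fatou => // n; exact/measurable_EFinP.
rewrite limn_einf_lim; apply: lime_le; first exact: is_cvg_einfs.
case: hc => n0 _ hn0; apply: nearW => n; rewrite /einfs /=.
apply: le_trans (hn0 (maxn n0 n) (leq_maxl _ _)).
by apply: ereal_inf_lbound; exists (maxn n0 n) => //=; exact: leq_maxr.
Qed.

(** * Fourier coefficients of the sampled Fejer kernel *)

Section FejerCoefficients.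
Context {R : realType}.
Variable N : nat.
Hypothesis N0 : (0 < N)%N.

(** [N.-1 * l] stands for [- l] modulo [N]: the pairs with [k - l + m] divisible by [N] are counted.
    This is the [m]-th Fourier coefficient of the Fejer kernel sampled at the [N]-th roots of
    unity. *)
Definition fejer_coef n m : R :=
  n%:R^-1 * \sum_(k < n) \sum_(l < n) (N %| k + N.-1 * l + m)%N%:R.

Lemma fejer_dvd k l m : (l < N)%N -> (N %| k + N.-1 * l + m)%N = (l == (k + m) %% N)%N.
Proof.
move=> lN; rewrite /dvdn -[X in _ == X](mod0n N) -(eqn_modDr l) add0n.
have -> : (k + N.-1 * l + m + l = l * N + (k + m))%N by case: (N) N0 => // M _ /=; lia.
by rewrite modnMDl [(l %% N)%N]modn_small// eq_sym.
Qed.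

Lemma fejer_inner n k m : (n <= N)%N ->
  \sum_(l < n) (N %| k + N.-1 * l + m)%N%:R = ((k + m) %% N < n)%N%:R :> R.
Proof.
move=> nN; under eq_bigr => l _ do rewrite (fejer_dvd _ _ (leq_trans (ltn_ord l) nN)).
case: ltnP => h.
  rewrite (bigD1 (Ordinal h)) //= eqxx big1 ?addr0// => l ne.
  by case: eqVneq => // e; case/eqP: ne; exact: val_inj.
by rewrite big1// => l _; case: eqVneq => // e; move: h; rewrite -e leqNgt ltn_ord.
Qed.

Lemma fejer_coef_ge0 n m : 0 <= fejer_coef n m.
Proof.
by rewrite mulr_ge0 ?invr_ge0//; apply: sumr_ge0 => k _; apply: sumr_ge0.
Qed.

Lemma fejer_coef_le1 n m : (n <= N)%N -> fejer_coef n m <= 1.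
Proof.
move=> nN; rewrite /fejer_coef; have [->|n0] := posnP n; first by rewrite invr0 mul0r.
rewrite mulrC ler_pdivrMr ?ltr0n// mul1r.
apply: (@le_trans _ _ (\sum_(k < n) 1)); last by rewrite sumr_const card_ord.
by apply: ler_sum => k _; rewrite fejer_inner//; case: (_ < _)%N.
Qed.

(** For [n + m < N] no index wraps around and the count is the classical one; the subtraction
    [n - m] truncates at 0. *)
Lemma fejer_coef_eq n m : (n + m < N)%N -> fejer_coef n m = (n - m)%:R / n%:R.
Proof.
move=> nmN; have nN : (n <= N)%N by lia.
rewrite /fejer_coef mulrC; congr (_ / _).
under eq_bigr => k _.
  rewrite fejer_inner// modn_small; first over.
  by have := ltn_ord k; lia.
rewrite -natr_sum; congr _%:R.
have h r M : (\sum_(k < r) (k + m < M))%N = minn r (M - m).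
  elim: r => [|r IH]; first by rewrite big_ord0 min0n.
  by rewrite big_ord_recr /= IH; case: ltnP; lia.
by rewrite h; lia.
Qed.

End FejerCoefficients.

(** * Roots of unity and the discrete Fejer kernel *)

Section RootsOfUnity.
Context {R : realType}.
Local Notation C := R[i]^o.

Lemma primitive_root_exists N : (0 < N)%N -> exists w : C, N.-primitive_root w.
Proof.
move=> N0; have [r Dr] := @closed_field_poly_normal R[i] ('X^N - 1).
rewrite (monicP (monicXnsubC _ N0)) scale1r in Dr.
have hr : all N.-unity_root r by apply/allP => z; rewrite -root_prod_XsubC -Dr.
have ur : uniq r by rewrite -separable_prod_XsubC -Dr separable_Xn_sub_1 // pnatr_eq0 -lt0n.
have sr : (N <= size r)%N by rewrite -ltnS -(size_prod_XsubC r id) -Dr size_XnsubC.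
by have /hasP[w _ pw] := has_prim_root N0 hr ur sr; exists w.
Qed.

Variables (N : nat) (w : C).
Hypotheses (N0 : (0 < N)%N) (pw : N.-primitive_root w).

Lemma prim_root_sum e : \sum_(j < N) (w ^+ j) ^+ e = if (N %| e)%N then N%:R else 0.
Proof.
rewrite (prim_order_dvd pw); under eq_bigr do rewrite exprAC.
case: ifP => [/eqP ->|/negbT we].
  by rewrite (eq_bigr (fun=> 1)) ?sumr_const ?card_ord// => j _; rewrite expr1n.
apply: (mulfI (x := w ^+ e - 1)); first by rewrite subr_eq0.
rewrite mulr0 -subrX1.
by rewrite exprAC (prim_expr_order pw) expr1n subrr.
Qed.

Lemma mod_prim_root : modulus w = 1.
Proof.
apply/eqP; rewrite -(@eqrXn2 _ N)// ?mod_ge0//.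
by rewrite -modX (prim_expr_order pw) mod1 expr1n.
Qed.

Lemma mod_prim_rootX j : modulus (w ^+ j) = 1.
Proof. by rewrite modX mod_prim_root expr1n. Qed.

Lemma conj_prim_rootX j : ((w ^+ j)^*)%C = w ^+ j ^+ (N.-1).
Proof.
have wj0 : w ^+ j != 0 by rewrite -mod_gt0 mod_prim_rootX.
apply: (mulIf wj0); rewrite -exprSr prednK// exprAC (prim_expr_order pw) expr1n.
by apply: complex_eqP; [rewrite Re_conjM mod_prim_rootX expr1n|case: (w ^+ j) => x y /=; ring].
Qed.

(* The Fejer kernel at [w ^ j], normalized so that its values add up to 1. *)
Definition fejer_weight n j : R := modulus (\sum_(k < n) (w ^+ j) ^+ k) ^+ 2 / (n%:R * N%:R).

Lemma fejer_weight_ge0 n j : 0 <= fejer_weight n j.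
Proof. by rewrite divr_ge0 ?sqr_ge0// mulr_ge0. Qed.

(** Conjugation raises [w^j] to the power [N - 1], so the squared modulus expands into powers of
    [w^j]; orthogonality of the roots of unity keeps the exponents divisible by [N]. *)
Lemma sum_fejer_weight n m :
  \sum_(j < N) (fejer_weight n j)%:C * (w ^+ j) ^+ m = (fejer_coef N n m)%:C :> C.
Proof.
have wE j : (modulus (\sum_(k < n) (w ^+ j) ^+ k) ^+ 2)%:C =
    \sum_(k < n) \sum_(l < n) (w ^+ j) ^+ (k + N.-1 * l) :> C.
  set S := \sum_(k < n) w ^+ j ^+ k.
  have -> : (modulus S ^+ 2)%:C = S * (S^*)%C.
    by apply: complex_eqP; rewrite mulrC ?Re_conjM//; case: (S) => x y /=; ring.
  rewrite /S rmorph_sum /= mulr_suml; apply: eq_bigr => k _; rewrite mulr_sumr.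
  apply: eq_bigr => l _; rewrite rmorphXn /= exprD exprM; congr (_ * _ ^+ _).
  exact: conj_prim_rootX.
rewrite /fejer_weight /fejer_coef.
under eq_bigr => j _ do rewrite rmorphM /= wE mulrAC mulr_suml.
rewrite -mulr_suml exchange_big /= rmorphM /= [RHS]mulrC rmorph_sum /= invfM rmorphM /= mulrA.
have NC : N%:R != 0 :> C by rewrite -mod_gt0 mod_nat ltr0n.
have cN : (N%:R^-1)%:C = N%:R^-1 :> C.
  by apply: (mulfI NC); rewrite divff// -[N%:R in LHS]/(N%:R : C) -(rmorph_nat (real_complex R)) -rmorphM /= divff ?rmorph1// pnatr_eq0 -lt0n.
rewrite cN -mulrA [_ * N%:R^-1]mulrC mulrA mulr_suml; congr (_ * _).
apply: eq_bigr => k _; under eq_bigr do rewrite mulr_suml.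
rewrite exchange_big /= rmorph_sum /= mulr_suml; apply: eq_bigr => l _.
under eq_bigr do rewrite -exprD.
rewrite prim_root_sum; case: ifP => _; last by rewrite mul0r rmorph0.
by rewrite divff// rmorph1.
Qed.

End RootsOfUnity.

(** * Fejer means do not increase the Bergman norm *)

Section FejerMeans.
Context {R : realType}.
Local Notation C := R[i]^o.
Local Notation mu := (@lebesgue_measure R).
Implicit Types (x y t : R) (z u : C).
Variables (alpha p : R).
Hypotheses (p1 : 1 < p).

Lemma wint_patch (g : C -> R) : measurable_fun (@disk2 R) (fun w => g (w.1 +i* w.2)) ->
  exists2 f : R * R -> \bar R, measurable_fun [set: R * R] f /\ (forall w, 0 <= f w)%E &
    (forall w, f w = if w \in @disk2 R then (g (w.1 +i* w.2) `^ p * (1 - modulus (w.1 +i* w.2) ^+ 2) `^ alpha)%:E else 0%E) /\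
    wint alpha p g = (\int[mu \x mu]_w f w)%E.
Proof.
move=> mg.
pose F (w : R * R) := (g (w.1 +i* w.2) `^ p * (1 - modulus (w.1 +i* w.2) ^+ 2) `^ alpha)%:E.
exists (F \_ (@disk2 R)); last by split=> [w|]; [rewrite patchE|rewrite /wint integral_mkcond].
split; last by move=> w; apply: erestrict_ge0 => v _; rewrite lee_fin mulr_ge0 ?powR_ge0.
apply: (measurable_restrictT F (@measurable_disk2 R)).1.
apply/measurable_EFinP; apply: measurable_funM; first exact: measurable_powR_comp.
apply: measurable_funTS; apply: measurable_powR_comp; apply: measurable_funB; first exact: measurable_cst.
by apply: measurable_funX; apply: measurable_modulus; exact: cmeasurable_plane.
Qed.

Lemma wint_rotation (g : C -> R) u : modulus u = 1 ->
  measurable_fun (@disk2 R) (fun w => g (w.1 +i* w.2)) ->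
  wint alpha p (fun z => g (u * z)) = wint alpha p g.
Proof.
move=> u1 mg; have [f [mf f0] [fE ->]] := wint_patch mg.
have uu : complex.Re u ^+ 2 + complex.Im u ^+ 2 = 1 by rewrite -sqr_mod u1 expr1n.
rewrite -(integral_rotation uu mf f0) /wint integral_mkcond; apply: eq_integral => w _.
rewrite patchE fE /=.
have e : (complex.Re u * w.1 - complex.Im u * w.2) +i* (complex.Im u * w.1 + complex.Re u * w.2) =
   u * (w.1 +i* w.2) by case: (u) => c d; apply: complex_eqP => /=; ring.
have -> : ((complex.Re u * w.1 - complex.Im u * w.2, complex.Im u * w.1 + complex.Re u * w.2) \in @disk2 R) = (w \in @disk2 R).
  by apply/idP/idP; rewrite !inE /disk2 /unit_disk /= e modM u1 mul1r.
by rewrite e modM u1 mul1r.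
Qed.

Lemma powR_mod_cvg (v : nat -> C) (l : C) : v N @[N --> \oo] --> l ->
  modulus (v N) `^ p @[N --> \oo] --> modulus l `^ p.
Proof.
move=> vl; have vm := cvgC_mod (@filter_filter _ _ eventually_filter) vl.
have [l0|l0] := eqVneq l 0; last first.
  have ml : 0 < modulus l by rewrite mod_gt0.
  exact: (cvg_comp _ _ vm (powR_cvg_gt0 (c := p) ml)).
(* At the limit 0 the convergence of the powers comes from [x^p <= x] for [0 <= x <= 1]. *)
rewrite l0 mod0 in vm *; rewrite powR0; last by rewrite gt_eqF// (lt_trans ltr01).
apply: (squeeze_cvgr _ (cvg_cst 0) vm); near=> N.
rewrite powR_ge0 /= -[leRHS](powRr1 (mod_ge0 _)).
have [->|v0] := eqVneq (v N) 0; first by rewrite mod0 !powR0// ?gt_eqF// (lt_trans ltr01).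
apply: ger_powR; last exact: ltW.
rewrite mod_gt0 v0 /=; near: N.
move/cvgrPdist_lt: vm => /(_ 1 ltr01); apply: filterS => N.
by rewrite sub0r normrN ger0_norm ?mod_ge0// => /ltW.
Unshelve. all: by end_near. Qed.

Lemma cvgC_sum (I : Type) (r : seq I) (v : I -> nat -> C) (l : I -> C) :
  (forall i, v i N @[N --> \oo] --> l i) ->
  \sum_(i <- r) v i N @[N --> \oo] --> (\sum_(i <- r) l i : C).
Proof.
move=> vl; elim: r => [|i r IH].
  by under eq_fun do rewrite big_nil; rewrite big_nil; exact: cvg_cst.
by under eq_fun do rewrite big_cons; rewrite big_cons; apply: cvgCD; [exact: vl|exact: IH].
Qed.

Lemma wint_fatou (g_ : nat -> C -> C) (g : C -> C) (c : \bar R) :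
  (forall N, cmeasurable (@disk2 R) (fun w => g_ N (w.1 +i* w.2))) ->
  (forall z, modulus z < 1 -> g_ N z @[N --> \oo] --> g z) ->
  (forall N, wint alpha p (fun z => modulus (g_ N z)) <= c)%E ->
  (wint alpha p (fun z => modulus (g z)) <= c)%E.
Proof.
move=> mg gc gle.
pose F N (v : R * R) := modulus (g_ N (v.1 +i* v.2)) `^ p * (1 - modulus (v.1 +i* v.2) ^+ 2) `^ alpha.
pose G (v : R * R) := modulus (g (v.1 +i* v.2)) `^ p * (1 - modulus (v.1 +i* v.2) ^+ 2) `^ alpha.
have h := @fatou_le _ _ _ (mu \x mu)%E (@disk2 R) F G c; apply: h.
- exact: measurable_disk2.
- move=> N; apply: measurable_funM; last first.
    apply: measurable_funTS; apply: measurable_powR_comp; apply: measurable_funB; first exact: measurable_cst.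
    by apply: measurable_funX; apply: measurable_modulus; exact: cmeasurable_plane.
  by apply: measurable_powR_comp; apply: measurable_modulus; exact: mg.
- by move=> N v _; rewrite mulr_ge0 ?powR_ge0.
- by move=> v Dv; apply: cvgM; [apply: powR_mod_cvg; exact: gc|exact: cvg_cst].
- by apply: nearW => N; exact: gle.
Qed.

Variables (f : C -> C) (a : nat -> C).
Hypothesis fa : taylor_expansion f a.

Lemma cmeasurable_expansion : cmeasurable (@disk2 R) (fun w => f (w.1 +i* w.2)).
Proof.
apply: (@cmeasurable_cvg _ _ _ _ (fun N w => taylor_series a (w.1 +i* w.2) N)).
- exact: measurable_disk2.
- by move=> N; apply: cmeasurableS; exact: measurable_taylor.
- by move=> w Dw; exact: fa.
Qed.

Lemma taylor_terms_bounded z : modulus z < 1 -> exists2 A : R, 0 <= A &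
  forall k, modulus (a k) * modulus z ^+ k <= A.
Proof.
move=> z1; have h := cvgC_mod (@filter_filter _ _ eventually_filter) (fa z1).
have [M [_ hM]] : bounded_fun (fun N => modulus (taylor_series a z N)).
  by apply: cvg_seq_bounded; apply/cvg_ex; exists (modulus (f z)).
have {}hM N : modulus (taylor_series a z N) <= M + 1.
  by have := hM (M + 1); rewrite ltrDl ltr01 => /(_ isT N I) /=; rewrite ger0_norm ?mod_ge0.
exists (M + 1 + (M + 1)); first by have := hM 0%N; have := mod_ge0 (taylor_series a z 0); lra.
move=> k; have -> : modulus (a k) * modulus z ^+ k = modulus (taylor_series a z k.+1 - taylor_series a z k).
  by rewrite /taylor_series seriesSr addrAC subrr add0r modM modX.
by apply: le_trans (modB _ _) _; rewrite lerD.
Qed.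

(** Abel's lemma: bounded terms at a radius between [|z|] and 1 give a geometric majorant at
    [|z|]. *)
Lemma taylor_abs_cvg z : modulus z < 1 -> cvgn (series (fun k => modulus (a k) * modulus z ^+ k)).
Proof.
move=> z1; pose r : R := (1 + modulus z) / 2; have z0 := mod_ge0 z.
have [r0 r1 zr] : [/\ 0 < r, r < 1 & modulus z < r] by split; rewrite /r; lra.
clearbody r.
have mr : modulus (r%:C : C) = r by rewrite mod_real ger0_norm// ltW.
have [|A A0 hA] := @taylor_terms_bounded r%:C; first by rewrite mr.
have q1 : modulus z / r < 1 by rewrite ltr_pdivrMr ?mul1r.
have q0 : 0 <= modulus z / r by rewrite divr_ge0// ltW.
apply: (@series_le_cvg _ _ (fun k => A * (modulus z / r) ^+ k)).
- by move=> k; rewrite mulr_ge0 ?exprn_ge0 ?mod_ge0.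
- by move=> k; rewrite mulr_ge0 ?exprn_ge0.
- move=> k; have := hA k; rewrite mr exprMn exprVn => h.
  rewrite mulrCA [leRHS]mulrC ler_wpM2r ?exprn_ge0//.
  by rewrite ler_pdivlMr// exprn_gt0.
- exact/is_cvg_seriesZ/geometric_cvg.
Qed.

Variable n : nat.
Hypothesis n0 : (0 < n)%N.

(** By [sum_fejer_weight] this is, for [n < N], a finite average of [f] over the rotations by the
    [N]-th roots of unity. As [N] grows its coefficients become those of the Fejer mean. *)
Definition fejer_avg N z : C := limn (taylor_series (fun m => (fejer_coef N n m)%:C * a m) z).

Lemma mod_fejer_coef_le N m : (n <= N)%N -> modulus ((fejer_coef N n m)%:C * a m) <= modulus (a m).
Proof.
move=> nN; rewrite modM ler_piMl ?mod_ge0//.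
by rewrite mod_real ger0_norm ?fejer_coef_ge0 ?fejer_coef_le1//; lia.
Qed.

Lemma cmeasurable_fejer_avg N : (n <= N)%N ->
  cmeasurable (@disk2 R) (fun w => fejer_avg N (w.1 +i* w.2)).
Proof.
move=> nN.
apply: (@cmeasurable_cvg _ _ _ _ (fun M w => taylor_series (fun m => (fejer_coef N n m)%:C * a m) (w.1 +i* w.2) M)).
- exact: measurable_disk2.
- by move=> M; apply: cmeasurableS; exact: measurable_taylor.
move=> w Dw; apply: (@cvgC_abs_series _ _ (fun k => modulus (a k) * modulus (w.1 +i* w.2) ^+ k)).
  by move=> k; rewrite modM modX ler_wpM2r ?exprn_ge0 ?mod_ge0// mod_fejer_coef_le.
exact: taylor_abs_cvg.
Qed.

(** Truncated subtraction makes it vanish for [k >= n], so the Fejer mean is a polynomial. *)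
Definition fejer_seq k : C := ((n - k)%:R / n%:R)%:C * a k.

Lemma fejer_seq_le k : modulus (fejer_seq k) <= modulus (a k).
Proof.
rewrite modM mod_real ger0_norm// ler_piMl ?mod_ge0//.
by rewrite ler_pdivrMr ?ltr0n// mul1r ler_nat leq_subr.
Qed.

Lemma fejer_avg_cvg z : modulus z < 1 ->
  fejer_avg N z @[N --> \oo] --> (taylor_series fejer_seq z n : C).
Proof.
move=> z1.
have -> : taylor_series fejer_seq z n = limn (series (fun m => fejer_seq m * z ^+ m)).
  apply/esym/cvgC_lim; apply: cvg_near_cst; near=> N.
  have nN : (n <= N)%N by near: N; exact: nbhs_infty_ge.
  rewrite /taylor_series /series /= (big_cat_nat (leq0n n) nN)/= [X in _ + X]big1_seq ?addr0//.
  move=> k; rewrite mem_index_iota => /andP[_ /andP[nk _]].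
  by rewrite /fejer_seq (eqP nk) mul0r rmorph0 !mul0r.

pose x N k : C := if (n <= N)%N then (fejer_coef N n k)%:C * a k * z ^+ k else 0.
have h : limn (series (x N)) @[N --> \oo] --> limn (series (fun m => fejer_seq m * z ^+ m)).
  apply: (tannery (M := fun k => modulus (a k) * modulus z ^+ k)).
  - move=> N k; rewrite /x; case: ifP => nN; last by rewrite mod0 mulr_ge0 ?exprn_ge0 ?mod_ge0.
    by rewrite modM modX ler_wpM2r ?exprn_ge0 ?mod_ge0//; exact: mod_fejer_coef_le.
  - exact: taylor_abs_cvg.
  - move=> k; apply: cvg_near_cst; near=> N.
    have nN : (n + k < N)%N by near: N; exact: nbhs_infty_gt.
    rewrite /x /fejer_seq fejer_coef_eq//; last by lia.
    by have -> : (n <= N)%N by lia.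
apply: cvg_trans h; apply: near_eq_cvg; near=> N.
have nN : (n <= N)%N by near: N; exact: nbhs_infty_ge.
by rewrite /fejer_avg /taylor_series /x nN.
Unshelve. all: by end_near. Qed.

Lemma jensen_sum (I : finType) (l x : I -> R) : (forall i, 0 <= l i) -> \sum_i l i = 1 ->
  (forall i, 0 <= x i) -> (\sum_i l i * x i) `^ p <= \sum_i l i * x i `^ p.
Proof.
move=> l0 l1 x0; set c := \sum_i l i * x i.
have c0 : 0 <= c by apply: sumr_ge0 => i _; rewrite mulr_ge0.
have pp : 0 < p := lt_trans ltr01 p1.
have h : \sum_i l i * (x i * c `^ (p - 1)) <= \sum_i l i * (x i `^ p / p + c `^ p * (1 - p^-1)).
  by apply: ler_sum => i _; rewrite ler_wpM2l// young_tangent.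
have e1 : \sum_i l i * (x i * c `^ (p - 1)) = c * c `^ (p - 1).
  by rewrite /c mulr_suml; apply: eq_bigr => i _; rewrite mulrA.
have e2 : \sum_i l i * (x i `^ p / p + c `^ p * (1 - p^-1)) =
    (\sum_i l i * x i `^ p) / p + c `^ p * (1 - p^-1).
  rewrite -[X in _ = _ + X]mul1r -l1 !mulr_suml -big_split /=; apply: eq_bigr => i _.
  by rewrite mulrDr mulrA.
have cp : c * c `^ (p - 1) = c `^ p.
  have [->|cn] := eqVneq c 0; first by rewrite mul0r powR0// gt_eqF.
  rewrite -{1}(powRr1 c0) -powRD ?cn ?implybT//; congr powR; ring.
rewrite e1 e2 cp in h.
have : c `^ p / p <= (\sum_i l i * x i `^ p) / p by lra.
by rewrite ler_pM2r ?invr_gt0.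
Qed.

(** Jensen's inequality for the weights [l j], then rotation invariance of each integral. *)
Lemma wint_fejer_avg_le N : (n < N)%N ->
  (wint alpha p (fun z => modulus (fejer_avg N z)) <= wint alpha p (fun z => modulus (f z)))%E.
Proof.
move=> nN; have N0 : (0 < N)%N by lia.
have [w pw] := @primitive_root_exists R N N0.
pose l (j : 'I_N) := fejer_weight N w n j.
have l0 j : 0 <= l j by exact: fejer_weight_ge0.
have l1 : \sum_j l j = 1.
  have := sum_fejer_weight N0 pw n 0; rewrite fejer_coef_eq ?addn0// subn0 divff ?pnatr_eq0 -?lt0n//.
  under eq_bigr do rewrite expr0 mulr1.
  by move=> h; have := congr1 (@complex.Re R) h; rewrite Re_sum.
have FE z : modulus z < 1 -> fejer_avg N z = \sum_j (l j)%:C * f (w ^+ j * z).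
  move=> z1; apply: cvgC_lim.
  have h : \sum_j (l j)%:C * taylor_series a (w ^+ j * z) M @[M --> \oo] --> (\sum_j (l j)%:C * f (w ^+ j * z) : C).
    apply: cvgC_sum => j; apply: cvgCM; first exact: cvg_cst.
    by apply: fa; rewrite /unit_disk /= modM (mod_prim_rootX N0 pw) mul1r.
  apply: cvg_trans h; apply: near_eq_cvg; apply: nearW => M.
  rewrite /taylor_series /series /=; under eq_bigr do rewrite mulr_sumr.
  rewrite exchange_big /=; apply: eq_bigr => m _.
  rewrite -(sum_fejer_weight N0 pw) !mulr_suml; apply: eq_bigr => j _.
  by rewrite exprMn /l; ring.
have le z : modulus z < 1 -> modulus (fejer_avg N z) `^ p <= \sum_j l j * modulus (f (w ^+ j * z)) `^ p.
  move=> z1; apply: le_trans (jensen_sum l0 l1 (fun j => mod_ge0 (f (w ^+ j * z)))).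
  apply: ge0_ler_powR; rewrite ?nnegrE ?mod_ge0 ?(ltW (lt_trans ltr01 p1))//.
    by apply: sumr_ge0 => j _; rewrite mulr_ge0 ?mod_ge0.
  rewrite (FE z z1); apply: le_trans (mod_sum _ _ _) _.
  by apply: ler_sum => j _; rewrite modM mod_real ger0_norm.
have mf : measurable_fun (@disk2 R) (fun w => modulus (f (w.1 +i* w.2))).
  by apply: measurable_modulus; exact: cmeasurable_expansion.
pose wt (v : R * R) : R := (1 - modulus (v.1 +i* v.2) ^+ 2) `^ alpha.
have mwt : measurable_fun (@disk2 R) wt.
  apply: measurable_funTS; apply: measurable_powR_comp; apply: measurable_funB; first exact: measurable_cst.
  by apply: measurable_funX; apply: measurable_modulus; exact: cmeasurable_plane.
have mfj (j : 'I_N) : measurable_fun (@disk2 R) (fun v => modulus (f (w ^+ j * (v.1 +i* v.2)))).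
  apply: measurable_modulus.
  apply: (@cmeasurable_cvg _ _ _ _ (fun M v => taylor_series a (w ^+ j * (v.1 +i* v.2)) M)).
  - exact: measurable_disk2.
  - move=> M; apply: cmeasurableS; apply: cmeasurable_sum => k; apply: cmeasurableM; first exact: cmeasurable_cst.
    apply: cmeasurableX; apply: cmeasurableM; first exact: cmeasurable_cst.
    exact: cmeasurable_plane.
  - by move=> v Dv; apply: fa; rewrite /unit_disk /= modM (mod_prim_rootX N0 pw) mul1r.
have mF : measurable_fun (@disk2 R) (fun v => modulus (fejer_avg N (v.1 +i* v.2))).
  by apply: measurable_modulus; apply: cmeasurable_fejer_avg; lia.
have mjw (j : 'I_N) : measurable_fun (@disk2 R) (fun v : R * R =>
    modulus (f (w ^+ j * (v.1 +i* v.2))) `^ p * wt v).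
  by apply: measurable_funM; [apply: measurable_powR_comp; exact: mfj|exact: mwt].
apply: (@le_trans _ _ (\int[mu \x mu]_(v in @disk2 R) \sum_j ((l j)%:E *
    (modulus (f (w ^+ j * (v.1 +i* v.2))) `^ p * wt v)%:E))%E).
  apply: ge0_le_integral; first exact: measurable_disk2.
  - by move=> v _; rewrite lee_fin mulr_ge0 ?powR_ge0.
  - apply/measurable_EFinP; apply: measurable_funM; last exact: mwt.
    exact: measurable_powR_comp.
  - apply: emeasurable_sum => j; apply: measurable_funeM; apply/measurable_EFinP.
    exact: mjw.
  move=> v Dv; rewrite sumEFin lee_fin.
  under eq_bigr do rewrite mulrA.
  by rewrite -mulr_suml ler_wpM2r ?powR_ge0//; apply: le.
rewrite ge0_integral_sum; last 3 first.
- exact: measurable_disk2.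
- move=> j; apply: measurable_funeM; apply/measurable_EFinP.
  exact: mjw.
- by move=> j v _; rewrite mule_ge0 ?lee_fin ?l0// mulr_ge0 ?powR_ge0.
have -> : wint alpha p (fun z => modulus (f z)) = (\sum_j (l j)%:E * wint alpha p (fun z => modulus (f z)))%E.
  rewrite -ge0_sume_distrl; last by move=> j _; rewrite lee_fin.
  by rewrite sumEFin l1 mul1e.
apply: lee_sum => j _.
have -> : (\int[mu \x mu]_(v in @disk2 R) ((l j)%:E * (modulus (f (w ^+ j * (v.1 +i* v.2))) `^ p * wt v)%:E) =
    (l j)%:E * wint alpha p (fun z => modulus (f (w ^+ j * z)%R)%R))%E.
  apply: ge0_integralZl_EFin.
  - exact: measurable_disk2.
  - by move=> v _; rewrite lee_fin mulr_ge0 ?powR_ge0.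
  - by apply/measurable_EFinP; exact: mjw.
  - exact: l0.
apply: lee_wpmul2l; first by rewrite lee_fin.
by rewrite (@wint_rotation (fun z => modulus (f z)) (w ^+ j) (mod_prim_rootX N0 pw j) mf).
Qed.

(** Fatou's lemma as the number of rotations tends to infinity with [n] fixed. *)
Lemma wint_fejer_le :
  (wint alpha p (fun z => modulus (taylor_series fejer_seq z n)) <= wint alpha p (fun z => modulus (f z)))%E.
Proof.
apply: (@wint_fatou (fun N => fejer_avg (n + N).+1)).
- by move=> N; apply: cmeasurable_fejer_avg; lia.
- move=> z z1; have := fejer_avg_cvg z1.
  rewrite -(cvg_shiftn n.+1); apply: cvg_trans; apply: near_eq_cvg; apply: nearW => N /=.
  by rewrite addnS addnC.
- by move=> N; apply: wint_fejer_avg_le; lia.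
Qed.

End FejerMeans.

(** * Norms of the functions [(1 - z)^(- c)] *)

Section TestFunctionNorms.
Context {R : realType}.
Local Notation C := R[i]^o.
Local Notation mu := (@lebesgue_measure R).
Implicit Types (x y t u v c e : R) (z : C).
Local Notation I01 := `](0 : R), (1 : R)[%classic.

Lemma powR_half_le x c : 2^-1 <= x -> x <= 1 -> x `^ c <= 1 + 2^-1 `^ c.
Proof.
move=> x2 x1; have x0 : 0 < x by apply: lt_le_trans x2; rewrite invr_gt0.
have [c0|c0] := leP 0 c.
  apply: (@le_trans _ _ 1); last by rewrite lerDl powR_ge0.
  by rewrite -[leRHS](powRr0 x); apply: ger_powR => //; rewrite x0.
apply: (@le_trans _ _ (2^-1 `^ c)); last by rewrite lerDr.
have -> : c = - (- c) by rewrite opprK.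
rewrite !(powRN _ (- c)) lef_pV2 ?posrE ?powR_gt0 ?invr_gt0//.
by apply: ge0_ler_powR; rewrite ?nnegrE ?invr_ge0 ?(ltW x0)// oppr_ge0 ltW.
Qed.

Definition ebeta c e : \bar R := (\int[mu]_(u in I01) (u `^ (c - 1) * (1 - u) `^ (e - 1))%:E)%E.

Lemma measurable_beta_kernel c e : measurable_fun [set: R] (fun u => u `^ (c - 1) * (1 - u) `^ (e - 1)).
Proof.
by apply: measurable_funM; apply: measurable_powR_comp => //; exact: measurable_funB.
Qed.

Lemma ebeta_lt_pinfty c e : 0 < c -> 0 < e -> (ebeta c e < +oo)%E.
Proof.
move=> c0 e0.
pose K := (1 + 2^-1 `^ (c - 1)) + (1 + 2^-1 `^ (e - 1)).
have K0 : 0 <= K by rewrite !addr_ge0 ?powR_ge0.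
have m1 : measurable_fun I01 (fun u : R => (u `^ (c - 1))%:E).
  by apply: measurable_funTS; apply/measurable_EFinP; exact: measurable_powR.
have m2 : measurable_fun I01 (fun u : R => ((1 - u) `^ (e - 1))%:E).
  apply: measurable_funTS; apply/measurable_EFinP; apply: measurable_powR_comp.
  exact: measurable_funB.
have i2 : (\int[mu]_(t in I01) ((1 - t) `^ (e - 1))%:E = (e^-1)%:E)%E.
  rewrite (@integral_onem _ (fun t => (t `^ (e - 1))%:E)).
  - exact: integral_powR01.
  - by apply/measurable_EFinP; exact: measurable_powR.
  - by move=> x; rewrite lee_fin powR_ge0.
have i1 : (\int[mu]_(t in I01) (t `^ (c - 1))%:E = (c^-1)%:E)%E by exact: integral_powR01.
apply: (@le_lt_trans _ _ (\int[mu]_(u in I01) (K%:E * ((u `^ (c - 1))%:E + ((1 - u) `^ (e - 1))%:E)))%E).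
  apply: ge0_le_integral; first exact: measurable_itv.
  - by move=> u _; rewrite lee_fin mulr_ge0 ?powR_ge0.
  - by apply: measurable_funTS; apply/measurable_EFinP; exact: measurable_beta_kernel.
  - by apply: measurable_funeM; exact: emeasurable_funD.
  move=> u; rewrite /= in_itv /= => /andP[u0 u1]; rewrite -EFinD -EFinM lee_fin.
  have P1 := powR_ge0 u (c - 1); have P2 := powR_ge0 (1 - u) (e - 1).
  have Q1 := powR_ge0 2^-1 (c - 1) : 0 <= _ :> R; have Q2 := powR_ge0 2^-1 (e - 1) : 0 <= _ :> R.
  have [u2|u2] := leP u 2^-1.
    have : (1 - u) `^ (e - 1) <= 1 + 2^-1 `^ (e - 1) by apply: powR_half_le; lra.
    by rewrite /K; nra.
  have : u `^ (c - 1) <= 1 + 2^-1 `^ (c - 1) by apply: powR_half_le; lra.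
  by rewrite /K; nra.
have -> : (\int[mu]_(u in I01) (K%:E * ((u `^ (c - 1))%:E + ((1 - u) `^ (e - 1))%:E)) =
   K%:E * (\int[mu]_(u in I01) (u `^ (c - 1))%:E + \int[mu]_(u in I01) ((1 - u) `^ (e - 1))%:E))%E.
  rewrite -ge0_integralD//; last 2 first.
  - by move=> t _; rewrite lee_fin powR_ge0.
  - by move=> t _; rewrite lee_fin powR_ge0.
  apply: ge0_integralZl_EFin => //; first by move=> t _; rewrite -EFinD lee_fin addr_ge0 ?powR_ge0.
  exact: emeasurable_funD.
by rewrite i1 i2 -EFinD -EFinM ltry.
Qed.

(** This is the rate of blow-up as [c] tends to 0; the condition [e <= 1] makes the second factor at
    least 1. *)
Lemma ebeta_ge c e : 0 < c -> 0 < e -> e <= 1 -> ((c^-1)%:E <= ebeta c e)%E.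
Proof.
move=> c0 e0 e1.
have <- : (\int[mu]_(t in I01) (t `^ (c - 1))%:E = (c^-1)%:E)%E by exact: integral_powR01.
apply: ge0_le_integral; first exact: measurable_itv.
- by move=> u _; rewrite lee_fin powR_ge0.
- by apply: measurable_funTS; apply/measurable_EFinP; exact: measurable_powR.
- by apply: measurable_funTS; apply/measurable_EFinP; exact: measurable_beta_kernel.
move=> u; rewrite /= in_itv /= => /andP[u0 u1]; rewrite lee_fin ler_peMr ?powR_ge0//.
rewrite -[leLHS](powRr0 (1 - u)); apply: ger_powR; last by lra.
by apply/andP; split; lra.
Qed.

(* In the coordinates [x + i x v] of the half-plane, the mass of [(1 - z)^(- c)] is the
   product of an integral in the slope [v] and, after [x = 1 / (2 u)], a Beta integral. *)
Definition slope_int e : \bar R := (\int[mu]_v ((1 + v ^+ 2) `^ (- e))%:E)%E.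

Lemma measurable_slope e : measurable_fun [set: R] (fun v => (1 + v ^+ 2) `^ (- e)).
Proof.
apply: measurable_powR_comp; apply: measurable_funD; first exact: measurable_cst.
exact: measurable_funX.
Qed.

(** The integrand is even. For [0 < v <= 1] it is at most 1, and inversion turns [v > 1] into an
    integrand on []0, 1[] below [t^(2 e - 2)], which is integrable as [e > 1 / 2]. *)
Lemma slope_int_lt_pinfty e : 2^-1 < e -> (slope_int e < +oo)%E.
Proof.
move=> e2.
have e0 : 0 <= e by lra.
have sq0 v : 0 <= v ^+ 2 by exact: sqr_ge0.
pose g v := (1 + v ^+ 2) `^ (- e).
have mg : measurable_fun [set: R] (fun v => (g v)%:E) by apply/measurable_EFinP; exact: measurable_slope.
have cg : continuous g.
  move=> v; apply: (@continuous_comp _ _ _ (fun v => 1 + v ^+ 2) (fun x => x `^ (- e))).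
    by apply: continuousD; [exact: cst_continuous|exact: exprn_continuous].
  by apply: powR_cvg_gt0; have := sq0 v; lra.
rewrite /slope_int (@ge0_symfun_integralT _ g); last 3 first.
- by move=> v; exact: powR_ge0.
- exact: cg.
- by move=> v; rewrite /g /= sqrrN.
rewrite (_ : [set x | 0 <= x] = `[0%R, +oo[%classic); last first.
  by apply/seteqP; split => x /=; rewrite in_itv /= andbT.
rewrite -integral_itv_obnd_cbnd; last by exact: measurable_funTS.
pose h v : \bar R := if 1 < v then (g v)%:E else 0%E.
have mh : measurable_fun [set: R] h.
  by apply: measurable_fun_if => //; [exact: measurable_fun_ltr|exact: measurable_funTS].
have h0 v : (0 <= h v)%E by rewrite /h; case: ifP => // _; rewrite lee_fin powR_ge0.
apply: lte_mul_pinfty => //.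
have i1 : (\int[mu]_(t in I01) (t `^ (2 * e - 1 - 1))%:E = ((2 * e - 1)^-1)%:E)%E.
  by apply: integral_powR01; lra.
have hle : (\int[mu]_(v in `]0%R, +oo[) h v <= ((2 * e - 1)^-1)%:E)%E.
  rewrite (ge0_integral_inv mh h0) -i1 [leRHS]integral_mkcond [leLHS]integral_mkcond.
  apply: ge0_le_integral; first exact: measurableT.
  - by move=> x _; apply: erestrict_ge0 => y _; rewrite mule_ge0// lee_fin invr_ge0.
  - apply: measurable_patch => //; apply: emeasurable_funM.
      by apply: (measurableT_comp mh); exact: measurable_inv.
    by apply/measurable_EFinP; apply: measurable_funV; exact: measurable_funX.
  - by apply: measurable_patch => //; apply/measurable_EFinP; exact: measurable_powR.
  move=> x _; rewrite !patchE !mem_setE !in_itv /= andbT.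
  case: ifPn => x0; last by rewrite andFb.
  rewrite /h invf_gt1//= ; case: ifPn => x1; last by rewrite mul0e.
  rewrite -EFinM lee_fin /g.
  have -> : 1 + x^-1 ^+ 2 = x `^ (- 2%:R) * (1 + x ^+ 2).
    by rewrite powRN powR_mulrn ?(ltW x0)//; field; rewrite gt_eqF.
  rewrite powRM ?powR_ge0//; last by have := sq0 x; lra.
  rewrite -powRrM (_ : x ^- 2 = x `^ (- 2%:R)); last by rewrite powRN powR_mulrn// ltW.
  rewrite mulrAC -powRD; last by apply/implyP => _; rewrite gt_eqF.
  rewrite (_ : - 2%:R * - e + - 2%:R = 2 * e - 1 - 1); last by ring.
  rewrite ler_piMr ?powR_ge0// powRN invf_le1 ?powR_gt0//; last by have := sq0 x; lra.
  rewrite -[leLHS](powRr0 (1 + x ^+ 2)); apply: ler_powR => //.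
  by have := sq0 x; lra.
apply: (@le_lt_trans _ _ (\int[mu]_(v in `]0%R, +oo[) (\1_(`]0%R, 1%R]%classic) v)%:E +
   \int[mu]_(v in `]0%R, +oo[) h v)%E).
  rewrite -ge0_integralD//; last 2 first.
  - by apply/measurable_EFinP; apply: measurable_funTS; exact: measurable_indic.
  - exact: measurable_funTS.
  apply: ge0_le_integral => //.
  - by move=> v _; rewrite lee_fin powR_ge0.
  - exact: measurable_funTS.
  - apply: emeasurable_funD; last exact: measurable_funTS.
    by apply/measurable_EFinP; apply: measurable_funTS; exact: measurable_indic.
  move=> v; rewrite /= in_itv /= andbT => v0.
  rewrite indicE mem_setE in_itv /= v0 /= /h; case: leP => v1; last by rewrite add0e.
  rewrite adde0 lee_fin /g powRN invf_le1 ?powR_gt0//; last by have := sq0 v; lra.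
  rewrite -[leLHS](powRr0 (1 + v ^+ 2)); apply: ler_powR => //.
  by have := sq0 v; lra.
apply: (@le_lt_trans _ _ (1%:E + ((2 * e - 1)^-1)%:E)%E); last by rewrite -EFinD ltry.
apply: leeD hle; rewrite integral_indic//.
apply: (@le_trans _ _ (mu `]0%R, 1%R]%classic)).
  by apply: le_measure; rewrite ?inE//; apply: measurableI.
by rewrite lebesgue_measure_itv /= lte_fin ltr01 oppr0 adde0.
Qed.

Lemma slope_int_ge e : 0 <= e -> ((2 `^ (- e))%:E <= slope_int e)%E.
Proof.
move=> e0; apply: (@le_trans _ _ (\int[mu]_(v in I01) ((1 + v ^+ 2) `^ (- e))%:E)%E); last first.
  apply: ge0_subset_integral => //.
  - by apply/measurable_EFinP; exact: measurable_slope.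
  - by move=> x _; rewrite lee_fin powR_ge0.
have <- : (\int[mu]_(v in I01) (2 `^ (- e))%:E = (2 `^ (- e))%:E)%E.
  have mI : mu I01 = 1%E by rewrite lebesgue_measure_itv /= lte_fin ltr01 oppr0 adde0.
  by rewrite integral_cst//= [X in (_ * X)%E]mI mule1.
apply: ge0_le_integral; first exact: measurable_itv.
- by move=> v _; rewrite lee_fin powR_ge0.
- exact: measurable_cst.
- by apply: measurable_funTS; apply/measurable_EFinP; exact: measurable_slope.
move=> v; rewrite /= in_itv /= => /andP[v0 v1]; rewrite lee_fin !powRN lef_pV2 ?posrE ?powR_gt0//; last first.
  by have := sqr_ge0 v; lra.
apply: ge0_ler_powR; rewrite ?nnegrE//; last by nra.
by have := sqr_ge0 v; lra.
Qed.

Variables (alpha p c : R).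
Hypotheses (al : -1 < alpha) (p0 : 0 < p).
(** The exponent in [|1 + i v|^(c p - q p) = (1 + v^2)^(- e)]. *)
Let e := alpha + 2 - c * p / 2.
Let q := 2 * (alpha + 2) / p.
Let qp : q * p = 2 * (alpha + 2). Proof. by rewrite divfK// gt_eqF. Qed.

Lemma measurable_test : measurable_fun [set: R * R] (fun w => modulus (1 - (w.1 +i* w.2)) `^ (- c)).
Proof.
apply: measurable_powR_comp; apply: measurable_modulus.
by apply: cmeasurableD; [exact: cmeasurable_cst|apply: cmeasurableN; exact: cmeasurable_plane].
Qed.

Lemma test_inv z : modulus (1 - (1 - z^-1)) `^ (- c) = modulus z `^ c.
Proof. by rewrite subKr modV -powR_inv1 ?mod_ge0// -powRrM mulN1r opprK. Qed.

Lemma test_modE x v : 0 < x ->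
  (modulus (x +i* (x * v + 0)) `^ c * modulus (x +i* (x * v + 0)) `^ (- q)) `^ p =
  x `^ (c * p - 2 * alpha - 4) * (1 + v ^+ 2) `^ (- e).
Proof.
move=> x0; have o0 : 0 < 1 + v ^+ 2 by have := sqr_ge0 v; lra.
have mz : modulus (x +i* (x * v + 0)) = x * (1 + v ^+ 2) `^ (2^-1).
  apply/eqP; rewrite -(@eqrXn2 _ 2)// ?mod_ge0 ?mulr_ge0 ?powR_ge0 ?(ltW x0)//.
  have h2 : (1 + v ^+ 2) `^ 2^-1 ^+ 2 = 1 + v ^+ 2.
    by rewrite -powR_mulrn ?powR_ge0// -powRrM mulVf// powRr1// ltW.
  by rewrite sqr_mod exprMn h2 /=; apply/eqP; ring.
have m0 : 0 < modulus (x +i* (x * v + 0)) by rewrite mz mulr_gt0 ?powR_gt0.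
rewrite -powRD; last by apply/implyP => _; rewrite gt_eqF.
rewrite -powRrM mz powRM ?powR_ge0 ?(ltW x0)// -powRrM mulrBl qp.
by congr (powR _ _ * powR _ _); rewrite /e; field.
Qed.

Lemma test_slice x : 0 < x ->
  (\int[mu]_y ((modulus (x +i* y) `^ c * modulus (x +i* y) `^ (- q)) `^ p)%:E =
   (x `^ (c * p - 2 * alpha - 3))%:E * slope_int e)%E.
Proof.
move=> x0.
have mF : measurable_fun [set: R] (fun y => ((modulus (x +i* y) `^ c * modulus (x +i* y) `^ (- q)) `^ p)%:E).
  have cx : measurable_fun [set: R] (fun y => modulus (x +i* y)).
    by apply: measurable_modulus; split; [exact: measurable_cst|exact: measurable_id].
  apply/measurable_EFinP; apply: measurable_powR_comp; apply: measurable_funM.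
    exact: measurable_powR_comp.
  exact: measurable_powR_comp.
have F0 y : (0 <= ((modulus (x +i* y) `^ c * modulus (x +i* y) `^ (- q)) `^ p)%:E)%E.
  by rewrite lee_fin powR_ge0.
have gx := ger0_norm (ltW x0).
rewrite (@ge0_integral_affine _ x 0 _ (lt0r_neq0 x0) mF F0) gx.
have -> : (\int[mu]_v ((modulus (x +i* (x * v + 0)) `^ c * modulus (x +i* (x * v + 0)) `^ (- q)) `^ p)%:E =
  \int[mu]_v ((x `^ (c * p - 2 * alpha - 4))%:E * ((1 + v ^+ 2) `^ (- e))%:E))%E.
  by apply: eq_integral => v _; rewrite -EFinM test_modE.
have ms : measurable_fun [set: R] (fun v => ((1 + v ^+ 2) `^ (- e))%:E).
  by apply/measurable_EFinP; exact: measurable_slope.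
have s0 v : (0 <= ((1 + v ^+ 2) `^ (- e))%:E)%E by rewrite lee_fin powR_ge0.
rewrite (ge0_integralZT (powR_ge0 _ _) ms s0) -/(slope_int e).
rewrite muleA -EFinM; congr (_%:E * _)%E.
rewrite -{1}(powRr1 (ltW x0)) -powRD; last by apply/implyP => _; rewrite gt_eqF.
by congr powR; ring.
Qed.

(** The first Beta argument [alpha + 2 - c p] tends to 0 as [c] tends to [(alpha + 2) / p]; this is
    the source of the blow-up. *)
Lemma wint_test :
  (wint alpha p (fun z => (modulus (1 - z) `^ (- c))%R) =
   (2 `^ (2 * alpha + 2 - c * p))%:E * slope_int e * ebeta (alpha + 2 - c * p) (alpha + 1))%E.
Proof.
rewrite (wint_halfplane qp); last 2 first.
- by move=> z; exact: powR_ge0.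
- exact: measurable_test.
pose G x : \bar R := if 2^-1 < x then ((2 * x - 1) `^ alpha * x `^ (c * p - 2 * alpha - 3))%:E else 0%E.
have mG : measurable_fun [set: R] G.
  apply: measurable_fun_if => //; first exact: measurable_fun_ltr.
  apply: measurable_funTS; apply/measurable_EFinP; apply: measurable_funM.
    by apply: measurable_powR_comp; exact: measurable_affine.
  exact: measurable_powR.
have G0 x : (0 <= G x)%E by rewrite /G; case: ifP => // _; rewrite lee_fin mulr_ge0 ?powR_ge0.
have s0 : (0 <= slope_int e)%E by apply: integral_ge0 => v _; rewrite lee_fin powR_ge0.
have -> : (\int[mu]_(x in `]2^-1%R, +oo[) (((2 * x - 1) `^ alpha)%:E *
    \int[mu]_y ((modulus (1 - (1 - (x +i* y)^-1)) `^ (- c) * modulus (x +i* y) `^ (- q)) `^ p)%:E) =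
   \int[mu]_x (slope_int e * G x))%E.
  rewrite integral_mkcond; apply: eq_integral => x _; rewrite patchE mem_setE in_itv /= andbT /G.
  case: ifP => x0; last by rewrite mule0.
  have x1 : 0 < x by apply: lt_trans x0; rewrite invr_gt0.
  have -> : (\int[mu]_y ((modulus (1 - (1 - (x +i* y)^-1)) `^ (- c) * modulus (x +i* y) `^ (- q)) `^ p)%:E =
     \int[mu]_y ((modulus (x +i* y) `^ c * modulus (x +i* y) `^ (- q)) `^ p)%:E)%E.
    by apply: eq_integral => y _; rewrite test_inv.
  by rewrite test_slice// muleA muleC -EFinM.
rewrite (ge0_integralZl mu measurableT mG (fun x _ => G0 x) s0).
have -> : (\int[mu]_x G x = (2 `^ (2 * alpha + 2 - c * p))%:E * ebeta (alpha + 2 - c * p) (alpha + 1))%E.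
  have h2 : (2^-1 : R) != 0 by rewrite invr_eq0.
  have mG2 : measurable_fun [set: R] (fun x => G (2^-1 * x + 0)).
    by apply: (measurableT_comp mG); exact: measurable_affine.
  rewrite (@ge0_integral_affine _ 2^-1 0 _ h2 mG G0) ger0_norm//.
  have -> : (\int[mu]_x G (2^-1 * x + 0)%R = \int[mu]_(x in `]0%R, +oo[) G (2^-1 * x + 0)%R)%E.
    rewrite [RHS]integral_mkcond; apply: eq_integral => x _; rewrite patchE mem_setE in_itv /= andbT.
    case: ifPn => // x0; rewrite /G; case: ifP => // x1.
    by move: x0 => /negP; case; have : (0 : R) < 2^-1 by []; lra.
  rewrite (ge0_integral_inv mG2 (fun x => G0 _)).
  have -> : (\int[mu]_(x in `]0%R, +oo[) (G (2^-1 * x^-1 + 0)%R * (x ^- 2)%:E) =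
     \int[mu]_x ((2 `^ (2 * alpha + 3 - c * p))%:E *
       ((fun u => (u `^ (alpha + 2 - c * p - 1) * (1 - u) `^ (alpha + 1 - 1))%:E) \_ I01) x))%E.
    rewrite [LHS]integral_mkcond; apply: eq_integral => u _; rewrite !patchE !mem_setE !in_itv /= andbT.
    case: ifPn => u0; last by rewrite mule0.
    rewrite /G addr0 -[X in X < _]mulr1 ltr_pM2l ?invr_gt0// invf_gt1//.
    case: ifPn => u1; last by rewrite mul0e mule0.
    rewrite -!EFinM; congr EFin.
    have -> : 2 * (2^-1 * u^-1) - 1 = u^-1 * (1 - u) by field; rewrite gt_eqF.
    have u1' : 0 <= 1 - u by lra.
    rewrite !powRM ?invr_ge0 ?(ltW u0)//.
    have uV r : u^-1 `^ r = u `^ (- r) by rewrite -powR_inv1 ?(ltW u0)// -powRrM mulN1r.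
    have -> : 2^-1 `^ (c * p - 2 * alpha - 3) = 2 `^ (2 * alpha + 3 - c * p) :> R.
      by rewrite -powR_inv1// -powRrM mulN1r; congr powR; ring.
    rewrite !uV (_ : u ^- 2 = u `^ (- 2%:R)); last by rewrite powRN powR_mulrn// ltW.
    rewrite (_ : alpha + 1 - 1 = alpha); last by ring.
    have -> : u `^ (alpha + 2 - c * p - 1) = u `^ (- alpha) * u `^ (- (c * p - 2 * alpha - 3)) * u `^ (- 2%:R).
      rewrite -!powRD; try by apply/implyP => _; rewrite gt_eqF.
      by congr powR; ring.
    by ring.
  have mb : measurable_fun [set: R] ((fun u => (u `^ (alpha + 2 - c * p - 1) * (1 - u) `^ (alpha + 1 - 1))%:E) \_ I01).
    by apply: measurable_patch => //; apply/measurable_EFinP; exact: measurable_beta_kernel.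
  rewrite (ge0_integralZT (powR_ge0 _ _) mb); last first.
    by move=> x; apply: erestrict_ge0 => u _; rewrite lee_fin mulr_ge0 ?powR_ge0.
  rewrite -integral_mkcond -/(ebeta _ _) muleA -EFinM; congr (_%:E * _)%E.
  rewrite -powR_inv1// -powRD; last by rewrite pnatr_eq0 implybT.
  by congr powR; ring.
by rewrite muleA [(slope_int e * _)%E]muleC.
Qed.

Lemma wint_test_lt_pinfty : c * p < alpha + 2 ->
  (wint alpha p (fun z => (modulus (1 - z) `^ (- c))%R) < +oo)%E.
Proof.
move=> cp; rewrite wint_test; apply: lte_mul_pinfty.
- by rewrite mule_ge0 ?lee_fin ?powR_ge0//; apply: integral_ge0 => v _; rewrite lee_fin powR_ge0.
- rewrite fin_numM// ge0_fin_numE; last by apply: integral_ge0 => v _; rewrite lee_fin powR_ge0.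
  by apply: slope_int_lt_pinfty; rewrite /e; have := al; have := cp; lra.
- by apply: ebeta_lt_pinfty; have := al; have := cp; lra.
Qed.

End TestFunctionNorms.

(** * Summability of [|a_k| / (k + 1)] for functions of the Bergman space *)

Section CoefficientSummability.
Context {R : realType}.
Local Notation C := R[i]^o.
Local Notation mu := (@lebesgue_measure R).
Implicit Types (x y : R) (z : C) (a g : nat -> C) (n k : nat).

(** Two exponents below [n] differ by less than [n + 1], so [n + 1] roots of unity suffice for
    orthogonality. *)
Lemma parseval n (w : C) g z : n.+1.-primitive_root w ->
  \sum_(j < n.+1) modulus (taylor_series g (w ^+ j * z) n) ^+ 2 =
  n.+1%:R * \sum_(k < n) modulus (g k * z ^+ k) ^+ 2.
Proof.
move=> pw; pose h k : C := g k * z ^+ k; pose N := n.+1; have N0 : (0 < N)%N by [].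
have sE j : (modulus (taylor_series g (w ^+ j * z) n) ^+ 2)%:C =
    \sum_(k < n) \sum_(l < n) h k * (h l)^*%C * (w ^+ j) ^+ (k + N.-1 * l) :> C.
  have -> : taylor_series g (w ^+ j * z) n = \sum_(k < n) h k * (w ^+ j) ^+ k.
    rewrite /taylor_series /series /= big_mkord; apply: eq_bigr => k _.
    by rewrite exprMn /h; ring.
  set S := \sum_(k < n) h k * (w ^+ j) ^+ k.
  have -> : (modulus S ^+ 2)%:C = S * (S^*)%C.
    by apply: complex_eqP; rewrite mulrC ?Re_conjM//; case: (S) => x y /=; ring.
  rewrite /S rmorph_sum /= mulr_suml; apply: eq_bigr => k _; rewrite mulr_sumr.
  apply: eq_bigr => l _; rewrite rmorphM rmorphXn /= exprD exprM -(conj_prim_rootX N0 pw).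
  by ring.
suff : (\sum_(j < N) modulus (taylor_series g (w ^+ j * z) n) ^+ 2)%:C =
    (N%:R * \sum_(k < n) modulus (h k) ^+ 2)%:C :> C by move=> /(congr1 (@complex.Re R)).
rewrite rmorph_sum /=; under eq_bigr do rewrite sE.
rewrite exchange_big rmorphM rmorph_nat rmorph_sum mulr_sumr /=; apply: eq_bigr => k _.
rewrite exchange_big /= (bigD1 k)//= [X in _ + X]big1 ?addr0.
  rewrite -mulr_sumr (prim_root_sum pw) -[(k + n * k)%N]addn0 (fejer_dvd N0); last first.
    by have := ltn_ord k; rewrite /N; lia.
  rewrite addn0 modn_small ?eqxx; last by have := ltn_ord k; rewrite /N; lia.
  rewrite mulrC; congr (_ * _).
  by apply: complex_eqP; rewrite mulrC ?Re_conjM//; case: (h k) => x y /=; ring.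
move=> l lk; rewrite -mulr_sumr (prim_root_sum pw) -[(k + n * l)%N]addn0 (fejer_dvd N0); last first.
  by have := ltn_ord l; rewrite /N; lia.
rewrite addn0 modn_small; last by have := ltn_ord k; rewrite /N; lia.
by rewrite (_ : (_ == _) = false) ?mulr0//; apply/negbTE.
Qed.

Lemma measurable_disk_weight (b : R) :
  measurable_fun [set: R * R] (fun w => (1 - modulus (w.1 +i* w.2) ^+ 2) `^ b).
Proof.
apply: measurable_powR_comp; apply: measurable_funB; first exact: measurable_cst.
by apply: measurable_funX; apply: measurable_modulus; exact: cmeasurable_plane.
Qed.

(** The constant 1 is the test function with [c = 0]. *)
Lemma wint_one_lt_pinfty (b : R) : -1 < b -> (wint b 1 (fun=> 1%R : R) < +oo)%E.
Proof.
move=> b1.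
have -> : wint b 1 (fun=> 1%R : R) = wint b 1 (fun z : C => (modulus (1 - z) `^ (- 0))%R).
  by apply: eq_integral => w _; rewrite oppr0 powRr0.
by apply: wint_test_lt_pinfty => //; rewrite mul0r; lra.
Qed.

(** Only the order [1 / (k + 1)] matters. The points with [0 < x < 1 / 2] at vertical distance less
    than [h] below the upper arc fill an area [h / 2]; there [|z|^2 >= 1 - 2 h], and Bernoulli's
    inequality bounds the integrand below by [1 / 2]. *)
Lemma integral_disk_pow k :
  (((16 * k.+1%:R)^-1)%:E <=
   \int[mu \x mu]_(w in @disk2 R) ((modulus (w.1 +i* w.2) ^+ 2) ^+ k)%:E)%E.
Proof.
pose F (w : R * R) : \bar R := ((modulus (w.1 +i* w.2) ^+ 2) ^+ k)%:E.
have mF : measurable_fun [set: R * R] F.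
  apply/measurable_EFinP; apply: measurable_funX; apply: measurable_funX.
  by apply: measurable_modulus; exact: cmeasurable_plane.
have mG : measurable_fun [set: R * R] (F \_ (@disk2 R)).
  by apply: measurable_patch => //; exact: measurable_disk2.
have G0 w : (0 <= (F \_ (@disk2 R)) w)%E.
  by apply: erestrict_ge0 => v _; rewrite lee_fin exprn_ge0// exprn_ge0// mod_ge0.
have -> : (\int[mu \x mu]_(w in @disk2 R) ((modulus (w.1 +i* w.2) ^+ 2) ^+ k)%:E =
   \int[mu]_x \int[mu]_y (F \_ (@disk2 R)) (x, y))%E.
  by rewrite integral_mkcond tonelli.
pose h : R := (4 * k.+1%:R)^-1.
have h0 : 0 < h by rewrite invr_gt0 mulr_gt0.
have kh : 4 * h * k.+1%:R = 1.
  by rewrite /h mulrAC divff// mulf_neq0.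
have h4 : h <= 4^-1 by rewrite lef_pV2 ?posrE// ?mulr_gt0// ler_peMr// ler1n.
apply: (@le_trans _ _ (\int[mu]_(x in `]0%R, 2^-1%R[) (h / 2)%:E)%E).
  rewrite integral_cst//= lebesgue_measure_itv /= lte_fin invr_gt0 ltr0n /= oppr0 adde0 -EFinM lee_fin.
  have : (k.+1%:R : R) != 0 by []; rewrite /h; set K := k.+1%:R => K0.
  by rewrite (_ : (4 * K)^-1 / 2 / 2 = (16 * K)^-1)//; field.
have mI : measurable_fun [set: R] (fun x => \int[mu]_y (F \_ (@disk2 R)) (x, y))%E.
  by apply: (@measurable_fun_fubini_tonelli_F _ _ _ _ _ mu (F \_ (@disk2 R))).
apply: (@le_trans _ _ (\int[mu]_(x in `]0%R, 2^-1%R[) \int[mu]_y (F \_ (@disk2 R)) (x, y))%E); last first.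
  apply: ge0_subset_integral => //.
  by move=> x _; apply: integral_ge0 => y _.
apply: ge0_le_integral; first exact: measurable_itv.
- by move=> x _; rewrite lee_fin divr_ge0// ltW.
- exact: measurable_cst.
- exact: measurable_funTS.
move=> x; rewrite /= in_itv /= => /andP[x0 x2].
pose b := Num.sqrt (1 - x ^+ 2).
have b2 : b ^+ 2 = 1 - x ^+ 2 by rewrite sqr_sqrtr//; nra.
have bh : 2^-1 < b.
  rewrite -(@ltr_pXn2r _ 2)// ?nnegrE ?sqrtr_ge0 ?invr_ge0//.
  by rewrite b2; nra.
have b1 : b <= 1 by rewrite -sqrtr1 ler_sqrt//; nra.
apply: (@le_trans _ _ (\int[mu]_(y in `](b - h)%R, b[) (2^-1)%:E)%E).
  rewrite integral_cst//= lebesgue_measure_itv /= lte_fin ltrBlDr ltrDl h0 -EFinD -EFinM lee_fin.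
  by lra.
have mS : measurable_fun [set: R] (fun y => (F \_ (@disk2 R)) (x, y)) by exact: measurable_section1.
apply: (@le_trans _ _ (\int[mu]_(y in `](b - h)%R, b[) (F \_ (@disk2 R)) (x, y))%E); last first.
  exact: ge0_subset_integral.
apply: ge0_le_integral; first exact: measurable_itv.
- by move=> y _; rewrite lee_fin.
- exact: measurable_cst.
- exact: measurable_funTS.
move=> y; rewrite /= in_itv /= => /andP[y1 y2].
have y0 : 0 < y by lra.
have yb : y ^+ 2 < b ^+ 2 by nra.
have D : disk2 (x, y) by apply/disk2E => /=; lra.
rewrite patchE mem_set// lee_fin.
have m : 1 - 2 * h <= modulus (x +i* y) ^+ 2 by rewrite sqr_mod /=; nra.
apply: (@le_trans _ _ ((1 - 2 * h) ^+ k)); last by apply: lerXn2r; rewrite ?nnegrE ?exprn_ge0 ?mod_ge0//; lra.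
have bern j : 1 - 2 * h * j%:R <= (1 - 2 * h) ^+ j.
  elim: j => [|j IH]; first by rewrite mulr0 subr0 expr0.
  rewrite exprS -natr1; have : 0 <= j%:R :> R by [].
  have h1 : 0 <= 1 - 2 * h by lra.
  have := ler_wpM2l h1 IH; nra.
apply: le_trans (bern k); have : k.+1%:R = k%:R + 1 :> R by rewrite natr1.
by move=> e; rewrite e in kh; nra.
Qed.

(* With [W = 1 - |z|^2], Young's inequality bounds the integral of [|g|^2 W^beta] by the
   Bergman norm; by Parseval it controls the [|g_k|^2 |z|^(2 k) W^beta], and
   AM-GM against [|z|^(2 k) W^(- beta)], whose sum is at most [W^(- 1 - beta)], gives
   the [|g_k| |z|^(2 k)]. Everything is integrable because [- 1 / 2 < beta < 0]. *)
Variables (alpha p : R).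
Hypotheses (al0 : alpha <= 0) (p2 : 2 < p).
(** For [y = W^(- 1 / (2 p))] the inequality [x^2 y^(p - 2) <= x^p + y^p] produces exactly the
    weights [W^beta] and [W^(- 1 / 2)]. *)
Let beta : R := - ((p - 2) / (2 * p)).

(** The [p]-th power of the larger of [x] and [y] bounds the left side by itself. *)
Lemma powR_young x y : 0 <= x -> 0 < y -> x `^ 2 * y `^ (p - 2) <= x `^ p + y `^ p.
Proof.
have p2' := p2; move=> x0 y0; have [xy|yx] := leP x y.
  apply: (@le_trans _ _ (y `^ p)); last by rewrite lerDr powR_ge0.
  rewrite [leRHS](_ : _ = y `^ 2 * y `^ (p - 2)); last first.
    by rewrite -powRD ?(gt_eqF y0) ?implybT//; congr powR; ring.
  by apply: ler_wpM2r; rewrite ?powR_ge0//; apply: ge0_ler_powR; rewrite // nnegrE ltW.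
have {}x0 : 0 < x by exact: lt_trans yx.
apply: (@le_trans _ _ (x `^ p)); last by rewrite lerDl powR_ge0.
rewrite [leRHS](_ : _ = x `^ 2 * x `^ (p - 2)); last first.
  by rewrite -powRD ?(gt_eqF x0) ?implybT//; congr powR; ring.
by apply: ler_wpM2l; rewrite ?powR_ge0//; apply: ge0_ler_powR; rewrite ?nnegrE ?ltW//; lra.
Qed.

Lemma young_weight x y : 0 <= x -> 0 < y -> y <= 1 ->
  x `^ 2 * y `^ beta <= x `^ p * y `^ alpha + y `^ (- 2^-1).
Proof.
have p2' := p2; move=> x0 y0 y1; have := powR_young x0 (powR_gt0 (- (2 * p)^-1) y0).
rewrite -!powRrM (_ : - (2 * p)^-1 * (p - 2) = beta); last by rewrite /beta; field; lra.
rewrite (_ : - (2 * p)^-1 * p = - 2^-1); last by field; lra.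
move=> h; apply: le_trans h _; rewrite lerD2r ler_peMr ?powR_ge0//.
by rewrite -[leLHS](powRr0 y); apply: ger_powR => //; rewrite y0.
Qed.

Lemma poly_l2_le g n :
  (wint beta 2 (fun z => modulus (taylor_series g z n)) <=
   wint alpha p (fun z => modulus (taylor_series g z n)) + wint (- 2^-1) 1 (fun=> 1%R : R))%E.
Proof.
have mg : measurable_fun [set: R * R] (fun w => modulus (taylor_series g (w.1 +i* w.2) n)).
  by apply: measurable_modulus; exact: measurable_taylor.
have m1 := measurable_funTS (D := @disk2 R) (@measurable_wint_integrand _ alpha p
  (fun z => modulus (taylor_series g z n)) mg).
have m2 := measurable_funTS (D := @disk2 R) (@measurable_wint_integrand _ (- 2^-1) 1
  (fun=> 1 : R) (measurable_cst (1 : R))).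
have m3 := measurable_funTS (D := @disk2 R) (@measurable_wint_integrand _ beta 2
  (fun z => modulus (taylor_series g z n)) mg).
rewrite /wint -ge0_integralD; [|exact: measurable_disk2|
  by move=> w _; rewrite lee_fin mulr_ge0 ?powR_ge0|exact: m1|
  by move=> w _; rewrite lee_fin mulr_ge0 ?powR_ge0|exact: m2].
apply: ge0_le_integral; first exact: measurable_disk2.
- by move=> w _; rewrite lee_fin mulr_ge0 ?powR_ge0.
- exact: m3.
- exact: emeasurable_funD.
move=> w Dw; rewrite -EFinD lee_fin powR1 mul1r; have m0 := mod_ge0 (w.1 +i* w.2).
have m1' : modulus (w.1 +i* w.2) < 1 := Dw.
by apply: young_weight; [exact: mod_ge0|nra|nra].
Qed.

(** Rotation invariance replaces the squared modulus by its mean over [n + 1] rotations, to which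
    Parseval applies at each point. *)
Lemma poly_l2E g n :
  (wint beta 2 (fun z => modulus (taylor_series g z n)) =
   \int[mu \x mu]_(w in @disk2 R) ((\sum_(k < n) modulus (g k * (w.1 +i* w.2) ^+ k) ^+ 2) *
     (1 - modulus (w.1 +i* w.2) ^+ 2) `^ beta)%:E)%E.
Proof.
have [w pw] := @primitive_root_exists R n.+1 (ltn0Sn n).
pose G z := modulus (taylor_series g z n).
have mG : measurable_fun [set: R * R] (fun v => G (v.1 +i* v.2)).
  by apply: measurable_modulus; exact: measurable_taylor.
have eq j : wint beta 2 (fun z => G (w ^+ j * z)) = wint beta 2 G.
  apply: wint_rotation.
    by rewrite (mod_prim_rootX (ltn0Sn n) pw).
  exact: measurable_funTS.
have mj (j : 'I_n.+1) : measurable_fun (@disk2 R) (fun v : R * R =>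
    (G (w ^+ j * (v.1 +i* v.2)) `^ 2 * (1 - modulus (v.1 +i* v.2) ^+ 2) `^ beta)%:E).
  apply: measurable_funTS; apply: (@measurable_wint_integrand _ _ _ (fun z => G (w ^+ j * z))).
  apply: (measurable_cplane_comp mG); apply: cmeasurableM; first exact: cmeasurable_cst.
  exact: cmeasurable_plane.
have n0 : n.+1%:R != 0 :> R by [].
have s : (\sum_(j < n.+1) wint beta 2 (fun z => G (w ^+ j * z)%R) = n.+1%:R%:E * wint beta 2 G)%E.
  under eq_bigr do rewrite eq -[wint _ _ _]mul1e.
  by rewrite -ge0_sume_distrl// sumEFin sumr_const card_ord.
have s1 : (\sum_(j < n.+1) wint beta 2 (fun z => G (w ^+ j * z)%R) =
    \int[mu \x mu]_(v in @disk2 R) \sum_(j < n.+1) (G (w ^+ j * (v.1 +i* v.2)) `^ 2 *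
      (1 - modulus (v.1 +i* v.2) ^+ 2) `^ beta)%:E)%E.
  apply/esym; apply: ge0_integral_sum; [exact: measurable_disk2|exact: mj|].
  by move=> j v _; rewrite lee_fin mulr_ge0 ?powR_ge0.
have -> : wint beta 2 (fun z => modulus (taylor_series g z n)) =
    ((n.+1%:R^-1)%:E * \sum_(j < n.+1) wint beta 2 (fun z => G (w ^+ j * z)%R))%E.
  by rewrite s muleA -EFinM mulVf// mul1e.
rewrite s1; apply: (@eq_trans _ _ (\int[mu \x mu]_(v in @disk2 R) ((n.+1%:R^-1)%:E *
  \sum_(j < n.+1) (G (w ^+ j * (v.1 +i* v.2)) `^ 2 *
      (1 - modulus (v.1 +i* v.2) ^+ 2) `^ beta)%:E))%E).
  apply/esym; apply: ge0_integralZl_EFin; first exact: measurable_disk2.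
  - by move=> v _; apply: sume_ge0 => j _; rewrite lee_fin mulr_ge0 ?powR_ge0.
  - exact: emeasurable_sum.
  - by rewrite invr_ge0.
apply: eq_integral => v _; rewrite sumEFin -EFinM; congr EFin.
rewrite -mulr_suml mulrA; congr (_ * _).
under eq_bigr do rewrite powR_mulrn ?mod_ge0//.
by rewrite parseval// mulKf.
Qed.

Lemma poly_coef_le g n :
  ((\sum_(k < n) modulus (g k) / (16 * k.+1%:R))%:E <=
   wint beta 2 (fun z => modulus (taylor_series g z n)) + wint (- 1 - beta) 1 (fun=> 1%R : R))%E.
Proof.
pose Q k (w : R * R) := modulus (g k) * (modulus (w.1 +i* w.2) ^+ 2) ^+ k.
have mz : measurable_fun [set: R * R] (fun w => modulus (w.1 +i* w.2)).
  by apply: measurable_modulus; exact: cmeasurable_plane.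
have mk k : measurable_fun (@disk2 R) (fun w : R * R => ((modulus (w.1 +i* w.2) ^+ 2) ^+ k)%:E).
  by apply: measurable_funTS; apply/measurable_EFinP; apply: measurable_funX; exact: measurable_funX.
have mQ k : measurable_fun (@disk2 R) (fun w => (Q k w)%:E).
  apply: measurable_funTS; apply/measurable_EFinP; apply: measurable_funM; first exact: measurable_cst.
  by apply: measurable_funX; exact: measurable_funX.
have Q0 k w : 0 <= Q k w by rewrite mulr_ge0 ?exprn_ge0 ?mod_ge0.
have eQ k : (\int[mu \x mu]_(w in @disk2 R) (Q k w)%:E = (modulus (g k))%:E *
    \int[mu \x mu]_(w in @disk2 R) ((modulus (w.1 +i* w.2) ^+ 2) ^+ k)%:E)%E.
  transitivity (\int[mu \x mu]_(w in @disk2 R) ((modulus (g k))%:E *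
      ((modulus (w.1 +i* w.2) ^+ 2) ^+ k)%:E))%E.
    by apply: eq_integral => w _; rewrite -EFinM.
  apply: ge0_integralZl_EFin.
  - exact: measurable_disk2.
  - by move=> w _; rewrite lee_fin !exprn_ge0 ?mod_ge0.
  - exact: mk.
  - exact: mod_ge0.
apply: (@le_trans _ _ (\int[mu \x mu]_(w in @disk2 R) (\sum_(k < n) (Q k w)%:E))%E).
  rewrite ge0_integral_sum; last 3 first.
  - exact: measurable_disk2.
  - by move=> k; exact: mQ.
  - by move=> k w _; rewrite lee_fin.
  rewrite -sumEFin; apply: lee_sum => k _; rewrite eQ EFinM.
  by apply: lee_wpmul2l; [rewrite lee_fin mod_ge0|exact: integral_disk_pow].
pose A (w : R * R) := (\sum_(k < n) modulus (g k * (w.1 +i* w.2) ^+ k) ^+ 2) *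
     (1 - modulus (w.1 +i* w.2) ^+ 2) `^ beta.
have A0 w : 0 <= A w by rewrite mulr_ge0 ?powR_ge0//; apply: sumr_ge0 => k _; rewrite exprn_ge0 ?mod_ge0.
have mA : measurable_fun (@disk2 R) (fun w => (A w)%:E).
  apply: measurable_funTS; apply/measurable_EFinP; apply: measurable_funM; last exact: measurable_disk_weight.
  apply: measurable_sum => k; apply: measurable_funX; apply: measurable_modulus.
  by apply: cmeasurableM; [exact: cmeasurable_cst|apply: cmeasurableX; exact: cmeasurable_plane].
have m2 := measurable_funTS (D := @disk2 R) (@measurable_wint_integrand _ (- 1 - beta) 1
  (fun=> 1 : R) (measurable_cst (1 : R))).
rewrite poly_l2E /wint -ge0_integralD; [|exact: measurable_disk2|
  by move=> w _; rewrite lee_fin A0|exact: mA|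
  by move=> w _; rewrite lee_fin mulr_ge0 ?powR_ge0|exact: m2].
apply: ge0_le_integral; first exact: measurable_disk2.
- by move=> w _; apply: sume_ge0 => k _; rewrite lee_fin.
- by apply: emeasurable_sum => k; exact: mQ.
- exact: emeasurable_funD.
move=> w Dw; rewrite sumEFin -EFinD lee_fin powR1 mul1r /A /Q; set z := _ +i* _.
have z0 : 0 <= modulus z ^+ 2 by rewrite sqr_ge0.
have z1 : modulus z ^+ 2 < 1 by rewrite expr_lt1 ?mod_ge0.
have -> : \sum_(k < n) modulus (g k * z ^+ k) ^+ 2 = \sum_(k < n) modulus (g k) ^+ 2 * (modulus z ^+ 2) ^+ k.
  by apply: eq_bigr => k _; rewrite modM modX exprMn exprAC.
set y := 1 - _; have y0 : 0 < y by rewrite /y; lra.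
have -> : y `^ (- 1 - beta) = y^-1 * y `^ (- beta).
  by rewrite -powR_inv1 ?(ltW y0)// -powRD// (gt_eqF y0) implybT.
have yb : y `^ beta * y `^ (- beta) = 1.
  by rewrite -powRD ?(gt_eqF y0) ?implybT// subrr powRr0.
apply: (@le_trans _ _ ((\sum_(k < n) modulus (g k) ^+ 2 * (modulus z ^+ 2) ^+ k) * y `^ beta +
   (\sum_(k < n) (modulus z ^+ 2) ^+ k) * y `^ (- beta))).
  rewrite !mulr_suml -big_split /=; apply: ler_sum => k _.
  set u := modulus (g k); set v := (_ ^+ 2) ^+ k.
  have v0 : 0 <= v by rewrite exprn_ge0.
  have -> : u ^+ 2 * v * y `^ beta + v * y `^ (- beta) = (u ^+ 2 * y `^ beta + y `^ (- beta)) * v by ring.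
  rewrite ler_wpM2r//.
  have := sqr_ge0 (u * y `^ beta - 1); have b0 := powR_gt0 beta y0.
  have b1 := powR_gt0 (- beta) y0; have u0 : 0 <= u := mod_ge0 _.
  have -> : y `^ (- beta) = (y `^ beta)^-1 by rewrite powRN.
  move=> h; rewrite -(ler_pM2r b0) mulrDl mulVf ?gt_eqF//.
  by move: h; have := mulr_ge0 u0 (ltW b0); set B := y `^ beta; nra.
rewrite lerD2l ler_wpM2r ?powR_ge0//.
rewrite -[leRHS]mul1r ler_pdivlMr// mulrC.
have := subrX1 (modulus z ^+ 2) n; have : 0 <= (modulus z ^+ 2) ^+ n by rewrite exprn_ge0.
by rewrite /y; nra.
Qed.

(** The estimates for polynomials have constants independent of the degree, and the Fejer
    polynomials of [f] have no larger norm than [f], so the partial sums stay bounded. *)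
Lemma taylor_hsummable (f : C -> C) a : taylor_expansion f a -> alpha > -1 ->
  (wint alpha p (fun z => modulus (f z)) < +oo)%E -> hsummable a.
Proof.
move=> fa al fp; have p2' := p2.
pose M := (wint alpha p (fun z => modulus (f z)) + wint (- 2^-1) 1 (fun=> 1%R : R) +
  wint (- 1 - beta) 1 (fun=> 1%R : R))%E.
have w0 (c q : R) (h : C -> R) : (0 <= wint c q h)%E.
  by apply: integral_ge0 => w _; rewrite lee_fin mulr_ge0 ?powR_ge0.
have b0 : beta < 0 by rewrite /beta oppr_lt0 divr_gt0//; lra.
have Mf : M \is a fin_num.
  have M0 : (0 <= M)%E by apply: adde_ge0; [apply: adde_ge0|]; exact: w0.
  rewrite ge0_fin_numE//; apply: lte_add_pinfty; last by apply: wint_one_lt_pinfty; lra.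
  apply: lte_add_pinfty; [exact: fp|apply: wint_one_lt_pinfty; lra].
apply: nondecreasing_is_cvgn.
  by apply: nondecreasing_series => k _ _; rewrite divr_ge0// mod_ge0.
(* For [k < m] and [n = 2 m + 1] the Fejer factor is at least [1 / 2]; with the 16 of
   [integral_disk_pow] this gives 32. *)
exists (32 * fine M) => _ [m _ <-]; pose n := (2 * m).+1.
have := poly_coef_le (fejer_seq a n) n.
move=> /le_trans /(_ (leeD2r _ (poly_l2_le _ _))).
have hf := wint_fejer_le alpha (lt_trans (ltr1n _ 2 : (1 : R) < 2) p2) fa (ltn0Sn (2 * m)).
move=> /le_trans /(_ (leeD2r _ (leeD2r _ hf))).
rewrite -/M -(fineK Mf) lee_fin => h.
rewrite /series /= -ler_pdivrMl//; apply: le_trans h.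
have mn : (m <= n)%N by rewrite /n; lia.
rewrite -(big_mkord predT (fun k => modulus (fejer_seq a n k) / (16 * k.+1%:R))).
rewrite (big_cat_nat (leq0n m) mn)/= -[leLHS]addr0; apply: lerD; last first.
  by apply: sumr_ge0 => k _; rewrite divr_ge0 ?mod_ge0// mulr_ge0.
rewrite !big_mkord mulr_sumr; apply: ler_sum => k _.
have km := ltn_ord k.
have hk : 2^-1 <= (n - k)%:R / n%:R :> R.
  by rewrite ler_pdivlMr ?ltr0n// mulrC ler_pdivrMr// -natrM ler_nat; lia.
rewrite modM mod_real ger0_norm ?divr_ge0// !invfM.
have := mod_ge0 (a k); have : 0 <= k.+1%:R^-1 :> R by [].
set A := modulus _; set B := _^-1; set D := _ / _ in hk *; move=> B0 A0.
have := mulr_ge0 A0 B0; set E := A * B => E0.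
have -> : D * A * (16^-1 * B) = 16^-1 * D * E by rewrite /E; ring.
by nra.
Qed.

End CoefficientSummability.

(** * The upper bound for general functions *)

Section UpperBound.
Context {R : realType}.
Local Notation C := R[i]^o.
Variables (alpha p b : R).
Hypotheses (al : -1 < alpha) (p1 : 1 < p) (pal : 2 * (alpha + 2) <= p) (b0 : 0 <= b).

Lemma fejer_seq_cvg (a : nat -> C) k : fejer_seq a n k @[n --> \oo] --> a k.
Proof.
rewrite -[X in _ --> X]mul1r; apply: cvgCM; last exact: cvg_cst.
apply/(@cvgC_modP _ _ _ (@filter_filter _ _ eventually_filter)).
apply: (@squeeze_cvgr _ _ _ _ (fun=> 0) (fun n => k%:R / (n + 0)%:R)); last 2 first.
- exact: cvg_cst.
- exact: cvg_harmonic_shift.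
near=> n; have n0 : (0 < n)%N by near: n; exact: nbhs_infty_gt.
have kn : (k <= n)%N by near: n; exact: nbhs_infty_ge.
have n0' : n%:R != 0 :> R by rewrite pnatr_eq0 -lt0n.
rewrite mod_ge0 /= addn0 (_ : _ - _ = ((n - k)%:R / n%:R - 1)%:C); last by rewrite rmorphB rmorph1.
rewrite mod_real natrB// (_ : _ - 1 = - (k%:R / n%:R)); last by field.
by rewrite normrN ger0_norm.
Unshelve. all: by end_near. Qed.

(** Fatou's lemma along the Fejer polynomials of [f]: their coefficients are dominated by those of
    [f], so the images converge at every point of the disk. *)
Lemma wint_hilbert_le (f : C -> C) a : taylor_expansion f a -> hsummable a ->
  (wint alpha p (fun z => modulus (hilbert_op b a z)) <=
   (hbeta alpha p b `^ p)%:E * wint alpha p (fun z => modulus (f z)))%E.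
Proof.
move=> fa sa; have B0 := powR_ge0 (hbeta alpha p b) p.
have tE n : trunc (fejer_seq a n) n = fejer_seq a n.
  apply/funext => k; rewrite /trunc; case: ltnP => // nk.
  by rewrite /fejer_seq (eqP nk) mul0r rmorph0 mul0r.
(* The shift to [N.+1] excludes the degenerate Fejer mean with [n = 0]. *)
apply: (@wint_fatou _ _ _ p1 (fun N => hilbert_op b (fejer_seq a N.+1))).
- by move=> N; rewrite -tE; apply: cmeasurable_hilbert_op => //; exact: trunc_summable.
- move=> z z1; apply: hilbert_op_cvg => //; first by move=> N k; exact: fejer_seq_le.
  by move=> k; have := @fejer_seq_cvg a k; rewrite -cvg_shiftS.
move=> N; rewrite -tE; apply: le_trans (wint_hilbert_poly_le al p1 pal b0 _ _) _.
apply: lee_wpmul2l; first by rewrite lee_fin.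
exact: wint_fejer_le.
Qed.

End UpperBound.

(** * The lower bound, by concentration of test functions at 1 *)

Section LowerBound.
Context {R : realType}.
Local Notation C := R[i]^o.
Local Notation mu := (@lebesgue_measure R).
Local Notation I01 := `](0 : R), (1 : R)[%classic.
Implicit Types (t d c r : R) (z w : C).

Definition test_seq c k : C := (binc c k)%:C.
Definition test_fun c z : C := cpow (- c) (1 - z).

Lemma Re_onem_gt0 z : modulus z < 1 -> 0 < complex.Re (1 - z).
Proof.
by move=> z1; rewrite ReCD ReCN /=; have := Re_le_mod z; have := ler_norm (complex.Re z); lra.
Qed.

Lemma cpow_inv c w : 0 < complex.Re w -> 0 < complex.Re w^-1 -> cpow (- c) w^-1 = cpow c w.
Proof.
move=> w0 v0; have wn : w != 0 by rewrite -mod_gt0 Re_gt0_mod.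
have h : cpow (- c) w != 0 by rewrite -mod_gt0 mod_cpow powR_gt0// mod_gt0.
apply: (mulIf h); rewrite -cpowD// subrr cpow0 -cpowM//; last by rewrite mulVf//= ltr01.
by rewrite mulVf// -[1]/((1 : R)%:C) cpow_real// powR1.
Qed.

Lemma mod_tkern_lt1 t z : 0 < t -> t < 1 -> modulus z < 1 -> modulus (t%:C * kern t z : C) < 1.
Proof.
move=> t0 t1 z1; rewrite modM mod_real (gtr0_norm t0) modV.
have h : t < modulus (1 - (1 - t)%:C * z).
  have e : modulus (1 : C) <= modulus (1 - (1 - t)%:C * z) + modulus ((1 - t)%:C * z).
    by apply: le_trans (modD _ _); rewrite subrK.
  rewrite mod1 modM mod_real ger0_norm in e; last by lra.
  by have := mod_ge0 z; nra.
by rewrite ltr_pdivrMr ?mul1r// (lt_trans t0).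
Qed.

(** Because [1 - t / w = (1 - t) (1 - z) / w], where all the numbers to which [cpowM] is applied
    have positive real part. *)
Lemma test_transform c t z : 0 < t -> t < 1 -> modulus z < 1 ->
  kern t z * test_fun c (t%:C * kern t z) =
  ((1 - t) `^ (- c))%:C * test_fun c z * cpow (c - 1) (1 - (1 - t)%:C * z).
Proof.
move=> t0 t1 z1; have t1' : 0 < 1 - t by rewrite subr_gt0.
rewrite /test_fun /kern; set w := 1 - (1 - t)%:C * z.
have w0 : 0 < complex.Re w by apply: Re_onem_gt0; exact: mod_onem_mul.
have wn : w != 0 by rewrite -mod_gt0 Re_gt0_mod.
have v0 : 0 < complex.Re w^-1.
  rewrite (_ : w^-1 = (modulus w ^- 2)%:C * (w^*)%C).
    by rewrite ReZ pmulr_rgt0 ?invr_gt0 ?exprn_gt0 ?mod_gt0//; case: (w) w0.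
  apply: (mulIf wn); rewrite mulVf// -mulrA.
  have -> : (w^*)%C * w = (modulus w ^+ 2)%:C.
    by apply: complex_eqP; rewrite ?Re_conjM//; case: (w) => x y /=; ring.
  by rewrite -rmorphM /= mulVf ?rmorph1// expf_neq0// gt_eqF// mod_gt0.
have r0 : 0 < complex.Re (1 - t%:C / w) by apply: Re_onem_gt0; exact: mod_tkern_lt1.
have e : 1 - t%:C / w = (1 - t)%:C * ((1 - z) / w).
  apply: (mulIf wn); rewrite mulrBl mul1r divfK// -mulrA divfK// /w rmorphB rmorph1; ring.
have q0 : 0 < complex.Re ((1 - z) / w) by move: r0; rewrite e ReZ pmulr_rgt0.
have tn : 0 < complex.Re ((1 - t)%:C : C) by [].
rewrite [in LHS]e (cpowM _ tn q0) -?e// (cpowM _ (Re_onem_gt0 z1) v0 q0) cpow_inv// cpow_real//.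
by rewrite addrC cpowD// cpowN1//; ring.
Qed.

(** A lower bound for the real part of [(1 - t)^(b - c) w^(c - 1)] when [|1 - z| <= d]: there
    [Re w >= t] and [|w| <= t + d]. Letting [d] tend to 0 and [c] to [s] gives [kweight]. *)
Definition test_kernel (b c d t : R) : R := (1 - t) `^ (b - c) * (t * (t + d) `^ (c - 2)).

Lemma test_kernel_ge0 b c d t : 0 <= t -> 0 <= test_kernel b c d t.
Proof. by move=> t0; rewrite !mulr_ge0 ?powR_ge0. Qed.

Lemma measurable_test_kernel b c d : measurable_fun [set: R] (test_kernel b c d).
Proof.
apply: measurable_funM; first by apply: measurable_powR_comp; exact: measurable_funB.
by apply: measurable_funM => //; apply: measurable_powR_comp; exact: measurable_funD.
Qed.

(** With the conjugate of [f] at [z] as multiplier, the integrand is the squared modulus of [f]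
    times a factor of positive real part, so nothing cancels in the integral. *)
Lemma hilbert_test_ge (b c d r : R) z : 0 <= b -> 0 < c -> c < 1 -> hsummable (test_seq c) ->
  (r%:E <= \int[mu]_(t in I01) (test_kernel b c d t)%:E)%E ->
  modulus z < 1 -> modulus (1 - z) <= d ->
  r * modulus (test_fun c z) <= modulus (hilbert_op b (test_seq c) z).
Proof.
move=> b0 c0 c1 sa rle z1 zd; set f := test_fun c z.
have f0 : 0 < modulus f by rewrite mod_cpow powR_gt0// Re_gt0_mod// Re_onem_gt0.
have aT t : 0 < t < 1 -> taylor_series (test_seq c) (t%:C * kern t z) n @[n --> \oo] -->
    test_fun c (t%:C * kern t z).
  by case/andP => t0 t1; apply: cvg_binomial_series; [exact: ltW|exact: ltW|exact: mod_tkern_lt1].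
have h := hilbert_op_integral b0 (f^*)%C sa z1 aT.
have hi := hilbert_op_integrable b0 (f^*)%C sa z1 aT.
rewrite -(ler_pM2l f0); apply: (@le_trans _ _ (complex.Re ((f^*)%C * hilbert_op b (test_seq c) z))); last first.
  by apply: le_trans (ler_norm _) (le_trans (Re_le_mod _) _); rewrite modM mod_conj.
rewrite -lee_fin h mulrCA mulrA -mulrA -expr2 mulrC EFinM.
apply: (@le_trans _ _ ((modulus f ^+ 2)%:E * \int[mu]_(t in I01) (test_kernel b c d t)%:E)%E).
  by apply: lee_wpmul2l => //; rewrite lee_fin exprn_ge0// mod_ge0.
have tk0 t : I01 t -> (0 <= (test_kernel b c d t)%:E)%E.
  by rewrite /= in_itv /= => /andP[t0 _]; rewrite lee_fin test_kernel_ge0// ltW.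
have mt : measurable_fun I01 (fun t => (test_kernel b c d t)%:E).
  by apply: measurable_funTS; apply/measurable_EFinP; exact: measurable_test_kernel.
rewrite -(@ge0_integralZl_EFin _ _ _ mu I01 _ _ tk0 mt (modulus f ^+ 2))//; last first.
  by rewrite exprn_ge0// mod_ge0.
apply: ge0_le_integral; first exact: measurable_itv.
- by move=> t tt; rewrite mule_ge0 ?tk0// lee_fin exprn_ge0// mod_ge0.
- exact: measurable_funeM.
- by case/integrableP: hi.
move=> t; rewrite /= in_itv /= => /andP[t0 t1]; rewrite -EFinM lee_fin test_transform// -/f.
set w := 1 - (1 - t)%:C * z; set X := cpow _ w.
have t1' : 0 < 1 - t by rewrite subr_gt0.
have -> : (f^*)%C * (((1 - t) `^ (- c))%:C * f * X) = (modulus f ^+ 2 * (1 - t) `^ (- c))%:C * X.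
  have ff : (modulus f ^+ 2)%:C = (f^*)%C * f.
    by apply: complex_eqP; rewrite ?Re_conjM//; case: (f) => x y /=; ring.
  by rewrite rmorphM /= ff -!mulrA; congr (_ * _); rewrite mulrCA.
rewrite ReZ /test_kernel powRD ?(gt_eqF t1') ?implybT//.
have rew x y u v : x * (y * u * v) = y * (x * u) * v :> R by ring.
rewrite [leRHS]rew [leLHS]mulrA; apply: ler_wpM2l.
  by apply: mulr_ge0; [exact: sqr_ge0|rewrite mulr_ge0 ?powR_ge0].
have wE : w = t%:C + (1 - t)%:C * (1 - z) by rewrite /w rmorphB rmorph1; ring.
have z0 := Re_onem_gt0 z1.
have wR : t <= complex.Re w.
  by rewrite wE ReCD ReZ /= lerDl mulr_ge0// ltW.
have w0 : 0 < complex.Re w := lt_le_trans t0 wR.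
have wd : modulus w <= t + d.
  rewrite wE; apply: le_trans (modD _ _) _; rewrite modM !mod_real !ger0_norm ?(ltW t0) ?(ltW t1')//.
  by rewrite lerD2l; have := mod_ge0 (1 - z); nra.
apply: (@le_trans _ _ (modulus w `^ (c - 1 - 1) * complex.Re w)); last by apply: Re_cpow_ge => //; lra.
rewrite mulrC; apply: ler_pM => //; [exact: powR_ge0|exact: ltW|].
rewrite (_ : c - 1 - 1 = - (2 - c)); last by ring.
rewrite (_ : c - 2 = - (2 - c)); last by ring.
have m0 := Re_gt0_mod w0.
rewrite !(powRN _ (2 - c)) lef_pV2 ?posrE ?powR_gt0//; last exact: lt_le_trans wd.
by apply: ge0_ler_powR; rewrite ?nnegrE ?(ltW m0) ?(le_trans (ltW m0) wd)//; lra.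
Qed.

Variables (alpha p b K : R).
Hypotheses (al : -1 < alpha) (al0 : alpha < 0) (p1 : 1 < p) (pal : 2 * (alpha + 2) <= p) (b0 : 0 <= b).
Local Notation s := ((alpha + 2) / p).

Let p0 : 0 < p. Proof. exact: lt_trans p1. Qed.
Let sp : s * p = alpha + 2. Proof. by rewrite divfK// gt_eqF. Qed.
Let s0 : 0 < s. Proof. by rewrite divr_gt0//; have := al; lra. Qed.
Let s1 : s < 1. Proof. by rewrite ltr_pdivrMr// mul1r; have := pal; have := al; lra. Qed.

Local Notation test_mass c := (wint alpha p (fun z => modulus (test_fun c z))).

Lemma test_massE c : test_mass c = wint alpha p (fun z => (modulus (1 - z) `^ (- c))%R).
Proof. by apply: eq_integral => w _; rewrite mod_cpow. Qed.

Lemma test_mass_lt_pinfty c : c < s -> (test_mass c < +oo)%E.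
Proof.
by move=> cs; rewrite test_massE; apply: wint_test_lt_pinfty => //; rewrite -sp ltr_pM2r.
Qed.

Lemma test_mass_ge c : 0 < c -> c < s -> (((8 * (alpha + 2 - c * p))^-1)%:E <= test_mass c)%E.
Proof.
move=> c0 cs; rewrite test_massE wint_test//.
have cp : c * p < alpha + 2 by rewrite -sp ltr_pM2r.
have cp0 : 0 < c * p by rewrite mulr_gt0.
have [h1 h2] := (al, al0).
have e0 : 0 < alpha + 2 - c * p by lra.
(* [2^(2 alpha + 2 - c p) >= 1 / 2] because the exponent exceeds [alpha > - 1], and the slope
   integral is at least [2^(- 2)] because its exponent is below 2. *)
apply: (@le_trans _ _ ((2^-1)%:E * (4^-1)%:E * ((alpha + 2 - c * p)^-1)%:E)%E).
  rewrite -!EFinM lee_fin invfM (_ : 8^-1 = 2^-1 * 4^-1 :> R)//.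
  by rewrite -invfM -natrM.
have k1 : ((2^-1)%:E <= (2 `^ (2 * alpha + 2 - c * p))%:E :> \bar R)%E.
  rewrite lee_fin -powR_inv1//; apply: ler_powR; last by lra.
  by rewrite ler1n.
have k2 : ((4^-1)%:E <= slope_int (alpha + 2 - c * p / 2))%E.
  apply: le_trans (slope_int_ge _); last by lra.
  rewrite lee_fin powRN (_ : 4^-1 = (2 `^ 2)^-1 :> R); last by rewrite powR_mulrn// -natrX.
  by rewrite lef_pV2 ?posrE ?powR_gt0//; apply: ler_powR; [rewrite ler1n|lra].
apply: lee_pmul.
- by rewrite -EFinM lee_fin.
- by rewrite lee_fin invr_ge0 ltW.
- by apply: lee_pmul => //; rewrite lee_fin.
- by apply: ebeta_ge => //; lra.
Qed.

Lemma test_seq_expansion c : 0 <= c -> c <= 1 -> taylor_expansion (test_fun c) (test_seq c).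
Proof. by move=> c0 c1 z z1; apply: cvg_binomial_series. Qed.

Lemma test_seq_summable c : 0 < c -> c < s -> hsummable (test_seq c).
Proof.
move=> c0 cs; have h1 := al; have h2 := pal; have h3 := s1.
apply: (@taylor_hsummable _ alpha p _ _ (test_fun c)) => //; [exact: ltW|lra|
  by apply: test_seq_expansion; lra|exact: test_mass_lt_pinfty].
Qed.

Hypothesis K0 : 0 <= K.
Hypothesis HK : forall c, 0 < c -> c < s ->
  (wint alpha p (fun z => modulus (hilbert_op b (test_seq c) z)) <= (K `^ p)%:E * test_mass c)%E.

(** Where [|1 - z| <= d] the bound of [hilbert_test_ge] applies; elsewhere the test function has
    [p]-th power at most [d^(- c p) <= d^(- (alpha + 2))], which costs an amount independent of
    [c]. *)
Lemma test_kernel_le c d r : 0 < c -> c < s -> 0 < d -> d < 1 -> 0 <= r ->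
  (r%:E <= \int[mu]_(t in I01) (test_kernel b c d t)%:E)%E ->
  ((r `^ p)%:E * test_mass c <=
   (K `^ p)%:E * test_mass c + (r `^ p * d `^ (- (alpha + 2)))%:E * wint alpha 1 (fun=> 1%R : R))%E.
Proof.
move=> c0 cs d0 d1 r0 rle.
have sa := test_seq_summable c0 cs.
apply: (@le_trans _ _ (wint alpha p (fun z => modulus (hilbert_op b (test_seq c) z)) +
   (r `^ p * d `^ (- (alpha + 2)))%:E * wint alpha 1 (fun=> 1%R : R))%E); last first.
  by apply: leeD2r; exact: HK.
have dd : 0 <= r `^ p * d `^ (- (alpha + 2)) by rewrite mulr_ge0 ?powR_ge0.
have mw : measurable_fun (@disk2 R) (fun w : R * R => (1 - modulus (w.1 +i* w.2) ^+ 2) `^ alpha).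
  by apply: measurable_funTS; exact: measurable_disk_weight.
have mf : measurable_fun (@disk2 R) (fun w : R * R => modulus (test_fun c (w.1 +i* w.2))).
  apply: measurable_modulus; apply: (@cmeasurable_expansion _ _ (test_seq c)).
  by apply: test_seq_expansion; have := s1; lra.
have mh : measurable_fun (@disk2 R) (fun w : R * R => modulus (hilbert_op b (test_seq c) (w.1 +i* w.2))).
  by apply: measurable_modulus; exact: cmeasurable_hilbert_op.
have m1 : measurable_fun (@disk2 R) (fun w : R * R =>
   (modulus (test_fun c (w.1 +i* w.2)) `^ p * (1 - modulus (w.1 +i* w.2) ^+ 2) `^ alpha)%:E).
  by apply/measurable_EFinP; apply: measurable_funM => //; exact: measurable_powR_comp.
have m2 : measurable_fun (@disk2 R) (fun w : R * R =>
   (modulus (hilbert_op b (test_seq c) (w.1 +i* w.2)) `^ p * (1 - modulus (w.1 +i* w.2) ^+ 2) `^ alpha)%:E).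
  by apply/measurable_EFinP; apply: measurable_funM => //; exact: measurable_powR_comp.
have m3 : measurable_fun (@disk2 R) (fun w : R * R =>
   (1 `^ 1 * (1 - modulus (w.1 +i* w.2) ^+ 2) `^ alpha)%:E).
  by apply/measurable_EFinP; apply: measurable_funM => //; exact: measurable_cst.
have e1 : ((r `^ p)%:E * test_mass c = \int[mu \x mu]_(w in @disk2 R) ((r `^ p)%:E *
   (modulus (test_fun c (w.1 +i* w.2)) `^ p * (1 - modulus (w.1 +i* w.2) ^+ 2) `^ alpha)%:E))%E.
  apply/esym; apply: ge0_integralZl_EFin; [exact: measurable_disk2| |exact: m1|exact: powR_ge0].
  by move=> w _; rewrite lee_fin mulr_ge0 ?powR_ge0.
have e2 : ((r `^ p * d `^ (- (alpha + 2)))%:E * wint alpha 1 (fun=> 1%R : R) =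
   \int[mu \x mu]_(w in @disk2 R) ((r `^ p * d `^ (- (alpha + 2)))%:E *
   (1 `^ 1 * (1 - modulus (w.1 +i* w.2) ^+ 2) `^ alpha)%:E))%E.
  apply/esym; apply: ge0_integralZl_EFin; [exact: measurable_disk2| |exact: m3|exact: dd].
  by move=> w _; rewrite lee_fin mulr_ge0 ?powR_ge0.
rewrite e1 e2 /wint -ge0_integralD; [|exact: measurable_disk2|
  by move=> w _; rewrite lee_fin mulr_ge0 ?powR_ge0|exact: m2|
  by move=> w _; rewrite mule_ge0// lee_fin// mulr_ge0 ?powR_ge0|exact: measurable_funeM].
apply: ge0_le_integral; first exact: measurable_disk2.
- by move=> w _; rewrite mule_ge0 ?lee_fin ?mulr_ge0 ?powR_ge0.
- exact: measurable_funeM.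
- by apply: emeasurable_funD => //; exact: measurable_funeM.
move=> w Dw; rewrite -!EFinM -EFinD lee_fin powR1 mul1r; set z := _ +i* _.
have z1 : modulus z < 1 := Dw.
rewrite !mulrA -mulrDl ler_wpM2r ?powR_ge0//.
have [zd|dz] := leP (modulus (1 - z)) d.
  apply: (@le_trans _ _ (modulus (hilbert_op b (test_seq c) z) `^ p)); last by rewrite lerDl.
  rewrite -powRM ?mod_ge0//; apply: ge0_ler_powR; rewrite ?nnegrE ?mulr_ge0 ?mod_ge0 ?(ltW p0)//.
  by apply: (@hilbert_test_ge b c d) => //; exact: lt_trans s1.
apply: (@le_trans _ _ (r `^ p * d `^ (- (alpha + 2)))); last by rewrite lerDr powR_ge0.
rewrite ler_wpM2l ?powR_ge0// mod_cpow -powRrM.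
have cp : c * p < alpha + 2 by rewrite -sp ltr_pM2r.
have cp0 : 0 <= c * p by rewrite mulr_ge0 ?ltW.
have mz0 := lt_trans d0 dz; rewrite mulNr !powRN lef_pV2 ?posrE ?powR_gt0//.
apply: (@le_trans _ _ (d `^ (c * p))).
  by apply: ger_powR; [rewrite d0 ltW|exact: ltW].
by apply: ge0_ler_powR => //; [rewrite nnegrE ltW|rewrite nnegrE mod_ge0|exact: ltW].
Qed.

Lemma cvg_powR_exp (x : R) (u : nat -> R) (l : R) : 0 < x -> u n @[n --> \oo] --> l ->
  x `^ u n @[n --> \oo] --> x `^ l.
Proof.
move=> x0 ul; rewrite /powR gt_eqF//; apply: (continuous_cvg _ (@continuous_expR R _)).
by apply: cvgM => //; exact: cvg_cst.
Qed.

(* For [r > K], the blow-up of the masses forces the integral of [test_kernel] to be at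
   most [r]; Fatou's lemma is applied to [c -> s], then to [d -> 0]. *)
Lemma hilbert_norm_ge : hbeta alpha p b <= K.
Proof.
apply/ler_addgt0Pr => e e0; set r := K + e.
have [r0 rK] : 0 <= r /\ K < r by rewrite /r; have := K0; split; lra.
(* With this choice [alpha + 2 - c n p = (alpha + 2) / (n + 2)], so the masses grow at least
   linearly in [n]; the shift by 2 keeps [c n] positive. *)
pose c (n : nat) := s - s / (n + 2)%:R.
have c0 n : 0 < c n.
  by rewrite subr_gt0 gtr_pMr// invf_lt1 ?ltr0n ?addn2// ltr1n.
have cs n : c n < s by rewrite ltrBlDr ltrDl divr_gt0// ltr0n addn2.
have cc : c n @[n --> \oo] --> s.
  rewrite -[X in _ --> X]subr0; apply: cvgB; first exact: cvg_cst.
  exact: cvg_harmonic_shift.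
have W1 : wint alpha 1 (fun=> 1%R : R) \is a fin_num.
  rewrite ge0_fin_numE; first exact: wint_one_lt_pinfty.
  by apply: integral_ge0 => w _; rewrite lee_fin mulr_ge0 ?powR_ge0.
have step1 d : 0 < d -> d < 1 -> (\int[mu]_(t in I01) (test_kernel b s d t)%:E <= r%:E)%E.
  move=> d0 d1.
  apply: (@fatou_le _ _ _ mu I01 (fun n => test_kernel b (c n) d)).
  - exact: measurable_itv.
  - by move=> n; apply: measurable_funTS; exact: measurable_test_kernel.
  - by move=> n t; rewrite /= in_itv /= => /andP[t0 _]; rewrite test_kernel_ge0// ltW.
  - move=> t; rewrite /= in_itv /= => /andP[t0 t1]; apply: cvgM.
      apply: cvg_powR_exp; first by rewrite subr_gt0.
      by apply: cvgB => //; exact: cvg_cst.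
    apply: cvgM; first exact: cvg_cst.
    apply: cvg_powR_exp; first by rewrite addr_gt0.
    by apply: cvgB => //; exact: cvg_cst.
  (* The contribution of [|1 - z| > d], independent of [c]: it cannot balance [r^p - K^p > 0] times
     unbounded masses. *)
  pose M := r `^ p * d `^ (- (alpha + 2)) * fine (wint alpha 1 (fun=> 1%R : R)).
  have rp : K `^ p < r `^ p by apply: gt0_ltr_powR; rewrite ?nnegrE.
  near=> n; rewrite leNgt; apply/negP => /ltW rle.
  have := test_kernel_le (c0 n) (cs n) d0 d1 r0 rle.
  have Nf : test_mass (c n) \is a fin_num.
    rewrite ge0_fin_numE; first exact: test_mass_lt_pinfty.
    by apply: integral_ge0 => w _; rewrite lee_fin mulr_ge0 ?powR_ge0.
  have := test_mass_ge (c0 n) (cs n).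
  rewrite -(fineK Nf) -(fineK W1) -!EFinM -EFinD !lee_fin -/M => h1 h2.
  have : M / (r `^ p - K `^ p) < fine (test_mass (c n)).
    apply: lt_le_trans h1.
    have -> : alpha + 2 - c n * p = (alpha + 2) / (n + 2)%:R.
      have -> : c n * p = s * p - s * p / (n + 2)%:R by rewrite /c; ring.
      by rewrite sp; ring.
    have a0 : 0 < 8 * (alpha + 2) by have := al; lra.
    rewrite mulrA invf_div ltr_pdivlMr//.
    apply: (@lt_trans _ _ n%:R); last by rewrite ltr_nat addn2.
    by near: n; exact: nbhs_infty_gtr.
  rewrite ltr_pdivrMr ?subr_gt0//; lra.
apply: (@le_trans _ _ r) => //; rewrite -lee_fin -(integral_kweight al p1 pal b0).
pose d (n : nat) : R := 1 / (n + 2)%:R.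
have d0 n : 0 < d n by rewrite divr_gt0// ltr0n addn2.
have d1 n : d n < 1 by rewrite ltr_pdivrMr ?ltr0n ?addn2// mul1r ltr1n.
apply: (@fatou_le _ _ _ mu I01 (fun n => test_kernel b s (d n))).
- exact: measurable_itv.
- by move=> n; apply: measurable_funTS; exact: measurable_test_kernel.
- by move=> n t; rewrite /= in_itv /= => /andP[t0 _]; rewrite test_kernel_ge0// ltW.
- move=> t; rewrite /= in_itv /= => /andP[t0 t1].
  have -> : kweight alpha p b t = (1 - t) `^ (b - s) * (t * t `^ (s - 2)).
    have <- : t `^ (s - 1) = t * t `^ (s - 2).
      rewrite -{2}(powRr1 (ltW t0)) -powRD ?(gt_eqF t0) ?implybT//.
      by congr powR; ring.
    by rewrite /kweight mulrC.
  apply: cvgM; first exact: cvg_cst.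
  apply: cvgM; first exact: cvg_cst.
  apply: (cvg_comp _ _ _ (powR_cvg_gt0 (c := s - 2) t0)).
  have h : t + d n @[n --> \oo] --> t + 0.
    by apply: cvgD; [exact: cvg_cst|exact: cvg_harmonic_shift].
  by rewrite addr0 in h.
- by apply: nearW => n; exact: step1.
Unshelve. all: by end_near. Qed.

End LowerBound.

(** * From area integrals to Bergman norms and the operator norm *)

Section OperatorNorm.
Context {R : realType}.
Local Notation C := R[i]^o.
Variables (alpha p b : R).
Hypotheses (al : -1 < alpha) (al0 : alpha < 0) (b0 : 0 <= b) (p1 : 1 < p) (pal : 2 * (alpha + 2) <= p).

Let p0 : 0 < p. Proof. exact: lt_trans p1. Qed.
Let k : R := (alpha + 1) * pi^-1.
Let k0 : 0 < k. Proof. by rewrite mulr_gt0 ?invr_gt0 ?pi_gt0//; have := al; lra. Qed.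

Lemma bergman_normE (f : C -> C) :
  bergman_norm alpha p f = ((k%:E * wint alpha p (fun z => modulus (f z))) `^ p^-1)%E.
Proof. by rewrite /k EFinM -muleA. Qed.

Lemma wint_fine (g : C -> R) : (wint alpha p g < +oo)%E ->
  exists2 x : R, 0 <= x & wint alpha p g = x%:E.
Proof.
have w0 : (0 <= wint alpha p g)%E by apply: integral_ge0 => w _; rewrite lee_fin mulr_ge0 ?powR_ge0.
move=> wf; exists (fine (wint alpha p g)); first exact: fine_ge0.
by rewrite fineK// ge0_fin_numE.
Qed.

Lemma bergman_norm_fin (f : C -> C) (x : R) : wint alpha p (fun z => modulus (f z)) = x%:E ->
  bergman_norm alpha p f = ((k * x) `^ p^-1)%:E.
Proof. by move=> e; rewrite bergman_normE e -EFinM poweR_EFin. Qed.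

Lemma bergman_norm_lt_pinfty (f : C -> C) : (bergman_norm alpha p f < +oo)%E ->
  (wint alpha p (fun z => modulus (f z)) < +oo)%E.
Proof.
rewrite bergman_normE ltey => h; rewrite ltey; apply: contra h => /eqP ->.
by apply/eqP; apply: eqy_poweR; rewrite ?invr_gt0// gt0_muley// lte_fin.
Qed.

Lemma norm_le_wint_le (x y K : R) : 0 <= x -> 0 <= y -> 0 <= K ->
  ((k * y) `^ p^-1 <= K * (k * x) `^ p^-1) = (y <= K `^ p * x).
Proof.
move=> x0 y0 K0; have kx : 0 <= k * x by rewrite mulr_ge0// ltW.
have ky : 0 <= k * y by rewrite mulr_ge0// ltW.
have KE : K = (K `^ p) `^ p^-1 by rewrite -powRrM divff ?gt_eqF// powRr1.
rewrite {1}KE -powRM ?powR_ge0// mulrCA -[RHS](ler_pM2l k0).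
have kk : 0 <= k * (K `^ p * x) by apply: mulr_ge0; [exact: ltW|rewrite mulr_ge0 ?powR_ge0].
apply/idP/idP => h; last by apply: ge0_ler_powR => //; rewrite invr_ge0 ltW.
have := ge0_ler_powR (ltW p0) (powR_ge0 (k * y) p^-1) (powR_ge0 (k * (K `^ p * x)) p^-1) h.
by rewrite -!powRrM mulVf ?gt_eqF// !powRr1.
Qed.

(** [p >= 2 (alpha + 2) > 2] makes [taylor_hsummable] available, and with it the convergence of all
    the series in [hilbert_op]. *)
Lemma hilbert_bounded_hbeta : hilbert_bounded_by alpha b p (hbeta alpha p b).
Proof.
move=> f a [fan fn] fa; have [h1 h2 h3 h4] : [/\ -1 < alpha, alpha <= 0, 2 < p & 0 <= hbeta alpha p b].
  by split; [exact: al|exact: ltW|have := al; have := pal; lra|apply: ltW; exact: hbeta_gt0].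
have wf := bergman_norm_lt_pinfty fn.
have sa := taylor_hsummable h2 h3 fa h1 wf.
have le := wint_hilbert_le al p1 pal b0 fa sa.
have [x x0 xE] := wint_fine wf.
have wh : (wint alpha p (fun z => modulus (hilbert_op b a z)) < +oo)%E.
  by apply: le_lt_trans le _; rewrite xE -EFinM ltry.
have [y y0 yE] := wint_fine wh.
split; first exact: hsummable_well_defined.
  split; first exact: hilbert_op_analytic.
  by rewrite (bergman_norm_fin yE) ltry.
rewrite (bergman_norm_fin yE) (bergman_norm_fin xE) -EFinM lee_fin norm_le_wint_le//.
by move: le; rewrite xE yE -EFinM lee_fin.
Qed.

Lemma hbeta_le_bound (K : R) : 0 <= K -> hilbert_bounded_by alpha b p K -> hbeta alpha p b <= K.
Proof.
move=> K0 hK; apply: hilbert_norm_ge => // c c0 cs.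
have c1 : c <= 1.
  by apply: (le_trans (ltW cs)); rewrite ler_pdivrMr// mul1r; have := pal; have := al; lra.
have bd j : modulus (test_seq c j : C) <= 1 by apply: mod_binc_le1 => //; exact: ltW.
(* The sum of the series in place of [test_fun c]: the two agree on the disk, and the sum is already
   known to be differentiable for bounded coefficients. *)
pose f z : C := limn (taylor_series (test_seq c) z).
have fE z : modulus z < 1 -> f z = test_fun c z.
  by move=> z1; apply: cvgC_lim; apply: test_seq_expansion => //; exact: ltW.
have fa : taylor_expansion f (test_seq c).
  by move=> z z1; rewrite fE//; apply: test_seq_expansion => //; exact: ltW.
have wE : wint alpha p (fun z => modulus (f z)) = wint alpha p (fun z => modulus (test_fun c z)).
  by apply: eq_integral => w; rewrite inE => w1; rewrite fE.
have [|x x0 xE] := @wint_fine (fun z => modulus (f z)).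
  by rewrite wE; exact: test_mass_lt_pinfty.
have [] := hK f (test_seq c) _ fa.
  split; first by move=> z z1; exact: (bounded_taylor_derivable bd).
  by rewrite (bergman_norm_fin xE) ltry.
move=> _ [_ hn]; have [y y0 yE] := wint_fine (bergman_norm_lt_pinfty hn).
rewrite (bergman_norm_fin yE) (bergman_norm_fin xE) -EFinM lee_fin (norm_le_wint_le x0 y0 K0) => h.
by rewrite -wE xE yE -EFinM lee_fin.
Qed.

End OperatorNorm.

Theorem corollary4p1 (R : realType) (alpha b p : R)
  (halpha : -1 < alpha) (halpha0 : alpha < 0) (hb : 0 <= b) (hp : 1 < p)
  (hpalpha : 2 * (alpha + 2) <= p) :
  hilbert_opnorm alpha b p =
  (Beta ((alpha + 2) / p) (b + 1 - (alpha + 2) / p))%:E.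
Proof.
rewrite -/(hbeta alpha p b); apply/eqP; rewrite eq_le; apply/andP; split.
  apply: ereal_inf_lbound; exists (hbeta alpha p b); last by [].
  split; last by exact: hilbert_bounded_hbeta.
  by apply: ltW; exact: hbeta_gt0.
apply/ereal_infP => _ [K [K0 hK] <-].
by rewrite lee_fin -/(hbeta alpha p b); exact: hbeta_le_bound.
Qed.
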